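(* Let $(L\rightrightarrows L_M;G\rightrightarrows M)$ be a line bundle groupoid (LBG). The assignment $$\Omega^\bullet(G,L)\oplus\Omega^{\bullet+1}(M,L_M)\to\Omega_D^{\bullet+1}(L)\oplus\Omega_D^{\bullet+2}(L_M),\qquad (\theta,\kappa)\mapsto\big(\omega\rightleftharpoons(\theta,\partial\kappa),\ \Omega\rightleftharpoons(\kappa,0)\big)$$ (taken for $\bullet=1$) establishes a bijection between $+1$-shifted contact structures on $L$ and $+1$-shifted symplectic Atiyah forms on $L$. This bijection intertwines gauge equivalence (of $+1$-shifted contact structures, respectively of $+1$-shifted symplectic Atiyah forms), and it intertwines contact Morita equivalence with symplectic Morita equivalence.
   Context: VB groupoids. A VB groupoid (VBG) $(V\rightrightarrows V_M;G\rightrightarrows M)$ consists of Lie groupoids $V\rightrightarrows V_M$, $G\rightrightarrows M$ (Hausdorff) and vector bundles $V\to G$, $V_M\to M$ such that all structure maps $s,t,m,i,u$ of $V$ are vector bundle (VB) morphisms covering those of $G$. Products $gg'$ are defined when $s(g)=t(g')$; units are regarded as submanifolds. Its core is $C=\ker(s\colon V\to V_M)|_M$. A VBG morphism $(F,f)$ is a VB morphism that is also a Lie groupoid morphism $F$ covering a Lie groupoid morphism $f$; it is a VB Morita map if $F$ is a Morita map of Lie groupoids. A line bundle groupoid (LBG) is a VBG $(L\rightrightarrows L_M;G\rightrightarrows M)$ with $L\to G$, $L_M\to M$ line bundles; its core is automatically $0$, all face maps of the nerve $L^{(\bullet)}\to G^{(\bullet)}$ are isomorphisms on fibers, and $G$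 acts on $L_M$ by $g.v=t(s_g^{-1}(v))$, $s_g:=s|_{L_g}$. VB Morita maps between LBGs are isomorphisms on fibers. Atiyah forms. For a line bundle $L\to M$, $DL\to M$ is the Atiyah algebroid: $D_xL$ consists of $\mathbb R$-linear $\delta\colon\Gamma(L)\to L_x$ with $\delta(f\lambda)=v(f)\lambda_x+f(x)\delta(\lambda)$ for a (unique) $v=\sigma(\delta)\in T_xM$, the symbol. Atiyah forms are $\Omega_D^\bullet(L)=\Gamma(\operatorname{Alt}^\bullet(DL,L))$, with the Lie algebroid differential $d_D$ associated with the tautological action of $DL$ on $L$. Put $(\sigma^*\tau)(\delta_1,\dots)=\tau(\sigma\delta_1,\dots)$ for $\tau\in\Omega^\bullet(M,L)$. Every $\omega\in\Omega_D^k(L)$ is uniquely $\omega=\sigma^*\omega_1+d_D\sigma^*\omega_0$ with $\omega_0\in\Omega^{k-1}(M,L)$, $\omega_1\in\Omega^k(M,L)$; write $\omega\rightleftharpoons(\omega_0,\omega_1)$. A VB morphism $(F,f)\colon L'\to L$ of line bundles that is an isomorphism on fibers induces $DF\colon DL'\to DL$, $DF(\delta)\lambda=F(\delta(F^*\lambda))$, where $(F^*\lambda)_x=F_x^{-1}\lambda_{f(x)}$, and pull-backs $F^*$ of Atiyah forms (using $DF$) and of line bundle valued forms (using $df$), composed with $F_x^{-1}$ on values. Simplicial differential. For an LBG $L$, $\partial$ is the alternating sum of pull-backs along the face maps of $L^{(\bullet)}$, both on Atiyah forms and on line bundle valued forms: $\partial=s^*-t^*$ on forms over $M$, and $\partial=\mathrm{pr}_2^*-m^*+\mathrm{pr}_1^*$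 on forms over $G$. A form over $G$ is multiplicative if $\partial$ of it is $0$. Twisted dual. If $V\rightrightarrows V_M$ is a VBG over $G$ with core $C$, its $L$-twisted dual is the VBG $V^\dagger=\operatorname{Hom}(V,L)\rightrightarrows C^\dagger=\operatorname{Hom}(C,L_M)$ over $G$ with $\langle s(\psi),c\rangle=-s\langle\psi,0_g\cdot c^{-1}\rangle$, $\langle t(\psi),c'\rangle=t\langle\psi,c'\cdot0_g\rangle$ for $\psi\in V_g^\dagger$, $\langle\psi\psi',vv'\rangle=s_{gg'}^{-1}(g'^{-1}.s\langle\psi,v\rangle+s\langle\psi',v'\rangle)$, the unit at $\psi\in C_x^\dagger$ being $\psi\circ\mathrm{pr}_C$ ($\mathrm{pr}_C\colon V|_M\to C$ the projection with kernel $V_M$). Symplectic side. Let $A=\ker(ds)|_M$ be the Lie algebroid of $G$. Applying $D$ to the structure maps of $L$ gives a VBG $DL\rightrightarrows DL_M$ over $G$ with core $\cong A$ (via the symbol); its $L$-twisted dual is $J^1L=\operatorname{Hom}(DL,L)\rightrightarrows A^\dagger=\operatorname{Hom}(A,L_M)$. For multiplicative $\omega\in\Omega_D^2(L)$ the map $\omega\colon DL\to J^1L$, $\delta\mapsto\omega(\delta,-)$, is a VBG morphism. A $+1$-shifted symplectic Atiyah form on $L$ is a pair $(\omega,\Omega)\in\Omega_D^2(L)\oplus\Omega^3_D(L_M)$ with $\partial\omega=0$, $d_D\omega=\partial\Omega$, $d_D\Omega=0$ and $\omega\colon DL\to J^1L$ a VB Morita map. Its gauge transformation by $\alpha\in\Omega_D^2(L_M)$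 is $(\omega+\partial\alpha,\Omega+d_D\alpha)$. Contact side. Let $\theta\in\Omega^1(G,L)$ be multiplicative. Its Morita kernel $\mathsf MK_\theta$ is the VBG $TG\oplus L\rightrightarrows TM\oplus L_M$ over $G$ with $s(v,\lambda)=(ds(v),s(\lambda))$, $t(v,\lambda)=(dt(v),t(\lambda+\theta(v)))$, $u(v,\lambda)=(du(v),u(\lambda))$, $(v,\lambda)(v',\lambda')=(vv',s_{gg'}^{-1}(s(\lambda')))$; its core is $A$. Then $\mathsf MK_\theta^\dagger=T^\dagger G\oplus\mathbb R_G\rightrightarrows A^\dagger$, where $T^\dagger G=\operatorname{Hom}(TG,L)$ and $\mathbb R_G=G\times\mathbb R$. Fix a connection $\nabla$ on $L_M$, let $\eta_\nabla=s^*\nabla-t^*\nabla\in\Omega^1(G)$ (difference of the pull-back connections on $L$), and for $\kappa\in\Omega^2(M,L_M)$ define the Morita curvature (a VBG morphism) $$\mathsf MR_{(\theta,\kappa)}\colon\mathsf MK_\theta\to\mathsf MK_\theta^\dagger,\quad(v,\lambda)\mapsto\big(\iota_v(d^{t^*\nabla}\theta+\partial\kappa)+\lambda\otimes\eta_\nabla,\ -\eta_\nabla(v)\big).$$ A $+1$-shifted contact structure on $L$ is a pair $(\theta,\kappa)$ with $\theta\in\Omega^1(G,L)$ multiplicative, $\kappa\in\Omega^2(M,L_M)$ and $\mathsf MR_{(\theta,\kappa)}$ a VB Morita map (this does not depend on $\nabla$). Its gauge transformation by $(\beta,\gamma)\in\Omega^1(M,L_M)\oplus\Omega^2(M,L_M)$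 is $(\theta+\partial\beta,\kappa+\gamma)$. Morita equivalence. Two LBGs $L_1,L_2$ equipped with $+1$-shifted contact structures (resp. $+1$-shifted symplectic Atiyah forms) are contact (resp. symplectic) Morita equivalent if there are an LBG $L'$ and VB Morita maps $F_1\colon L'\to L_1$, $F_2\colon L'\to L_2$ such that the pulled-back structures on $L'$ agree up to a gauge transformation. *)

(* Defs.v *)
From HB Require Import structures.
From mathcomp Require Import all_boot all_order all_algebra.
From mathcomp Require Import ring.
From mathcomp Require Import all_classical all_reals all_analysis.
Import Order.TTheory GRing.Theory Num.Theory numFieldNormedType.Exports.

Set Implicit Arguments.
Unset Strict Implicit.
Unset Printing Implicit Defensive.

Local Open Scope classical_set_scope.
Local Open Scope ring_scope.

(* Conventions.  Structures (smooth spaces, bundles, groupoids, VB groupoids)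
   are records of raw data, the axioms being separate predicates.  An object
   characterised by a property is written [the d P], "the element satisfying
   P", with junk value [d] when there is none. *)

Definition the (T : Type) (d : T) (P : T -> Prop) : T :=
  match pselect (exists x, P x) with left e => sval (cid e) | right _ => d end.

Record submodule (R : pzRingType) (W : lmodType R) := Submodule {
  scar : set W;
  sclosed : scar 0 /\
    forall (a : R) u v, scar u -> scar v -> scar (a *: u + v) }.

Section SubmoduleType.
Variables (R : pzRingType) (W : lmodType R) (S : submodule W).

Definition smem : {pred W} := mem (scar S).

Lemma smem_closed : submod_closed smem.
Proof.
have [S0 Sl] := sclosed S; split; first by rewrite /smem inE.
by move=> a u v; rewrite /smem !inE; exact: Sl.
Qed.

HB.instance Definition _ :=
  GRing.isSubmodClosed.Build R W smem smem_closed.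

Definition subm : Type := {w : W | w \in smem}.

HB.instance Definition _ := SubChoice.on subm.
HB.instance Definition _ := [SubChoice_isSubLmodule of subm by <:].

Definition subval (w : subm) : W := val w.

End SubmoduleType.

(* The linear hull of a set; it is the set itself when that is a submodule.  It
   is used to define kernels of maps which are only known to be linear under
   the axioms of VB groupoids. *)
Lemma hull_closed (R : pzRingType) (W : lmodType R) (A : set W) :
  let H := [set w | forall S : submodule W, A `<=` scar S -> scar S w] in
  H 0 /\ forall (a : R) u v, H u -> H v -> H (a *: u + v).
Proof.
split=> [S _|a u v Hu Hv S AS]; first exact: (sclosed S).1.
by apply: (sclosed S).2; [exact: Hu | exact: Hv].
Qed.
Definition hull (R : pzRingType) (W : lmodType R) (A : set W) : submodule W :=
  Submodule (hull_closed A).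

Lemma hom_closed (R : comPzRingType) (U W : lmodType R) :
  let H := [set f : U -> W | linear f] in
  H 0 /\ forall (a : R) u v, H u -> H v -> H (a *: u + v).
Proof.
split=> [b x y|a u v Hu Hv b x y] /=; first by rewrite /= scaler0 addr0.
have E (z : U) : (a *: u + v) z = a *: u z + v z by [].
rewrite !E Hu Hv !scalerDr !scalerA (mulrC a b) -!addrA; congr (_ + _).
by rewrite !addrA; congr (_ + _); exact: addrC.
Qed.
Definition homS (R : comPzRingType) (U W : lmodType R) : submodule (U -> W) :=
  Submodule (hom_closed U W).
Definition Hom (R : comPzRingType) (U W : lmodType R) := subm (homS U W).
Definition happ (R : comPzRingType) (U W : lmodType R) (h : Hom U W) : U -> W :=
  val h.
(* The element of Hom(U, W) with underlying map f, when f is linear. *)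
Definition tohom (R : comPzRingType) (U W : lmodType R) (f : U -> W) :
  Hom U W := the 0 (fun h => happ h = f).

Fixpoint Ck (R : realType) (k n : nat) (f : 'rV[R]_n -> R) : Prop :=
  match k with
  | 0 => continuous f
  | k'.+1 => continuous f /\ forall i : 'I_n,
      (forall x, derivable f x (delta_mx 0 i)) /\
      Ck k' (fun x => 'D_(delta_mx 0 i) f x)
  end.
Definition Cinfty (R : realType) (n : nat) (f : 'rV[R]_n -> R) : Prop :=
  forall k, Ck k f.

(* A smooth structure (in the sense of Sikorski) presented by generators: the
   topology is the initial one, and the smooth functions are those which are
   locally smooth functions of finitely many generators.  Manifolds are the
   Hausdorff second countable such spaces which are locally diffeomorphic to
   open subsets of R^n. *)
Record dspace (R : realType) := DSpace {
  pt :> Type;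
  gen : set (pt -> R) }.

Section Smooth.
Variable R : realType.
Implicit Types M N P : dspace R.

Definition evgen M (x : {classic (pt M)}) :
    prod_topology (fun _ : {h : M -> R | gen h} => R) := fun h => sval h x.
Definition dtop M : topologicalType := initial_topology (@evgen M).

Definition smooth_fun M (f : M -> R) : Prop := forall x : dtop M,
  exists n (g : 'I_n -> M -> R) (F : 'rV[R]_n -> R),
    [/\ forall i, gen (g i), Cinfty F &
        \forall y \near x, f y = F (\row_i g i y)].

Definition smooth_map M N (f : M -> N) : Prop :=
  forall h : N -> R, smooth_fun h -> smooth_fun (h \o f).

Definition euclid (n : nat) : dspace R :=
  @DSpace R 'rV[R]_n [set h | exists i : 'I_n, h = fun x : 'rV[R]_n => x 0 i].

Definition prodd M N : dspace R :=
  @DSpace R (M * N)%type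
    [set h | (exists2 a, gen a & h = a \o fst) \/
             (exists2 b, gen b & h = b \o snd)].

Definition subd M (A : set M) : dspace R :=
  @DSpace R {x : M | A x} [set h | exists2 a, gen a & h = a \o sval].

Definition smooth_on M N (A : set M) (f : M -> N) : Prop :=
  @smooth_map (subd A) N (f \o sval).

Definition diffeo_on M N (A : set M) (B : set N) (f : M -> N) : Prop :=
  exists g : N -> M,
    [/\ forall x, A x -> B (f x) /\ g (f x) = x,
        forall y, B y -> A (g y) /\ f (g y) = y,
        smooth_on A f & smooth_on B g].

Definition is_manifold M : Prop :=
  [/\ hausdorff_space (dtop M), @second_countable (dtop M) &
      exists n, forall x : M, exists (U : set M) (V : set 'rV[R]_n) phi,
        [/\ @open (dtop M) U, U x, open V &
            @diffeo_on M (euclid n) U V phi]].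

Section Tangent.
Variable M : dspace R.

(* Derivations at x of the algebra of smooth functions; they are made total by
   letting them vanish on functions which are not smooth. *)
Definition is_tangent (x : M) (v : (M -> R) -> R^o) : Prop :=
  [/\ forall f, ~ smooth_fun f -> v f = 0,
      forall a f g, smooth_fun f -> smooth_fun g ->
        v (fun y => a * f y + g y) = a * v f + v g &
      forall f g, smooth_fun f -> smooth_fun g ->
        v (fun y => f y * g y) = v f * g x + f x * v g].

Lemma tangent_closed (x : M) :
  is_tangent x 0 /\ forall (a : R) u v, is_tangent x u -> is_tangent x v ->
    is_tangent x (a *: u + v).
Proof.
split=> [|a u v [u0 uD uM] [v0 vD vM]].
  split=> [//|b f g _ _|f g _ _] /=.
    by rewrite (_ : forall h, (0 : (M -> R) -> R^o) h = 0) // mulr0 addr0.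
  rewrite !(_ : forall h, (0 : (M -> R) -> R^o) h = 0) //.
  by rewrite mul0r mulr0 addr0.
have E h : (a *: u + v) h = a * u h + v h by [].
split=> [f nf|b f g sf sg|f g sf sg]; rewrite !E.
- by rewrite u0 // v0 // mulr0 addr0.
- by rewrite uD // vD //; ring.
- by rewrite uM // vM //; ring.
Qed.

Definition tangent (x : M) : lmodType R := subm (Submodule (tangent_closed x)).
Definition tapp (x : M) (v : tangent x) : (M -> R) -> R := val v.

End Tangent.

Definition dmap M N (f : M -> N) (x : M) (v : tangent x) : tangent (f x) :=
  the 0 (fun w => forall h, smooth_fun h -> tapp w h = tapp v (h \o f)).

Definition submersion M N (f : M -> N) : Prop :=
  smooth_map f /\
  forall (x : M) (w : tangent (f x)), exists v : tangent x, dmap f v = w.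

Record bundle M := Bundle {
  fib :> M -> lmodType R;
  bgen : set ({x : M & fib x} -> R) }.

Definition tot M (E : bundle M) : dspace R := DSpace (@bgen M E).
Definition mkt M (E : bundle M) (x : M) (e : E x) : tot E :=
  existT (fun y => E y) x e.

(* Transport of e along an equality of base points. *)
Definition cast M (E : bundle M) (x y : M) (e : E x) : E y :=
  match pselect (x = y) with
  | left h => eq_rect x (fun z => E z : Type) e y h
  | right _ => 0
  end.

Definition is_vbundle M (E : bundle M) (r : nat) : Prop :=
  smooth_map (fun p : tot E => projT1 p) /\
  forall x : M, exists (U : set M) (phi : tot E -> euclid r),
    [/\ @open (dtop M) U, U x,
        forall y, U y -> linear (fun e : E y => phi (mkt e) : 'rV[R]_r) &
        @diffeo_on (tot E) (prodd M (euclid r))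
          [set p | U (projT1 p)] [set q | U q.1]
          (fun p => (projT1 p, phi p))].

Definition sec M (E : bundle M) : Type := forall x : M, E x.
Definition smooth_sec M (E : bundle M) (e : sec E) : Prop :=
  smooth_map (fun x : M => mkt (e x)).

Definition fib_linear M (E : bundle M) (xi : tot E -> R) : Prop :=
  smooth_fun xi /\ forall x, linear (fun e : E x => xi (mkt e) : R^o).

Definition vbmap M N (f : M -> N) (E : bundle M) (E' : bundle N) : Type :=
  forall x : M, E x -> E' (f x).
Definition totmap M N (f : M -> N) (E : bundle M) (E' : bundle N)
  (F : vbmap f E E') (p : tot E) : tot E' := mkt (F (projT1 p) (projT2 p)).
Definition vblinear M N (f : M -> N) (E : bundle M) (E' : bundle N)
  (F : vbmap f E E') : Prop := forall x, linear (F x).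
Definition finv M N (f : M -> N) (E : bundle M) (E' : bundle N)
  (F : vbmap f E E') (x : M) (e' : E' (f x)) : E x :=
  the 0 (fun e => F x e = e').

(* On a manifold the total spaces below have enough global smooth functions,
   sections and fiberwise linear functions (bump functions) for these
   generators to induce the usual manifold structures. *)
Definition tanb M : bundle M :=
  @Bundle M (@tangent M)
    [set q | (exists2 h, gen h & q = fun p => h (projT1 p)) \/
             (exists2 f, smooth_fun f & q = fun p => tapp (projT2 p) f)].

Definition homb M (E L : bundle M) : bundle M :=
  @Bundle M (fun x => Hom (E x) (L x))
    [set q | (exists2 h, gen h & q = fun p => h (projT1 p)) \/
             (exists (e : sec E) (xi : tot L -> R),
               [/\ smooth_sec e, fib_linear xi &
                   q = fun p => xi (mkt (happ (projT2 p) (e (projT1 p))))])].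

Definition sumb M (E F : bundle M) : bundle M :=
  @Bundle M (fun x => (E x * F x)%type : lmodType R)
    [set q | (exists2 h, @gen _ (tot E) h &
                q = fun p => h (mkt (projT2 p).1)) \/
             (exists2 h, @gen _ (tot F) h &
                q = fun p => h (mkt (projT2 p).2))].

Section Atiyah.
Variables (M : dspace R) (L : bundle M).

(* Made total in the same way as tangent vectors. *)
Definition is_atiyah (x : M) (d : sec L -> L x) : Prop :=
  [/\ forall l, ~ smooth_sec l -> d l = 0,
      forall a l m, smooth_sec l -> smooth_sec m ->
        d (fun y => a *: l y + m y) = a *: d l + d m &
      exists v : tangent x, forall f l, smooth_fun f -> smooth_sec l ->
        d (fun y => f y *: l y) = tapp v f *: l x + f x *: d l].

Lemma atiyah_closed (x : M) :
  is_atiyah (0 : sec L -> L x) /\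
  forall (a : R) u v, is_atiyah u -> is_atiyah v -> @is_atiyah x (a *: u + v).
Proof.
split=> [|a u v [u0 uD [s us]] [v0 vD [t vt]]].
  have E h : (0 : sec L -> L x) h = 0 by [].
  split=> [//|b f g _ _|]; first by rewrite !E scaler0 addr0.
  exists 0 => f l _ _; rewrite !E (_ : tapp (0 : tangent x) f = 0) //.
  by rewrite scale0r scaler0 addr0.
have E h : (a *: u + v) h = a *: u h + v h by [].
split=> [l nl|b l m sl sm|].
- by rewrite E u0 // v0 // scaler0 addr0.
- rewrite !E uD // vD // !scalerDr !scalerA (mulrC a b) -!addrA.
  by congr (_ + _); rewrite !addrA; congr (_ + _); exact: addrC.
- exists (a *: s + t) => f l sf sl; rewrite !E us // vt //.
  have -> : tapp (a *: s + t) f = a * tapp s f + tapp t f by [].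
  rewrite !scalerDr scalerDl !scalerA (mulrC a (f x)) -!addrA.
  by congr (_ + _); rewrite !addrA; congr (_ + _); exact: addrC.
Qed.

Definition atiyah (x : M) : lmodType R := subm (Submodule (atiyah_closed x)).
Definition dapp (x : M) (d : atiyah x) : sec L -> L x := val d.

Definition atiyahb : bundle M :=
  @Bundle M atiyah
    [set q | (exists2 h, gen h & q = fun p => h (projT1 p)) \/
             (exists (l : sec L) (xi : tot L -> R),
               [/\ smooth_sec l, fib_linear xi &
                   q = fun p => xi (mkt (dapp (projT2 p) l))])].

Definition is_symbol (x : M) (d : atiyah x) (v : tangent x) : Prop :=
  forall f l, smooth_fun f -> smooth_sec l ->
    dapp d (fun y => f y *: l y) = tapp v f *: l x + f x *: dapp d l.
Definition symbol (x : M) (d : atiyah x) : tangent x := the 0 (is_symbol d).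

End Atiyah.

Definition pullsec M N (f : M -> N) (L : bundle M) (L' : bundle N)
  (F : vbmap f L L') (l : sec L') : sec L := fun x => finv F (l (f x)).

Definition Dmap M N (f : M -> N) (L : bundle M) (L' : bundle N)
    (F : vbmap f L L') : vbmap f (atiyahb L) (atiyahb L') :=
  fun x d => the 0 (fun d' : atiyah L' (f x) =>
    forall l, smooth_sec l -> dapp d' l = F x (dapp d (pullsec F l))).

(* L-valued k-cochains on E; E = TM for line bundle valued forms, E = DL for
   Atiyah forms. *)
Definition form M (E L : bundle M) (k : nat) : Type :=
  forall x : M, ('I_k -> E x) -> L x.

Definition upd (T : Type) k (v : 'I_k -> T) (i : 'I_k) (e : T) : 'I_k -> T :=
  fun j => if j == i then e else v j.

Definition is_form M (E L : bundle M) k (w : form E L k) : Prop :=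
  [/\ forall x v i, linear (fun e : E x => w x (upd v i e)),
      forall x v (i j : 'I_k), i != j -> v i = v j -> w x v = 0 &
      forall e : 'I_k -> sec E, (forall i, smooth_sec (e i)) ->
        smooth_sec (fun x => w x (fun i => e i x))].

Definition form0 M (E L : bundle M) k : form E L k := fun _ _ => 0.
Definition fadd M (E L : bundle M) k (w w' : form E L k) : form E L k :=
  fun x v => w x v + w' x v.
Definition fsub M (E L : bundle M) k (w w' : form E L k) : form E L k :=
  fun x v => w x v - w' x v.

Definition pull M N (f : M -> N) (L : bundle M) (L' : bundle N)
    (F : vbmap f L L') (E : bundle M) (E' : bundle N) (dF : vbmap f E E')
    k (w : form E' L' k) : form E L k :=
  fun x v => finv F (w (f x) (fun i => dF x (v i))).

Definition pullT M N (f : M -> N) (L : bundle M) (L' : bundle N)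
    (F : vbmap f L L') k (w : form (tanb N) L' k) : form (tanb M) L k :=
  pull F (dmap f : vbmap f (tanb M) (tanb N)) w.
Definition pullD M N (f : M -> N) (L : bundle M) (L' : bundle N)
    (F : vbmap f L L') k (w : form (atiyahb L') L' k) : form (atiyahb L) L k :=
  pull F (Dmap F) w.

(* Koszul formula, for a bracket on sections of E and an action of E on L by
   derivations. *)
Definition koszul M (E L : bundle M) (br : sec E -> sec E -> sec E)
    (act : forall x, E x -> atiyah L x) k (w : form E L k)
    (X : 'I_k.+1 -> sec E) (x : M) : L x :=
  \sum_(i < k.+1) (-1) ^+ i *:
     dapp (act x (X i x)) (fun y => w y (fun j => X (lift i j) y)) +
  \sum_(i < k.+1) \sum_(j < k.+1 | (i < j)%N) (-1) ^+ (i + j) *: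
     w x (fun a : 'I_k => nth 0
       (br (X i) (X j) x ::
        [seq X c x | c <- enum 'I_k.+1 & (c != i) && (c != j)]) a).

(* The value at vectors e_i of E_x is computed on any smooth sections extending
   the e_i. *)
Definition extd M (E L : bundle M) (br : sec E -> sec E -> sec E)
    (act : forall x, E x -> atiyah L x) k (w : form E L k) :
    form E L k.+1 :=
  fun x e => the 0 (fun y => forall X : 'I_k.+1 -> sec E,
    (forall i, smooth_sec (X i)) -> (forall i, X i x = e i) ->
    y = koszul br act w X x).

Definition tbracket M (X Y : sec (tanb M)) : sec (tanb M) :=
  fun x => the 0 (fun v : tangent x => forall f, smooth_fun f ->
    tapp v f = tapp (X x) (fun y => tapp (Y y) f)
             - tapp (Y x) (fun y => tapp (X y) f)).

Definition dbracket M (L : bundle M) (X Y : sec (atiyahb L)) :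
    sec (atiyahb L) :=
  fun x => the 0 (fun d : atiyah L x => forall l, smooth_sec l ->
    dapp d l = dapp (X x) (fun y => dapp (Y y) l)
             - dapp (Y x) (fun y => dapp (X y) l)).

Definition dD M (L : bundle M) k (w : form (atiyahb L) L k) :
    form (atiyahb L) L k.+1 :=
  extd (@dbracket M L) (fun x d => d) w.

Definition sigma_pull M (L : bundle M) k (w : form (tanb M) L k) :
    form (atiyahb L) L k :=
  fun x d => w x (fun i => symbol (d i)).

(* The Atiyah form with components (w0, w1). *)
Definition atiyah_form M (L : bundle M) k (w0 : form (tanb M) L k)
    (w1 : form (tanb M) L k.+1) : form (atiyahb L) L k.+1 :=
  fadd (sigma_pull w1) (dD (sigma_pull w0)).

(* A connection, v |-> \nabla_v, with the Leibniz rule expressed by the fact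
   that \nabla_v is a derivation of symbol v. *)
Definition connection M (L : bundle M) : Type :=
  forall x : M, tangent x -> atiyah L x.
Definition is_connection M (L : bundle M) (nabla : connection L) : Prop :=
  [/\ forall x, linear (nabla x),
      forall x (v : tangent x), is_symbol (nabla x v) v &
      forall (X : sec (tanb M)) (l : sec L), smooth_sec X -> smooth_sec l ->
        smooth_sec (fun x => dapp (nabla x (X x)) l)].

Definition pullconn M N (f : M -> N) (L : bundle M) (L' : bundle N)
    (F : vbmap f L L') (nabla : connection L') : connection L :=
  fun x v => the 0 (fun d => is_symbol d v /\
    forall l, smooth_sec l ->
      dapp d (pullsec F l) = finv F (dapp (nabla (f x) (dmap f v)) l)).

Definition dconn M (L : bundle M) (nabla : connection L) k
    (w : form (tanb M) L k) : form (tanb M) L k.+1 :=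
  @extd M (tanb M) L (@tbracket M) nabla k w.

(* mul g h is only meaningful when src g = tgt h *)
Record groupoid := Groupoid {
  ob : dspace R;
  ar : dspace R;
  src : ar -> ob;
  tgt : ar -> ob;
  uni : ob -> ar;
  inv : ar -> ar;
  mul : ar -> ar -> ar }.

Definition composable (G : groupoid) (p : prodd (ar G) (ar G)) : Prop :=
  src p.1 = tgt p.2.

Definition is_lie_groupoid (G : groupoid) : Prop :=
  [/\ is_manifold (ob G) /\ is_manifold (ar G),
      submersion (@src G) /\ submersion (@tgt G),
      [/\ smooth_map (@uni G), smooth_map (@inv G) &
          smooth_on (@composable G)
            (fun p : prodd (ar G) (ar G) => mul p.1 p.2)],
      [/\ forall x : ob G, src (uni x) = x /\ tgt (uni x) = x,
          forall g : ar G, src (inv g) = tgt g /\ tgt (inv g) = src g &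
          forall g h : ar G, src g = tgt h ->
            src (mul g h) = src h /\ tgt (mul g h) = tgt g] &
      [/\ forall g h k : ar G, src g = tgt h -> src h = tgt k ->
            mul (mul g h) k = mul g (mul h k),
          forall g : ar G, mul g (uni (src g)) = g /\ mul (uni (tgt g)) g = g &
          forall g : ar G, mul g (inv g) = uni (tgt g) /\
                           mul (inv g) g = uni (src g)]].

Definition is_gpd_morphism (G H : groupoid) (f : ar G -> ar H)
    (f0 : ob G -> ob H) : Prop :=
  [/\ smooth_map f /\ smooth_map f0,
      forall g, src (f g) = f0 (src g) /\ tgt (f g) = f0 (tgt g),
      forall x, f (uni x) = uni (f0 x) &
      forall g h, src g = tgt h -> f (mul g h) = mul (f g) (f h)].

(* Essential surjectivity: t o pr_1 is a surjective submersion on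
   H x_{s,f0} ob G.  Full faithfulness: the square formed by (t, s), f and
   f0 x f0 is a pull-back. *)
Definition is_morita (G H : groupoid) (f : ar G -> ar H)
    (f0 : ob G -> ob H) : Prop :=
  let P : dspace R :=
    subd [set p : prodd (ar H) (ob G) | src p.1 = f0 p.2] in
  let Q : set (prodd (prodd (ob G) (ar H)) (ob G)) :=
    [set q | tgt q.1.2 = f0 q.1.1 /\ src q.1.2 = f0 q.2] in
  [/\ is_gpd_morphism f f0,
      @submersion P (ob H) (fun p => tgt (sval p).1),
      (forall y, exists p : P, tgt (sval p).1 = y) &
      @diffeo_on (ar G) (prodd (prodd (ob G) (ar H)) (ob G)) setT Q
        (fun g => ((tgt g, f g), src g))].

Section VBGroupoids.
Variable G : groupoid.

Record vbg := VBG {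
  vb : bundle (ar G);
  vb0 : bundle (ob G);
  vs : vbmap (@src G) vb vb0;
  vt : vbmap (@tgt G) vb vb0;
  vu : vbmap (@uni G) vb0 vb;
  vi : vbmap (@inv G) vb vb;
  vm : forall g h : ar G, vb g -> vb h -> vb (mul g h) }.

Definition vbg_groupoid (V : vbg) : groupoid :=
  @Groupoid (tot (vb0 V)) (tot (vb V)) (totmap (@vs V)) (totmap (@vt V))
    (totmap (@vu V)) (totmap (@vi V))
    (fun p q => mkt (vm (projT2 p) (projT2 q))).

Definition vcomp (V : vbg) (g h : ar G) (v : vb V g) (w : vb V h) : Prop :=
  mkt (vs v) = mkt (vt w).

Definition is_vbg (V : vbg) : Prop :=
  [/\ is_lie_groupoid G, is_lie_groupoid (vbg_groupoid V),
      (exists r, is_vbundle (vb V) r) /\ (exists r, is_vbundle (vb0 V) r),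
      [/\ vblinear (@vs V), vblinear (@vt V), vblinear (@vu V) &
          vblinear (@vi V)] &
      forall g h (a : R) (v v' : vb V g) (w w' : vb V h),
        vcomp v w -> vcomp v' w' ->
        vm (a *: v + v') (a *: w + w') = a *: vm v w + vm v' w'].

Definition is_lbg (L : vbg) : Prop :=
  [/\ is_vbg L, is_vbundle (vb L) 1 & is_vbundle (vb0 L) 1].

Definition core_fib (V : vbg) (x : ob G) : lmodType R :=
  subm (hull [set c : vb V (uni x) | vs c = 0]).
Definition cval (V : vbg) (x : ob G) (c : core_fib V x) : vb V (uni x) :=
  subval c.
Definition core (V : vbg) : bundle (ob G) :=
  @Bundle (ob G) (core_fib V)
    [set q | exists2 h, @gen _ (tot (vb V)) h &
               q = fun p => h (mkt (cval (projT2 p)))].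

Definition ar2 : dspace R := subd (@composable G).
Definition mkar2 (g h : ar G) (e : src g = tgt h) : ar2 :=
  exist (@composable G) (g, h) e.
Definition pr1 (p : ar2) : ar G := (sval p).1.
Definition pr2 (p : ar2) : ar G := (sval p).2.
Definition mul2 (p : ar2) : ar G := mul (sval p).1 (sval p).2.

Definition nerve2_fib (L : vbg) (p : ar2) : lmodType R :=
  subm (hull [set l : (vb L (pr1 p) * vb L (pr2 p))%type | vcomp l.1 l.2]).
Definition lpr1_fib (L : vbg) (p : ar2) (l : nerve2_fib L p) : vb L (pr1 p) :=
  (subval l).1.
Definition lpr2_fib (L : vbg) (p : ar2) (l : nerve2_fib L p) : vb L (pr2 p) :=
  (subval l).2.
Definition nerve2 (L : vbg) : bundle ar2 :=
  @Bundle ar2 (nerve2_fib L)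
    [set q | (exists2 h, @gen _ (tot (vb L)) h &
                q = fun p => h (mkt (lpr1_fib (projT2 p)))) \/
             (exists2 h, @gen _ (tot (vb L)) h &
                q = fun p => h (mkt (lpr2_fib (projT2 p))))].
Definition lpr1 (L : vbg) : vbmap pr1 (nerve2 L) (vb L) := @lpr1_fib L.
Definition lpr2 (L : vbg) : vbmap pr2 (nerve2 L) (vb L) := @lpr2_fib L.
Definition lmul (L : vbg) : vbmap mul2 (nerve2 L) (vb L) :=
  fun p l => vm (lpr1 l) (lpr2 l).

Section Simplicial.
Variables (L : vbg) (k : nat).

Definition delT0 (w : form (tanb (ob G)) (vb0 L) k) :
    form (tanb (ar G)) (vb L) k :=
  fsub (pullT (@vs L) w) (pullT (@vt L) w).
Definition delT1 (w : form (tanb (ar G)) (vb L) k) :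
    form (tanb ar2) (nerve2 L) k :=
  fadd (fsub (pullT (@lpr2 L) w) (pullT (@lmul L) w)) (pullT (@lpr1 L) w).
Definition delD0 (w : form (atiyahb (vb0 L)) (vb0 L) k) :
    form (atiyahb (vb L)) (vb L) k :=
  fsub (pullD (@vs L) w) (pullD (@vt L) w).
Definition delD1 (w : form (atiyahb (vb L)) (vb L) k) :
    form (atiyahb (nerve2 L)) (nerve2 L) k :=
  fadd (fsub (pullD (@lpr2 L) w) (pullD (@lmul L) w)) (pullD (@lpr1 L) w).

End Simplicial.

Section TwistedDual.
Variables (L V : vbg).

(* h.z, for z in the fiber of L_M over s(h) *)
Definition lact (h : ar G) (x : ob G) (z : vb0 L x) : vb0 L (tgt h) :=
  vt (finv (@vs L) (cast (src h) z)).

Definition dual_s : vbmap (@src G) (homb (vb V) (vb L))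
                                   (homb (core V) (vb0 L)) :=
  fun g psi => tohom (fun c : core V (src g) =>
    - vs (happ psi (cast g (vm (0 : vb V g) (vi (cval c)))))).

Definition dual_t : vbmap (@tgt G) (homb (vb V) (vb L))
                                   (homb (core V) (vb0 L)) :=
  fun g psi => tohom (fun c : core V (tgt g) =>
    vt (happ psi (cast g (vm (cval c) (0 : vb V g))))).

(* psi o pr_C, as the map equal to psi on the core and 0 on the units V_M *)
Definition dual_u : vbmap (@uni G) (homb (core V) (vb0 L))
                                   (homb (vb V) (vb L)) :=
  fun x psi => the 0 (fun chi : Hom (vb V (uni x)) (vb L (uni x)) =>
    forall (c : core V x) (w : vb0 V x),
      happ chi (cval c + vu w) = vu (happ psi c)).

(* Forced by the multiplication: <psi^{-1}, v^{-1}> = - <psi, v>^{-1}. *)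
Definition dual_i : vbmap (@inv G) (homb (vb V) (vb L))
                                   (homb (vb V) (vb L)) :=
  fun g psi => the 0 (fun chi : Hom (vb V (inv g)) (vb L (inv g)) =>
    forall v : vb V g, happ chi (vi v) = - vi (happ psi v)).

Definition dual_m (g h : ar G) (psi : homb (vb V) (vb L) g)
    (psi' : homb (vb V) (vb L) h) : homb (vb V) (vb L) (mul g h) :=
  the 0 (fun chi : Hom (vb V (mul g h)) (vb L (mul g h)) =>
    forall (v : vb V g) (v' : vb V h), vcomp v v' ->
      happ chi (vm v v') =
      finv (@vs L) (cast (src (mul g h))
        (cast (src h) (lact (inv h) (vs (happ psi v))) + vs (happ psi' v')))).

Definition twisted_dual : vbg := VBG dual_s dual_t dual_u dual_i dual_m.

End TwistedDual.

Definition DL (L : vbg) : vbg :=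
  @VBG (atiyahb (vb L)) (atiyahb (vb0 L))
    (Dmap (@vs L)) (Dmap (@vt L)) (Dmap (@vu L)) (Dmap (@vi L))
    (fun g h d d' => the 0 (fun e : atiyahb (vb L) (mul g h) =>
      exists (c : src g = tgt h) (dd : atiyahb (nerve2 L) (mkar2 c)),
        [/\ Dmap (@lpr1 L) dd = d, Dmap (@lpr2 L) dd = d' &
            Dmap (@lmul L) dd = e])).

Definition J1L (L : vbg) : vbg := twisted_dual L (DL L).

Definition tmul (g h : ar G) (v : tangent g) (w : tangent h) :
    tangent (mul g h) :=
  the 0 (fun z : tangent (mul g h) =>
    exists (c : src g = tgt h) (vw : @tangent ar2 (mkar2 c)),
      [/\ dmap pr1 vw = v, dmap pr2 vw = w & dmap mul2 vw = z]).

Definition form1 (M : dspace R) (L : bundle M) (w : form (tanb M) L 1)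
  (x : M) (v : tangent x) : L x := w x (fun _ => v).
Definition pair2 (T : Type) (v w : T) : 'I_2 -> T :=
  fun i => if i == ord0 then v else w.

Section MoritaCurvature.
Variables (L : vbg) (theta : form (tanb (ar G)) (vb L) 1).

(* The inverse (v, l)^{-1} = (v^{-1}, (l + theta(v))^{-1}) is forced by the
   other structure maps. *)
Definition MK : vbg :=
  @VBG (sumb (tanb (ar G)) (vb L)) (sumb (tanb (ob G)) (vb0 L))
    (fun g vl => (dmap (@src G) vl.1, vs vl.2))
    (fun g vl => (dmap (@tgt G) vl.1, vt (vl.2 + form1 theta vl.1)))
    (fun x vl => (dmap (@uni G) vl.1, vu vl.2))
    (fun g vl => (dmap (@inv G) vl.1, vi (vl.2 + form1 theta vl.1)))
    (fun g h vl wl => (tmul vl.1 wl.1,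
                       finv (@vs L) (cast (src (mul g h)) (vs wl.2)))).

Variables (kappa : form (tanb (ob G)) (vb0 L) 2)
          (nabla : connection (vb0 L)).

Definition eta (g : ar G) (v : tangent g) : R :=
  the 0 (fun r => forall l : sec (vb L), smooth_sec l ->
    dapp (pullconn (@vs L) nabla v) l - dapp (pullconn (@vt L) nabla v) l
    = r *: l g).

Definition curvature : form (tanb (ar G)) (vb L) 2 :=
  fadd (dconn (pullconn (@vt L) nabla) theta) (delT0 kappa).

(* A pair (psi, r) in T^dagger G + R_G is identified with the element
   (w, m) |-> psi(w) + r m of Hom(TG + L, L). *)
Definition MR : vbmap (fun g => g) (vb MK) (vb (twisted_dual L MK)) :=
  fun g vl => tohom (fun wm : vb MK g =>
    @curvature g (pair2 vl.1 wm.1)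
    + eta wm.1 *: vl.2 + (- eta vl.1) *: wm.2).

End MoritaCurvature.

End VBGroupoids.

Definition is_vbg_morphism (G H : groupoid) (V : vbg G) (W : vbg H)
    (f : ar G -> ar H) (f0 : ob G -> ob H)
    (F : vbmap f (vb V) (vb W)) (F0 : vbmap f0 (vb0 V) (vb0 W)) : Prop :=
  [/\ is_gpd_morphism f f0,
      @is_gpd_morphism (vbg_groupoid V) (vbg_groupoid W)
        (totmap F) (totmap F0),
      vblinear F & vblinear F0].

Definition is_vb_morita (G H : groupoid) (V : vbg G) (W : vbg H)
    (f : ar G -> ar H) (f0 : ob G -> ob H)
    (F : vbmap f (vb V) (vb W)) (F0 : vbmap f0 (vb0 V) (vb0 W)) : Prop :=
  is_vbg_morphism F F0 /\
  @is_morita (vbg_groupoid V) (vbg_groupoid W) (totmap F) (totmap F0).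

(* A map over the identity of G, given on arrows only, is VB Morita; the map on
   objects is determined by it. *)
Definition is_vb_morita_id (G : groupoid) (V W : vbg G)
    (F : vbmap (fun g => g) (vb V) (vb W)) : Prop :=
  exists F0 : vbmap (fun x => x) (vb0 V) (vb0 W), is_vb_morita F F0.

Section Shifted.
Variables (G : groupoid) (L : vbg G).

Definition flat2 (w : form (atiyahb (vb L)) (vb L) 2) :
    vbmap (fun g => g) (vb (DL L)) (vb (J1L L)) :=
  fun g d => tohom (fun d' : atiyahb (vb L) g => w g (pair2 d d')).

(* For k = 1, the data of a shifted symplectic Atiyah form, resp. of a shifted
   contact structure. *)
Definition sdata (k : nat) : Type :=
  (form (atiyahb (vb L)) (vb L) k.+1 *
   form (atiyahb (vb0 L)) (vb0 L) k.+2)%type.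
Definition cdata (k : nat) : Type :=
  (form (tanb (ar G)) (vb L) k * form (tanb (ob G)) (vb0 L) k.+1)%type.

Definition is_shifted_symplectic (wW : sdata 1) : Prop :=
  [/\ is_form wW.1 /\ is_form wW.2,
      delD1 wW.1 = @form0 _ _ _ _,
      dD wW.1 = delD0 wW.2,
      dD wW.2 = @form0 _ _ _ _ &
      is_vb_morita_id (flat2 wW.1)].

Definition symplectic_gauge (a : form (atiyahb (vb0 L)) (vb0 L) 2)
    (wW : sdata 1) : sdata 1 :=
  (fadd wW.1 (delD0 a), fadd wW.2 (dD a)).
Definition symplectic_gauge_equiv (wW wW' : sdata 1) : Prop :=
  exists2 a, is_form a & wW' = symplectic_gauge a wW.

(* The Morita condition does not depend on the connection nabla. *)
Definition is_shifted_contact (tk : cdata 1) : Prop :=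
  [/\ is_form tk.1 /\ is_form tk.2,
      delT1 tk.1 = @form0 _ _ _ _ &
      exists2 nabla, is_connection nabla &
        is_vb_morita_id (@MR G L tk.1 tk.2 nabla)].

Definition contact_gauge (b : form (tanb (ob G)) (vb0 L) 1)
    (c : form (tanb (ob G)) (vb0 L) 2) (tk : cdata 1) : cdata 1 :=
  (fadd tk.1 (delT0 b), fadd tk.2 c).
Definition contact_gauge_equiv (tk tk' : cdata 1) : Prop :=
  exists b c, [/\ is_form b, is_form c & tk' = contact_gauge b c tk].

Definition to_atiyah (k : nat) (tk : cdata k) : sdata k :=
  (atiyah_form tk.1 (delT0 tk.2), atiyah_form tk.2 (@form0 _ _ _ _)).

End Shifted.

Definition contact_morita (G1 G2 : groupoid) (L1 : vbg G1) (L2 : vbg G2)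
    (tk1 : cdata L1 1) (tk2 : cdata L2 1) : Prop :=
  exists (G : groupoid) (L : vbg G)
    (f1 : ar G -> ar G1) (g1 : ob G -> ob G1)
    (F1 : vbmap f1 (vb L) (vb L1)) (H1 : vbmap g1 (vb0 L) (vb0 L1))
    (f2 : ar G -> ar G2) (g2 : ob G -> ob G2)
    (F2 : vbmap f2 (vb L) (vb L2)) (H2 : vbmap g2 (vb0 L) (vb0 L2)),
    [/\ is_lbg L, is_vb_morita F1 H1, is_vb_morita F2 H2 &
        @contact_gauge_equiv G L
          (pullT F1 tk1.1, pullT H1 tk1.2) (pullT F2 tk2.1, pullT H2 tk2.2)].

Definition symplectic_morita (G1 G2 : groupoid) (L1 : vbg G1) (L2 : vbg G2)
    (w1 : sdata L1 1) (w2 : sdata L2 1) : Prop :=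
  exists (G : groupoid) (L : vbg G)
    (f1 : ar G -> ar G1) (g1 : ob G -> ob G1)
    (F1 : vbmap f1 (vb L) (vb L1)) (H1 : vbmap g1 (vb0 L) (vb0 L1))
    (f2 : ar G -> ar G2) (g2 : ob G -> ob G2)
    (F2 : vbmap f2 (vb L) (vb L2)) (H2 : vbmap g2 (vb0 L) (vb0 L2)),
    [/\ is_lbg L, is_vb_morita F1 H1, is_vb_morita F2 H2 &
        @symplectic_gauge_equiv G L
          (pullD F1 w1.1, pullD H1 w1.2) (pullD F2 w2.1, pullD H2 w2.2)].

End Smooth.

(* Main.v *)
(* The components of w = d_D (sigma^* theta) + sigma^* omega_1 can be recovered:
   the identity derivation 1 has symbol 0 and is central in DL, so by Cartan's
   formula contraction of w with 1 returns sigma^* theta; in the same way, closed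
   Atiyah forms are exact. This gives the bijection on the level of
   forms and its compatibility with gauge transformations and pull-backs.
   To compare the two nondegeneracy conditions, both DL and the Morita kernel are
   seen as VB groupoids with fibers T_gG x_TM V_M that carry a multiplicative skew
   pairing. For these the map to the twisted dual is VB Morita if and only if
   rank A = rank V_M and a core element killed by the anchor and by the pairing
   with units vanishes. At a unit both conditions say: if v in ker ds and ker dt
   satisfies theta(v) = 0, eta(v) = 0 and K(v, du -) = 0, where K is the
   curvature of theta, then v = 0. *)
From HB Require Import structures.
From mathcomp Require Import all_boot all_order all_algebra.
From mathcomp Require Import ring lra.
From mathcomp Require Import all_classical all_reals all_analysis.
Require Import Defs.
Import Order.TTheory GRing.Theory Num.Theory numFieldNormedType.Exports.

Set Implicit Arguments.
Unset Strict Implicit.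
Unset Printing Implicit Defensive.

Local Open Scope classical_set_scope.
Local Open Scope ring_scope.

Arguments src {R g}.
Arguments tgt {R g}.
Arguments uni {R g}.
Arguments inv {R g}.
Arguments vs {R G v} [x].
Arguments vt {R G v} [x].
Arguments vu {R G v} [x].
Arguments vi {R G v} [x].
Arguments lpr1 {R G L} [x].
Arguments lpr2 {R G L} [x].
Arguments lmul {R G L} [x].
Notation form00 := (@form0 _ _ _ _ _) (only parsing).
Notation smooth_lift X := (smooth_map (fun y => mkt (X y))) (only parsing).
Ltac fext := (congr smooth_fun || congr smooth_map); apply/funext.

Notation dfunext := functional_extensionality_dep (only parsing).
Notation tmkt := (@mkt _ _ (tanb _) _) (only parsing).

(** * Smooth functions on Euclidean space *)

Section Calculus.
Variable R : realType.

(** Manifolds are Sikorski spaces and tangent vectors are derivations of global functions, so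
    neither coordinates nor dimensions are given: they are recovered by Hadamard's lemma and the
    inverse function theorem, and carried over to the space of composable pairs, on which the
    products of TG and DL and the simplicial differential are defined. Differentials, inverses and
    products are elements picked by [the], so that existence and uniqueness must be shown before
    they can be computed with. Base points often agree only propositionally, and equations between
    vectors are then stated in the total space, through [mkt]. A contact structure involves some
    connection; one is built by a partition of unity. The Morita criterion reduces to a condition on
    the core because the pairing maps the complex C -> V_M to its dual, and the cone 0 -> C -> V_M +
    V_M^* -> C^* -> 0 of this map has as last arrow the transpose of the first one, up to a sign on
    one summand. With equal ranks, exactness on the left therefore gives exactness everywhere.
    Conversely exactness forces the ranks to be equal. *)

Lemma line_is_derive (V : normedModType R) (f : V -> R) (x v : V) (t : R) : derivable f (x + t *: v) v ->
 is_derive t 1 (fun s => f (x + s *: v)) ('D_v f (x + t *: v)).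
move=> df.
have E : (fun h : R => h^-1 *: (((fun s => f (x + s *: v)) \o shift t) (h *: 1)
   - f (x + t *: v))) = (fun h : R => h^-1 *: ((f \o shift (x + t *: v)) (h *: v) - f (x + t *: v))).
 apply/funext => h /=; congr (_ *: (f _ - _)).
 by rewrite -[h *: 1]/(h * 1) mulr1 scalerDl addrCA.
by apply: DeriveDef; rewrite /derivable /derive E.
Qed.

Section Rn.
Variable n : nat.
Implicit Types f g : 'rV[R]_n -> R.

Definition pder (i : 'I_n) f : 'rV[R]_n -> R := fun x => 'D_(delta_mx 0 i) f x.

Lemma CkS k f : Ck k.+1 f <-> continuous f /\ forall i : 'I_n,
 (forall x, derivable f x (delta_mx 0 i)) /\ Ck k (pder i f).
by []. Qed.

Lemma Ck_cont k f : Ck k f -> continuous f.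
by case: k => [|k] // []. Qed.

Lemma CkW k f : Ck k.+1 f -> Ck k f.
elim: k f => [|k IH] f; first by case.
move=> /CkS[cf H]; apply/CkS; split=> // i; have [d c] := H i.
by split=> //; exact: IH.
Qed.

Lemma Ck_cst k (a : R) : Ck k (fun _ : 'rV[R]_n => a).
elim: k a => [|k IH] a; first exact: cst_continuous.
apply/CkS; split=> [|i]; first exact: cst_continuous.
split=> [x|]; first exact: derivable_cst.
rewrite (_ : pder i _ = fun=> 0); first exact: IH.
by apply/funext => x; rewrite /pder derive_cst.
Qed.

Lemma coord_drv (j : 'I_n) (x v : 'rV[R]_n) : is_derive x v (fun y : 'rV[R]_n => y 0 j) (v 0 j).
have d : derivable (fun y : 'rV[R]_n => y) x v by exact: derivable_id.
have /derivable_mxP /(_ 0 j) d' := d; apply: DeriveDef => //.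
have := derive_mx d; rewrite derive_id => /matrixP /(_ 0 j).
by rewrite mxE.
Qed.

Lemma coord_cont (j : 'I_n) : continuous (fun y : 'rV[R]_n => y 0 j).
exact: coord_continuous. Qed.

Lemma Ck_coord k (j : 'I_n) : Ck k (fun y : 'rV[R]_n => y 0 j).
case: k => [|k]; first exact: coord_cont.
split=> [|i]; first exact: coord_cont.
split=> [x|]; first by have [] := coord_drv j x (delta_mx 0 i).
rewrite (_ : (fun _ => _) = fun=> (delta_mx 0 i : 'rV[R]_n) 0 j); first exact: Ck_cst.
by apply/funext => x; have [_ ->] := coord_drv j x (delta_mx 0 i).
Qed.

Lemma pderD i f g x : derivable f x (delta_mx 0 i) -> derivable g x (delta_mx 0 i) ->
 pder i (fun y => f y + g y) x = pder i f x + pder i g x.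
by move=> df dg; exact: (deriveD df dg). Qed.

Lemma pderM i f g x : derivable f x (delta_mx 0 i) -> derivable g x (delta_mx 0 i) ->
 pder i (fun y => f y * g y) x = pder i f x * g x + f x * pder i g x.
move=> df dg; rewrite /pder (deriveM df dg) addrC.
by rewrite /GRing.scale /= mulrC.
Qed.

Lemma CkD k f g : Ck k f -> Ck k g -> Ck k (fun y => f y + g y).
elim: k f g => [|k IH] f g.
 by move=> /Ck_cont cf /Ck_cont cg x; exact: (cvgD (cf x) (cg x)).
move=> /CkS[cf Hf] /CkS[cg Hg]; apply/CkS; split.
 by move=> x; exact: (cvgD (cf x) (cg x)).
move=> i; have [df cdf] := Hf i; have [dg cdg] := Hg i.
split=> [x|]; first exact: derivableD.
rewrite (_ : pder i _ = fun y => pder i f y + pder i g y); first exact: IH.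
by apply/funext => x; rewrite pderD.
Qed.

Lemma CkM k f g : Ck k f -> Ck k g -> Ck k (fun y => f y * g y).
elim: k f g => [|k IH] f g.
 by move=> /Ck_cont cf /Ck_cont cg x; exact: (cvgM (cf x) (cg x)).
move=> Cf Cg; have Cf' := CkW Cf; have Cg' := CkW Cg.
move: Cf Cg => /CkS[cf Hf] /CkS[cg Hg]; apply/CkS; split.
 by move=> x; exact: (cvgM (cf x) (cg x)).
move=> i; have [df cdf] := Hf i; have [dg cdg] := Hg i.
split=> [x|]; first exact: derivableM.
rewrite (_ : pder i _ = fun y => pder i f y * g y + f y * pder i g y).
 by apply: CkD; exact: IH.
by apply/funext => x; rewrite pderM.
Qed.

Lemma Ck_sum k (I : Type) (r : seq I) (P : pred I) (F : I -> 'rV[R]_n -> R) :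
 (forall i, P i -> Ck k (F i)) -> Ck k (fun y => \sum_(i <- r | P i) F i y).
move=> H; elim: r => [|i r IH].
 rewrite (_ : (fun y => _) = fun=> 0); first exact: Ck_cst.
 by apply/funext => y; rewrite big_nil.
case Pi : (P i).
 rewrite (_ : (fun y => _) = fun y => F i y + \sum_(j <- r | P j) F j y).
  by apply: CkD => //; exact: H.
 by apply/funext => y; rewrite big_cons Pi.
by rewrite (_ : (fun y => _) = fun y => \sum_(j <- r | P j) F j y) //; apply/funext => y; rewrite big_cons Pi.
Qed.

Lemma Cinfty_cst a : Cinfty (fun _ : 'rV[R]_n => a).
by move=> k; exact: Ck_cst. Qed.
Lemma Ccoord j : Cinfty (fun y : 'rV[R]_n => y 0 j).
by move=> k; exact: Ck_coord. Qed.
Lemma CinftyD f g : Cinfty f -> Cinfty g -> Cinfty (fun y => f y + g y).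
by move=> cf cg k; exact: CkD. Qed.
Lemma CinftyM f g : Cinfty f -> Cinfty g -> Cinfty (fun y => f y * g y).
by move=> cf cg k; exact: CkM. Qed.
Lemma CinftyN f : Cinfty f -> Cinfty (fun y => - f y).
move=> cf; rewrite (_ : (fun y => _) = fun y => (-1) * f y).
 by apply: CinftyM => //; exact: Cinfty_cst.
by apply/funext => y; rewrite mulN1r.
Qed.
Lemma CinftyB f g : Cinfty f -> Cinfty g -> Cinfty (fun y => f y - g y).
by move=> cf cg; apply: CinftyD => //; exact: CinftyN. Qed.
Lemma Cinfty_sum (I : Type) (r : seq I) (P : pred I) (F : I -> 'rV[R]_n -> R) :
 (forall i, P i -> Cinfty (F i)) -> Cinfty (fun y => \sum_(i <- r | P i) F i y).
by move=> H k; apply: Ck_sum => i Pi; exact: H. Qed.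
Lemma Cinfty_cont f : Cinfty f -> continuous f.
by move=> /(_ 0%N). Qed.
Lemma Cinfty_pder i f : Cinfty f -> Cinfty (pder i f).
by move=> cf k; have /CkS[_ /(_ i)[]] := cf k.+1. Qed.
Lemma Cinfty_dble i f x : Cinfty f -> derivable f x (delta_mx 0 i).
by move=> cf; have /CkS[_ /(_ i)[]] := cf 1%N. Qed.

End Rn.

Lemma near_eqv (T : Type) (F : set_system T) {FF : Filter F} (P Q : T -> Prop) :
 (forall x, P x -> Q x) -> (\forall x \near F, P x) -> \forall x \near F, Q x.
by move=> PQ; apply: filterS. Qed.

Lemma choice2 (T U : Type) (P Q : T -> U -> Prop) :
 (forall x, exists2 y, P x y & Q x y) -> exists f, forall x, P x (f x) /\ Q x (f x).
move=> H; have /boolp.choice[f Hf] x : exists y, P x y /\ Q x y.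
 by have [y] := H x; exists y.
by exists f.
Qed.

Lemma near_cvg (T : Type) (F : set_system T) {FF : Filter F} (U : topologicalType) (f g : T -> U) (l : U) :
 (\forall x \near F, f x = g x) -> f x @[x --> F] --> l -> g x @[x --> F] --> l.
by move=> fg; apply: cvg_trans; exact: near_eq_cvg. Qed.

(** The intermediate point is given as a fraction s of t, so that positive, negative and zero t are
    covered by the same formula. *)
Lemma mvt_dir (V : normedModType R) (f : V -> R) (x v : V) (t : R) : (forall y, derivable f y v) ->
 exists2 s : R, 0 <= s <= 1 & f (x + t *: v) - f x = t * 'D_v f (x + (s * t) *: v).
move=> df; pose g s := f (x + s *: v).
have dg (s : R) : is_derive s 1 g ('D_v f (x + s *: v)) by exact: line_is_derive.
have cg (a b : R) : {within `[a, b], continuous g}.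
 apply: derivable_within_continuous => s _.
 by have [] := dg s.
have [t0|t0|->] := ltgtP t 0; last first.
- by exists 0; rewrite ?lexx ?ler01 // scale0r addr0 subrr mul0r.
- have [c] := @MVT R g _ 0 t t0 (fun s _ => dg s) (cg _ _).
 rewrite in_itv /= => /andP[tc c0]; rewrite /g scale0r addr0 subr0 => E.
 exists (c / t); last by rewrite divfK ?gt_eqF // E mulrC.
 rewrite ler_pdivrMr // ler_pdivlMr // mul0r mul1r.
 by rewrite (ltW tc) (ltW c0).
- have [c] := @MVT R g _ t 0 t0 (fun s _ => dg s) (cg _ _).
 rewrite in_itv /= => /andP[tc c0]; rewrite /g scale0r addr0 sub0r => E.
 exists (c / t); last first.
  by rewrite divfK ?lt_eqF // -[LHS]opprB E mulrN opprK mulrC.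
 rewrite ler_ndivrMr // ler_ndivlMr // mul0r mul1r.
 by rewrite (ltW tc) (ltW c0).
Qed.

(** The norm of row vectors is the sup norm. Positivity of r matters for n = 0, where the right-hand
    side is vacuous. *)
Lemma rV_norm_lt n (u : 'rV[R]_n) (r : R) : 0 < r -> (`|u| < r) <-> forall j, `|u 0 j| < r.
move=> r0; have E : (`|u| < r) <-> ball (0 : 'rV[R]_n) r u.
 by rewrite -ball_normE /ball_ /= sub0r normrN.
rewrite E; split.
 move=> [_ /(_ 0)] H j; have := H j.
 by rewrite -ball_normE /ball_ /= mxE sub0r normrN.
move=> H; split=> // i j; rewrite (ord1 i) -ball_normE /ball_ /= mxE sub0r normrN.
exact: H.
Qed.

Lemma rV_coord_le n (u : 'rV[R]_n) j : `|u 0 j| <= `|u|.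
rewrite leNgt; apply/negP => H.
have u0 : 0 < `|u 0 j| by exact: le_lt_trans H.
by move/(rV_norm_lt u u0): H => /(_ j); rewrite ltxx.
Qed.

(** The path from a to b changes one coordinate at a time, and [mvt_dir] is applied on each leg;
    only partial derivatives are involved. Balls of the sup norm are boxes, so any ball containing a
    and b contains the whole path. *)
Lemma mvt_rV n (F : 'rV[R]_n -> R) (a b : 'rV[R]_n) : (forall i x, derivable F x (delta_mx 0 i)) ->
 exists xi : 'I_n -> 'rV[R]_n, (forall k c r, `|a - c| < r -> `|b - c| < r -> `|xi k - c| < r) /\
  F b - F a = \sum_k (b 0 k - a 0 k) * pder k F (xi k).
move=> dF; pose p (k : nat) : 'rV[R]_n := \row_j (if (j < k)%N then b 0 j else a 0 j).
have pS (k : 'I_n) : p k.+1 = p k + (b 0 k - a 0 k) *: delta_mx 0 k.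
 apply/rowP => j; rewrite !mxE eqxx /= ltnS leq_eqVlt.
 have [->|jk] := eqVneq j k; first by rewrite eqxx ltnn /= mulr1 addrC subrK.
 by rewrite (_ : (j == k :> nat) = false) ?mulr0 ?addr0 //; apply/negbTE.
have /choice2[s Hs] (k : 'I_n) := mvt_dir (p k) (b 0 k - a 0 k) (fun y => dF k y).
exists (fun k : 'I_n => p k + (s k * (b 0 k - a 0 k)) *: delta_mx 0 k); split.
 move=> k c r ac bc; have r0 : 0 < r by exact: le_lt_trans ac.
 apply/rV_norm_lt => // j; rewrite !mxE eqxx /=.
 move/rV_norm_lt : ac => /(_ r0 j); move/rV_norm_lt : bc => /(_ r0 j).
 rewrite !mxE => bc ac; have [jk|jk] := eqVneq j k; last first.
  by rewrite mulr0 addr0; case: ifP.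
 subst j; rewrite ltnn mulr1; have [/andP[s0 s1] _] := Hs k.
 rewrite (_ : _ - _ = (1 - s k) * (a 0 k - c 0 k) + s k * (b 0 k - c 0 k)); last by ring.
 apply: (le_lt_trans (ler_normD _ _)); rewrite !normrM (ger0_norm s0).
 rewrite ger0_norm ?subr_ge0 //.
 have mr : Num.max `|a 0 k - c 0 k| `|b 0 k - c 0 k| < r by rewrite gt_max ac bc.
 apply: le_lt_trans mr; set m := Num.max _ _.
 have -> : m = (1 - s k) * m + s k * m by ring.
 by apply: lerD; apply: ler_wpM2l; rewrite ?subr_ge0 // le_max lexx ?orbT.
rewrite -[LHS](_ : \sum_(0 <= k < n) (F (p k.+1) - F (p k)) = _); last first.
 rewrite telescope_sumr //; congr (F _ - F _); apply/rowP => j; rewrite mxE.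
 - by rewrite ltn_ord.
 - by [].
rewrite big_mkord; apply: eq_bigr => k _; rewrite pS.
by have [_ ->] := Hs k.
Qed.

Lemma cvgr_sum (T : Type) (F : set_system T) {FF : Filter F} (I : Type) (r : seq I) (f : I -> T -> R) (l : I -> R) :
 (forall i, f i x @[x --> F] --> l i) -> (\sum_(i <- r) f i x) @[x --> F] --> \sum_(i <- r) l i.
move=> H; elim: r => [|i r IH].
 rewrite big_nil; apply: near_cvg (cvg_cst 0).
 by apply: nearW => x; rewrite big_nil.
rewrite big_cons; apply: near_cvg (cvgD (H i) IH).
by apply: nearW => x; rewrite big_cons.
Qed.

Lemma is_derive_cvg (V : normedModType R) (f : V -> R) (x v : V) (l : R) : is_derive x v f l <->
 (h^-1 * (f (h *: v + x) - f x)) @[h --> (0 : R)^'] --> l.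
split=> [[df <-]|H]; first exact: df.
by apply: DeriveDef; [apply/cvg_ex; exists l; exact: H|exact: cvg_lim H].
Qed.

Lemma derivable_line_cont (V : normedModType R) (f : V -> R) (x v : V) :
 derivable f x v -> f (h *: v + x) @[h --> (0 : R)^'] --> f x.
move=> df; have /is_derive_cvg H : is_derive x v f ('D_v f x) by exact: DeriveDef.
have H2 : h @[h --> (0 : R)^'] --> (0 : R).
 by apply: cvg_within_filter; exact: cvg_id.
have : (h * (h^-1 * (f (h *: v + x) - f x)) + f x) @[h --> (0 : R)^'] --> 0 * 'D_v f x + f x.
 by apply: cvgD; [exact: cvgM|exact: cvg_cst].
rewrite mul0r add0r; apply: near_cvg.
near=> h; rewrite mulVKf ?subrK //.
by near: h; exact: nbhs_dnbhs_neq.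
Unshelve. all: by end_near.
Qed.

Lemma cvg_rV (T : Type) (F : set_system T) {FF : Filter F} m (G : 'I_m -> T -> R) (a : 'rV[R]_m) :
 (forall k, G k x @[x --> F] --> a 0 k) -> (\row_k G k x) @[x --> F] --> a.
move=> H; apply/cvgrPdist_lt => e e0.
have {}H k : \forall h \near F, `|a 0 k - G k h| < e.
 by have /cvgrPdist_lt /(_ _ e0) := H k.
have := filter_forall FF H; apply: filterS => h {}H.
by apply/rV_norm_lt => // j; rewrite !mxE; exact: H.
Qed.

(** The increment of F is written by [mvt_rV] with partial derivatives at intermediate points, which
    tend to the base point; continuity of the partial derivatives then gives the limit of the
    difference quotient. *)
Lemma is_derive_comp_rV (V : normedModType R) m (G : 'I_m -> V -> R) (F : 'rV[R]_m -> R) (x v : V) :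
 (forall i y, derivable F y (delta_mx 0 i)) -> (forall i, continuous (pder i F)) ->
 (forall k, derivable (G k) x v) -> is_derive x v (fun y => F (\row_k G k y))
  (\sum_k 'D_v (G k) x * pder k F (\row_k G k x)).
move=> dF cF dG; apply/is_derive_cvg; set a := \row_k G k x.
pose b (h : R) : 'rV[R]_m := \row_k G k (h *: v + x).
have /choice[xi Hxi] (h : R) := mvt_rV a (b h) dF.
have cb : b h @[h --> (0 : R)^'] --> a.
 by apply: cvg_rV => k; rewrite mxE; exact: derivable_line_cont.
have cxi k : xi h k @[h --> (0 : R)^'] --> a.
 apply/cvgrPdist_lt => e e0; move/cvgrPdist_lt : cb => /(_ _ e0).
 apply: near_eqv => h H; have [Hx _] := Hxi h.
 by rewrite distrC; apply: Hx; rewrite ?subrr ?normr0 // distrC.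
suff H : (\sum_k (h^-1 * (G k (h *: v + x) - G k x)) * pder k F (xi h k))
  @[h --> (0 : R)^'] --> \sum_k 'D_v (G k) x * pder k F a.
 apply: cvg_trans H; apply: near_eq_cvg; apply: nearW => h.
 have [_ ->] := Hxi h; rewrite mulr_sumr; apply: eq_bigr => k _.
 by rewrite !mxE mulrA.
apply: cvgr_sum => k; apply: cvgM.
 by apply/is_derive_cvg; exact: DeriveDef.
by apply: (cvg_comp _ _ (cxi k)); exact: cF.
Qed.

Arguments Cinfty_dble {n i f} x _.
Arguments Cinfty_pder {n i f} _.
Lemma Ck_comp k n m (G : 'I_m -> 'rV[R]_n -> R) (F : 'rV[R]_m -> R) :
 Cinfty F -> (forall i, Cinfty (G i)) -> Ck k (fun y => F (\row_i G i y)).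
move=> + cG; elim: k F => [|k IH] F cF; last apply/CkS; last split.
- move=> y; apply: continuous_comp; last exact: Cinfty_cont cF _.
 apply: (@cvg_rV _ (nbhs y)) => i; rewrite mxE.
 exact: Cinfty_cont (cG i) _.
- by apply: Ck_cont; exact: IH.
move=> i; have H x := is_derive_comp_rV (fun j y => Cinfty_dble (i := j) y cF)
 (fun j => Cinfty_cont (Cinfty_pder (i := j) cF)) (fun k => Cinfty_dble (i := i) x (cG k)).
split=> [x|]; first by have [] := H x.
rewrite (_ : pder i _ = fun x => \sum_k pder i (G k) x * pder k F (\row_k G k x)).
 apply: Ck_sum => j _; apply: CkM; first exact: Cinfty_pder.
 by apply: IH; exact: Cinfty_pder.
by apply/funext => x; have [_] := H x.
Qed.

Lemma Cinfty_comp n m (G : 'I_m -> 'rV[R]_n -> R) (F : 'rV[R]_m -> R) :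
 Cinfty F -> (forall i, Cinfty (G i)) -> Cinfty (fun y => F (\row_i G i y)).
by move=> cF cG k; exact: Ck_comp. Qed.

Lemma Ck_inv k n (f : 'rV[R]_n -> R) : Cinfty f -> (forall y, f y != 0) -> Ck k (fun y => (f y)^-1).
move=> cf f0; elim: k => [|k IH].
 by move=> y; exact: (cvgV (f0 y) (Cinfty_cont cf (x := y))).
apply/CkS; split; first exact: Ck_cont IH.
move=> i; have D x : derivable (fun y => (f y)^-1) x (delta_mx 0 i).
 by apply: derivableV; [exact: f0|exact: Cinfty_dble].
split=> //.
rewrite (_ : pder i _ = fun y => (- pder i f y) * ((f y)^-1 * (f y)^-1)).
 by apply: CkM; [apply: CinftyN; exact: Cinfty_pder|exact: CkM].
apply/funext => x; rewrite /pder deriveV //; last exact: Cinfty_dble.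
by rewrite -[_ *: _]/(_ * _) -exprVn expr2 mulNr mulNr mulrC.
Qed.

Lemma Cinfty_inv n (f : 'rV[R]_n -> R) : Cinfty f -> (forall y, f y != 0) -> Cinfty (fun y => (f y)^-1).
by move=> cf f0 k; exact: Ck_inv. Qed.

Lemma Cinfty_prod n (I : Type) (r : seq I) (F : I -> 'rV[R]_n -> R) :
 (forall i, Cinfty (F i)) -> Cinfty (fun y => \prod_(i <- r) F i y).
move=> H; elim: r => [|i r IH].
 rewrite (_ : (fun y => _) = fun=> 1); first exact: Cinfty_cst.
 by apply/funext => y; rewrite big_nil.
rewrite (_ : (fun y => _) = fun y => F i y * \prod_(j <- r) F j y).
 by apply: CinftyM => //; exact: H.
by apply/funext => y; rewrite big_cons.
Qed.

(** The functions t^-m exp(-1/t), continued by 0. All m are treated together because the family is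
    closed under differentiation: the derivative of [flat m] is a combination of [flat m.+2] and
    [flat m.+1]. *)
Definition flat (m : nat) (t : R) : R := if 0 < t then t^-1 ^+ m * expR (- t^-1) else 0.

(** With u = 1/t, the term u^(m+1)/(m+1)! of the exponential series bounds u^m = t u^(m+1) by (m+1)!
    t exp(u). *)
Lemma flat_le m (t : R) : 0 < t -> flat m t <= (m.+1)`!%:R * t.
move=> t0; rewrite /flat t0; have u0 : 0 <= t^-1 by rewrite invr_ge0 ltW.
have := expR_ge1Dxn m u0; set u := t^-1; rewrite expRN.
have f0 : 0 < (m.+1)`!%:R :> R by rewrite ltr0n fact_gt0.
have e0 : 0 < expR u by exact: expR_gt0.
move=> H; rewrite -(ler_pM2r e0) -mulrA mulVf ?gt_eqF // mulr1.
have H2 : u ^+ m.+1 <= (m.+1)`!%:R * expR u.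
 rewrite mulrC -ler_pdivrMr //; apply: le_trans H.
 by rewrite lerDr ler01.
have -> : u ^+ m = t * u ^+ m.+1 by rewrite exprS mulrA divff ?gt_eqF // mul1r.
by rewrite (mulrC _ t) -mulrA ler_wpM2l // ltW.
Qed.

Lemma flat_ge0 m t : 0 <= flat m t.
rewrite /flat; case: ifP => // t0; apply: mulr_ge0; last exact: expR_ge0.
by apply: exprn_ge0; rewrite invr_ge0 ltW.
Qed.

Lemma flat_is_derive m (t : R) : is_derive t 1 (flat m) (flat m.+2 t - m%:R * flat m.+1 t).
have [t0|t0|->] := ltgtP t 0.
- have E s : s <= 0 -> flat m s = 0 by move=> s0; rewrite /flat ltNge s0.
 have -> : flat m.+2 t - m%:R * flat m.+1 t = 0.
  by rewrite /flat !(ltNge 0 t) (ltW t0) /= mulr0 subrr.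
 apply: (@near_eq_is_derive _ _ _ (cst 0)).
 by near=> s; rewrite E // ltW //; near: s; exact: lt_nbhsl.
- apply: (@near_eq_is_derive _ _ _ ((fun s : R => s^-1) ^+ m * (expR \o (fun s : R => - s^-1)))).
  near=> s; rewrite /flat ifT; first by rewrite fctE /= exprfctE.
  by near: s; exact: lt_nbhsr.
 have t1 : t != 0 by rewrite gt_eqF.
 have dV : is_derive t 1 (fun s : R => s^-1) (- t ^- 2).
  apply: is_derive_eq (@is_deriveV _ id t 1 1 t1 _) _.
  by rewrite -[LHS]/(_ * _) mulr1.
 have dN : is_derive t 1 (fun s : R => - s^-1) (t ^- 2).
  by apply: is_derive_eq (is_deriveN dV) _; rewrite opprK.
 have dE := @is_derive1_comp _ expR (fun s : R => - s^-1) t _ _ (is_derive_expR _) dN.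
 apply: is_derive_eq (is_deriveM (is_deriveX m dV) dE) _.
 rewrite /flat t0 -![_ *: _]/(_ * _) /= exprfctE -exprVn.
 set e := expR _; set u := t^-1.
 case: m => [|m]; first by rewrite !expr0 !mul0r mulr0 addr0 subr0 mul1r mulrC.
 by rewrite /= !exprS; ring.
(* At t = 0 the difference quotient of [flat m] is [flat m.+1], which [flat_le] squeezes between
   multiples of |h|. *)
apply/is_derive_cvg; rewrite /flat ltxx mulr0 subrr.
apply: (@near_cvg _ _ _ _ (fun h : R => if 0 < h then flat m.+1 h else 0)).
 near=> h; rewrite -[h *: 1]/(h * 1) mulr1 addr0 subr0.
 have h0 : h != 0 by near: h; exact: nbhs_dnbhs_neq.
 case: ifP => [hp|_]; last by rewrite mulr0.
 by rewrite /flat hp exprS mulrA.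
have nzc (c : R) : c * `|h| @[h --> (0 : R)^'] --> (0 : R).
 have : c * `|h| @[h --> (0 : R)^'] --> c * `|0 : R|.
  by apply: cvgMr; apply: cvg_norm; apply: cvg_within_filter; exact: cvg_id.
 by rewrite normr0 mulr0.
have nz := nzc (m.+2)`!%:R; have nzN := nzc (- (m.+2)`!%:R).
apply: (@squeeze_cvgr _ _ _ _ (fun h : R => - ((m.+2)`!%:R * `|h|)) (fun h : R => (m.+2)`!%:R * `|h|)).
- apply: nearW => h; have H0 : 0 <= (m.+2)`!%:R * `|h| by apply: mulr_ge0.
 case: ifP => hp; last by rewrite H0 lerNl oppr0 H0.
 apply/andP; split; first by apply: le_trans (flat_ge0 _ _); rewrite oppr_le0.
 by apply: le_trans (flat_le _ hp) _; rewrite gtr0_norm.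
- apply: near_cvg nzN; apply: nearW => h; exact: mulNr.
- exact: nz.
Unshelve. all: by end_near.
Qed.

Lemma Cinfty_flat m : Cinfty (fun y : 'rV[R]_1 => flat m (y 0 0)).
move=> k; elim: k m => [|k IH] m; last apply/CkS.
 move=> y; apply: (@continuous_comp _ _ _ (fun y : 'rV[R]_1 => y 0 0) (flat m)).
  exact: coord_cont.
 apply: differentiable_continuous; apply/derivable1_diffP.
 by have [] := flat_is_derive m (y 0 0).
split; first exact: Ck_cont (IH m).
move=> i; rewrite (ord1 i).
have D x : is_derive x (delta_mx 0 0) (fun y : 'rV[R]_1 => flat m (y 0 0))
  (flat m.+2 (x 0 0) - m%:R * flat m.+1 (x 0 0)).
 apply/is_derive_cvg; have /is_derive_cvg := flat_is_derive m (x 0 0).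
 by apply: near_cvg; apply: nearW => h; rewrite !mxE eqxx.
split=> [x|]; first by have [] := D x.
rewrite (_ : pder _ _ = fun x => flat m.+2 (x 0 0) + (- m%:R) * flat m.+1 (x 0 0)).
 by apply: CkD; [exact: IH|apply: CkM; [exact: Ck_cst|exact: IH]].
by apply/funext => x; have [_] := D x; rewrite /pder mulNr.
Qed.

Lemma Cinfty_flat_comp m n (f : 'rV[R]_n -> R) : Cinfty f -> Cinfty (fun y => flat m (f y)).
move=> cf; have := Cinfty_comp (Cinfty_flat m) (fun _ : 'I_1 => cf).
by congr Cinfty; apply/funext => y; rewrite mxE.
Qed.

Definition step (t : R) : R := flat 0 t / (flat 0 t + flat 0 (1 - t)).

Lemma flat0_gt0 t : 0 < t -> 0 < flat 0 t.
by move=> t0; rewrite /flat t0 expr0 mul1r expR_gt0. Qed.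
Lemma flat_le0 m t : t <= 0 -> flat m t = 0.
by move=> t0; rewrite /flat ltNge t0. Qed.

Lemma step_den t : 0 < flat 0 t + flat 0 (1 - t).
have [t0|t0] := ltP 0 t.
 by apply: ltr_pwDl; [exact: flat0_gt0|exact: flat_ge0].
by apply: ltr_wpDl; [exact: flat_ge0|apply: flat0_gt0; lra].
Qed.

Lemma step_ge0 t : 0 <= step t.
by apply: divr_ge0; [exact: flat_ge0|exact: ltW (step_den t)]. Qed.
Lemma step_le1 t : step t <= 1.
by rewrite ler_pdivrMr ?step_den // mul1r lerDl flat_ge0. Qed.
Lemma step1 t : 1 <= t -> step t = 1.
move=> t1; rewrite /step (@flat_le0 _ (1 - t)) ?subr_le0 // addr0 divff //.
by rewrite gt_eqF // flat0_gt0 //; lra.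
Qed.
Lemma step0 t : t <= 0 -> step t = 0.
by move=> t0; rewrite /step flat_le0 // mul0r. Qed.

Lemma Cinfty_step n (f : 'rV[R]_n -> R) : Cinfty f -> Cinfty (fun y => step (f y)).
move=> cf; apply: CinftyM; first exact: Cinfty_flat_comp.
apply: Cinfty_inv => [|y]; last by rewrite gt_eqF // step_den.
apply: CinftyD; first exact: Cinfty_flat_comp.
by apply: Cinfty_flat_comp; apply: CinftyB => //; exact: Cinfty_cst.
Qed.

Lemma bump_rV n (a : 'rV[R]_n) (e : R) : 0 < e ->
 (* Each factor is a [step] whose argument is at most 0 once |y_j - a_j| >= e, and at least 1 once
    (y_j - a_j)^2 <= e^2/2, in particular within e/2; squares keep the argument smooth. *)
 exists chi : 'rV[R]_n -> R, [/\ Cinfty chi, forall y, 0 <= chi y <= 1, forall y, `|y - a| < e / 2 -> chi y = 1 &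
  forall y, e <= `|y - a| -> chi y = 0].
move=> e0; pose phi (j : 'I_n) (y : 'rV[R]_n) := step ((e ^+ 2 - (y 0 j - a 0 j) ^+ 2) * (2 / e ^+ 2)).
have c0 : 0 < 2 / e ^+ 2 by apply: divr_gt0 => //; exact: exprn_gt0.
exists (fun y => \prod_j phi j y); split.
- apply: Cinfty_prod => j; apply: Cinfty_step; apply: CinftyM; last exact: Cinfty_cst.
 have H : Cinfty (fun y : 'rV[R]_n => y 0 j - a 0 j).
  by apply: CinftyB; [exact: Ccoord|exact: Cinfty_cst].
 by apply: CinftyB; [exact: Cinfty_cst|exact: CinftyM].
- move=> y; apply/andP; split; first by apply: prodr_ge0 => j _; exact: step_ge0.
 by apply: prodr_ile1 => j _; rewrite step_ge0 step_le1.
- move=> y H; rewrite big1 // => j _; apply: step1.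
 have e2 : 0 < e / 2 by rewrite divr_gt0.
 move/rV_norm_lt : H => /(_ e2 j); rewrite !mxE; set d := y 0 j - a 0 j => H.
 have {}H : d ^+ 2 <= (e / 2) ^+ 2.
  by rewrite -[d ^+ 2]real_normK ?num_real // ler_sqr ?nnegrE // ltW.
 rewrite mulrA ler_pdivlMr ?exprn_gt0 // mul1r.
 rewrite exprMn in H; have : (2^-1 : R) ^+ 2 = 4^-1 by field.
 move=> E; rewrite E in H; have := sqr_ge0 e.
 by move: (d ^+ 2) (e ^+ 2) H => A B; lra.
- move=> y H; apply/eqP; rewrite prodf_seq_eq0; apply/hasP.
 have : exists j, e <= `|y 0 j - a 0 j|.
  apply: contrapT => /forallNP N; move: H; rewrite leNgt => /negP; apply.
  by apply/rV_norm_lt => // j; rewrite !mxE ltNge; apply/negP.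
 move=> [j ej]; exists j; first by rewrite mem_index_enum.
 apply/eqP; apply: step0; apply: mulr_le0_ge0; last exact: ltW.
 rewrite subr_le0 -[leRHS]real_normK ?num_real // ler_sqr ?nnegrE //.
 exact: ltW.
Qed.

Lemma Cinfty_inv_near n (F : 'rV[R]_n -> R) a : Cinfty F -> F a != 0 ->
 exists2 H, Cinfty H & \forall y \near a, H y = (F y)^-1.
move=> cF Fa; have c0 : 0 < F a ^+ 2 by rewrite exprn_even_gt0.
(* The inverse near a is F / D. Where F^2 >= F(a)^2/2 the [step] term vanishes and F / D = 1/F;
   where F = 0 it equals 1, so D has no zero. *)
pose D y := F y ^+ 2 + step (2 - F y ^+ 2 * (4 / F a ^+ 2)).
have D0 y : D y != 0.
 rewrite gt_eqF // /D; have [->|Fy] := eqVneq (F y) 0.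
  by rewrite expr0n /= mul0r subr0 add0r step1 ?ltr01 // ler1n.
 by apply: ltr_pwDl; [rewrite exprn_even_gt0|exact: step_ge0].
have cF2 : Cinfty (fun y => F y ^+ 2) by exact: CinftyM.
exists (fun y => F y * (D y)^-1).
 apply: CinftyM => //; apply: Cinfty_inv => //; apply: CinftyD => //; apply: Cinfty_step.
 by apply: CinftyB; [exact: Cinfty_cst|apply: CinftyM => //; exact: Cinfty_cst].
have c2 : F a ^+ 2 / 2 < F a ^+ 2 by rewrite gtr_pMr // invf_lt1 // ltr1n.
have cFa : F y ^+ 2 @[y --> a] --> F a ^+ 2 := Cinfty_cont cF2 (x := a).
apply: filterS (cvgr_gt _ cFa _ c2) => y Fy.
have Fy0 : F y != 0 by apply/eqP => F0; move: Fy; rewrite F0 expr0n /= ltNge divr_ge0 // ltW.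
rewrite /D step0 ?addr0; first by rewrite expr2 invfM mulrA divff // mul1r.
by rewrite subr_le0 mulrA ler_pdivlMr //; move: (_ ^+ 2) (_ ^+ 2) Fy => A B; lra.
Qed.

(** * Hadamard's lemma, by integration along segments *)

Section Hadamard.
Variables (n : nat) (a : 'rV[R]_n).
Implicit Types F : 'rV[R]_n -> R.
Notation mu := (@lebesgue_measure R).

Lemma bounded_box F (r : R) : continuous F -> exists C : R,
 forall y : 'rV[R]_n, (forall i, `|y 0 i| <= r) -> `|F y| <= C.
move=> cF; have cK : compact [set v : 'rV[R]_n | forall i, `[- r, r]%classic (v ord0 i)].
 by apply: (@rV_compact R n (fun=> `[- r, r]%classic)) => i; exact: segment_compact.
have := compact_bounded (continuous_compact (continuous_subspaceT cF) cK).
move=> [C [_ HC]]; exists (C + 1) => y yr; apply: (HC (C + 1)); first by rewrite ltrDl.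
by exists y => // i; rewrite /= in_itv /= -ler_norml; exact: yr.
Qed.

Lemma line_cont (d : 'rV[R]_n) : continuous (fun t : R => a + t *: d).
move=> t; apply: cvgD; first exact: cvg_cst.
exact: (@scalel_continuous _ _ d t).
Qed.

(** Differentiating in d brings out a factor t; the weight t^m makes the family closed under partial
    derivatives. *)
Definition segint m F (d : 'rV[R]_n) : R := \int[mu]_(t in `[0, 1]) (t ^+ m * F (a + t *: d)).

Lemma segint_cont m F d : continuous F -> continuous (fun t : R => t ^+ m * F (a + t *: d)).
move=> cF t; apply: cvgM; first exact: exprn_continuous.
by apply: continuous_comp; [exact: line_cont|exact: cF].
Qed.

Lemma cont_integrable (f : R -> R) : continuous f -> mu.-integrable `[0, 1] (EFin \o f).
move=> cf; apply: continuous_compact_integrable; first exact: segment_compact.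
exact: continuous_subspaceT.
Qed.

Lemma int01_cst (c : R) : \int[mu]_(t in `[0, 1]) c = c.
rewrite Rintegral_cst; last exact: measurable_itv.
rewrite -[RHS]mulr1; congr (_ * _).
have := @lebesgue_measure_itv R `[0, 1].
by rewrite /= lte_fin ltr01 oppr0 adde0 => ->.
Qed.

Lemma segint_is_derive m F d j : Cinfty F -> is_derive d (delta_mx 0 j) (segint m F) (segint m.+1 (pder j F) d).
move=> cF; have cF0 := Cinfty_cont cF; have cF1 := Cinfty_cont (Cinfty_pder (i := j) cF).
pose e : 'rV[R]_n := delta_mx 0 j.
pose f (x t : R) := t ^+ m * F (a + t *: (x *: e + d)).
have df (x t : R) : is_derive x 1 (f^~ t) (t ^+ m.+1 * pder j F (a + t *: (x *: e + d))).
 pose psi s := F (a + t *: d + s *: e).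
 have E y : a + t *: (y *: e + d) = a + t *: d + (t * y) *: e.
  by rewrite scalerDr scalerA addrAC addrA.
 have dpsi : is_derive (t * x) 1 psi (pder j F (a + t *: (x *: e + d))).
  by rewrite E; apply: line_is_derive; exact: Cinfty_dble.
 have dl : is_derive x 1 (fun y : R => t * y) t.
  have := is_deriveZ t (is_derive_id x (1 : R)).
  by rewrite -[t%:A]/(t * 1) mulr1.
 have H := is_deriveZ (t ^+ m) (is_derive1_comp dpsi dl).
 have -> : f^~ t = t ^+ m \*: (psi \o (fun y => t * y)).
  by apply/funext => y; rewrite /f E.
 by apply: is_derive_eq H _; rewrite -[LHS]/(t ^+ m * (_ * t)) exprSr; ring.
have If x : mu.-integrable `[0, 1] (EFin \o f x).
 by apply: cont_integrable; exact: segint_cont.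
(* For |x| < 1 and t in [0, 1] all evaluation points lie in the box of radius r, and a bound of the
   partial derivative on that box is the dominating function for differentiation under the
   integral. *)
pose r := `|a| + `|d| + 1.
have [C HC] := bounded_box r cF1.
have rb (x t : R) : `]-1, 1[%classic x -> `[0, 1]%classic t -> forall i, `|(a + t *: (x *: e + d)) 0 i| <= r.
 rewrite /= !in_itv /= -ltr_norml => x1 /andP[t0 t1] i.
 rewrite !mxE eqxx /=; apply: (le_trans (ler_normD _ _)).
 have H1 : `|x * (i == j)%:R + d 0 i| <= 1 + `|d|.
  apply: (le_trans (ler_normD _ _)); apply: lerD; last exact: rV_coord_le.
  by rewrite normrM; case: (i == j); rewrite ?normr1 ?normr0 ?mulr1 ?mulr0 ?ler01 // ltW.
 rewrite /r -addrA; apply: lerD; first exact: rV_coord_le.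
 rewrite normrM (ger0_norm t0) (addrC `|d|); apply: (le_trans _ H1).
 by rewrite ler_piMl.
have mB : measurable (`[0, 1]%classic : set (measurableTypeR R)) by exact: measurable_itv.
have C0 : forall y : R, 0 <= `|C| by move=> _; exact: normr_ge0.
have Cub (x t : R) : `]-1, 1[%classic x -> `[0, 1]%classic t -> `|partial1of2 f x t| <= `|C|.
 move=> x1 t1; rewrite /partial1of2 derive1E; have [_ ->] := df x t.
 rewrite normrM; apply: (@le_trans _ _ (1 * `|C|)); last by rewrite mul1r.
 apply: ler_pM => //.
  move: t1; rewrite /= in_itv /= => /andP[t0 t1].
  by rewrite ger0_norm ?exprn_ge0 // exprn_ile1.
 by apply: le_trans (ler_norm _); apply: HC; exact: rb.
have I0 : `]-1, 1[%classic (0 : R) by rewrite /= in_itv /= ltrN10 ltr01.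
have ID (x t : R) : `]-1, 1[%classic x -> `[0, 1]%classic t -> derivable (f^~ t) x 1.
 by move=> _ _; have [] := df x t.
have IC : mu.-integrable `[0, 1] (EFin \o (fun=> `|C|)).
 by apply: cont_integrable; exact: cst_continuous.
have D1 := derivable_under_integral mB I0 (fun x _ => If x) ID C0 IC Cub.
have D2 := differentiation_under_integral mB I0 (fun x _ => If x) ID C0 IC Cub.
have DD : is_derive (0 : R) 1 (fun x => \int[mu]_(t in `[0, 1]) f x t) (segint m.+1 (pder j F) d).
 apply: DeriveDef => //; rewrite -derive1E D2; congr (Rintegral _ _ _).
 apply/funext => t; rewrite /partial1of2 derive1E; have [_ ->] := df 0 t.
 by rewrite scale0r add0r.
apply/is_derive_cvg; move/is_derive_cvg : DD; apply: near_cvg; apply: nearW => h.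
by rewrite -[h *: 1]/(h * 1) mulr1 addr0 /f /segint scale0r add0r.
Qed.

Lemma segint_Ck k m F : Cinfty F -> Ck k (segint m F).
move=> cF; elim: k m F cF => [|k IH] m F cF; last first.
 apply/CkS; split; first exact: Ck_cont (IH m F cF).
 move=> i; split=> [x|]; first by have [] := segint_is_derive m x i cF.
 rewrite (_ : pder i _ = segint m.+1 (pder i F)); first by apply: IH; exact: Cinfty_pder.
 by apply/funext => x; have [_] := segint_is_derive m x i cF.
(* Continuity at d: the partial derivatives of [segint] are bounded on the unit ball around d, hence
   by [mvt_rV] increments from d are bounded by a constant times the distance. *)
move=> d; pose r := `|a| + `|d| + 1.
have /boolp.choice[C HC] (i : 'I_n) := bounded_box r (Cinfty_cont (Cinfty_pder (i := i) cF)).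
have C0 i : 0 <= `|C i| by [].
have b1 i (z : 'rV[R]_n) : `|z - d| < 1 -> `|segint m.+1 (pder i F) z| <= `|C i|.
 move=> zd; apply: (le_trans (le_normr_Rintegral _ _)) => //.
  by apply: cont_integrable; apply: segint_cont; apply: Cinfty_cont; exact: Cinfty_pder.
 apply: (@le_trans _ _ (\int[mu]_(t in `[0, 1]) `|C i|)); last first.
  by rewrite int01_cst.
 apply: le_Rintegral => //.
 - apply: (@cont_integrable (fun t => `|t ^+ m.+1 * pder i F (a + t *: z)|)) => t.
  apply: cvg_norm; apply: segint_cont; apply: Cinfty_cont; exact: Cinfty_pder.
 - by apply: cont_integrable; exact: cst_continuous.
 move=> t; rewrite /= in_itv /= => /andP[t0 t1].
 rewrite normrM; apply: (@le_trans _ _ (1 * `|C i|)); last by rewrite mul1r.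
 apply: ler_pM => //; first by rewrite ger0_norm ?exprn_ge0 // exprn_ile1.
 apply: le_trans (ler_norm _); apply: HC => k; apply: (le_trans (rV_coord_le _ _)).
 apply: (le_trans (ler_normD _ _)); rewrite /r -addrA; apply: lerD => //.
 rewrite normrZ (ger0_norm t0); apply: (@le_trans _ _ `|z|); first by rewrite ler_piMl.
 rewrite -[z](subrK d); apply: (le_trans (ler_normD _ _)).
 by rewrite addrC; apply: lerD => //; exact: ltW.
apply/(@cvgrPdist_lt _ _ _ _ (nbhs_filter d)) => e e0.
pose S := \sum_i `|C i| + 1; have S0 : 0 < S by apply: ltr_wpDl; rewrite ?sumr_ge0.
have : \forall z \near d, `|d - z| < Num.min 1 (e / S).
 have e1 : 0 < Num.min 1 (e / S) by rewrite lt_min ltr01 divr_gt0.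
 by apply/nbhs_ballP; exists (Num.min 1 (e / S)) => // z; rewrite -ball_normE.
apply: filterS => z; rewrite lt_min => /andP[z1 z2].
have [xi [Hxi ->]] := mvt_rV z d (fun i x => @ex_derive _ _ _ _ _ _ _ (segint_is_derive m x i cF)).
apply: (le_lt_trans (ler_norm_sum _ _ _)).
apply: (@le_lt_trans _ _ (\sum_i `|d - z| * `|C i|)).
 apply: ler_sum => i _; rewrite normrM; apply: ler_pM => //.
  by have := rV_coord_le (d - z) i; rewrite !mxE.
 rewrite /pder; have [_ ->] := segint_is_derive m (xi i) i cF; apply: b1.
 by apply: Hxi; rewrite ?subrr ?normr0 // distrC.
rewrite -mulr_sumr; move: z2; rewrite ltr_pdivlMr // => z2.
by apply: le_lt_trans z2; apply: ler_wpM2l => //; rewrite lerDl.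
Qed.

(** The fundamental theorem of calculus for t |-> F(a + t(y - a)), with H_i(y) the integral of the
    i-th partial derivative along the segment. It lets a derivation at a point be computed from its
    values on coordinate functions. *)
Lemma hadamard F : Cinfty F -> exists H : 'I_n -> 'rV[R]_n -> R,
 [/\ forall i, Cinfty (H i), forall i, H i a = pder i F a & forall y, F y = F a + \sum_i (y 0 i - a 0 i) * H i y].
move=> cF; have cFi i := Cinfty_pder (i := i) cF.
exists (fun i y => segint 0 (pder i F) (y - a)); split.
- move=> i; have H j : Cinfty (fun y : 'rV[R]_n => y 0 j - a 0 j).
  by apply: CinftyB; [exact: Ccoord|exact: Cinfty_cst].
 have E : (fun y : 'rV[R]_n => segint 0 (pder i F) (y - a)) =
   (fun y => segint 0 (pder i F) (\row_j (y 0 j - a 0 j))).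
  apply/funext => y; apply: f_equal; by apply/rowP => j; rewrite !mxE.
 by rewrite E; exact: (Cinfty_comp (fun k => segint_Ck k 0 (cFi i)) H).
- move=> i; rewrite subrr /segint; rewrite -[RHS]int01_cst; congr (Rintegral _ _ _).
 by apply/funext => t; rewrite scaler0 addr0 expr0 mul1r.
move=> y; pose G (t : R) := F (a + t *: (y - a)).
pose g (t : R) := \sum_i (y 0 i - a 0 i) * pder i F (a + t *: (y - a)).
have dG (t : R) : is_derive t 1 G (g t).
 have dl k : is_derive t 1 (fun s : R => (a + s *: (y - a)) 0 k) (y 0 k - a 0 k).
  have := is_deriveD (is_derive_cst (a 0 k) t 1) (is_deriveM (is_derive_id t (1 : R)) (is_derive_cst (y 0 k - a 0 k) t 1)).
  have -> : (cst (a 0 k) + id * cst (y 0 k - a 0 k)) = (fun s : R => (a + s *: (y - a)) 0 k).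
   by apply/funext => s; rewrite !mxE.
  by move=> H; apply: is_derive_eq H _; rewrite -![_ *: _]/(_ * _) mulr0 mulr1 !add0r.
 have := is_derive_comp_rV (fun i z => Cinfty_dble z cF)
  (fun i => Cinfty_cont (cFi i)) (fun k => @ex_derive _ _ _ _ _ _ _ (dl k)).
 have rE s : \row_k (a + s *: (y - a)) 0 k = a + s *: (y - a) by apply/rowP => k; rewrite mxE.
 have -> : (fun s : R => F (\row_k (a + s *: (y - a)) 0 k)) = G.
  by apply/funext => s; rewrite rE.
 move=> H; apply: is_derive_eq H _; rewrite rE; apply: eq_bigr => i _; congr (_ * _).
 by have [_] := dl i.
have cG : continuous G.
 move=> t; apply: differentiable_continuous; apply/derivable1_diffP.
 by have [] := dG t.
have ci i : continuous (fun t : R => pder i F (a + t *: (y - a))).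
 move=> t; apply: continuous_comp; first exact: line_cont.
 exact: Cinfty_cont (cFi i) _.
have cg : continuous g.
 move=> t; apply: (@cvgr_sum _ (nbhs t)) => i; apply: cvgM; first exact: cvg_cst.
 exact: ci.
have := @continuous_FTC2 R g G 0 1 ltr01 (continuous_subspaceT cg).
have LR : derivable_oo_LRcontinuous G 0 1.
 split; first by move=> t _; have [] := dG t.
  by apply: cvg_at_right_filter; exact: cG.
 by apply: cvg_at_left_filter; exact: cG.
move=> /(_ LR); have E : {in `]0, 1[, G^`()%classic =1 g}.
 by move=> t _; rewrite derive1E; have [_ ->] := dG t.
have yE : a + 1 *: (y - a) = y by rewrite scale1r addrC subrK.
move=> /(_ E) /(congr1 (@fine R)); rewrite /= /G scale0r addr0 yE => E1.
rewrite -[LHS](subrK (F a)) addrC -E1; congr (_ + _).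
transitivity (\int[mu]_(t in `[0, 1]) g t) => //.
rewrite /g; elim: (index_enum _) => [|i s IH].
 rewrite big_nil -[RHS]int01_cst; congr (Rintegral _ _ _).
 by apply/funext => t; rewrite big_nil.
rewrite big_cons -IH.
have -> : (fun t : R => \sum_(j <- i :: s) (y 0 j - a 0 j) * pder j F (a + t *: (y - a))) =
  (fun t => (y 0 i - a 0 i) * pder i F (a + t *: (y - a)) +
   \sum_(j <- s) (y 0 j - a 0 j) * pder j F (a + t *: (y - a))).
 by apply/funext => t; rewrite big_cons.
rewrite RintegralD //.
- congr (_ + _); rewrite RintegralZl //; last exact: cont_integrable.
 congr (_ * _); congr (Rintegral _ _ _).
 by apply/funext => t; rewrite expr0 mul1r.
- by apply: cont_integrable => t; apply: cvgM; [exact: cvg_cst|exact: ci].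
- apply: cont_integrable => t; apply: (@cvgr_sum _ (nbhs t)) => j.
 by apply: cvgM; [exact: cvg_cst|exact: ci].
Qed.

End Hadamard.

End Calculus.

Arguments Cinfty_dble {R n i f} x _.
Arguments Cinfty_pder {R n i f} _.
Arguments Ccoord {R n} j.
Arguments Cinfty_cst {R n} a.

HB.instance Definition _ (R : realType) (m n : nat) := Complete.on 'M[R]_(m, n).

(** * The inverse function theorem *)

Section IFT.
Variable R : realType.

Lemma subrV n (u v : 'rV[R]_n) k : (u - v) 0 k = u 0 k - v 0 k.
by rewrite !mxE. Qed.

Lemma ball_rV n (a y : 'rV[R]_n) r : ball a r y <-> `|y - a| < r.
by rewrite -ball_normE /ball_ /= distrC. Qed.

Lemma near_rV n (a : 'rV[R]_n) (P : 'rV[R]_n -> Prop) :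
 (\forall y \near a, P y) <-> exists2 r, 0 < r & forall y, `|y - a| < r -> P y.
split=> [/nbhs_ballP[r r0 H]|[r r0 H]].
 by exists r => // y /ball_rV; exact: H.
by apply/nbhs_ballP; exists r => // y /ball_rV; exact: H.
Qed.

Lemma cvg_prodr (T : Type) (F : set_system T) {FF : Filter F} (I : Type) (r : seq I) (f : I -> T -> R) (l : I -> R) :
 (forall i, f i x @[x --> F] --> l i) -> (\prod_(i <- r) f i x) @[x --> F] --> \prod_(i <- r) l i.
move=> H; elim: r => [|i r IH].
 rewrite big_nil; apply: near_cvg (cvg_cst (1 : R)).
 by apply: nearW => x; rewrite big_nil.
rewrite big_cons; apply: near_cvg (cvgM (H i) IH).
by apply: nearW => x; rewrite big_cons.
Qed.

Lemma cvg_det (T : Type) (F : set_system T) {FF : Filter F} n (M : T -> 'M[R]_n) (L : 'M[R]_n) :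
 (forall i j, M x i j @[x --> F] --> L i j) -> \det (M x) @[x --> F] --> \det L.
move=> H; apply: cvgr_sum => s; apply: cvgM; first exact: cvg_cst.
by apply: cvg_prodr => i; exact: H.
Qed.

Lemma cvg_adj (T : Type) (F : set_system T) {FF : Filter F} n (M : T -> 'M[R]_n) (L : 'M[R]_n) i0 j0 :
 (forall i j, M x i j @[x --> F] --> L i j) -> (\adj (M x)) i0 j0 @[x --> F] --> (\adj L) i0 j0.
move=> H; have -> : (fun x => (\adj (M x)) i0 j0) = fun y => (-1) ^+ (j0 + i0) * \det (row' j0 (col' i0 (M y))).
 by apply/funext => y; rewrite mxE.
rewrite mxE; apply: cvgM; first exact: cvg_cst.
apply: cvg_det => i j; rewrite !mxE; apply: near_cvg (H _ _).
by apply: nearW => x; rewrite !mxE.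
Qed.

Lemma Cinfty_det n m (M : 'rV[R]_n -> 'M[R]_m) :
 (forall i j, Cinfty (fun y => M y i j)) -> Cinfty (fun y => \det (M y)).
move=> H; apply: Cinfty_sum => s _; apply: CinftyM; first exact: Cinfty_cst.
by apply: Cinfty_prod => i; exact: H.
Qed.

Lemma Cinfty_adj n m (M : 'rV[R]_n -> 'M[R]_m) i0 j0 :
 (forall i j, Cinfty (fun y => M y i j)) -> Cinfty (fun y => (\adj (M y)) i0 j0).
move=> H; have -> : (fun y => (\adj (M y)) i0 j0) = fun y => (-1) ^+ (j0 + i0) * \det (row' j0 (col' i0 (M y))).
 by apply/funext => y; rewrite mxE.
apply: CinftyM; first exact: Cinfty_cst.
apply: Cinfty_det => i j.
have -> : (fun y => row' j0 (col' i0 (M y)) i j) = fun y => M y (lift j0 i) (lift i0 j).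
 by apply/funext => y; rewrite !mxE.
exact: H.
Qed.

Lemma row_mul_bound n m (B : 'M[R]_(n, m)) : exists2 K, 0 < K & forall u : 'rV[R]_n, `|u *m B| <= K * `|u|.
exists (\sum_i \sum_j `|B i j| + 1).
 by apply: ltr_wpDl => //; do 2!apply: sumr_ge0 => ? _.
move=> u; rewrite leNgt; apply/negP => H.
have K0 : 0 < `|u *m B| by apply: le_lt_trans H; rewrite mulr_ge0 // addr_ge0 // ?sumr_ge0 // => *; exact: sumr_ge0.
suff : `|u *m B| < `|u *m B| by rewrite ltxx.
apply/rV_norm_lt => // j; apply: le_lt_trans H; rewrite mxE.
apply: (le_trans (ler_norm_sum _ _ _)); rewrite mulrDl mul1r mulr_suml.
apply: (@le_trans _ _ (\sum_i (\sum_k `|B i k|) * `|u|)); last by rewrite lerDl.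
apply: ler_sum => i _; rewrite normrM mulrC; apply: ler_pM => //; last exact: rV_coord_le.
by rewrite (bigD1 j) //= lerDl sumr_ge0.
Qed.

Variables (n : nat) (f : 'I_n -> 'rV[R]_n -> R) (a : 'rV[R]_n).
Let fr y : 'rV[R]_n := \row_i f i y.
Let J y : 'M[R]_n := \matrix_(i, j) pder j (f i) y.
Hypotheses (cf : forall i, Cinfty (f i)) (Ja : \det (J a) != 0).
Let b := fr a.

Let cJ i j : Cinfty (fun y => J y i j).
rewrite (_ : (fun y => _) = pder j (f i)); first exact: Cinfty_pder.
by apply/funext => y; rewrite mxE.
Qed.

(** Points are row vectors, hence the transpose. The map [phi] is Newton's iteration with the
    derivative frozen at a: its derivative vanishes at a, and a fixed point of [phi] shifted by (z -
    b)B solves [fr y = z]. *)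
Let B : 'M[R]_n := invmx (J a)^T.
Let phi y : 'rV[R]_n := y - (fr y - b) *m B.

Let Bu : B \in unitmx.
by rewrite unitmx_inv unitmx_tr unitmxE unitfE. Qed.

(** The partial derivatives of [phi] vanish at a, so near a they stay below 1/(2(n+1)); the n terms
    of the mean value formula then add up to at most 1/2. The successor avoids dividing by zero for
    n = 0. *)
Let phi_small : exists2 r, 0 < r & forall y y', `|y - a| < r -> `|y' - a| < r ->
 `|phi y - phi y'| <= 2^-1 * `|y - y'|.
have cphi k : Cinfty (fun y => phi y 0 k).
 rewrite (_ : (fun y => _) = fun y : 'rV[R]_n => y 0 k - \sum_i (f i y - b 0 i) * B i k).
  apply: CinftyB; first exact: Ccoord.
  apply: Cinfty_sum => i _; apply: CinftyM; last exact: Cinfty_cst.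
  by apply: CinftyB => //; exact: Cinfty_cst.
 apply/funext => y; rewrite !mxE; congr (_ - _); apply: eq_bigr => i _.
 by rewrite !mxE.
have dphi k j : pder j (fun y => phi y 0 k) a = 0.
 have D i : is_derive a (delta_mx 0 j) (f i) (pder j (f i) a).
  by apply: DeriveDef => //; exact: Cinfty_dble.
 have E : (fun y => phi y 0 k) = (fun y : 'rV[R]_n => y 0 k) - (\sum_i (fun y => B i k * (f i y - b 0 i))).
  apply/funext => y; rewrite !fctE fct_sumE !mxE; congr (_ - _).
  by apply: eq_bigr => i _; rewrite !mxE mulrC.
 have H : is_derive a (delta_mx 0 j) (fun y => phi y 0 k)
   ((delta_mx 0 j : 'rV[R]_n) 0 k - \sum_i B i k * pder j (f i) a).
  rewrite E; apply: is_deriveB; first exact: coord_drv.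
  apply: is_derive_sum => i.
  have := is_deriveZ (B i k) (is_deriveB (D i) (is_derive_cst (b 0 i) a (delta_mx 0 j))).
  by rewrite subr0.
 rewrite /pder; have [_ ->] := H; rewrite mxE eqxx /=.
 have := mulmxV (_ : (J a)^T \in unitmx); rewrite unitmx_tr unitmxE unitfE.
 move=> /(_ Ja) /matrixP /(_ j k); rewrite !mxE eq_sym => <-.
 apply/eqP; rewrite subr_eq0; apply/eqP; apply: eq_bigr => i _.
 by rewrite !mxE mulrC.
pose e : R := (2 * n.+1%:R)^-1; have e0 : 0 < e by rewrite invr_gt0 mulr_gt0.
have : \forall y \near a, forall kj : 'I_n * 'I_n, `|pder kj.2 (fun y => phi y 0 kj.1) y| < e.
 apply: (@filter_forall _ _ (fun kj : 'I_n * 'I_n => [set y | `|pder kj.2 (fun y => phi y 0 kj.1) y| < e]) _ (nbhs_filter a)) => -[k j] /=.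
 have /cvgrPdist_lt /(_ _ e0) := Cinfty_cont (@Cinfty_pder _ _ j _ (cphi k)) (x := a).
 by apply: filterS => y; rewrite dphi sub0r normrN.
move/near_rV => [r r0 Hr]; exists r => // y y' yr y'r.
rewrite leNgt; apply/negP => H.
suff : `|phi y - phi y'| < `|phi y - phi y'| by rewrite ltxx.
have K0 : 0 < `|phi y - phi y'| by apply: le_lt_trans H; rewrite mulr_ge0.
apply/rV_norm_lt => // k; apply: le_lt_trans H; rewrite subrV.
have [xi [Hxi ->]] := mvt_rV y' y (fun i x => Cinfty_dble x (cphi k)).
apply: (le_trans (ler_norm_sum _ _ _)).
apply: (@le_trans _ _ (\sum_(i < n) `|y - y'| * e)).
 apply: ler_sum => i _; rewrite normrM; apply: ler_pM => //.
  by have := rV_coord_le (y - y') i; rewrite !mxE.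
 by apply: ltW; apply: (Hr _ _ (k, i)); exact: Hxi.
rewrite sumr_const card_ord -[_ *+ n]mulr_natr -mulrA (mulrC 2^-1); apply: ler_wpM2l => //.
rewrite /e invfM -mulrA ler_piMr // mulrC ler_pdivrMr // mul1r ler_nat //.
Qed.

Let inv_near : exists2 D, Cinfty D & \forall y \near a, D y = (\det (J y))^-1.
by apply: Cinfty_inv_near => //; exact: Cinfty_det. Qed.

(** The local inverse g comes from Banach's fixed point theorem and is smooth only near b. The
    functions h are g times a bump function, so that they are smooth on the whole space and invert f
    on germs. *)
Lemma inverse_function : exists h : 'I_n -> 'rV[R]_n -> R,
 [/\ forall i, Cinfty (h i), \forall y \near a, \row_i h i (fr y) = y & \forall z \near b, fr (\row_i h i z) = z].
have [r r0 Hphi] := phi_small; have [D cD nD] := inv_near.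
have [r1 r10 HD] : exists2 r1, 0 < r1 & forall y, `|y - a| < r1 -> D y = (\det (J y))^-1 /\ \det (J y) != 0.
 by apply/near_rV; apply: filterS2 nD (cvgr_neq0 _ (Cinfty_cont (Cinfty_det cJ) (x := a)) Ja) => y.
(* Half of the minimum, so that the closed ball of radius q lies in both open balls. *)
pose q := Num.min r r1 / 2; have q0 : 0 < q by rewrite divr_gt0 // lt_min r0 r10.
have qlt t : t <= q -> t < r /\ t < r1.
 move=> tq; apply/andP; rewrite -lt_min; apply: le_lt_trans tq _.
 by rewrite gtr_pMr ?invf_lt1 ?ltr1n // lt_min r0 r10.
have [K K0 HK] := row_mul_bound B.
(* Chosen so that q/2 + K sg = q: the shifted map T then sends the closed ball of radius q into
   itself. *)
pose sg := q / (2 * K); have sg0 : 0 < sg by rewrite divr_gt0 // mulr_gt0.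
have phia : phi a = a by rewrite /phi subrr mul0mx subr0.
have fixp z : `|z - b| < sg -> exists2 y, `|y - a| <= q & fr y = z.
 move=> zb; pose T y := phi y + (z - b) *m B.
 have HT : {homo T : y / [set y : 'rV[R]_n | `|y - a| <= q] y >-> [set y : 'rV[R]_n | `|y - a| <= q] y}.
  move=> y /= yq; have [yr _] := qlt _ yq.
  have -> : T y - a = (phi y - phi a) + (z - b) *m B by rewrite phia /T addrAC.
  apply: (le_trans (ler_normD _ _)).
  have -> : q = 2^-1 * q + K * sg by rewrite /sg; field; rewrite gt_eqF.
  apply: lerD.
   apply: le_trans (Hphi _ _ yr _) _; first by rewrite subrr normr0.
   by apply: ler_wpM2l => //; rewrite invr_ge0.
  by apply: le_trans (HK _) _; apply: ler_wpM2l; apply: ltW.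
 have [] := @banach_fixed_point _ _ _ (mkfun_fun HT).
 - exists (2^-1)%:nng; split => /=; first by rewrite invf_lt1 // ltr1n.
  move=> [y y'] /= [/= yq y'q].
  have -> : T y - T y' = phi y - phi y' by rewrite /T opprD addrACA subrr addr0.
  by apply: Hphi; [case: (qlt _ yq)|case: (qlt _ y'q)].
 - have := @closed_closed_ball_ R 'rV[R]_n a q.
  rewrite (_ : closed_ball_ _ _ _ = [set y : 'rV[R]_n | `|y - a| <= q]) //.
  by apply/seteqP; split=> y /=; rewrite distrC.
 - by exists a => /=; rewrite subrr normr0 ltW.
 move=> y yq E; exists y => //.
 have : (z - fr y) *m B = 0.
  have : y = T y := E; rewrite /T /phi => /(congr1 (fun u => u - y)).
  rewrite subrr => {}E.
  have -> : z - fr y = (z - b) - (fr y - b) by rewrite opprB addrA subrK.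
  rewrite mulmxBl; move: ((fr y - b) *m B) ((z - b) *m B) E => P Q E.
  by apply/rowP => k; move/rowP/(_ k): E; rewrite !mxE; lra.
 move/(congr1 (mulmx^~ (invmx B))); rewrite /= mulmxK // mul0mx => /eqP.
 by rewrite subr_eq0 => /eqP.
(* Since [phi] contracts by 1/2, the distance of y and y' is absorbed up to a factor 2. The estimate
   gives uniqueness of preimages and the Lipschitz bound for g. *)
have est y y' : `|y - a| <= q -> `|y' - a| <= q -> `|y - y'| <= 2 * K * `|fr y - fr y'|.
 move=> yq y'q; have [yr _] := qlt _ yq; have [y'r _] := qlt _ y'q.
 have E : y - y' = (phi y - phi y') + (fr y - fr y') *m B.
  have -> : fr y - fr y' = (fr y - b) - (fr y' - b) by rewrite opprB addrA subrK.
  rewrite mulmxBl /phi; move: ((fr y - b) *m B) ((fr y' - b) *m B) => P Q.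
  by apply/rowP => k; rewrite !mxE; ring.
 have : `|y - y'| <= 2^-1 * `|y - y'| + K * `|fr y - fr y'|.
  rewrite {1}E; apply: (le_trans (ler_normD _ _)); apply: lerD => //.
  exact: Hphi.
 by move: `|y - y'| `|fr y - fr y'| => A1 A2; nra.
have /choice2[g Hg] (z : 'rV[R]_n) : exists2 y, (`|z - b| < sg -> `|y - a| <= q) & (`|z - b| < sg -> fr y = z).
 have [zb|zb] := ltP `|z - b| sg; last by exists 0.
 by have [y] := fixp z zb; exists y.
have lipg z z' : `|z - b| < sg -> `|z' - b| < sg -> `|g z - g z'| <= 2 * K * `|z - z'|.
 move=> zb z'b; have [/(_ zb) h1 /(_ zb) h2] := Hg z; have [/(_ z'b) h3 /(_ z'b) h4] := Hg z'.
 by have := est _ _ h1 h3; rewrite h2 h4.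
have cg z : `|z - b| < sg -> g x @[x --> z] --> g z.
 move=> zb; apply/(@cvgrPdist_lt _ _ _ _ (nbhs_filter z)) => e e0.
 have : \forall x \near z, `|x - z| < Num.min (e / (2 * K)) (sg - `|z - b|).
  apply/near_rV; exists (Num.min (e / (2 * K)) (sg - `|z - b|)) => //.
  by rewrite lt_min divr_gt0 ?mulr_gt0 // subr_gt0.
 apply: filterS => x; rewrite lt_min => /andP[x1 x2].
 have xb : `|x - b| < sg.
  by rewrite -(subrK z x) -addrA; apply: le_lt_trans (ler_normD _ _) _; rewrite -ltrBrDr.
 apply: le_lt_trans (lipg _ _ zb xb) _.
 by rewrite mulrC -ltr_pdivlMr ?mulr_gt0 // distrC.
(* The entries of the inverse Jacobian by Cramer's rule, with 1/det replaced by the global smooth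
   function D. *)
pose Gm (k j : 'I_n) y := D y * (\adj (J y)) k j.
have cGm k j : Cinfty (Gm k j) by apply: CinftyM => //; exact: Cinfty_adj.
(* The mean value formula for each f_i gives an exact linear system M(h) v = h e_j for the increment
   v of g. It is solved with the adjugate, and M(h) tends to the Jacobian as h tends to 0. *)
have dg k j z : `|z - b| < sg -> is_derive z (delta_mx 0 j) (fun z => g z 0 k) (Gm k j (g z)).
 move=> zb; have [/(_ zb) yq /(_ zb) fz] := Hg z; set y0 := g z in yq fz *.
 have [_ /HD[Dy d0]] := qlt _ yq.
 pose zh (h : R) : 'rV[R]_n := h *: delta_mx 0 j + z.
 have czh : zh h @[h --> (0 : R)^'] --> z.
  have zh0 : zh 0 = z by rewrite /zh scale0r add0r.
  have : zh h @[h --> (0 : R)] --> zh 0.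
   by apply: cvgD; [exact: (@scalel_continuous _ _ (delta_mx 0 j) 0)|exact: cvg_cst].
  by rewrite zh0; exact: cvg_within_filter.
 have cgh : g (zh h) @[h --> (0 : R)^'] --> y0 by apply: cvg_comp czh (cg _ zb).
 have /boolp.choice[xi Hxi] (hi : R * 'I_n) := mvt_rV y0 (g (zh hi.1)) (fun i x => Cinfty_dble x (cf hi.2)).
 pose M (h : R) : 'M[R]_n := \matrix_(i, l) pder l (f i) (xi (h, i) l).
 have cM i l : M h i l @[h --> (0 : R)^'] --> J y0 i l.
  rewrite mxE; apply: (@near_cvg _ _ _ _ (fun h => pder l (f i) (xi (h, i) l))).
   by apply: nearW => h; rewrite mxE.
  have cx : xi (h, i) l @[h --> (0 : R)^'] --> y0.
   apply/cvgrPdist_lt => e e0; apply: filterS (cvgr_dist_lt _ _ cgh _ e0) => h H; have [Hx _] := Hxi (h, i).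
   by rewrite distrC; apply: Hx; rewrite ?subrr ?normr0 //= distrC.
  by apply: (cvg_comp _ _ cx); exact: Cinfty_cont (Cinfty_pder (cf i)) _.
 have cdet : \det (M h) @[h --> (0 : R)^'] --> \det (J y0) by exact: cvg_det.
 have cadj : (\adj (M h)) k j @[h --> (0 : R)^'] --> (\adj (J y0)) k j by exact: cvg_adj.
 apply/is_derive_cvg; rewrite /Gm Dy mulrC.
 apply: near_cvg (cvgM cadj (cvgV d0 cdet)).
 near=> h; rewrite -[unstable.inv_fun _ h]/(\det (M h))^-1.
 have h0 : h != 0 by near: h; exact: nbhs_dnbhs_neq.
 have dh0 : \det (M h) != 0 by near: h; exact: (cvgr_neq0 _ cdet d0).
 have zhb : `|zh h - b| < sg.
  near: h; have sz : 0 < sg - `|z - b| by rewrite subr_gt0.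
  apply: filterS (cvgr_dist_lt _ _ czh _ sz) => h H.
  by rewrite -(subrK z (zh h)) -addrA; apply: le_lt_trans (ler_normD _ _) _; rewrite -ltrBrDr distrC.
 have [_ /(_ zhb) fzh] := Hg (zh h).
 pose v : 'cV[R]_n := (g (zh h) - y0)^T.
 have Mv : M h *m v = h *: delta_mx j 0.
  apply/colP => i; rewrite !mxE; have [_ /= Ei] := Hxi (h, i).
  transitivity (f i (g (zh h)) - f i y0).
   by rewrite Ei; apply: eq_bigr => l _; rewrite !mxE mulrC.
  have := congr1 (fun u : 'rV[R]_n => u 0 i) fzh; have := congr1 (fun u : 'rV[R]_n => u 0 i) fz.
  by rewrite !mxE eqxx andbT eq_sym => -> ->; rewrite addrK.
 have /colP/(_ k) := congr1 (mulmx (\adj (M h))) Mv.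
 rewrite mulmxA mul_adj_mx mul_scalar_mx -scalemxAr -colE mxE [v k 0]mxE subrV.
 rewrite [RHS]mxE [col _ _ _ _]mxE => E.
 have -> : g (zh h) 0 k - y0 0 k = h * (\adj (M h)) k j / \det (M h).
  by rewrite -E mulrAC divff // mul1r.
 by rewrite -mulrA mulKf.
have gfr y : `|y - a| <= q -> `|fr y - b| < sg -> g (fr y) = y.
 move=> yq yb; have [/(_ yb) h1 /(_ yb) h2] := Hg (fr y).
 have := est _ _ h1 yq; rewrite h2 subrr normr0 mulr0 normr_le0 subr_eq0.
 by move/eqP.
pose s := sg / 2; have s0 : 0 < s by rewrite divr_gt0.
have ss : s < sg by rewrite gtr_pMr // invf_lt1 // ltr1n.
(* Nothing is known about g outside the ball of radius sg. A factor vanishing beyond the smaller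
   radius s makes chi (H o g) smooth across the boundary. *)
pose cut (chi : 'rV[R]_n -> R) := Cinfty chi /\ forall z, s < `|z - b| -> chi z = 0.
have loc0 chi z : cut chi -> s < `|z - b| -> \forall x \near z, chi x = 0.
 move=> [_ H] sz; apply/near_rV; exists (`|z - b| - s); first by rewrite subr_gt0.
 move=> y yz; apply: H; have := ler_normD (z - y) (y - b).
 by rewrite addrA subrK (distrC z y); lra.
have der0 (F : 'rV[R]_n -> R) z i : (\forall x \near z, F x = 0) -> is_derive z (delta_mx 0 i) F 0.
 by move=> L; apply: (@near_eq_is_derive _ _ _ (cst 0)); apply: filterS L => x ->.
have cutd chi i : cut chi -> cut (pder i chi).
 move=> cc; split=> [|z sz]; first by case: cc => cc _; exact: Cinfty_pder.
 by have [_] := der0 _ z i (loc0 _ _ cc sz).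
have loc1 chi (H : 'rV[R]_n -> R) z : cut chi -> sg <= `|z - b| -> \forall x \near z, chi x * H (g x) = 0.
 by move=> cc zb; apply: filterS (loc0 _ _ cc (lt_le_trans ss zb)) => x ->; rewrite mul0r.
have step chi H i z : Cinfty H -> cut chi -> is_derive z (delta_mx 0 i) (fun z => chi z * H (g z))
  (pder i chi z * H (g z) + chi z * (\sum_k Gm k i (g z) * pder k H (g z))).
 move=> cH cc; have [zb|zb] := ltP `|z - b| sg; last first.
  have sz := lt_le_trans ss zb; rewrite (cutd chi i cc).2 // cc.2 // !mul0r addr0.
  by apply: der0; exact: loc1.
 have D1 : is_derive z (delta_mx 0 i) chi (pder i chi z).
  by apply: DeriveDef => //; apply: Cinfty_dble; case: cc.
 have D2 := is_derive_comp_rV (fun i x => Cinfty_dble x cH) (fun i => Cinfty_cont (Cinfty_pder cH))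
  (fun k => @ex_derive _ _ _ _ _ _ _ (dg k i z zb)).
 have E z' : \row_k g z' 0 k = g z' by apply/rowP => ?; rewrite mxE.
 have E2 : (fun y => H (\row_k g y 0 k)) = fun y => H (g y) by apply/funext => y; rewrite E.
 rewrite E2 E in D2; apply: is_derive_eq (is_deriveM D1 D2) _.
 rewrite -![_ *: _]/(_ * _) addrC mulrC; congr (_ + _ * _); apply: eq_bigr => l _.
 by congr (_ * _); have [_] := dg l i z zb.
have c0 H chi : Cinfty H -> cut chi -> continuous (fun z => chi z * H (g z)).
 move=> cH cc z; have [zb|zb] := ltP `|z - b| sg; last first.
  have L := loc1 chi H z cc zb; rewrite /continuous_at (_ : chi z * H (g z) = 0); last exact: nbhs_singleton L.
  by apply: (@near_cvg _ (nbhs z) _ _ (cst 0)); [apply: filterS L => x ->|exact: cvg_cst].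
 have H2 : H (g x) @[x --> z] --> H (g z).
  by apply: (cvg_comp _ _ (cg _ zb)); exact: Cinfty_cont cH _.
 exact: (cvgM (Cinfty_cont cc.1 (x := z)) H2).
(* The products chi (H o g), for all smooth H and all [cut] chi, have partial derivatives that are
   sums of such products, so one induction on k covers them all. *)
have Cg k : forall H chi, Cinfty H -> cut chi -> Ck k (fun z => chi z * H (g z)).
 elim: k => [|k IH] H chi cH cc; first exact: c0.
 apply/CkS; split=> [|i]; [exact: c0|split=> [z|]]; first by have [] := step chi H i z cH cc.
 have -> : pder i (fun z => chi z * H (g z)) = fun z => pder i chi z * H (g z) +
   chi z * ((fun y => \sum_k Gm k i y * pder k H y) (g z)).
  by apply/funext => z; have [_] := step chi H i z cH cc.
 apply: CkD; first by apply: IH => //; exact: cutd.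
 apply: (IH (fun y => \sum_k Gm k i y * pder k H y)) => //.
 by apply: Cinfty_sum => l _; apply: CinftyM => //; exact: Cinfty_pder.
have [chi [cchi _ chi1 chi0]] := bump_rV b s0.
have s4 : 0 < s / 2 by rewrite divr_gt0.
have hE z : `|z - b| < s / 2 -> \row_k (chi z * g z 0 k) = g z.
 by move=> zb; apply/rowP => k; rewrite mxE chi1 // mul1r.
exists (fun k z => chi z * g z 0 k); split.
- move=> i k; apply: (Cg k (fun y => y 0 i) chi); first exact: Ccoord.
 by split=> // z /ltW; exact: chi0.
- have cfr : fr y @[y --> a] --> b.
  by apply: (@cvg_rV _ _ (nbhs a)) => k; rewrite mxE; exact: Cinfty_cont (cf k) _.
 near=> y; have yb : `|fr y - b| < s / 2.
  by near: y; apply: filterS (cvgr_dist_lt _ _ cfr _ s4) => y; rewrite distrC.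
 have yq : `|y - a| <= q by near: y; apply/near_rV; exists q => // y; exact: ltW.
 by rewrite hE // gfr //; apply: lt_trans yb _; lra.
- apply/near_rV; exists (s / 2) => // z zb; rewrite hE //.
 have zs : `|z - b| < sg by apply: lt_trans zb _; lra.
 by have [_ /(_ zs)] := Hg z.
Unshelve. all: by end_near.
Qed.

End IFT.

(** * Differential spaces and tangent vectors *)

Section Spaces.
Variable R : realType.
Implicit Types M N P : dspace R.

Notation "'nearM' x P" := (\forall y \near (x : dtop _), P y) (at level 10, x at level 9, P at level 9).

(** Neighbourhoods given by finitely many generators and one radius. They are those of the initial
    topology by [nearME], and the only form in which the topology is used concretely. *)
Definition basic M (x : M) : set_system (dtop M) := [set P |
 exists s : seq (M -> R), exists2 e : R, 0 < e /\ (forall h, List.In h s -> gen h) &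
  forall y, (forall h, List.In h s -> `|h y - h x| < e) -> P y].

Lemma basic_filter M (x : M) : ProperFilter (basic x).
split.
 move=> [s [e [e0 _] /(_ x)]]; apply=> h _.
 by rewrite subrr normr0.
split.
- by exists [::], 1.
- move=> A B [s [e [e0 gs] H]] [s' [e' [e0' gs'] H']].
 exists (s ++ s'), (Num.min e e').
  split; first by rewrite lt_min e0 e0'.
  by move=> h /List.in_app_iff[]; [exact: gs|exact: gs'].
 move=> y Hy; split.
  apply: H => h hs; have := Hy h (proj2 (List.in_app_iff _ _ _) (or_introl hs)).
  by rewrite lt_min => /andP[].
 apply: H' => h hs; have := Hy h (proj2 (List.in_app_iff _ _ _) (or_intror hs)).
 by rewrite lt_min => /andP[].
- by move=> A B AB [s [e eP H]]; exists s, e => // y Hy; apply: AB; exact: H.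
Qed.

Lemma cvg_initial (S : choiceType) (T : topologicalType) (f : S -> T) (F : set_system S) (s : S) : Filter F ->
 f x @[x --> F] --> f s -> F --> (s : initial_topology f).
move=> FF H A /=; rewrite nbhsE => -[U [[V oV <-] Vx] UA].
by apply: filterS UA _; apply: H; exact: open_nbhs_nbhs.
Qed.

Lemma cvg_prod_topology (I : Type) (K : I -> topologicalType)
  (F : set_system (prod_topology K)) (f : prod_topology K) : Filter F ->
 (F --> f) <-> (forall i, (fun g : prod_topology K => g i) g @[g --> F] --> f i).
move=> FF; split=> [/cvg_sup H i|H]; last first.
 by apply/cvg_sup => i; apply: cvg_initial; exact: H.
have c := @initial_continuous _ _ (fun f : (forall i, K i) => f i) f.
exact: (cvg_comp _ _ (H i) c).
Qed.

Lemma gen_cont M (h : M -> R) (x : M) (e : R) : gen h -> 0 < e -> \forall y \near (x : dtop M), `|h y - h x| < e.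
move=> gh e0; have c1 := @initial_continuous _ _ (@evgen R M) x.
pose i : {h : M -> R | gen h} := exist _ h gh.
have H := @cvg_prod_topology {h : M -> R | gen h} (fun=> R : topologicalType)
 ((@evgen R M) @ nbhs (x : dtop M)) (@evgen R M x) _.
have c3 : (fun y : dtop M => h y) y @[y --> (x : dtop M)] --> h x.
 exact: ((H _).1 c1 i).
have /cvgrPdist_lt/(_ _ e0) := c3.
by apply: filterS => y; rewrite distrC.
Qed.

Lemma nearME M (x : M) (P : M -> Prop) : (\forall y \near (x : dtop M), P y) <-> basic x P.
split=> [H|[s [e [e0 gs] H]]]; last first.
 have : \forall y \near (x : dtop M), forall h, List.In h s -> `|h y - h x| < e.
  elim: s gs {H} => [|h s IH] gs; first by apply: filterE.
  have H1 := gen_cont x (gs h (or_introl erefl)) e0.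
  have H2 := IH (fun k ks => gs k (or_intror ks)).
  by apply: filterS2 H1 H2 => y h1 h2 k [<-|] //; exact: h2.
 by apply: filterS.
have FF := basic_filter x.
suff : basic x --> (x : dtop M) by move=> /(_ _ H).
move=> A /=; rewrite nbhsE => -[U [[V oV <-] Vx] UA].
have : (@evgen R M) @ (basic x) --> (@evgen R M x).
 apply/cvg_prod_topology => -[h gh]; apply/cvgrPdist_lt => e e0.
 exists [:: h], e; first by split=> // k [<-|].
 by move=> y /(_ h (or_introl erefl)); rewrite distrC.
move=> /(_ V) HV; apply: (@filterS _ _ FF _ _ UA); apply: HV.
by apply: open_nbhs_nbhs.
Unshelve. all: by end_near.
Qed.

Arguments nearME {M x P}.

Lemma near_self M (x : M) (P : M -> Prop) : (\forall y \near (x : dtop M), P y) -> P x.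
by move/nbhs_singleton. Qed.

Lemma near_near M (x : M) (P : M -> Prop) : (\forall y \near (x : dtop M), P y) ->
 \forall y \near (x : dtop M), \forall z \near (y : dtop M), P z.
exact: nbhs_interior.
Qed.

Definition eqnear M (x : M) (T : Type) (f g : M -> T) := \forall y \near (x : dtop M), f y = g y.

Lemma smooth_gen M (h : M -> R) : gen h -> smooth_fun h.
move=> gh x; exists 1%N, (fun=> h), (fun y : 'rV[R]_1 => y 0 0); split=> //.
 exact: Ccoord.
by apply: filterE => y; rewrite mxE.
Qed.

Lemma smooth_local M (f : M -> R) : (forall x, exists2 f', smooth_fun f' & eqnear x f f') -> smooth_fun f.
move=> H x; have [f' sf' E] := H x; have [n [g [F [gg cF E']]]] := sf' x.
by exists n, g, F; split=> //; apply: filterS2 E E' => y -> ->.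
Qed.

Lemma near_forall M (x : M) (I : finType) (P : I -> M -> Prop) : (forall i, \forall y \near (x : dtop M), P i y) ->
 \forall y \near (x : dtop M), forall i, P i y.
by move=> H; exact: (@filter_forall _ _ P _ (nbhs_filter (x : dtop M))). Qed.

Lemma smooth_cvg M (f : M -> R) (x : M) : smooth_fun f -> f y @[y --> (x : dtop M)] --> f x.
move=> /(_ x)[n [g [F [gg cF E]]]]; rewrite (near_self E).
apply: (@near_cvg _ (nbhs (x : dtop M)) _ _ (fun y => F (\row_i g i y))); first by apply: filterS E => y ->.
apply: (cvg_comp (fun y : dtop M => \row_i g i y) F); last exact: Cinfty_cont cF _.
apply: (@cvg_rV _ _ (nbhs (x : dtop M))) => k; rewrite mxE; apply/cvgrPdist_lt => e e0.
by apply: filterS (gen_cont x (gg k) e0) => y; rewrite distrC.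
Qed.

Lemma smooth_dist M (f : M -> R) (x : M) (e : R) : smooth_fun f -> 0 < e ->
 \forall y \near (x : dtop M), `|f y - f x| < e.
move=> sf e0; have /cvgrPdist_lt/(_ _ e0) := smooth_cvg (x := x) sf.
by apply: filterS => y; rewrite distrC.
Qed.

Lemma smooth_comp M n (g : 'I_n -> M -> R) (F : 'rV[R]_n -> R) :
 Cinfty F -> (forall i, smooth_fun (g i)) -> smooth_fun (fun y => F (\row_i g i y)).
move=> cF sg x.
have /boolp.choice[d Hd] (i : 'I_n) : exists p : {m : nat & (('I_m -> M -> R) * ('rV[R]_m -> R))%type},
  [/\ forall j, gen ((tagged p).1 j), Cinfty (tagged p).2 &
  \forall y \near x, g i y = (tagged p).2 (\row_j (tagged p).1 j y)].
 by have [m [h [G H]]] := sg i x; exists (existT _ m (h, G)).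
pose m i := tag (d i); pose h i := (tagged (d i)).1; pose G i := (tagged (d i)).2.
(* Each g i depends near x on its own finite list of generators; the lists are concatenated along
   this sigma type and enumerated. *)
pose T : finType := {i : 'I_n & 'I_(m i)}.
pose k (a : 'I_#|T|) := let p := enum_val a in h (tag p) (tagged p).
pose Q i (y : 'rV[R]_#|T|) := G i (\row_j y 0 (enum_rank (Tagged (fun i => 'I_(m i)) j))).
have cQ i : Cinfty (Q i).
 by apply: Cinfty_comp; [have [] := Hd i|move=> j; exact: Ccoord].
exists #|T|, k, (fun y => F (\row_i Q i y)); split.
- by move=> a; have [+ _ _] := Hd (tag (enum_val a)); apply.
- exact: Cinfty_comp.
have := near_forall (fun i => let: And3 _ _ E := Hd i in E).
apply: filterS => y E; congr F; apply/rowP => i; rewrite !mxE E; congr (G i).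
by apply/rowP => j; rewrite !mxE /k enum_rankK.
Qed.

Lemma smooth_cst M a : smooth_fun (fun _ : M => a).
by have := @smooth_comp M 0 (fun _ _ => 0) (fun=> a) (Cinfty_cst a) (fun i => match i with Ordinal _ p => False_ind _ (notF p) end).
Qed.

Lemma smooth_comp1 M (f : M -> R) (F : 'rV[R]_1 -> R) : Cinfty F -> smooth_fun f ->
 smooth_fun (fun y => F (\row_i f y)).
by move=> cF sf; exact: (@smooth_comp M 1 (fun=> f)). Qed.

Lemma smoothD M (f g : M -> R) : smooth_fun f -> smooth_fun g -> smooth_fun (fun y => f y + g y).
move=> sf sg; pose h (i : 'I_2) := if i == 0 then f else g.
have sh i : smooth_fun (h i) by rewrite /h; case: ifP.
have := smooth_comp (CinftyD (Ccoord 0) (Ccoord 1)) sh.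
by fext => y; rewrite !mxE.
Qed.

Lemma smoothM M (f g : M -> R) : smooth_fun f -> smooth_fun g -> smooth_fun (fun y => f y * g y).
move=> sf sg; pose h (i : 'I_2) := if i == 0 then f else g.
have sh i : smooth_fun (h i) by rewrite /h; case: ifP.
have := smooth_comp (CinftyM (Ccoord 0) (Ccoord 1)) sh.
by fext => y; rewrite !mxE.
Qed.

Lemma smoothN M (f : M -> R) : smooth_fun f -> smooth_fun (fun y => - f y).
move=> sf; have := smoothM (@smooth_cst M (-1)) sf.
by fext => y; rewrite mulN1r.
Qed.

Lemma smoothB M (f g : M -> R) : smooth_fun f -> smooth_fun g -> smooth_fun (fun y => f y - g y).
by move=> sf sg; apply: smoothD => //; exact: smoothN. Qed.

Lemma smooth_sum M (I : Type) (r : seq I) (P : pred I) (F : I -> M -> R) :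
 (forall i, P i -> smooth_fun (F i)) -> smooth_fun (fun y => \sum_(i <- r | P i) F i y).
move=> H; elim: r => [|i r IH].
 have := @smooth_cst M 0; fext => y; by rewrite big_nil.
case Pi : (P i); last first.
 by move: IH; fext => y; rewrite big_cons Pi.
have := smoothD (H i Pi) IH; fext => y.
by rewrite big_cons Pi.
Qed.

Lemma smooth_prod M (I : Type) (r : seq I) (F : I -> M -> R) :
 (forall i, smooth_fun (F i)) -> smooth_fun (fun y => \prod_(i <- r) F i y).
move=> H; elim: r => [|i r IH].
 have := @smooth_cst M 1; fext => y; by rewrite big_nil.
have := smoothM (H i) IH; fext => y.
by rewrite big_cons.
Qed.

Lemma smooth_inv_near M (f : M -> R) (x : M) : smooth_fun f -> f x != 0 ->
 exists2 g, smooth_fun g & eqnear x g (fun y => (f y)^-1).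
move=> sf fx; have := @Cinfty_inv_near R 1 (fun y => y 0 0) (\row_i f x) (Ccoord 0).
rewrite mxE => /(_ fx)[H cH /near_rV[e e0 HE]].
exists (fun y => H (\row_i f y)); first exact: smooth_comp1.
apply: filterS (smooth_dist x sf e0) => y Hy; rewrite HE ?mxE //.
by apply/rV_norm_lt => // j; rewrite !mxE.
Qed.

Lemma smooth_step M (f : M -> R) : smooth_fun f -> smooth_fun (fun y => step (f y)).
move=> sf; have := smooth_comp1 (Cinfty_step (@Ccoord R 1 0)) sf.
by fext => y; rewrite mxE.
Qed.

Lemma smooth_locE M (f g : M -> R) x : eqnear x f g -> eqnear x g f.
by apply: filterS => y ->. Qed.

(** The last clause says that the support of chi lies in the interior of P. This is what allows data
    that are smooth on P only to be multiplied by chi and continued by zero. *)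
Lemma bump M (x : M) (P : M -> Prop) : (\forall y \near (x : dtop M), P y) ->
 exists chi : M -> R, [/\ smooth_fun chi, forall y, 0 <= chi y <= 1, \forall y \near (x : dtop M), chi y = 1 &
  forall y, ~ (\forall z \near (y : dtop M), P z) -> \forall z \near (y : dtop M), chi z = 0].
move=> /near_near/nearME[s [e [e0 gs H]]].
(* With d = h y - h x the argument is at least 1 for |d| <= e/2 and at most 0 for d^2 >= e^2/2, in
   particular for |d| > 3e/4. The gap between 3e/4 and e leaves room e/4 for a neighbourhood on
   which chi vanishes. *)
pose phi (h : M -> R) (y : M) := step ((e ^+ 2 - 2 * (h y - h x) ^+ 2) * (2 / e ^+ 2)).
have c0 : 0 < 2 / e ^+ 2 by apply: divr_gt0 => //; exact: exprn_gt0.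
have sphi h : List.In h s -> smooth_fun (phi h).
 move=> hs; have sh := smooth_gen (gs h hs); apply: smooth_step; apply: smoothM; last exact: smooth_cst.
 have H2 : smooth_fun (fun y => h y - h x) by apply: smoothB => //; exact: smooth_cst.
 by apply: smoothB; [exact: smooth_cst|apply: smoothM; [exact: smooth_cst|exact: smoothM]].
have e2 : 0 < e / 2 by rewrite divr_gt0.
have phi0 h y : `|h y - h x| > e * (3 / 4) -> phi h y = 0.
 move=> H1; apply: step0; apply: mulr_le0_ge0; last exact: ltW.
 have e3 : 0 <= e * (3 / 4) by rewrite mulr_ge0 // ltW.
 have : (e * (3 / 4)) ^+ 2 <= (h y - h x) ^+ 2.
  by rewrite -[leRHS]real_normK ?num_real // ler_sqr ?nnegrE // ltW.
 by move: (h y - h x) => t; nra.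
have {e2} phi1 h y : `|h y - h x| < e / 2 -> phi h y = 1.
 move=> H1; apply: step1; rewrite mulrA ler_pdivlMr ?exprn_gt0 // mul1r.
 have : (h y - h x) ^+ 2 <= (e / 2) ^+ 2.
  by rewrite -[leLHS]real_normK ?num_real // ler_sqr ?nnegrE // ltW.
 by move: (h y - h x) => t; nra.
exists (fun y => \prod_(h <- s) phi h y); split.
- elim: s gs sphi {H} => [|h s IH] gs sphi.
  by have := @smooth_cst M 1; fext => y; rewrite big_nil.
 have := smoothM (sphi h (or_introl erefl)) (IH (fun k ks => gs k (or_intror ks)) (fun k ks => sphi k (or_intror ks))).
 by fext => y; rewrite big_cons.
- move=> y; rewrite prodr_ge0 /=; last by move=> h _; exact: step_ge0.
 elim: {gs sphi H} s => [|h s IH]; first by rewrite big_nil.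
 rewrite big_cons mulr_ile1 ?step_ge0 ?step_le1 //.
 by apply: prodr_ge0 => k _; exact: step_ge0.
- apply/nearME; exists s, (e / 2); first by split=> //; rewrite divr_gt0.
 move=> y; elim: {gs sphi H} s => [|h s IH] Hy; first by rewrite big_nil.
 rewrite big_cons phi1 ?mul1r; first by apply: IH => k ks; apply: Hy; right.
 by apply: Hy; left.
move=> y nP.
have [h hs ehy] : exists2 h, List.In h s & e <= `|h y - h x|.
 apply: contrapT => N; apply: nP; apply: H => h hs; rewrite ltNge; apply/negP => eh.
 by apply: N; exists h.
have sh := smooth_gen (gs h hs); have e4 : 0 < e / 4 by rewrite divr_gt0.
apply: filterS (smooth_dist y sh e4) => z zy.
have hz : phi h z = 0.
 apply: phi0; have := ler_normB (h z - h x) (h z - h y).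
 rewrite (_ : h z - h x - (h z - h y) = h y - h x); last by ring.
 by move: ehy zy; lra.
elim: s hs {gs sphi H} => [|k s IH] //= [->|hs]; rewrite big_cons; first by rewrite hz mul0r.
by rewrite IH // mulr0.
Qed.

Lemma near_map M N (f : M -> N) (x : M) (P : N -> Prop) : (forall h, gen h -> smooth_fun (h \o f)) ->
 (\forall z \near (f x : dtop N), P z) -> \forall y \near (x : dtop M), P (f y).
move=> sf /nearME[s [e [e0 gs] H]].
have : \forall y \near (x : dtop M), forall h, List.In h s -> `|h (f y) - h (f x)| < e.
 elim: s gs {H} => [|h s IH] gs; first by apply: filterE.
 have H1 := smooth_dist x (sf h (gs h (or_introl erefl))) e0.
 have H2 := IH (fun k ks => gs k (or_intror ks)).
 by apply: filterS2 H1 H2 => y h1 h2 k [<-|] //; exact: h2.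
by apply: filterS => y; exact: H.
Qed.

Lemma smap_gen M N (f : M -> N) : (forall h, gen h -> smooth_fun (h \o f)) -> smooth_map f.
move=> sf h sh; apply: smooth_local => x; have [n [g [F [gg cF E]]]] := sh (f x).
exists (fun y => F (\row_i (g i \o f) y)).
 by apply: smooth_comp => // i; exact: sf.
exact: (near_map sf E).
Qed.

Lemma smooth_near M N (f : M -> N) (x : M) (P : N -> Prop) : smooth_map f ->
 (\forall z \near (f x : dtop N), P z) -> \forall y \near (x : dtop M), P (f y).
by move=> sf; apply: near_map => h /smooth_gen; exact: sf. Qed.

Lemma smap_comp M N P (f : M -> N) (g : N -> P) : smooth_map f -> smooth_map g -> smooth_map (fun x => g (f x)).
by move=> sf sg h sh; exact: (sf _ (sg _ sh)). Qed.

Lemma smap_id M : smooth_map (fun x : M => x).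
by move=> h. Qed.

Lemma smooth_map_cst M N (y : N) : smooth_map (fun _ : M => y).
by move=> h _; exact: smooth_cst. Qed.

Lemma smooth_map_local M N (f : M -> N) : (forall x, exists2 f', smooth_map f' & eqnear x f f') -> smooth_map f.
move=> H h sh; apply: smooth_local => x; have [f' sf' E] := H x.
by exists (h \o f'); [exact: sf'|apply: filterS E => y /= ->].
Qed.

Lemma near_sub M (A : set M) (x : subd A) (P : subd A -> Prop) : (\forall y \near (x : dtop (subd A)), P y) <->
 \forall z \near (sval x : dtop M), forall Az : A z, P (exist _ z Az).
split=> /nearME[s [e [e0 gs] H]]; apply/nearME.
 have [s' [gs' E]] : exists s', (forall h, List.In h s' -> gen h) /\
   forall h, List.In h s -> exists2 k, List.In k s' & h = k \o sval.
  elim: s gs {H} => [|h s IH] gs; first by exists [::].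
  have [s' [gs' E]] := IH (fun k ks => gs k (or_intror ks)).
  have [k gk hk] := gs h (or_introl erefl).
  exists (k :: s'); split=> [l [<- //|]|l [<-|/E[j js ->]]]; first exact: gs'.
   by exists k => //; left.
  by exists j => //; right.
 exists s', e => // y Hy Ay; apply: H => h /E[k ks' ->]; exact: Hy.
exists [seq h \o sval | h <- s], e.
 by split=> // h /List.in_map_iff[k [<- ks]]; exists k => //; exact: gs.
move=> [y Ay] Hy; apply: H => h hs; apply: (Hy (h \o sval)).
by apply/List.in_map_iff; exists h.
Qed.

Lemma smooth_sval M (A : set M) : @smooth_map R (subd A) M sval.
by apply: smap_gen => h gh; apply: smooth_gen; exists h. Qed.

Lemma smooth_subP M (A : set M) (k : subd A -> R) : smooth_fun k <->
 forall x : subd A, exists2 k' : M -> R, smooth_fun k' & \forall y \near (x : dtop (subd A)), k y = k' (sval y).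
split=> [sk x|H]; last first.
 apply: smooth_local => x; have [k' sk' E] := H x.
 by exists (k' \o sval) => //; exact: smooth_sval.
have [n [g [F [gg cF E]]]] := sk x.
have /choice2[g' Hg'] i := gg i.
exists (fun y => F (\row_i g' i y)).
 by apply: smooth_comp => // i; apply: smooth_gen; have [] := Hg' i.
apply: filterS E => y ->; congr F; apply/rowP => i; rewrite !mxE.
by have [_ ->] := Hg' i.
Qed.

Lemma smooth_into_sub M N (A : set M) (f : N -> subd A) : smooth_map (fun x => sval (f x)) -> smooth_map f.
move=> sf; apply: smap_gen => h [k gk ->].
by apply: (sf k); exact: smooth_gen.
Qed.

Lemma smooth_fst M N : @smooth_map R (prodd M N) M fst.
by apply: smap_gen => h gh; apply: smooth_gen; left; exists h. Qed.
Lemma smooth_snd M N : @smooth_map R (prodd M N) N snd.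
by apply: smap_gen => h gh; apply: smooth_gen; right; exists h. Qed.
Lemma smooth_pair M N P (f : P -> M) (g : P -> N) : smooth_map f -> smooth_map g ->
 @smooth_map R P (prodd M N) (fun x => (f x, g x)).
move=> sf sg; apply: smap_gen => h [[k gk ->]|[k gk ->]].
 by apply: (sf k); exact: smooth_gen.
by apply: (sg k); exact: smooth_gen.
Qed.

Lemma near_euclid n (x : 'rV[R]_n) (P : 'rV[R]_n -> Prop) :
 (\forall y \near (x : dtop (euclid R n)), P y) <-> (\forall y \near x, P y).
split=> [/nearME[s [e [e0 gs] H]]|/near_rV[e e0 H]]; last first.
 apply/nearME; exists [seq (fun y : 'rV[R]_n => y 0 i) | i <- enum 'I_n], e.
  by split=> // h /List.in_map_iff[i [<- _]]; exists i.
 move=> y Hy; apply: H; apply/rV_norm_lt => // i; rewrite subrV.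
 apply: (Hy (fun y : 'rV[R]_n => y 0 i)); apply/List.in_map_iff; exists i; split=> //.
 have := mem_enum 'I_n i; elim: (enum _) => [|j s IH] //=.
 by rewrite inE => /orP[/eqP ->|/IH]; [left|right].
apply/near_rV; exists e => // y /rV_norm_lt Hy; apply: H => h /gs[i ->].
by have := Hy e0 i; rewrite subrV.
Qed.

Lemma smooth_euclid n (F : 'rV[R]_n -> R) : @smooth_fun R (euclid R n) F <->
 forall x : 'rV[R]_n, exists2 G, Cinfty G & \forall y \near x, F y = G y.
split=> [sF x|H x].
 have [m [g [G [gg cG E]]]] := sF x; have /boolp.choice[k Hk] i := gg i.
 exists (fun y => G (\row_i g i y)); last by apply/(near_euclid x).
 by apply: Cinfty_comp => // i; rewrite Hk; exact: Ccoord.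
have [G cG E] := H x.
exists n, (fun i (y : 'rV[R]_n) => y 0 i), G; split=> //; first by move=> i; exists i.
apply/(near_euclid x); apply: filterS E => y ->; congr G.
by apply/rowP => i; rewrite mxE.
Qed.

Lemma Cinfty_smooth n (F : 'rV[R]_n -> R) : Cinfty F -> @smooth_fun R (euclid R n) F.
by move=> cF; apply/smooth_euclid => x; exists F => //; apply: filterE. Qed.

Lemma smooth_euclidP M n (f : M -> 'rV[R]_n) :
 (forall i, smooth_fun (fun x => f x 0 i)) -> @smooth_map R M (euclid R n) f.
by move=> sf; apply: smap_gen => h [i ->]; exact: sf. Qed.

Lemma theP (T : Type) (d : T) (P : T -> Prop) : (exists x, P x) -> P (the d P).
by move=> H; rewrite /the; case: pselect => // h; exact: (svalP (cid h)). Qed.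

Lemma the_eq (T : Type) (d : T) (P : T -> Prop) x : P x -> (forall y, P y -> y = x) -> the d P = x.
by move=> Px U; apply: U; apply: theP; exists x. Qed.

Section SubmoduleFacts.
Variables (K : pzRingType) (W : lmodType K) (S : submodule W).
Lemma subvalP (w : subm S) : scar S (subval w).
by have := valP w; rewrite /smem inE. Qed.
Lemma subval_inj : injective (@subval K W S).
exact: val_inj. Qed.
Lemma mksub w : scar S w -> exists v : subm S, subval v = w.
move=> Sw; have H : w \in smem S by rewrite /smem inE.
by exists (exist _ w H).
Qed.
End SubmoduleFacts.

Section TangentFacts.
Variable M : dspace R.
Implicit Types (x : M) (f g : M -> R).

Lemma tappP x (v : tangent x) : is_tangent x (tapp v).
exact: subvalP v. Qed.

Lemma tangent_ext x (v w : tangent x) : (forall f, smooth_fun f -> tapp v f = tapp w f) -> v = w.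
move=> H; apply: subval_inj; apply/funext => f; have [sf|nf] := pselect (smooth_fun f); first exact: H.
by have [v0 _ _] := tappP v; have [w0 _ _] := tappP w; rewrite [LHS]v0 // [RHS]w0.
Qed.

(** Elements of [tangent] are total and vanish on functions that are not smooth; the given w is
    replaced by 0 there. *)
Lemma mk_tangent x (w : (M -> R) -> R) : (forall a f g, smooth_fun f -> smooth_fun g ->
  w (fun y => a * f y + g y) = a * w f + w g) -> (forall f g, smooth_fun f -> smooth_fun g ->
  w (fun y => f y * g y) = w f * g x + f x * w g) -> exists v : tangent x, forall f, smooth_fun f -> tapp v f = w f.
move=> wD wM; pose w' f : R^o := if `[< smooth_fun f >] then w f else 0.
have E f : smooth_fun f -> w' f = w f by move=> sf; rewrite /w' ifT //; exact/asboolP.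
have [v Hv] : exists v : tangent x, subval v = w'.
 apply: mksub; split=> [f nf|a f g sf sg|f g sf sg].
 - by rewrite /w' ifF //; apply/asboolP.
 - rewrite !E //; first exact: wD.
  by apply: smoothD => //; apply: smoothM => //; exact: smooth_cst.
 - by rewrite !E //; [exact: wM|exact: smoothM].
by exists v => f sf; rewrite /tapp -[val v]/(subval v) Hv E.
Qed.

Lemma tapp_lin x (v : tangent x) a f g : smooth_fun f -> smooth_fun g ->
 tapp v (fun y => a * f y + g y) = a * tapp v f + tapp v g.
by have [_ H _] := tappP v; exact: H. Qed.
Lemma tappM x (v : tangent x) f g : smooth_fun f -> smooth_fun g ->
 tapp v (fun y => f y * g y) = tapp v f * g x + f x * tapp v g.
by have [_ _ H] := tappP v; exact: H. Qed.

Lemma tapp_cst x (v : tangent x) a : tapp v (fun=> a) = 0.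
have s1 := @smooth_cst M 1; have s0 := @smooth_cst M 0.
have v1 : tapp v (fun=> 1) = 0.
 have := tappM v s1 s1; rewrite !mulr1 !mul1r; lra.
have v0 : tapp v (fun=> 0) = 0.
 have := tappM v s0 s0.
 by rewrite (_ : (fun=> 0 * 0) = fun=> 0) ?mulr0 ?mul0r ?addr0 //; apply/funext => y; rewrite mulr0.
transitivity (a * tapp v (fun=> 1) + tapp v (fun=> 0)); last by rewrite v1 v0 mulr0 addr0.
by rewrite -tapp_lin //; congr tapp; apply/funext => y; rewrite mulr1 addr0.
Qed.

Lemma tappD x (v : tangent x) f g : smooth_fun f -> smooth_fun g -> tapp v (fun y => f y + g y) = tapp v f + tapp v g.
move=> sf sg; have := tapp_lin v 1 sf sg; rewrite mul1r => <-.
by congr tapp; apply/funext => y; rewrite mul1r.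
Qed.

Lemma tappZ x (v : tangent x) a f : smooth_fun f -> tapp v (fun y => a * f y) = a * tapp v f.
by move=> sf; rewrite tappM // ?tapp_cst ?mul0r ?add0r //; exact: smooth_cst. Qed.

Lemma tappN x (v : tangent x) f : smooth_fun f -> tapp v (fun y => - f y) = - tapp v f.
move=> sf; rewrite -mulN1r -tappZ //; congr tapp.
by apply/funext => y; rewrite mulN1r.
Qed.

Lemma tapp_sum x (v : tangent x) (I : Type) (r : seq I) (F : I -> M -> R) : (forall i, smooth_fun (F i)) ->
 tapp v (fun y => \sum_(i <- r) F i y) = \sum_(i <- r) tapp v (F i).
move=> H; elim: r => [|i r IH].
 rewrite big_nil -[RHS](tapp_cst v 0); congr tapp; apply/funext => y.
 by rewrite big_nil.
rewrite big_cons -IH -tappD //; last exact: smooth_sum.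
by congr tapp; apply/funext => y; rewrite big_cons.
Qed.

(** For a bump function chi supported where f = g, the product chi (f - g) is zero, and Leibniz at x
    turns this into v f = v g. *)
Lemma tapp_local x (v : tangent x) f g : smooth_fun f -> smooth_fun g -> eqnear x f g -> tapp v f = tapp v g.
move=> sf sg E; have [chi [schi _ c1 c0]] := bump E.
have sh : smooth_fun (fun y => f y - g y) by exact: smoothB.
have : tapp v (fun y => chi y * (f y - g y)) = 0.
 rewrite -[RHS](tapp_cst v 0); congr tapp; apply/funext => y.
 have [H|H] := pselect (\forall z \near (y : dtop M), f z = g z).
  by rewrite (near_self H) subrr mulr0.
 by rewrite (near_self (c0 y H)) mul0r.
rewrite tappM // (near_self E) subrr mulr0 add0r (near_self c1) mul1r.
rewrite tappD //; last exact: smoothN.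
by rewrite tappN // => /eqP; rewrite subr_eq0 => /eqP.
Qed.

(** By Hadamard F - F(a) is a sum of products (y_i - a_i) H_i; the first factor vanishes at a, so
    Leibniz leaves the value of H_i, which is the partial derivative. *)
Lemma tapp_chain x (v : tangent x) n (g : 'I_n -> M -> R) (F : 'rV[R]_n -> R) :
 Cinfty F -> (forall i, smooth_fun (g i)) ->
 tapp v (fun y => F (\row_i g i y)) = \sum_i pder i F (\row_i g i x) * tapp v (g i).
move=> cF sg; set a := \row_i g i x.
have [H [cH Ha E]] := hadamard a cF.
have sH i : smooth_fun (fun y => H i (\row_i g i y)) by exact: smooth_comp.
have sgi i : smooth_fun (fun y => g i y - a 0 i) by apply: smoothB => //; exact: smooth_cst.
have -> : (fun y => F (\row_i g i y)) = fun y => F a + \sum_i (g i y - a 0 i) * H i (\row_i g i y).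
 by apply/funext => y; rewrite E; congr (_ + _); apply: eq_bigr => i _; rewrite !mxE.
rewrite tappD ?tapp_cst ?add0r; last 2 first.
- exact: smooth_cst.
- by apply: smooth_sum => i _; exact: smoothM.
rewrite tapp_sum; last by move=> i; exact: smoothM.
apply: eq_bigr => i _; rewrite tappM // {2}/a mxE subrr mul0r addr0 -/a Ha mulrC.
congr (_ * _); rewrite tappD //; last exact: smooth_cst.
by rewrite tapp_cst addr0.
Qed.

End TangentFacts.

Lemma dmapE M N (f : M -> N) x (v : tangent x) h : smooth_map f -> smooth_fun h ->
 tapp (dmap f v) h = tapp v (h \o f).
move=> sf; rewrite /dmap; move: h.
apply: (@theP _ 0 (fun w : tangent (f x) => forall h, smooth_fun h -> tapp w h = tapp v (h \o f))).
have [|h1 h2 s1 s2|w Hw] := @mk_tangent N (f x) (fun h => tapp v (h \o f)); last by exists w.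
 by move=> a h1 h2 s1 s2; rewrite -tapp_lin //; exact: sf.
by rewrite -[RHS](@tappM _ _ v (h1 \o f) (h2 \o f)) //; exact: sf.
Qed.

Lemma dmap_lin M N (f : M -> N) (x : M) : smooth_map f -> linear (fun v : tangent x => dmap f v).
move=> sf a u v; apply: tangent_ext => h sh.
have E y (w w' : tangent y) k : tapp (a *: w + w') k = a * tapp w k + tapp w' k by [].
by rewrite E !dmapE // E.
Qed.

End Spaces.

Arguments smap_id {R M}.
Arguments smooth_fst {R M N}.
Arguments smooth_snd {R M N}.

(** * Coordinates and submersions *)

Section Coordinates.
Variable R : realType.
Implicit Types M N P : dspace R.

Lemma near_dnear n (z : 'rV[R]_n) (P : 'rV[R]_n -> Prop) : (\forall y \near z, P y) ->
 \forall y \near z, \forall w \near y, P w.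
exact: nbhs_interior. Qed.

(** Smoothness near z of a map out of Euclidean space. [Cinfty] speaks about functions on the whole
    space, so the pulled back functions are only required to have the germ of such a function. *)
Definition Cmap n (z : 'rV[R]_n) M (a : 'rV[R]_n -> M) : Prop :=
 forall f, smooth_fun f -> exists2 F, Cinfty F & \forall w \near z, f (a w) = F w.

Lemma Cmap_gen_cont n (z : 'rV[R]_n) M (a : 'rV[R]_n -> M) (P : M -> Prop) :
 (forall f, gen f -> exists2 F, Cinfty F & \forall w \near z, f (a w) = F w) ->
 (\forall y \near (a z : dtop M), P y) -> \forall w \near z, P (a w).
move=> ca /nearME[s [e [e0 gs] H]].
have : \forall w \near z, forall h, List.In h s -> `|h (a w) - h (a z)| < e.
 elim: s gs {H} => [|h s IH] gs; first by apply: filterE.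
 have [F cF E] := ca h (gs h (or_introl erefl)).
 have H1 : \forall w \near z, `|h (a w) - h (a z)| < e.
  have /cvgrPdist_lt/(_ _ e0) := Cinfty_cont cF (x := z).
  move: (nbhs_singleton E) => E0; apply: filterS2 E => w ->.
  by rewrite E0 distrC.
 have H2 := IH (fun k ks => gs k (or_intror ks)).
 by apply: filterS2 H1 H2 => y h1 h2 k [<-|] //; exact: h2.
by apply: filterS => w; exact: H.
Qed.

Lemma Cmap_gen n (z : 'rV[R]_n) M (a : 'rV[R]_n -> M) :
 (forall f, gen f -> exists2 F, Cinfty F & \forall w \near z, f (a w) = F w) -> Cmap z a.
move=> ca f sf; have [m [g [F [gg cF E]]]] := sf (a z).
have /choice2[G HG] i := ca _ (gg i).
exists (fun y => F (\row_i G i y)).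
 by apply: Cinfty_comp => // i; have [] := HG i.
have E2 := Cmap_gen_cont ca E.
have E3 : \forall w \near z, forall i, g i (a w) = G i w.
 by apply: (@filter_forall _ _ (fun i => [set w | g i (a w) = G i w]) _ (nbhs_filter z)) => i; have [] := HG i.
by apply: filterS2 E2 E3 => w -> E3; congr F; apply/rowP => i; rewrite !mxE.
Qed.

Lemma Cmap_cont n (z : 'rV[R]_n) M (a : 'rV[R]_n -> M) (P : M -> Prop) : Cmap z a ->
 (\forall y \near (a z : dtop M), P y) -> \forall w \near z, P (a w).
by move=> ca; apply: Cmap_gen_cont => f /smooth_gen; exact: ca. Qed.

Lemma Cmap_eq n (z : 'rV[R]_n) M (a b : 'rV[R]_n -> M) : (\forall w \near z, a w = b w) -> Cmap z a -> Cmap z b.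
move=> E ca f sf; have [F cF E2] := ca f sf; exists F => //.
by apply: filterS2 E E2 => w -> .
Qed.

Lemma Cmap_pair n (z : 'rV[R]_n) M N (a : 'rV[R]_n -> M) (b : 'rV[R]_n -> N) :
 Cmap z a -> Cmap z b -> @Cmap n z (prodd M N) (fun w => (a w, b w)).
move=> ca cb; apply: Cmap_gen => f [[k gk ->]|[k gk ->]].
 exact: (ca _ (smooth_gen gk)).
exact: (cb _ (smooth_gen gk)).
Qed.

Lemma Cmap_sub n (z : 'rV[R]_n) M (A : set M) (a : 'rV[R]_n -> subd A) : Cmap z (fun w => sval (a w)) -> Cmap z a.
by move=> ca; apply: Cmap_gen => f [k gk ->]; exact: (ca _ (smooth_gen gk)). Qed.

Section Coords.
Variable M : dspace R.

Definition qrow n (q : 'I_n -> M -> R) y : 'rV[R]_n := \row_i q i y.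

(** A chart whose coordinates q are smooth on all of M, because derivations act on global functions;
    only the inverse psi is local. *)
Definition coords n (q : 'I_n -> M -> R) (psi : 'rV[R]_n -> M) (U : set M) (V : set 'rV[R]_n) :=
 [/\ forall i, smooth_fun (q i), (forall y, U y -> \forall z \near (y : dtop M), U z) /\
   (forall z, V z -> \forall w \near z, V w), forall y, U y -> V (qrow q y) /\ psi (qrow q y) = y,
   forall z, V z -> U (psi z) /\ qrow q (psi z) = z & forall z, V z -> Cmap z psi].

Lemma qrow_near n (q : 'I_n -> M -> R) y (P : 'rV[R]_n -> Prop) : (forall i, smooth_fun (q i)) ->
 (\forall z \near (qrow q y), P z) -> \forall y' \near (y : dtop M), P (qrow q y').
move=> sq H; have sm : @smooth_map R M (euclid R n) (qrow q).
 by apply: smooth_euclidP => i; have := sq i; fext => x; rewrite mxE.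
by apply: (@smooth_near R M (euclid R n) (qrow q)) => //; apply/near_euclid.
Qed.

(** Produces the open sets of a chart from identities known on germs only: V is the set of points
    near which all the identities hold, U the corresponding set in M. *)
Lemma coords_make n (q : 'I_n -> M -> R) (psi : 'rV[R]_n -> M) (x : M) :
 (forall i, smooth_fun (q i)) -> psi (qrow q x) = x -> (\forall y \near (x : dtop M), psi (qrow q y) = y) ->
 (\forall z \near (qrow q x), qrow q (psi z) = z) -> (\forall z \near (qrow q x), Cmap z psi) ->
 exists U V, U x /\ coords q psi U V.
move=> sq px E1 E2 C; set z0 := qrow q x in px E2 C *.
pose Q (z : 'rV[R]_n) := [/\ Cmap z psi, qrow q (psi z) = z & \forall y \near (psi z : dtop M), psi (qrow q y) = y].
pose V := [set z : 'rV[R]_n | \forall z' \near z, Q z'].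
pose U := [set y | (\forall y' \near (y : dtop M), psi (qrow q y') = y') /\ V (qrow q y)].
have Vz0 : V z0.
 have C3 : \forall z \near z0, \forall y \near (psi z : dtop M), psi (qrow q y) = y.
  apply: (@Cmap_cont _ _ M psi (fun y0 => \forall y \near (y0 : dtop M), psi (qrow q y) = y)).
   exact: nbhs_singleton C.
  by rewrite px; exact: near_near.
 by apply: filterS3 C E2 C3.
have Vo z : V z -> \forall w \near z, V w by exact: near_dnear.
exists U, V; split; first by split.
split.
- exact: sq.
- split; last exact: Vo.
 move=> y [Hy Vy].
 apply: filterS2 (near_near Hy) (qrow_near sq (Vo _ Vy)) => y' h1 h2; by split.
- by move=> y [Hy Vy]; split; [exact: Vy|exact: near_self Hy].
- move=> z Vz; have [h1 h2 h3] := nbhs_singleton Vz; split; last exact: h2.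
 by split; [exact: h3|rewrite h2].
- by move=> z Vz; have [] := nbhs_singleton Vz.
Qed.

Section Use.
Variables (n : nat) (q : 'I_n -> M -> R) (psi : 'rV[R]_n -> M) (U : set M) (V : set 'rV[R]_n).
Hypothesis C : coords q psi U V.
Let sq i : smooth_fun (q i). by have [] := C. Qed.

Lemma coords_open y : U y -> \forall z \near (y : dtop M), U z.
by have [_ [H _] _ _ _] := C; exact: H. Qed.

Lemma coords_psi y : U y -> psi (qrow q y) = y.
by have [_ _ H _ _] := C; case/H. Qed.

Lemma coords_Cmap y : U y -> Cmap (qrow q y) psi.
by have [_ _ H _ K] := C; move=> /H[/K]. Qed.

Lemma coords_q y : U y -> \forall z \near (qrow q y), qrow q (psi z) = z /\ U (psi z).
have [_ [_ K] H L _] := C; case/H => Vy _; apply: filterS (K _ Vy) => z /L[].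
by [].
Qed.

Lemma coords_rep f y : U y -> smooth_fun f -> exists F, [/\ Cinfty F,
 eqnear y f (fun y => F (qrow q y)) & \forall z \near (qrow q y), f (psi z) = F z].
move=> Uy sf; have [F cF E] := coords_Cmap Uy sf; exists F; split=> //.
apply: filterS2 (coords_open Uy) (qrow_near sq E) => y' Uy' <-.
by rewrite coords_psi.
Qed.

Definition cpart i f y := pder i (fun z => f (psi z)) (qrow q y).

Lemma pder_near m i (F G : 'rV[R]_m -> R) z : (\forall w \near z, F w = G w) -> pder i F z = pder i G z.
by move=> E; rewrite /pder; apply: near_eq_derive.
Qed.

Lemma cpart_smooth i f y : U y -> smooth_fun f -> exists2 g, smooth_fun g & eqnear y (cpart i f) g.
move=> Uy sf; have [F [cF E1 E2]] := coords_rep Uy sf.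
exists (fun y => pder i F (qrow q y)).
 by apply: smooth_comp => //; exact: Cinfty_pder.
apply: filterS (qrow_near sq (near_dnear E2)) => y' E; exact: pder_near.
Qed.

Lemma cpartE i f F y : (\forall z \near (qrow q y), f (psi z) = F z) -> cpart i f y = pder i F (qrow q y).
exact: pder_near. Qed.

Lemma cvec_ex i y : U y -> exists v : tangent y, forall f, smooth_fun f -> tapp v f = cpart i f y.
move=> Uy; apply: mk_tangent => [a f g sf sg|f g sf sg].
 have [F [cF _ EF]] := coords_rep Uy sf; have [G [cG _ EG]] := coords_rep Uy sg.
 rewrite (cpartE i EF) (cpartE i EG).
 have E : \forall z \near (qrow q y), a * f (psi z) + g (psi z) = a * F z + G z.
  by apply: filterS2 EF EG => z -> ->.
 rewrite (@cpartE i (fun y => a * f y + g y) _ y E).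
 have caF : Cinfty (fun z => a * F z) by apply: CinftyM => //; exact: Cinfty_cst.
 rewrite pderD ?pderM; try exact: Cinfty_dble; last exact: derivable_cst.
 by rewrite {1}/pder derive_cst mul0r add0r.
have [F [cF _ EF]] := coords_rep Uy sf; have [G [cG _ EG]] := coords_rep Uy sg.
rewrite (cpartE i EF) (cpartE i EG).
have E : \forall z \near (qrow q y), f (psi z) * g (psi z) = F z * G z.
 by apply: filterS2 EF EG => z -> ->.
rewrite (@cpartE i (fun y => f y * g y) _ y E).
rewrite pderM; try exact: Cinfty_dble.
by move: (nbhs_singleton EF) (nbhs_singleton EG); rewrite coords_psi // => -> ->.
Qed.

Definition cvec i y : tangent y := the 0 (fun v => forall f, smooth_fun f -> tapp v f = cpart i f y).

Lemma cvecE i y f : U y -> smooth_fun f -> tapp (cvec i y) f = cpart i f y.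
by move=> Uy; apply: (@theP _ 0 (fun v : tangent y => forall f, smooth_fun f -> tapp v f = cpart i f y)); exact: cvec_ex. Qed.

Lemma cvec_q i j y : U y -> tapp (cvec i y) (q j) = (i == j)%:R.
move=> Uy; rewrite cvecE // (@cpartE i _ (fun z => z 0 j)).
 rewrite /pder; have [_ ->] := coord_drv j (qrow q y) (delta_mx 0 i).
 by rewrite mxE eqxx eq_sym.
by apply: filterS (coords_q Uy) => z [E _]; rewrite -{2}E mxE.
Qed.

Lemma tangent_coords y (v : tangent y) f : U y -> smooth_fun f -> tapp v f = \sum_i tapp v (q i) * cpart i f y.
move=> Uy sf; have [F [cF E1 E2]] := coords_rep Uy sf.
rewrite (tapp_local v sf _ E1); last exact: smooth_comp.
rewrite (tapp_chain v cF sq); apply: eq_bigr => i _.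
by rewrite (cpartE i E2) mulrC.
Qed.

Lemma tangent_coords_eq y (v w : tangent y) : U y -> (forall i, tapp v (q i) = tapp w (q i)) -> v = w.
move=> Uy H; apply: tangent_ext => f sf.
by rewrite !(tangent_coords _ Uy sf); apply: eq_bigr => i _; rewrite H.
Qed.

Lemma tapp_comb (y : M) (c : 'I_n -> R) (w : 'I_n -> tangent y) f :
 tapp (\sum_i c i *: w i) f = \sum_i c i * tapp (w i) f.
elim/big_ind2: _ => // v1 a1 v2 a2 <- <-; first by [].
Qed.

Lemma tangent_comb y (v : tangent y) : U y -> v = \sum_i tapp v (q i) *: cvec i y.
move=> Uy; apply: tangent_ext => f sf; rewrite (tangent_coords v Uy sf).
by rewrite tapp_comb; apply: eq_bigr => i _; rewrite cvecE.
Qed.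

End Use.
End Coords.

Lemma smooth_on_near M N (A : set M) (f : M -> N) x h : smooth_on A f ->
 (\forall y \near (x : dtop M), A y) -> smooth_fun h -> exists2 k, smooth_fun k & eqnear x (h \o f) k.
move=> sf nA sh; have Ax := near_self nA.
have /smooth_subP/(_ (exist _ x Ax))[k sk /near_sub E] := sf h sh.
by exists k => //; apply: filterS2 nA E => y Ay /(_ Ay).
Qed.

(** The components of a chart are smooth on a subspace only; each is replaced by a global smooth
    function with the same germ at x. *)
Lemma manifold_coords M : is_manifold M -> exists n, forall x : M, exists q psi U V, U x /\ @coords M n q psi U V.
move=> [_ _ [n H]]; exists n => x; have [U [V [phi [oU Ux oV [g [H1 H2 s1 s2]]]]]] := H x.
have openU y : U y -> \forall z \near (y : dtop M), U z by move=> Uy; exact: open_nbhs_nbhs.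
have openV z : V z -> \forall w \near z, V w by move=> Vz; exact: open_nbhs_nbhs.
have cg z : V z -> Cmap z g.
 move=> Vz f sf; have nV : \forall w \near (z : dtop (euclid R n)), V w.
  by apply/near_euclid; exact: openV.
 have [k sk E] := smooth_on_near s2 nV sf.
 have [F cF E2] := (smooth_euclid k).1 sk z.
 exists F => //; move/near_euclid : E => E.
 by apply: filterS2 E E2 => w /= -> .
have /choice2[q Hq] (i : 'I_n) : exists2 q : M -> R, smooth_fun q & \forall y \near (x : dtop M), q y = phi y 0 i.
 have sc : @smooth_fun R (euclid R n) (fun z : 'rV[R]_n => z 0 i).
  by apply: smooth_gen; exists i.
 have [k sk E] := smooth_on_near s1 (openU _ Ux) sc.
 by exists k => //; exact: smooth_locE E.
have px : qrow q x = phi x by apply/rowP => i; rewrite mxE; have [_ /near_self] := Hq i.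
have [gx Vx] : g (phi x) = x /\ V (phi x) by have [] := H1 x Ux.
have nq : \forall y \near (x : dtop M), qrow q y = phi y.
 have : \forall y \near (x : dtop M), forall i, q i y = phi y 0 i.
  by apply: near_forall => i; have [] := Hq i.
 by apply: filterS => y E; apply/rowP => i; rewrite mxE.
exists q, g; apply: coords_make; rewrite ?px //.
- by move=> i; have [] := Hq i.
- by apply: filterS2 nq (openU _ Ux) => y -> /H1[].
- have nq2 : \forall z \near (phi x), qrow q (g z) = phi (g z).
  by apply: (Cmap_cont (cg _ Vx) (P := fun y => qrow q y = phi y)); rewrite gx.
 by apply: filterS2 nq2 (openV _ Vx) => z -> /H2[].
- by apply: filterS (openV _ Vx) => z; exact: cg.
Qed.

Definition qsplit M m p (a : 'I_m -> M -> R) (b : 'I_p -> M -> R) (k : 'I_(m + p)) : M -> R :=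
 match fintype.split k with inl i => a i | inr j => b j end.

Lemma qsplitl M m p (a : 'I_m -> M -> R) (b : 'I_p -> M -> R) i : qsplit a b (lshift p i) = a i.
by rewrite /qsplit; have := fintype.unsplitK (inl i : 'I_m + 'I_p) => /= ->. Qed.
Lemma qsplitr M m p (a : 'I_m -> M -> R) (b : 'I_p -> M -> R) j : qsplit a b (rshift m j) = b j.
by rewrite /qsplit; have := fintype.unsplitK (inr j : 'I_m + 'I_p) => /= ->. Qed.

Lemma qsplit_smooth M m p (a : 'I_m -> M -> R) (b : 'I_p -> M -> R) k :
 (forall i, smooth_fun (a i)) -> (forall j, smooth_fun (b j)) -> smooth_fun (qsplit a b k).
by move=> sa sb; rewrite /qsplit; case: fintype.split. Qed.

Lemma qrow_split M m p (a : 'I_m -> M -> R) (b : 'I_p -> M -> R) x :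
 qrow (qsplit a b) x = row_mx (qrow a x) (qrow b x).
apply/rowP => k; rewrite [in RHS]mxE !mxE /qsplit.
by case: fintype.split => j; rewrite mxE.
Qed.

Lemma complement_rows m n (A : 'M[R]_(m, n)) : row_free A ->
 exists p (K : 'M[R]_(p, n)), (m + p)%N = n /\ row_full (col_mx A K).
move=> fA; exists (\rank A^C)%MS, (row_base A^C)%MS; split.
 rewrite mxrank_compl; move: (fA) (rank_leq_col A); rewrite /row_free => /eqP ->.
 exact: subnKC.
have := addsmx_compl_full A; rewrite -!sub1mx => /submx_trans; apply.
by rewrite -addsmxE addsmxS // eq_row_base.
Qed.

Lemma Cmap_comp_euclid n m (z : 'rV[R]_n) (u : 'rV[R]_n -> 'rV[R]_m) M (a : 'rV[R]_m -> M) :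
 @Cmap n z (euclid R m) u -> Cmap (u z) a -> Cmap z (fun w => a (u w)).
move=> cu ca f sf; have [F cF E] := ca f sf.
have [G cG E2] := cu F (Cinfty_smooth cF); exists G => //.
have E3 : \forall w \near z, f (a (u w)) = F (u w).
 by apply: (@Cmap_cont n z (euclid R m) u (fun w => f (a w) = F w) cu); apply/near_euclid.
by apply: filterS2 E2 E3 => w <- .
Qed.

Lemma Cmap_into_euclid n m (z : 'rV[R]_n) (u : 'rV[R]_n -> 'rV[R]_m) :
 (forall i, exists2 F, Cinfty F & \forall w \near z, u w 0 i = F w) -> @Cmap n z (euclid R m) u.
by move=> H; apply: Cmap_gen => f [i ->]; exact: H. Qed.

Lemma Cmap_row n m (z : 'rV[R]_n) (h : 'I_m -> 'rV[R]_n -> R) : (forall i, Cinfty (h i)) ->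
 @Cmap n z (euclid R m) (fun w => \row_i h i w).
by move=> ch; apply: Cmap_into_euclid => i; exists (h i) => //; apply: filterE => v; rewrite mxE. Qed.
Lemma coords_lift n M (q : 'I_n -> M -> R) psi U V y k (z : 'rV[R]_k) (u : 'rV[R]_k -> 'rV[R]_n) :
 coords q psi U V -> U y -> u z = qrow q y -> (\forall w \near z, @Cmap _ w (euclid R n) u) ->
 \forall w \near z, [/\ Cmap w (fun w => psi (u w)), qrow q (psi (u w)) = u w & U (psi (u w))].
move=> C Uy E cu.
have N : \forall v \near (u z : dtop (euclid R n)), qrow q (psi v) = v /\ U (psi v).
 by apply/near_euclid; rewrite E; exact: (coords_q C Uy).
apply: filterS2 cu (@Cmap_cont _ z (euclid R n) u _ (nbhs_singleton cu) N) => w cw [qw Uw]; split=> //; apply: Cmap_comp_euclid => //.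
by rewrite -qw; exact: (coords_Cmap C).
Qed.

(** The differentials of the pulled back coordinates are independent. They are completed by linear
    combinations y of the old coordinates, and the inverse function theorem turns the completed
    family into a chart. *)
Lemma submersion_coords M N (f : M -> N) (x : M) m n (zc : 'I_m -> N -> R) psiN UN VN (q : 'I_n -> M -> R) psi U V :
 coords zc psiN UN VN -> UN (f x) -> coords q psi U V -> U x -> smooth_map f ->
 (forall w : tangent (f x), exists v : tangent x, dmap f v = w) ->
 exists p, (m + p)%N = n /\ exists (y : 'I_p -> M -> R) psi' U' V',
  U' x /\ coords (qsplit (fun i => zc i \o f) y) psi' U' V'.
move=> CN UNx C Ux sf surj.
have sq i : smooth_fun (q i) by have [] := C.
have szf i : smooth_fun (zc i \o f) by apply: sf; have [] := CN.
have [A HA] : exists A : 'M[R]_(m, n), forall i j, A i j = cpart q psi j (zc i \o f) x.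
 by exists (\matrix_(i, j) cpart q psi j (zc i \o f) x) => i j; rewrite mxE.
(* A relation v among the rows is tested on a vector w of M over the i-th coordinate vector of N,
   which isolates v_i. *)
have fA : row_free A.
 apply/inj_row_free => v vA; apply/rowP => i; rewrite [RHS]mxE.
 have [w Hw] := surj (cvec zc psiN i (f x)).
 have wE k : tapp w (zc k \o f) = (i == k)%:R.
  rewrite -dmapE //; last by have [] := CN.
  by rewrite Hw (cvec_q CN).
 transitivity (\sum_k v 0 k * tapp w (zc k \o f)).
  rewrite (bigD1 i) //= wE eqxx mulr1 big1 ?addr0 // => k ki.
  by rewrite wE eq_sym (negbTE ki) mulr0.
 transitivity (\sum_j tapp w (q j) * (v *m A) 0 j); last by rewrite vA big1 // => j _; rewrite mxE mulr0.
 under [RHS]eq_bigr do rewrite mxE mulr_sumr.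
 rewrite exchange_big /=; apply: eq_bigr => k _.
 rewrite (tangent_coords C w Ux (szf k)) mulr_sumr; apply: eq_bigr => j _.
 by rewrite HA mulrCA.
have [p [K [e fK]]] := complement_rows fA.
exists p; split=> //; subst n.
have /boolp.choice[F HF] i := coords_rep C Ux (szf i).
(* The new coordinates as functions of the old ones; the Jacobian at x is the completed matrix
   [col_mx A K]. *)
pose Phi (k : 'I_(m + p)) (z : 'rV[R]_(m + p)) :=
 match fintype.split k with inl i => F i z | inr j => \sum_l K j l * z 0 l end.
have cPhi k : Cinfty (Phi k).
 rewrite /Phi; case: fintype.split => i; first by have [] := HF i.
 by apply: Cinfty_sum => l _; apply: CinftyM; [exact: Cinfty_cst|exact: Ccoord].
pose y (j : 'I_p) (w : M) := \sum_l K j l * q l w.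
have sy j : smooth_fun (y j).
 by apply: smooth_sum => l _; apply: smoothM => //; exact: smooth_cst.
pose q' := qsplit (fun i => zc i \o f) y.
have sq' k : smooth_fun (q' k) by exact: qsplit_smooth.
have q'E : \forall w \near (x : dtop M), qrow q' w = \row_k Phi k (qrow q w).
 have : \forall w \near (x : dtop M), forall i, (zc i \o f) w = F i (qrow q w).
  by apply: near_forall => i; have [_ E _] := HF i.
 apply: filterS => w E; apply/rowP => k; rewrite !mxE /q' /qsplit /Phi.
 case: fintype.split => i; first exact: E.
 by apply: eq_bigr => l _; rewrite mxE.
have J0 : \det (\matrix_(k, l) pder l (Phi k) (qrow q x)) != 0.
 have -> : \matrix_(k, l) pder l (Phi k) (qrow q x) = col_mx A K.
  apply/matrixP => k l; rewrite !mxE /Phi; case: fintype.split => i.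
   by rewrite HA; have [_ _ E] := HF i; rewrite (cpartE l E).
  have D l' : is_derive (qrow q x) (delta_mx 0 l) (fun z : 'rV[R]_(m + p) => K i l' * z 0 l') (K i l' * (delta_mx 0 l : 'rV[R]_(m + p)) 0 l').
   have H := is_deriveM (is_derive_cst (K i l') (qrow q x) (delta_mx 0 l)) (coord_drv l' (qrow q x) (delta_mx 0 l)).
   by apply: is_derive_eq H _; rewrite -![_ *: _]/(_ * _) mulr0 addr0.
  rewrite /pder (_ : (fun z : 'rV[R]_(m + p) => _) = \sum_l' (fun z : 'rV[R]_(m + p) => K i l' * z 0 l')); last first.
   by apply/funext => z; rewrite fct_sumE.
  have [_ ->] := is_derive_sum D.
  rewrite (bigD1 l) //= !mxE !eqxx mulr1 big1 ?addr0 // => l' ll'.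
  by rewrite mxE eqxx (negbTE ll') mulr0.
 by rewrite -unitfE -unitmxE -row_full_unit.
have [h [ch hE1 hE2]] := inverse_function cPhi J0.
have q'x := near_self q'E.
have hx : \row_i h i (qrow q' x) = qrow q x by rewrite q'x; exact: nbhs_singleton hE1.
pose psi' z := psi (\row_i h i z).
have /(_ (nbhs_filter _)) Cpsi' := coords_lift C Ux hx (filterE _ (fun z => Cmap_row z ch)).
exists y, psi'.
suff [U' [V' [H1 H2]]] : exists U' V', U' x /\ coords q' psi' U' V' by exists U', V'.
apply: coords_make => //.
- by rewrite /psi' hx (coords_psi C).
- apply: filterS3 q'E (qrow_near sq hE1) (coords_open C Ux) => w E H Uw.
 by rewrite /psi' E H (coords_psi C).
- have H1 : \forall z \near (qrow q' x), qrow q' (psi' z) = \row_k Phi k (qrow q (psi' z)).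
  have [cp _ _] := nbhs_singleton Cpsi'; apply: (Cmap_cont cp (P := fun w => qrow q' w = \row_k Phi k (qrow q w))).
  by rewrite /psi' hx (coords_psi C).
 have H3 : \forall z \near (qrow q' x), \row_k Phi k (\row_i h i z) = z by rewrite q'x.
 by apply: filterS3 H1 Cpsi' H3 => z -> [_ E _]; rewrite /psi' E.
- by apply: filterS Cpsi' => z [].
Qed.

(** A point (a, b) with f a = g b is recovered from the transverse coordinates y of a and the
    coordinates of b: the latter give b, hence the coordinates of f a = g b, and these together with
    y give a. *)
Lemma fiber_coords M N P (f : M -> N) (g : P -> N) (A : set (prodd M P))
  (s0 : subd A) m p np (zc : 'I_m -> N -> R) psiN UN VN
  (y : 'I_p -> M -> R) psiM UM VM (k : 'I_np -> P -> R) psiP UP VP :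
 (forall s, A s <-> f s.1 = g s.2) -> smooth_map f -> smooth_map g -> coords zc psiN UN VN -> UN (f (sval s0).1) ->
 coords (qsplit (fun i => zc i \o f) y) psiM UM VM -> UM (sval s0).1 -> coords k psiP UP VP -> UP (sval s0).2 ->
 exists psi U V, U s0 /\ @coords (subd A) _ (qsplit (fun j (s : subd A) => y j (sval s).1)
   (fun l (s : subd A) => k l (sval s).2)) psi U V.
move=> HA sf sg CN UNx CM UMx CP UPx.
have fg : f (sval s0).1 = g (sval s0).2 by apply/HA; case: s0 {UNx UMx UPx}.
set a0 := (sval s0).1 in UNx UMx fg *; set b0 := (sval s0).2 in UPx fg *.
have szc i : smooth_fun (zc i) by have [] := CN.
have sy j : smooth_fun (y j) by have [+ _ _ _ _] := CM; move=> /(_ (rshift m j)); rewrite qsplitr.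
have sk l : smooth_fun (k l) by have [] := CP.
set Q := qsplit _ _.
have sf1 := smap_comp (@smooth_sval _ _ A) smooth_fst; have sf2 := smap_comp (@smooth_sval _ _ A) smooth_snd.
have sQ i : smooth_fun (Q i) by apply: qsplit_smooth => j; [exact: (sf1 _ (sy j))|exact: (sf2 _ (sk j))].
pose bb (w : 'rV[R]_(p + np)) := psiP (rsubmx w).
pose uu (w : 'rV[R]_(p + np)) : 'rV[R]_(m + p) := row_mx (qrow zc (g (bb w))) (lsubmx w).
pose aa w := psiM (uu w).
(* The value s0 is junk, required because psi must land in the fiber product; [nA] shows that it
   does not occur near w0. *)
pose psi w : subd A := match pselect (A (aa w, bb w)) with | left h => exist _ (aa w, bb w) h | right _ => s0 end.
have QE s : qrow Q s = row_mx (qrow y (sval s).1) (qrow k (sval s).2) by rewrite qrow_split.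
pose w0 := qrow Q s0.
have rw0 : rsubmx w0 = qrow k b0 by rewrite /w0 QE row_mxKr.
have lw0 : lsubmx w0 = qrow y a0 by rewrite /w0 QE row_mxKl.
have bw0 : bb w0 = b0 by rewrite /bb rw0 (coords_psi CP).
have uw0 : uu w0 = qrow (qsplit (fun i => zc i \o f) y) a0.
 by rewrite qrow_split /uu bw0 -fg lw0; congr row_mx; apply/rowP => i; rewrite !mxE.
have aw0 : aa w0 = a0 by rewrite /aa uw0 (coords_psi CM).
have psiw0 : psi w0 = s0.
 rewrite /psi; case: pselect => // h; have E : (aa w0, bb w0) = sval s0 by rewrite aw0 bw0 -surjective_pairing.
 by move: h; rewrite E => h; case: s0 h {UNx UMx UPx fg a0 b0 psi w0 rw0 lw0 bw0 uw0 aw0 E} => s1 h1 /= h; congr exist; exact: Prop_irrelevance.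
have Hb : \forall w \near w0, [/\ Cmap w bb, qrow k (bb w) = rsubmx w & UP (bb w)].
 apply: (coords_lift CP UPx rw0); apply: filterE => w; apply: Cmap_into_euclid => i.
 by exists (fun w => w 0 (rshift p i)); [exact: Ccoord|apply: filterE => v; rewrite mxE].
have Cu : \forall w \near w0, @Cmap _ w (euclid R (m + p)) uu.
 apply: filterS Hb => w [cb _ _]; apply: Cmap_into_euclid => i.
 rewrite -[i]fintype.splitK; case: (fintype.split i) => j.
  have [F cF E] := cb _ (sg _ (szc j)); exists F => //.
  by apply: filterS E => v <-; rewrite row_mxEl mxE.
 exists (fun w => w 0 (lshift np j)); first exact: Ccoord.
 by apply: filterE => v; rewrite row_mxEr mxE.
have Hu : \forall w \near w0, [/\ Cmap w aa, qrow _ (aa w) = uu w & UM (aa w)] := coords_lift CM UMx uw0 Cu.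
have nA : \forall w \near w0, A (aa w, bb w).
 have na : \forall w \near w0, UN (f (aa w)).
  have [Ca _ _] := nbhs_singleton Hu; apply: (Cmap_cont (P := fun a => UN (f a)) Ca); rewrite aw0.
  by apply: smooth_near sf _; exact: (coords_open CN).
 have nb : \forall w \near w0, UN (g (bb w)).
  have [Cb _ _] := nbhs_singleton Hb; apply: (Cmap_cont (P := fun a => UN (g a)) Cb); rewrite bw0.
  by apply: smooth_near sg _; apply: (coords_open CN); rewrite -fg.
 apply: filterS3 na nb Hu => w Ua Ub [_ qu _]; apply/HA => /=.
 rewrite -(coords_psi CN Ua) -(coords_psi CN Ub); congr psiN.
 move: qu; rewrite qrow_split /uu => /eq_row_mx[<- _].
 by apply/rowP => i; rewrite !mxE.
have psiE w : A (aa w, bb w) -> sval (psi w) = (aa w, bb w).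
 by move=> h; rewrite /psi; case: pselect.
exists psi; apply: coords_make => //.
- have n1 := smooth_near (x := s0) sf1 (coords_open CM UMx).
 have n2 := smooth_near (x := s0) sf2 (coords_open CP UPx).
 apply: filterS2 n1 n2 => s U1 U2.
 have As : f (sval s).1 = g (sval s).2 by apply/HA; case: s {U1 U2}.
 have E2 : bb (qrow Q s) = (sval s).2 by rewrite /bb QE row_mxKr (coords_psi CP).
 have E1 : aa (qrow Q s) = (sval s).1.
  rewrite /aa /uu E2 QE row_mxKl -As -[RHS](coords_psi CM U1) qrow_split.
  by congr (psiM (row_mx _ _)); apply/rowP => i; rewrite !mxE.
 have h : A (aa (qrow Q s), bb (qrow Q s)) by rewrite E1 E2; apply/HA.
 have := psiE _ h; rewrite E1 E2 -surjective_pairing.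
 case: (psi _) => v hv; case: s {U1 U2 As E2 E1 h} => v' hv' /= E.
 by subst v'; congr exist; exact: Prop_irrelevance.
- apply: filterS3 nA Hb Hu => w h [_ kb _] [_ qa _]; rewrite QE (psiE _ h) /= kb.
 move: qa; rewrite qrow_split /uu => /eq_row_mx[_ ->].
 by rewrite hsubmxK.
- apply: filterS3 (near_dnear nA) Hu Hb => w nAw [ca _ _] [cb _ _]; apply: Cmap_sub.
 apply: (@Cmap_eq _ _ (prodd M P) (fun w => (aa w, bb w))); last exact: Cmap_pair.
 by apply: filterS nAw => v /psiE ->.
Qed.

End Coordinates.

(** * Vector bundles and frames *)

Section Frames.
Variable R : realType.
Implicit Types M N P : dspace R.

Definition smooth_at M (x : M) (f : M -> R) := exists2 k, smooth_fun k & eqnear x f k.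

Lemma smooth_atP M (f : M -> R) : (forall x, smooth_at x f) -> smooth_fun f.
exact: smooth_local. Qed.
Lemma smooth_atW M (f : M -> R) x : smooth_fun f -> smooth_at x f.
by move=> sf; exists f => //; apply: filterE. Qed.
Lemma smooth_at_eq M (f g : M -> R) x : eqnear x f g -> smooth_at x g -> smooth_at x f.
by move=> E [k sk Ek]; exists k => //; apply: filterS2 E Ek => y ->. Qed.
Lemma smooth_atD M (f g : M -> R) x : smooth_at x f -> smooth_at x g -> smooth_at x (fun y => f y + g y).
move=> [k sk Ek] [l sl El]; exists (fun y => k y + l y); first exact: smoothD.
by apply: filterS2 Ek El => y -> ->.
Qed.
Lemma smooth_atM M (f g : M -> R) x : smooth_at x f -> smooth_at x g -> smooth_at x (fun y => f y * g y).
move=> [k sk Ek] [l sl El]; exists (fun y => k y * l y); first exact: smoothM.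
by apply: filterS2 Ek El => y -> ->.
Qed.
Lemma smooth_at_sum M (I : Type) (r : seq I) (F : I -> M -> R) x :
 (forall i, smooth_at x (F i)) -> smooth_at x (fun y => \sum_(i <- r) F i y).
move=> H; elim: r => [|i r IH].
 apply: (@smooth_at_eq _ _ (fun=> 0)); last exact/smooth_atW/smooth_cst.
 by apply: filterE => y; rewrite big_nil.
apply: smooth_at_eq (smooth_atD (H i) IH).
by apply: filterE => y; rewrite big_cons.
Qed.
Lemma smooth_at_inv M (f : M -> R) x : smooth_at x f -> f x != 0 -> smooth_at x (fun y => (f y)^-1).
move=> [k sk Ek] fx; have kx : k x != 0 by rewrite -(near_self Ek).
have [g sg Eg] := smooth_inv_near sk kx; exists g => //.
by apply: filterS2 Ek Eg => y -> ->.
Qed.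
Lemma smooth_at_comp M N (f : M -> N) (h : N -> R) x :
 smooth_map f -> smooth_at (f x) h -> smooth_at x (fun y => h (f y)).
move=> sf [k sk E]; exists (k \o f); first exact: sf.
exact: (smooth_near sf E).
Qed.
Lemma smooth_map_at M N (f : M -> N) : (forall x h, gen h -> smooth_at x (h \o f)) -> smooth_map f.
by move=> H; apply: smap_gen => h gh; apply: smooth_atP => x; exact: H. Qed.

Lemma cutoff M (chi f : M -> R) (P : M -> Prop) : smooth_fun chi ->
 (forall y, ~ (\forall z \near (y : dtop M), P z) -> \forall z \near (y : dtop M), chi z = 0) ->
 (forall y, (\forall z \near (y : dtop M), P z) -> smooth_at y f) -> smooth_fun (fun y => chi y * f y).
move=> sc c0 H; apply: smooth_atP => y.
have [Py|nPy] := pselect (\forall z \near (y : dtop M), P z).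
 by apply: smooth_atM; [exact: smooth_atW|exact: H].
apply: (@smooth_at_eq _ _ (fun=> 0)); last exact/smooth_atW/smooth_cst.
by apply: filterS (c0 y nPy) => z ->; rewrite mul0r.
Qed.

Definition openM M (U : set M) := forall y, U y -> \forall z \near (y : dtop M), U z.

Definition theta M (E : bundle M) r (e : 'I_r -> sec E) (p : prodd M (euclid R r)) : tot E :=
 mkt (\sum_i (p.2 : 'rV[R]_r) 0 i *: e i p.1).

(** A local frame e with dual functionals xi, both continued smoothly to all of M; duality and
    spanning hold over U only. The last clause is smoothness over U of the combination map (x, c)
    |-> sum of c_i e_i(x). *)
Definition frame M (E : bundle M) r (U : set M) (e : 'I_r -> sec E) (xi : 'I_r -> tot E -> R) :=
 [/\ openM U /\ (forall i, smooth_sec (e i)), forall i, fib_linear (xi i),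
   forall y, U y -> forall i j, xi i (mkt (e j y)) = (i == j)%:R,
   forall y, U y -> forall v : E y, v = \sum_i xi i (mkt v) *: e i y &
   forall p : prodd M (euclid R r), U p.1 -> forall q, gen q -> smooth_at p (q \o theta e)].

(** The form of local triviality used throughout. It is proved for tangent, Hom, sum, Atiyah, core
    and nerve bundles, whose smooth structures are given by generators rather than by
    trivialisations. *)
Definition bundle_ok M (E : bundle M) r := smooth_map (fun p : tot E => projT1 p) /\
 forall x, exists U (e : 'I_r -> sec E) xi, U x /\ frame U e xi.

Section FrameUse.
Variables (M : dspace R) (E : bundle M) (r : nat).
Variables (U : set M) (e : 'I_r -> sec E) (xi : 'I_r -> tot E -> R).
Hypothesis F : frame U e xi.

Lemma frame_open : openM U. by have [[]] := F. Qed.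
Lemma frame_smooth i : smooth_sec (e i). by have [[]] := F. Qed.
Lemma xi_smooth i : smooth_fun (xi i). by have [_ /(_ i)[]] := F. Qed.
Lemma xi_lin i y : linear (fun v : E y => xi i (mkt v) : R^o).
by have [_ /(_ i)[]] := F. Qed.
Lemma frame_xi_e y i j : U y -> xi i (mkt (e j y)) = (i == j)%:R.
by move=> Uy; have [_ _ /(_ _ Uy)] := F. Qed.
Lemma frame_exp y (v : E y) : U y -> v = \sum_i xi i (mkt v) *: e i y.
by move=> Uy; have [_ _ _ /(_ _ Uy)] := F. Qed.

Lemma frame_eq y (v w : E y) : U y -> (forall i, xi i (mkt v) = xi i (mkt w)) -> v = w.
by move=> Uy H; rewrite (frame_exp v Uy) (frame_exp w Uy); apply: eq_bigr => i _; rewrite H. Qed.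

Lemma fib_lin0 (k : tot E -> R) y : linear (fun v : E y => k (mkt v) : R^o) -> k (mkt (0 : E y)) = 0.
by move=> l; have := l (-1) 0 0; rewrite scaleN1r addNr => ->; rewrite scaleN1r addNr. Qed.
Lemma fib_lin_sum (k : tot E -> R) y (I : Type) (s : seq I) (c : I -> R) (w : I -> E y) :
 linear (fun v : E y => k (mkt v) : R^o) -> k (mkt (\sum_(i <- s) c i *: w i)) = \sum_(i <- s) c i * k (mkt (w i)).
move=> l; elim: s => [|i s IH]; first by rewrite !big_nil fib_lin0.
by rewrite !big_cons -IH; exact: l.
Qed.
Lemma fib_linD (k : tot E -> R) y (v w : E y) : linear (fun v : E y => k (mkt v) : R^o) ->
 k (mkt (v + w)) = k (mkt v) + k (mkt w).
by move=> l; have := l 1 v w; rewrite !scale1r. Qed.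
Lemma fib_linZ (k : tot E -> R) y a (v : E y) : linear (fun v : E y => k (mkt v) : R^o) ->
 k (mkt (a *: v)) = a * k (mkt v).
by move=> l; have := l a v 0; rewrite addr0 (fib_lin0 l) addr0. Qed.

Lemma frame_xi_comb y i (c : 'I_r -> R) : U y -> xi i (mkt (\sum_j c j *: e j y)) = c i.
move=> Uy; rewrite fib_lin_sum; last exact: xi_lin.
rewrite (bigD1 i) //= frame_xi_e // eqxx mulr1 big1 ?addr0 // => j ji.
by rewrite frame_xi_e // eq_sym (negbTE ji) mulr0.
Qed.

Lemma smooth_theta N (f : N -> M) (c : 'I_r -> N -> R) x q : smooth_map f ->
 (forall i, smooth_at x (c i)) -> U (f x) -> gen q -> smooth_at x (fun y => q (mkt (\sum_i c i y *: e i (f y)))).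
move=> sf sc Ux gq; have /choice2[k Hk] i := sc i.
pose th : N -> prodd M (euclid R r) := fun y => (f y, \row_i k i y).
have sth : smooth_map th.
 apply: smooth_pair => //; apply: smooth_euclidP => i.
 by have [+ _] := Hk i; fext => y; rewrite mxE.
have [_ _ _ _ /(_ (th x) Ux q gq) H] := F.
apply: smooth_at_eq (smooth_at_comp sth H).
have : \forall y \near (x : dtop N), forall i, c i y = k i y.
 by apply: near_forall => i; have [] := Hk i.
apply: filterS => y Ey /=; congr q; rewrite /theta /=; congr mkt.
by apply: eq_bigr => i _; rewrite mxE Ey.
Qed.

Lemma frame_map_at N (f : N -> M) (l : forall y, E (f y)) x q : smooth_map f -> U (f x) ->
 (forall i, smooth_at x (fun y => xi i (mkt (l y)))) -> gen q -> smooth_at x (fun y => q (mkt (l y))).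
move=> sf Ux sc gq; apply: smooth_at_eq (smooth_theta sf sc Ux gq).
by apply: filterS (smooth_near sf (frame_open Ux)) => y Uy; rewrite -frame_exp.
Qed.

End FrameUse.

Lemma frame_map M (E : bundle M) N (f : N -> M) (l : forall y, E (f y)) r : smooth_map f ->
 (forall x, exists U (e : 'I_r -> sec E) xi, [/\ U (f x), frame U e xi &
   forall i, smooth_at x (fun y => xi i (mkt (l y)))]) -> smooth_lift l.
move=> sf H; apply: smooth_map_at => x q gq; have [U [e [xi [Ux F sx]]]] := H x.
exact: (frame_map_at F sf Ux sx gq).
Qed.

Section BundleOk.
Variables (M : dspace R) (E : bundle M) (r : nat).
Hypothesis ok : bundle_ok E r.

Lemma ok_proj : smooth_map (fun p : tot E => projT1 p). by case: ok. Qed.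
Lemma ok_frame x : exists U (e : 'I_r -> sec E) xi, U x /\ frame U e xi.
by case: ok. Qed.

Section Along.
Variables (N : dspace R) (f : N -> M).
Hypothesis sf : smooth_map f.

Lemma smooth_along (l : forall y, E (f y)) : (forall x U (e : 'I_r -> sec E) xi, U (f x) -> frame U e xi ->
   forall i, smooth_at x (fun y => xi i (mkt (l y)))) -> smooth_lift l.
move=> H; apply: (@frame_map _ _ _ f l r) => // x.
by have [U [e [xi [Ux F]]]] := ok_frame (f x); exists U, e, xi; split=> // i; exact: H F i.
Qed.

Lemma smooth_alongD (l l' : forall y, E (f y)) : smooth_lift l ->
 smooth_map (fun y => mkt (l' y)) -> smooth_map (fun y => mkt (l y + l' y)).
move=> sl sl'; apply: smooth_along => x U e xi Ux F i; have sx := xi_smooth F i.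
apply: (@smooth_at_eq _ _ (fun y => xi i (mkt (l y)) + xi i (mkt (l' y)))).
 by apply: filterE => y; rewrite fib_linD //; exact: xi_lin F i (f y).
by apply: smooth_atD; apply: smooth_atW; [exact: (sl _ sx)|exact: (sl' _ sx)].
Qed.

Lemma smooth_alongM (c : N -> R) (l : forall y, E (f y)) : smooth_fun c -> smooth_lift l ->
 smooth_map (fun y => mkt (c y *: l y)).
move=> sc sl; apply: smooth_along => x U e xi Ux F i; have sx := xi_smooth F i.
apply: (@smooth_at_eq _ _ (fun y => c y * xi i (mkt (l y)))).
 by apply: filterE => y; rewrite fib_linZ //; exact: xi_lin F i (f y).
by apply: smooth_atM; apply: smooth_atW => //; exact: (sl _ sx).
Qed.

Lemma smooth_tot0 : smooth_map (fun y => mkt (0 : E (f y))).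
apply: smooth_along => x U e xi Ux F i; apply: (@smooth_at_eq _ _ (fun=> 0)); last exact/smooth_atW/smooth_cst.
by apply: filterE => y; rewrite fib_lin0 //; exact: xi_lin F i (f y).
Qed.

Lemma smooth_along_sum (I : Type) (s : seq I) (l : I -> forall y, E (f y)) :
 (forall i, smooth_map (fun y => mkt (l i y))) -> smooth_map (fun y => mkt (\sum_(i <- s) l i y)).
move=> sl; elim: s => [|i s IH].
 by have := smooth_tot0; fext => y; rewrite big_nil.
by have := smooth_alongD (sl i) IH; fext => y; rewrite big_cons.
Qed.
End Along.

Lemma smooth_sec_at (l : sec E) : (forall x U (e : 'I_r -> sec E) xi, U x -> frame U e xi ->
   forall i, smooth_at x (fun y => xi i (mkt (l y)))) -> smooth_sec l.
exact: (smooth_along smap_id). Qed.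
Lemma smooth_secD (l m : sec E) : smooth_sec l -> smooth_sec m -> smooth_sec (fun y => l y + m y).
exact: (smooth_alongD smap_id). Qed.
Lemma smooth_secM (f : M -> R) (l : sec E) : smooth_fun f -> smooth_sec l -> smooth_sec (fun y => f y *: l y).
exact: (smooth_alongM smap_id). Qed.
Lemma smooth_sec0 : smooth_sec (fun y => 0 : E y).
exact: (smooth_tot0 smap_id). Qed.
Lemma smooth_secZ a (l : sec E) : smooth_sec l -> smooth_sec (fun y => a *: l y).
by move=> sl; apply: smooth_secM => //; exact: smooth_cst. Qed.
Lemma smooth_secS (I : Type) (s : seq I) (l : I -> sec E) :
 (forall i, smooth_sec (l i)) -> smooth_sec (fun y => \sum_(i <- s) l i y).
exact: (smooth_along_sum smap_id). Qed.

Lemma smooth_ext x (v : E x) : exists2 l : sec E, smooth_sec l & l x = v.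
have [U [e [xi [Ux F]]]] := ok_frame x.
exists (fun y => \sum_i xi i (mkt v) *: e i y); last by rewrite -(frame_exp F).
by apply: smooth_secS => i; apply: smooth_secZ; exact: frame_smooth F i.
Qed.

Lemma frame_sec_xi (l : sec E) U (e : 'I_r -> sec E) xi : smooth_sec l -> frame U e xi ->
 forall i, smooth_fun (fun y => xi i (mkt (l y))).
by move=> sl F i; exact: (sl _ (xi_smooth F i)). Qed.

End BundleOk.

End Frames.

Section Lin.
Variables (R : realType) (U W : lmodType R) (f : U -> W).
Hypothesis l : linear f.
Lemma linD u v : f (u + v) = f u + f v.
by have := l 1 u v; rewrite !scale1r. Qed.
Lemma lin0 : f 0 = 0.
by have := l (-1) 0 0; rewrite !scaleN1r !addNr. Qed.
Lemma linZ a u : f (a *: u) = a *: f u.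
by have := l a u 0; rewrite !addr0 lin0 addr0. Qed.
Lemma linN u : f (- u) = - f u.
by rewrite -scaleN1r linZ scaleN1r. Qed.
Lemma linB u v : f (u - v) = f u - f v.
by rewrite linD linN. Qed.
Lemma lin_sum (I : Type) (r : seq I) (w : I -> U) : f (\sum_(i <- r) w i) = \sum_(i <- r) f (w i).
by elim: r => [|i r IH]; rewrite ?big_nil ?lin0 // !big_cons linD IH. Qed.
End Lin.

Section Bundles.
Variable R : realType.
Implicit Types M N P : dspace R.

Lemma castE M (E : bundle M) (x : M) (v : E x) : cast x v = v.
by rewrite /cast; case: pselect => // h; rewrite (Prop_irrelevance h erefl). Qed.

Lemma mkt_inj M (E : bundle M) (x : M) (v w : E x) : mkt v = mkt w -> v = w.
by move/(congr1 (fun p : tot E => cast x (projT2 p))); rewrite /= !castE. Qed.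

Lemma mkt_cast M (E : bundle M) (x y : M) (v : E x) : x = y -> mkt (cast y v) = mkt v.
by move=> e; subst y; rewrite castE. Qed.

Lemma smooth_coord2 M r (i : 'I_r) : @smooth_fun R (prodd M (euclid R r)) (fun z => (z.2 : 'rV[R]_r) 0 i).
by apply: smooth_gen; right; exists (fun z : 'rV[R]_r => z 0 i) => //; exists i. Qed.

Section Vbundle.
Variables (M : dspace R) (E : bundle M) (r : nat).
Hypothesis vE : is_vbundle E r.

Definition triv (U : set M) (phi : tot E -> euclid R r) (G : prodd M (euclid R r) -> tot E) :=
 [/\ openM U, forall y, U y -> linear (fun v : E y => phi (mkt v) : 'rV[R]_r),
  forall y (a : 'rV[R]_r), U y -> exists2 v : E y, G (y, a) = mkt v & phi (mkt v) = a,
  forall y (v : E y), U y -> G (y, phi (mkt v)) = mkt v &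
  @smooth_on _ (tot E) (prodd M (euclid R r)) [set p | U (projT1 p)] (fun p => (projT1 p, phi p)) /\
  smooth_on [set q : prodd M (euclid R r) | U q.1] G].

Lemma vbundle_triv x : exists U phi G, U x /\ triv U phi G.
have [_ /(_ x)[U [phi [oU Ux lin [G [H1 H2 s1 s2]]]]]] := vE.
exists U, phi, G; split=> //; split=> //.
- by move=> y Uy; exact: open_nbhs_nbhs.
- move=> y a Uy; have [] := H2 (y, a) Uy; case: (G _) => y' v /= Uy' [e1 e2].
 by subst y'; exists v.
- by move=> y v Uy; have [] := H1 (mkt v) Uy.
Qed.

Lemma triv_smooth U phi G N (f : N -> M) (c : N -> 'rV[R]_r) (x : N) (q : tot E -> R) :
 triv U phi G -> smooth_map f -> (forall i, smooth_fun (fun y => c y 0 i)) -> U (f x) ->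
 smooth_fun q -> smooth_at x (fun y => q (G (f y, c y))).
move=> [oU _ _ _ [_ sG]] sf sc Ux sq.
pose th : N -> prodd M (euclid R r) := fun y => (f y, c y).
have sth : smooth_map th by apply: smooth_pair => //; exact: smooth_euclidP.
have nU : \forall p \near (th x : dtop (prodd M (euclid R r))), U p.1.
 exact: (smooth_near (x := th x) smooth_fst (oU _ Ux)).
have [k sk Ek] := smooth_on_near sG nU sq.
exact: (smooth_at_comp sth (ex_intro2 _ _ k sk Ek)).
Qed.

Lemma vzero_smooth x (q : tot E -> R) : smooth_fun q -> smooth_at x (fun y => q (mkt (0 : E y))).
move=> sq; have [U [phi [G [Ux T]]]] := vbundle_triv x.
have H := triv_smooth T (@smap_id _ M) (c := fun=> 0) _ Ux sq.
apply: smooth_at_eq (H _).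
 have [oU lin _ GE _] := T; apply: filterS (oU _ Ux) => y Uy; congr q.
 by rewrite -GE //; congr (G (_, _)); exact: (lin0 (lin y Uy)).
move=> i; have := @smooth_cst _ M 0; congr smooth_fun.
by apply/funext => y; rewrite mxE.
Qed.

(** Frame and dual functionals of a trivialisation are multiplied by a bump function chi. This makes
    them global, and nothing changes on the open set U' where chi = 1 nearby. *)
Lemma vbundle_ok : bundle_ok E r.
split; first by case: vE.
move=> x; have [U [phi [G [Ux T]]]] := vbundle_triv x.
have [oU lin Gex GE [sphi sG]] := T.
have [chi [schi chi01 chi1 chi0]] := bump (oU _ Ux).
pose s (y : M) (a : 'rV[R]_r) : E y := the 0 (fun v => phi (mkt v) = a).
have sE y a : U y -> phi (mkt (s y a)) = a.
 move=> Uy; apply: (@theP _ 0 (fun v : E y => phi (mkt v) = a)).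
 by have [v _] := Gex y a Uy; exists v.
have inj y (v w : E y) : U y -> phi (mkt v) = phi (mkt w) -> v = w.
 by move=> Uy H; apply: mkt_inj; rewrite -(GE _ v Uy) -(GE _ w Uy) H.
have phiZ y a (v : E y) : U y -> phi (mkt (a *: v)) = a *: (phi (mkt v) : 'rV[R]_r).
 by move=> Uy; exact: (linZ (lin y Uy)).
pose e (i : 'I_r) : sec E := fun y => chi y *: s y (delta_mx 0 i).
pose xi (i : 'I_r) (p : tot E) := chi (projT1 p) * (phi p : 'rV[R]_r) 0 i.
pose U' := [set y | \forall z \near (y : dtop M), chi z = 1 /\ U z].
have U'U y : U' y -> chi y = 1 /\ U y by move/near_self.
have phisum y (I : Type) (t : seq I) (c : I -> R) (w : I -> E y) : U y ->
  phi (mkt (\sum_(i <- t) c i *: w i)) = \sum_(i <- t) c i *: (phi (mkt (w i)) : 'rV[R]_r).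
 by move=> Uy; rewrite (lin_sum (lin y Uy)); apply: eq_bigr => i _; exact: phiZ.
have rowE (a : 'rV[R]_r) : \sum_i a 0 i *: (delta_mx 0 i : 'rV[R]_r) = a by rewrite [RHS]row_sum_delta.
exists U', e, xi; split; first by apply: filterS2 chi1 (oU _ Ux).
split.
- split; first by move=> y; exact: near_near.
 move=> i; apply: smooth_map_at => y q /smooth_gen sq.
 have [Uy|nUy] := pselect (\forall z \near (y : dtop M), U z); last first.
  apply: smooth_at_eq (vzero_smooth y sq).
  by apply: filterS (chi0 y nUy) => z; rewrite /= /e => ->; rewrite scale0r.
 have H := triv_smooth T (@smap_id _ M) (c := fun y => chi y *: delta_mx 0 i) _ (near_self Uy) sq.
 apply: smooth_at_eq (H _).
  apply: filterS Uy => z Uz /=; congr q.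
  by rewrite -GE // /e phiZ // sE.
 move=> j; have := smoothM schi (@smooth_cst _ M ((delta_mx 0 i : 'rV[R]_r) 0 j)).
 by fext => z; rewrite [RHS]mxE.
- move=> i; split.
  have sp : smooth_map (fun p : tot E => projT1 p) by case: vE.
  apply: (@cutoff _ (tot E) (fun p => chi (projT1 p)) (fun p => (phi p : 'rV[R]_r) 0 i) (fun p => U (projT1 p))).
  + exact: sp.
  + move=> p nP; apply: (smooth_near sp (P := fun y => chi y = 0)); apply: chi0 => H; apply: nP.
   exact: (smooth_near sp H).
  + by move=> p nU; have [k sk Ek] := smooth_on_near sphi nU (smooth_coord2 i); exists k.
 move=> y a v w; rewrite /xi /=; have [Uy|nUy] := pselect (U y).
  by have := lin y Uy a v w => ->; rewrite !mxE mulrDr mulrCA.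
 have -> : chi y = 0 by apply: near_self (chi0 y _) => /near_self.
 by rewrite !mul0r -[_ *: 0]/(a * 0) mulr0 addr0.
- move=> y /U'U[c1 Uy] i j; rewrite /xi /= /e c1 mul1r scale1r sE //.
 by rewrite mxE eqxx.
- move=> y /U'U[c1 Uy] v; apply: inj => //; rewrite phisum //.
 rewrite -[LHS]rowE; apply: eq_bigr => i _.
 by rewrite /xi /= c1 mul1r /e c1 scale1r sE.
- move=> p /U'U[_ Uy] q /smooth_gen sq.
 have s1 := @smooth_fst R M (euclid R r).
 have H := triv_smooth (x := p) T s1 (c := fun p : prodd M (euclid R r) => chi p.1 *: (p.2 : 'rV[R]_r)) _ Uy sq.
 apply: smooth_at_eq (H _).
  apply: filterS (smooth_near s1 (oU _ Uy)) => z Uz /=; congr q.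
  rewrite /theta -GE // phisum //; congr (G (_, _)).
  rewrite -[in RHS](rowE z.2) scaler_sumr; apply: eq_bigr => i _.
  by rewrite /e phiZ // sE // !scalerA mulrC.
 move=> i; have := smoothM (s1 _ schi) (smooth_coord2 i).
 by fext => z; rewrite [RHS]mxE.
Qed.

End Vbundle.

(** The common construction of frames when every generator of the total space is either a function
    on the base or fiberwise linear: smoothness of the local sections s is then tested on linear
    generators, and a bump function makes the frame global. *)
Lemma lin_frame M (E : bundle M) r (x : M) (U : set M) (s : 'I_r -> sec E) (xi : 'I_r -> tot E -> R) :
 smooth_map (fun p : tot E => projT1 p) ->
 (forall q : tot E -> R, gen q -> (exists2 h, smooth_fun h & q = fun p => h (projT1 p)) \/
   ((forall y, linear (fun v : E y => q (mkt v) : R^o)) /\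
   forall i y, U y -> smooth_at y (fun z => q (mkt (s i z))))) ->
 openM U -> U x -> (forall i, fib_linear (xi i)) ->
 (forall y, U y -> forall i j, xi i (mkt (s j y)) = (i == j)%:R) ->
 (forall y, U y -> forall v : E y, v = \sum_i xi i (mkt v) *: s i y) ->
 exists U' e, [/\ U' x, frame U' e xi & forall y, U' y -> U y /\ forall i, e i y = s i y].
move=> sp Hq oU Ux fl dual expd.
have [chi [schi chi01 chi1 chi0]] := bump (oU _ Ux).
pose e (i : 'I_r) : sec E := fun y => chi y *: s i y.
pose U' := [set y | \forall z \near (y : dtop M), chi z = 1 /\ U z].
have U'U y : U' y -> chi y = 1 /\ U y by move/near_self.
have sq (q : tot E -> R) i : (forall y, linear (fun v : E y => q (mkt v) : R^o)) ->
  (forall y, U y -> smooth_at y (fun z => q (mkt (s i z)))) -> smooth_fun (fun y => q (mkt (e i y))).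
 move=> lq sq; have := cutoff schi chi0 (fun y nU => sq y (near_self nU)).
 by fext => y; rewrite fib_linZ.
exists U', e; split; first by apply: filterS2 chi1 (oU _ Ux).
 2: by move=> y /U'U[c1 Uy]; split=> // i; rewrite /e c1 scale1r.
split=> //.
- split; first by move=> y; exact: near_near.
 move=> i; apply: smap_gen => q /Hq[[h sh ->]|[lq sqi]].
  by move: sh; fext.
 exact: (sq q i lq (sqi i)).
- by move=> y /U'U[c1 Uy] i j; rewrite /e c1 scale1r dual.
- by move=> y /U'U[c1 Uy] v; rewrite {1}(expd y Uy v); apply: eq_bigr => i _; rewrite /e c1 scale1r.
- move=> p /U'U[_ Uy] q /Hq[[h sh ->]|[lq sqi]].
  apply: smooth_atW; exact: (@smooth_fst R M (euclid R r) _ sh).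
 apply: smooth_atW.
 have -> : q \o theta e = fun p : prodd M (euclid R r) => \sum_i (p.2 : 'rV[R]_r) 0 i * q (mkt (e i p.1)).
  by apply/funext => z; rewrite /= /theta fib_lin_sum.
 apply: smooth_sum => i _; apply: smoothM; first exact: smooth_coord2.
 exact: (@smooth_fst R M (euclid R r) _ (sq q i lq (sqi i))).
Qed.

Lemma base_proj M (E : bundle M) : (forall h, gen h -> @gen R (tot E) (fun p => h (projT1 p))) ->
 smooth_map (fun p : tot E => projT1 p).
by move=> H; apply: smap_gen => h /H; exact: smooth_gen. Qed.

Lemma tanb_proj M : smooth_map (fun p : tot (tanb M) => projT1 p).
by apply: base_proj => h gh; left; exists h. Qed.

Lemma tanb_lin M f : smooth_fun f -> @fib_linear R M (tanb M) (fun p => tapp (projT2 p) f).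
by move=> sf; split=> //; apply: smooth_gen; right; exists f. Qed.

Lemma coords_frame M n (q : 'I_n -> M -> R) psi U V x : coords q psi U V -> U x ->
 exists U' (e : 'I_n -> sec (tanb M)), U' x /\ frame U' e (fun i (p : tot (tanb M)) => tapp (projT2 p) (q i)).
move=> C Ux; have sq i : smooth_fun (q i) by have [] := C.
have [|||//||||U' [e [U'x F _]]] :=
 @lin_frame M (tanb M) n x U (fun i y => cvec q psi i y) (fun i p => tapp (projT2 p) (q i)); last by exists U', e.
- exact: tanb_proj.
- move=> k [[h gh ->]|[f sf ->]]; [left|right].
  by exists h => //; exact: smooth_gen.
 split=> // i y Uy; have [g sg Eg] := cpart_smooth C i Uy sf.
 exists g => //; apply: filterS2 Eg (coords_open C Uy) => z <- Uz /=.
 exact: (cvecE C i Uz sf).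
- exact: coords_open C.
- by move=> i; exact: tanb_lin.
- by move=> y Uy i j /=; rewrite (cvec_q C) // eq_sym.
- by move=> y Uy v; rewrite [LHS](tangent_comb C).
Qed.

Lemma tanb_ok M n : (forall x : M, exists q psi U V, U x /\ @coords R M n q psi U V) -> bundle_ok (tanb M) n.
move=> H; split; first exact: tanb_proj.
move=> x; have [q [psi [U [V [Ux C]]]]] := H x.
have [U' [e [U'x F]]] := coords_frame C Ux.
by exists U', e, (fun i p => tapp (projT2 p) (q i)).
Qed.

Section HomFacts.
Variables (U W : lmodType R).
Lemma happ_linear (h : Hom U W) : linear (happ h).
exact: (@subvalP _ _ (homS U W) h). Qed.
Lemma tohomE (f : U -> W) : linear f -> happ (tohom f) = f.
move=> lf; apply: (@theP _ 0 (fun h : Hom U W => happ h = f)).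
by have [h Hh] := @mksub _ _ (homS U W) f lf; exists h.
Qed.
Lemma hom_ext (h k : Hom U W) : (forall v, happ h v = happ k v) -> h = k.
by move=> H; apply: (@subval_inj _ _ (homS U W)); apply/funext. Qed.
Lemma happD (h : Hom U W) u v : happ h (u + v) = happ h u + happ h v.
exact: linD (happ_linear h) u v. Qed.
Lemma happ0 (h : Hom U W) : happ h 0 = 0. exact: lin0 (happ_linear h). Qed.
Lemma happZ (h : Hom U W) a u : happ h (a *: u) = a *: happ h u.
exact: linZ (happ_linear h) a u. Qed.
Lemma happN (h : Hom U W) u : happ h (- u) = - happ h u. exact: linN (happ_linear h) u. Qed.
Lemma happ_comb a (h k : Hom U W) u : happ (a *: h + k) u = a *: happ h u + happ k u.
by []. Qed.
Lemma happ_sum (h : Hom U W) (I : Type) (r : seq I) (c : I -> R) (w : I -> U) :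
 happ h (\sum_(i <- r) c i *: w i) = \sum_(i <- r) c i *: happ h (w i).
by rewrite (lin_sum (happ_linear h)); apply: eq_bigr => i _; exact: happZ. Qed.
End HomFacts.

Lemma homb_proj M (E L : bundle M) : smooth_map (fun p : tot (homb E L) => projT1 p).
by apply: base_proj => h gh; left; exists h. Qed.

Lemma homb_ok M (E L : bundle M) r : bundle_ok E r -> bundle_ok L 1 -> bundle_ok (homb E L) r.
move=> oE oL; split; first exact: homb_proj.
move=> x; have [U1 [e [xi [U1x F]]]] := ok_frame oE x.
have [U2 [l [la [U2x F2]]]] := ok_frame oL x.
pose U y := U1 y /\ U2 y.
pose s (i : 'I_r) : sec (homb E L) := fun y => tohom (fun v : E y => xi i (mkt v) *: l 0 y).
have ls i y : linear (fun v : E y => xi i (mkt v) *: l 0 y).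
 by move=> a v w; rewrite (xi_lin F) scalerDl scalerA.
pose X (i : 'I_r) (p : tot (homb E L)) := la 0 (mkt (happ (projT2 p) (e i (projT1 p)))).
have [|||//||||U' [e' [U'x F' _]]] := @lin_frame M (homb E L) r x U s X; last by exists U', e', X.
- exact: homb_proj.
- move=> k [[h gh ->]|[d [zeta [sd fz ->]]]]; [left|right].
  by exists h => //; exact: smooth_gen.
 have lz := fz.2; split=> [y a v w /=|i y [U1y U2y]]; first exact: lz.
 apply: (@smooth_at_eq _ _ _ (fun z => xi i (mkt (d z)) * zeta (mkt (l 0 z)))).
  by apply: filterE => z /=; rewrite tohomE // fib_linZ.
 apply: smooth_atW; apply: smoothM; first exact: (sd _ (xi_smooth F i)).
 have s2 : smooth_sec (l 0) := frame_smooth F2 0; exact: (s2 _ fz.1).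
- by move=> y [U1y U2y]; apply: filterS2 (frame_open F U1y) (frame_open F2 U2y).
- move=> i; split; last by move=> y a v w; rewrite /X /= happ_comb fib_linD ?fib_linZ //; exact: xi_lin F2 0 y.
 apply: smooth_gen; right; exists (e i), (la 0); split=> //.
  exact: frame_smooth F i.
 by split; [exact: xi_smooth F2 0|exact: xi_lin F2 0].
- move=> y [U1y U2y] i j; rewrite /X /= tohomE // fib_linZ; last exact: xi_lin F2 0 y.
 by rewrite (frame_xi_e F) // (frame_xi_e F2) // mulr1 eq_sym.
- move=> y [U1y U2y] v; apply: hom_ext => w.
 have sE (c : 'I_r -> R) : happ (\sum_i c i *: s i y) w = \sum_i c i *: happ (s i y) w.
  by elim/big_ind2 : _ => // a1 b1 a2 b2 <- <-.
 rewrite sE {1}(frame_exp F w U1y) happ_sum; apply: eq_bigr => i _.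
 rewrite /s tohomE // scalerA mulrC -scalerA; congr (_ *: _).
 by rewrite {1}(frame_exp F2 (happ v (e i y)) U2y) big_ord1.
Qed.

Lemma sumb_smooth M (E F : bundle M) N (f : N -> M) (l : forall y, E (f y)) (m : forall y, F (f y)) :
 smooth_lift l -> smooth_lift m -> @smooth_map R N (tot (sumb E F)) (fun y => @mkt _ _ (sumb E F) (f y) (l y, m y)).
move=> sl sm; apply: smap_gen => q [[h gh ->]|[h gh ->]].
 exact: (sl _ (smooth_gen gh)).
exact: (sm _ (smooth_gen gh)).
Qed.

Lemma sumb_fst M (E F : bundle M) : @smooth_map R (tot (sumb E F)) (tot E) (fun p => mkt (projT2 p).1).
by apply: smap_gen => h gh; apply: smooth_gen; left; exists h. Qed.
Lemma sumb_snd M (E F : bundle M) : @smooth_map R (tot (sumb E F)) (tot F) (fun p => mkt (projT2 p).2).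
by apply: smap_gen => h gh; apply: smooth_gen; right; exists h. Qed.

Lemma sumb1 (U W : lmodType R) (I : Type) (r : seq I) (F : I -> (U * W)%type) :
 (\sum_(i <- r) F i).1 = \sum_(i <- r) (F i).1.
by elim: r => [|i r IH]; rewrite ?big_nil // !big_cons -IH. Qed.
Lemma sumb2 (U W : lmodType R) (I : Type) (r : seq I) (F : I -> (U * W)%type) :
 (\sum_(i <- r) F i).2 = \sum_(i <- r) (F i).2.
by elim: r => [|i r IH]; rewrite ?big_nil // !big_cons -IH. Qed.
Lemma pair_eq (A B : Type) (p q : A * B) : p.1 = q.1 -> p.2 = q.2 -> p = q.
by case: p q => [a b] [c d] /= -> ->. Qed.

Lemma sumb_ok M (E F : bundle M) r1 r2 : bundle_ok E r1 -> bundle_ok F r2 -> bundle_ok (sumb E F) (r1 + r2).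
move=> oE oF; split.
 exact: (smap_comp (@sumb_fst _ E F) (ok_proj oE)).
move=> x; have [U1 [e [xi [U1x F1]]]] := ok_frame oE x.
have [U2 [l [la [U2x F2]]]] := ok_frame oF x.
pose U y := U1 y /\ U2 y.
pose s (i : 'I_(r1 + r2)) : sec (sumb E F) := fun y =>
 match fintype.split i with inl j => (e j y, 0) | inr j => (0, l j y) end.
have sl (j : 'I_r1) : fintype.split (lshift r2 j) = inl j := fintype.unsplitK (inl j).
have sr (j : 'I_r2) : fintype.split (rshift r1 j) = inr j := fintype.unsplitK (inr j).
pose X (i : 'I_(r1 + r2)) (p : tot (sumb E F)) :=
 match fintype.split i with inl j => xi j (mkt (projT2 p).1) | inr j => la j (mkt (projT2 p).2) end.
have sumE (y : M) (c : 'I_(r1 + r2) -> R) : \sum_i c i *: s i y =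
  (\sum_j c (lshift r2 j) *: e j y, \sum_j c (rshift r1 j) *: l j y).
 apply: pair_eq; rewrite ?sumb1 ?sumb2 big_split_ord /=.
  rewrite [X in _ + X]big1 ?addr0; last first.
   by move=> i _; rewrite /s sr -[LHS]/(_ *: _) scaler0.
  by apply: eq_bigr => i _; rewrite /s sl.
 rewrite big1 ?add0r; last first.
  by move=> i _; rewrite /s sl -[LHS]/(_ *: _) scaler0.
 by apply: eq_bigr => i _; rewrite /s sr.
exists U, s, X; split=> //; split.
- split; first by move=> y [U1y U2y]; apply: filterS2 (frame_open F1 U1y) (frame_open F2 U2y).
 move=> i; rewrite /s; case: (fintype.split i) => j.
  apply: (@sumb_smooth M E F M (fun y => y) (e j) (fun y => 0)); first exact: (frame_smooth F1 j).
  exact: (smooth_sec0 oF).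
 apply: (@sumb_smooth M E F M (fun y => y) (fun y => 0) (l j)); last exact: (frame_smooth F2 j).
 exact: (smooth_sec0 oE).
- move=> i; rewrite /X; case: (fintype.split i) => j; split.
 + exact: (@sumb_fst _ E F _ (xi_smooth F1 j)).
 + by move=> y a v w; exact: (xi_lin F1).
 + exact: (@sumb_snd _ E F _ (xi_smooth F2 j)).
 + by move=> y a v w; exact: (xi_lin F2).
- move=> y [U1y U2y] i j; rewrite -(fintype.splitK i) -(fintype.splitK j) /X /s.
 case: (fintype.split i) => i'; case: (fintype.split j) => j'; rewrite !fintype.unsplitK /=.
 + by rewrite (frame_xi_e F1) // (inj_eq (@lshift_inj _ _)).
 + rewrite fib_lin0; last exact: xi_lin F1 i' y.
  by rewrite eq_lrshift.
 + rewrite fib_lin0; last exact: xi_lin F2 i' y.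
  by rewrite eq_rlshift.
 + by rewrite (frame_xi_e F2) // (inj_eq (@rshift_inj _ _)).
- move=> y [U1y U2y] [v w]; rewrite sumE; congr (_, _).
  rewrite {1}(frame_exp F1 v U1y); apply: eq_bigr => j _.
  by rewrite /X sl.
 rewrite {1}(frame_exp F2 w U2y); apply: eq_bigr => j _.
 by rewrite /X sr.
- move=> p [U1y U2y] q; have s1 := @smooth_fst R M (euclid R (r1 + r2)).
 have sc (i : 'I_(r1 + r2)) : smooth_at p (fun z : prodd M (euclid R (r1 + r2)) => (z.2 : 'rV[R]_(r1 + r2)) 0 i).
  exact/smooth_atW/smooth_coord2.
 case=> [[h gh ->]|[h gh ->]].
  apply: smooth_at_eq (smooth_theta F1 s1 (fun i => sc (lshift r2 i)) U1y gh).
  by apply: filterE => z /=; rewrite /theta sumE.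
 apply: smooth_at_eq (smooth_theta F2 s1 (fun i => sc (rshift r1 i)) U2y gh).
 by apply: filterE => z /=; rewrite /theta sumE.
Qed.

(** X is expanded in a local frame, so that by linearity of phi only its values on pulled back
    global sections matter. *)
Lemma smooth_lin_along M N (E L : bundle M) r p (f : N -> M) (phi : forall y, E (f y) -> L (f y)) (X : forall y, E (f y)) :
 bundle_ok E r -> bundle_ok L p -> smooth_map f -> (forall y, linear (phi y)) ->
 (forall e : sec E, smooth_sec e -> smooth_map (fun y => mkt (phi y (e (f y))))) ->
 smooth_lift X -> smooth_map (fun y => mkt (phi y (X y))).
move=> oE oL sf lp H sX; apply: (smooth_along oL sf) => x U e xi Ux F i.
have [U1 [e1 [xi1 [U1x F1]]]] := ok_frame oE (f x).
apply: (@smooth_at_eq _ _ _ (fun y => xi i (mkt (\sum_j xi1 j (mkt (X y)) *: phi y (e1 j (f y)))))).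
 apply: filterS (smooth_near sf (frame_open F1 U1x)) => y U1y.
 rewrite {1}(frame_exp F1 (X y) U1y) (lin_sum (lp y)); congr (xi i (mkt _)).
 by apply: eq_bigr => j _; exact: (linZ (lp y)).
apply: smooth_atW; apply: (smooth_along_sum oL sf _ _ (xi_smooth F i)) => j.
by apply: (smooth_alongM oL sf); [exact: (sX _ (xi_smooth F1 j))|exact: (H _ (frame_smooth F1 j))].
Qed.

End Bundles.

(** * The Atiyah algebroid *)

Section AtiyahFacts.
Variable R : realType.
Implicit Types M N P : dspace R.

Definition lframe M (L : bundle M) (U : set M) (e : sec L) (xi : tot L -> R) :=
 [/\ openM U, smooth_sec e, fib_linear xi, forall y, U y -> xi (mkt (e y)) = 1 &
   forall y, U y -> forall v : L y, v = xi (mkt v) *: e y].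

Lemma ok_lframe M (L : bundle M) x : bundle_ok L 1 -> exists U e xi, U x /\ @lframe M L U e xi.
move=> oL; have [U [e [xi [Ux F]]]] := ok_frame oL x.
exists U, (e 0), (xi 0); split=> //; split.
- exact: frame_open F.
- exact: frame_smooth F 0.
- by split; [exact: xi_smooth F 0|exact: xi_lin F 0].
- by move=> y Uy; rewrite (frame_xi_e F).
- by move=> y Uy v; rewrite {1}(frame_exp F v Uy) big_ord1.
Qed.

(* A line is separated by its linear functionals: identities in a fiber become
  identities between reals. *)
Lemma line_ext M (L : bundle M) x (v w : L x) : bundle_ok L 1 ->
 (forall k : L x -> R, linear (k : L x -> R^o) -> k v = k w) -> v = w.
move=> oL H; have [U [e [xi [Ux [_ _ [_ lx] _ ex]]]]] := ok_lframe x oL.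
by rewrite (ex x Ux v) (ex x Ux w) (H (fun v => xi (mkt v))).
Qed.

Section LinFun.
Variables (W : lmodType R) (k : W -> R).
Hypothesis l : linear (k : W -> R^o).
Lemma lfunD u v : k (u + v) = k u + k v. exact: (linD l). Qed.
Lemma lfun0 : k 0 = 0. exact: (lin0 l). Qed.
Lemma lfunZ a u : k (a *: u) = a * k u. exact: (linZ l). Qed.
Lemma lfunN u : k (- u) = - k u. exact: (linN l). Qed.
Lemma lfun_sum (I : Type) (r : seq I) (w : I -> W) : k (\sum_(i <- r) w i) = \sum_(i <- r) k (w i).
exact: (lin_sum l). Qed.
End LinFun.

End AtiyahFacts.

Ltac line_ring oL := apply: (line_ext oL) => ? ?;
 match goal with H : linear _ |- _ => rewrite !(lfunD H, lfunN H, lfunZ H, lfun0 H); ring end.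

Section OneBundle.
Variables (R : realType) (M : dspace R) (L : bundle M).
Implicit Types N P : dspace R.
Hypothesis oL : bundle_ok L 1.

Lemma line_nz x : exists2 e : sec L, smooth_sec e & e x != 0.
have [U [e [xi [Ux [_ se [_ lx] xe _]]]]] := ok_lframe x oL; exists e => //.
apply/eqP => e0; have := xe x Ux; rewrite e0 (fib_lin0 (lx x)) => /eqP.
by rewrite eq_sym oner_eq0.
Qed.

Lemma line_scale x (v : L x) a b : v != 0 -> a *: v = b *: v -> a = b.
move=> v0 /eqP; rewrite -subr_eq0 -scalerBl scaler_eq0 (negbTE v0) orbF subr_eq0.
by move/eqP.
Qed.

Lemma dappP x (d : atiyah L x) : is_atiyah (dapp d).
exact: (@subvalP _ _ (Submodule (atiyah_closed L x)) d). Qed.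

Lemma atiyah_ext x (d d' : atiyah L x) : (forall l, smooth_sec l -> dapp d l = dapp d' l) -> d = d'.
move=> H; apply: (@subval_inj _ _ (Submodule (atiyah_closed L x))).
apply/funext => l; have [sl|nl] := pselect (smooth_sec l); first exact: H.
have [h1 _ _] := dappP d; have [h2 _ _] := dappP d'.
by rewrite -[LHS]/(dapp d l) -[RHS]/(dapp d' l) h1 // h2.
Qed.

Lemma mk_atiyah x (w : sec L -> L x) (v : tangent x) :
 (forall a l m, smooth_sec l -> smooth_sec m -> w (fun y => a *: l y + m y) = a *: w l + w m) ->
 (forall f l, smooth_fun f -> smooth_sec l -> w (fun y => f y *: l y) = tapp v f *: l x + f x *: w l) ->
 exists d : atiyah L x, forall l, smooth_sec l -> dapp d l = w l.
move=> lw Lw; pose w' (l : sec L) := if pselect (smooth_sec l) then w l else 0.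
have w'E l : smooth_sec l -> w' l = w l by rewrite /w'; case: pselect.
have H : is_atiyah w'.
 split=> [l nl|a l m sl sm|]; first by rewrite /w'; case: pselect.
  rewrite !w'E //; first exact: lw.
  by apply: (smooth_secD oL) => //; exact: (smooth_secZ oL).
 by exists v => f l sf sl; rewrite !w'E //; [exact: Lw|exact: (smooth_secM oL)].
have [d dE] := @mksub _ _ (Submodule (atiyah_closed L x)) w' H.
by exists d => l sl; rewrite -w'E // -dE.
Qed.

Lemma dapp_lin x (d : atiyah L x) a l m : smooth_sec l -> smooth_sec m ->
 dapp d (fun y => a *: l y + m y) = a *: dapp d l + dapp d m.
by have [_ H _] := dappP d; exact: H. Qed.
Lemma dappD x (d : atiyah L x) l m : smooth_sec l -> smooth_sec m ->
 dapp d (fun y => l y + m y) = dapp d l + dapp d m.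
move=> sl sm; have := dapp_lin d 1 sl sm; rewrite scale1r => <-; congr dapp.
by apply/dfunext => y; rewrite scale1r.
Qed.
Lemma dapp0 x (d : atiyah L x) : dapp d (fun y => 0) = 0.
have s0 := smooth_sec0 oL; have := dapp_lin d (-1) s0 s0; rewrite scaleN1r addNr => <-.
by congr dapp; apply/dfunext => y; rewrite scaleN1r addNr.
Qed.
Lemma dappZ x (d : atiyah L x) a l : smooth_sec l -> dapp d (fun y => a *: l y) = a *: dapp d l.
move=> sl; have := dapp_lin d a sl (smooth_sec0 oL); rewrite dapp0 addr0 => <-; congr dapp.
by apply/dfunext => y; rewrite addr0.
Qed.
Lemma dappN x (d : atiyah L x) l : smooth_sec l -> dapp d (fun y => - l y) = - dapp d l.
move=> sl; rewrite -scaleN1r -dappZ //; congr dapp.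
by apply/dfunext => y; rewrite scaleN1r.
Qed.
Lemma smooth_secN (l : sec L) : smooth_sec l -> smooth_sec (fun y => - l y).
move=> sl; have := smooth_secZ oL (-1) sl; congr smooth_sec.
by apply/dfunext => y; rewrite scaleN1r.
Qed.
Lemma dappB x (d : atiyah L x) l m : smooth_sec l -> smooth_sec m ->
 dapp d (fun y => l y - m y) = dapp d l - dapp d m.
by move=> sl sm; rewrite dappD // ?dappN //; exact: smooth_secN. Qed.
Lemma dapp_sum x (d : atiyah L x) (I : Type) (r : seq I) (F : I -> sec L) : (forall i, smooth_sec (F i)) ->
 dapp d (fun y => \sum_(i <- r) F i y) = \sum_(i <- r) dapp d (F i).
move=> sF; elim: r => [|i r IH].
 by rewrite big_nil -(dapp0 d); congr dapp; apply/dfunext => y; rewrite big_nil.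
rewrite big_cons -IH -dappD //; last exact: (smooth_secS oL).
by congr dapp; apply/dfunext => y; rewrite big_cons.
Qed.

Lemma symbol_uniq x (d : atiyah L x) v w : is_symbol d v -> is_symbol d w -> v = w.
move=> sv sw; apply: tangent_ext => f sf; have [e se e0] := line_nz x.
by have := sv f e sf se; rewrite (sw f e sf se) => /addIr /(line_scale e0).
Qed.
Lemma symbolP x (d : atiyah L x) : is_symbol d (symbol d).
by rewrite /symbol; apply: theP; have [_ _ [v Hv]] := dappP d; exists v.
Qed.
Lemma symbol_eq x (d : atiyah L x) v : is_symbol d v -> symbol d = v.
by move=> H; apply: symbol_uniq H; exact: symbolP. Qed.

Lemma dappM x (d : atiyah L x) f l : smooth_fun f -> smooth_sec l ->
 dapp d (fun y => f y *: l y) = tapp (symbol d) f *: l x + f x *: dapp d l.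
by move=> sf sl; rewrite (symbolP d). Qed.

Lemma dapp_local x (d : atiyah L x) l m : smooth_sec l -> smooth_sec m ->
 (\forall y \near (x : dtop M), l y = m y) -> dapp d l = dapp d m.
move=> sl sm E; have [chi [schi _ chi1 chi0]] := bump E.
have snm := smooth_secN sm.
have sd := smooth_secD oL sl snm.
have := dappM d schi sd; rewrite (near_self E) subrr scaler0 add0r (near_self chi1) scale1r.
rewrite dappB // (_ : (fun y => chi y *: (l y - m y)) = fun y => 0) ?dapp0.
 by move/eqP; rewrite eq_sym subr_eq0 => /eqP.
apply/dfunext => y; have [nE|nE] := pselect (\forall z \near (y : dtop M), l z = m z).
 by rewrite (near_self nE) subrr scaler0.
by rewrite (near_self (chi0 y nE)) scale0r.
Qed.

Lemma symbol_lin x : linear (fun d : atiyah L x => symbol d).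
move=> a d d'; apply: symbol_eq => f l sf sl.
have E k : dapp (a *: d + d') k = a *: dapp d k + dapp d' k by [].
rewrite !E (dappM d) // (dappM d') //.
have -> : tapp (a *: symbol d + symbol d') f = a * tapp (symbol d) f + tapp (symbol d') f by [].
by line_ring oL.
Qed.

Section InFrame.
Variables (U : set M) (e : sec L) (xi : tot L -> R).
Hypothesis F : lframe U e xi.

Lemma lframe_sec (l : sec L) : smooth_sec l -> smooth_fun (fun y => xi (mkt (l y))).
by move=> sl; case: F => _ _ [sxi _] _ _; exact: sl. Qed.
Lemma lframe_lin y : linear (fun v : L y => xi (mkt v) : R^o).
by case: F => _ _ [_ H] _ _; exact: H. Qed.
Lemma lframe_smooth : smooth_sec e. by case: F. Qed.
Lemma lframe_open : openM U. by case: F. Qed.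
Lemma lframe_e y : U y -> xi (mkt (e y)) = 1. by case: F => _ _ _ H _; exact: H. Qed.
Lemma lframe_exp y (v : L y) : U y -> v = xi (mkt v) *: e y.
by case: F => _ _ _ _ H Uy; exact: H. Qed.
Lemma lframe_eq y (v w : L y) : U y -> xi (mkt v) = xi (mkt w) -> v = w.
by move=> Uy H; rewrite (lframe_exp v Uy) (lframe_exp w Uy) H. Qed.

Lemma dapp_frame y (d : atiyah L y) l : U y -> smooth_sec l ->
 dapp d l = tapp (symbol d) (fun z => xi (mkt (l z))) *: e y + xi (mkt (l y)) *: dapp d e.
move=> Uy sl; have sx := lframe_sec sl; have se := lframe_smooth.
rewrite -dappM //; apply: dapp_local => //; first exact: (smooth_secM oL).
by apply: filterS (lframe_open Uy) => z Uz; exact: lframe_exp.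
Qed.

Lemma atiyah_eq y (d d' : atiyah L y) : U y -> symbol d = symbol d' -> dapp d e = dapp d' e -> d = d'.
by move=> Uy Es Ee; apply: atiyah_ext => l sl; rewrite (dapp_frame d) // (dapp_frame d') // Es Ee.
Qed.

(** A local generator e splits the symbol sequence: l |-> v(xi(l)) e + xi(l) c is the derivation
    with symbol v and value c on e. *)
Lemma atiyah_make y (v : tangent y) (c : L y) : U y -> exists2 d : atiyah L y, symbol d = v & dapp d e = c.
move=> Uy; pose w (l : sec L) := tapp v (fun z => xi (mkt (l z))) *: e y + xi (mkt (l y)) *: c.
have se := lframe_smooth.
have wL f l : smooth_fun f -> smooth_sec l -> w (fun z => f z *: l z) = tapp v f *: l y + f y *: w l.
 move=> sf sl; rewrite /w.
 have -> : (fun z => xi (mkt (f z *: l z))) = fun z => f z * xi (mkt (l z)).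
  by apply/funext => z; rewrite fib_linZ //; exact: lframe_lin.
 rewrite tappM //; last exact: lframe_sec.
 rewrite fib_linZ; last exact: lframe_lin.
 rewrite {3}(lframe_exp (l y) Uy); by line_ring oL.
have [d dE] : exists d : atiyah L y, forall l, smooth_sec l -> dapp d l = w l.
 apply: (mk_atiyah (v := v)) => // a l m sl sm; rewrite /w.
 have -> : (fun z => xi (mkt (a *: l z + m z))) = fun z => a * xi (mkt (l z)) + xi (mkt (m z)).
  by apply/funext => z; rewrite fib_linD ?fib_linZ //; exact: lframe_lin.
 rewrite tapp_lin ?fib_linD ?fib_linZ //; try exact: lframe_sec; try exact: lframe_lin.
 by line_ring oL.
exists d.
 by apply: symbol_eq => f l sf sl; rewrite !dE //; [exact: wL|exact: (smooth_secM oL)].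
rewrite dE // /w.
rewrite lframe_e // scale1r -[RHS]add0r; congr (_ + _).
rewrite (_ : tapp v _ = 0) ?scale0r // -(tapp_cst v 1); apply: tapp_local.
- exact: lframe_sec.
- exact: smooth_cst.
- by apply: filterS (lframe_open Uy) => z Uz; exact: lframe_e.
Qed.

End InFrame.

(** The identity derivation l |-> l(x), which spans the kernel of the symbol. *)
Definition done (x : M) : atiyah L x := the 0 (fun d : atiyah L x => forall l, smooth_sec l -> dapp d l = l x).
Lemma doneE x l : smooth_sec l -> dapp (done x) l = l x.
move: l; apply: (@theP _ 0 (fun d : atiyah L x => forall l, smooth_sec l -> dapp d l = l x)).
apply: (mk_atiyah (v := 0)) => // f l _ _.
by rewrite (_ : tapp (0 : tangent x) f = 0) // scale0r add0r.
Qed.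
Lemma symbol_done x : symbol (done x) = 0.
apply: symbol_eq => f l sf sl; rewrite !doneE //; last exact: (smooth_secM oL).
by rewrite (_ : tapp (0 : tangent x) f = 0) // scale0r add0r.
Qed.

Lemma symbol0_done x (d : atiyah L x) : symbol d = 0 -> exists r, d = r *: done x.
move=> d0; have [U [e [xi [Ux F]]]] := ok_lframe x oL; exists (xi (mkt (dapp d e))).
apply: (atiyah_eq F Ux).
 by rewrite d0 (linZ (@symbol_lin x)) symbol_done scaler0.
have -> : dapp (xi (mkt (dapp d e)) *: done x) e = xi (mkt (dapp d e)) *: dapp (done x) e by [].
by rewrite doneE; [exact: (lframe_exp F)|exact: (lframe_smooth F)].
Qed.

Lemma atiyahb_proj : smooth_map (fun p : tot (atiyahb L) => projT1 p).
by apply: base_proj => h gh; left; exists h. Qed.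

Lemma smooth_atiyahP N (f : N -> M) (X : forall y, atiyahb L (f y)) : smooth_map f ->
 (forall l xi, smooth_sec l -> @fib_linear _ _ L xi -> smooth_fun (fun y => xi (mkt (dapp (X y) l)))) ->
 smooth_lift X.
move=> sf H; apply: smap_gen => q [[h gh ->]|[l [xi [sl fxi ->]]]]; last exact: H.
exact: (sf _ (smooth_gen gh)).
Qed.

Lemma dapp_smooth (l : sec L) (xi : tot L -> R) : smooth_sec l -> fib_linear xi ->
 @fib_linear _ _ (atiyahb L) (fun p => xi (mkt (dapp (projT2 p) l))).
move=> sl fxi; split; first by apply: smooth_gen; right; exists l, xi.
by move=> y a d d'; exact: (fxi.2 y a).
Qed.

Lemma smooth_dapp (X : sec (atiyahb L)) (l : sec L) : smooth_sec X -> smooth_sec l ->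
 smooth_sec (fun y => dapp (X y) l).
move=> sX sl; apply: (smooth_sec_at oL) => x U e xi Ux F i; apply: smooth_atW.
apply: (sX (fun p => xi i (mkt (dapp (projT2 p) l)))).
have fx : fib_linear (xi i) by split; [exact: xi_smooth F i|exact: xi_lin F i].
exact: (dapp_smooth sl fx).1.
Qed.

Lemma smooth_secD_dapp (X : sec (atiyahb L)) :
 (forall l, smooth_sec l -> smooth_sec (fun y => dapp (X y) l)) -> smooth_sec X.
move=> H; apply: (smooth_atiyahP (@smap_id _ M)) => l xi sl [sxi _].
exact: (H l sl).
Qed.

(** Near a point the number is read off from d(f e) - f d(e), with e a local generator. *)
Lemma symbol_smooth (f : M -> R) : smooth_fun f -> @fib_linear _ _ (atiyahb L) (fun p => tapp (symbol (projT2 p)) f).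
move=> sf; split; last by move=> y a d d' /=; rewrite (symbol_lin a).
apply: smooth_atP => p; have [U [e [xi [Ux F]]]] := ok_lframe (projT1 p) oL.
have se := lframe_smooth F; have [_ _ fxi _ _] := F.
have s1 := (dapp_smooth (smooth_secM oL sf se) fxi).1.
have s2 := (dapp_smooth se fxi).1.
have sp := atiyahb_proj.
apply: (@smooth_at_eq _ _ _ (fun p : tot (atiyahb L) => xi (mkt (dapp (projT2 p) (fun y => f y *: e y))) -
  f (projT1 p) * xi (mkt (dapp (projT2 p) e)))).
 apply: filterS (smooth_near sp (lframe_open F Ux)) => -[y d] /= Uy.
 rewrite dappM // fib_linD ?fib_linZ ?lframe_e //; try exact: (lframe_lin F).
 by rewrite (lframe_e F Uy); ring.
by apply: smooth_atW; apply: smoothB => //; apply: smoothM => //; exact: sp.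
Qed.

Lemma smooth_symbol N (f : N -> M) (X : forall y, atiyahb L (f y)) : smooth_map f ->
 smooth_lift X -> smooth_map (fun y => @mkt _ _ (tanb M) (f y) (symbol (X y))).
move=> sf sX; apply: smap_gen => q [[h gh ->]|[k sk ->]].
 exact: (sf _ (smooth_gen gh)).
exact: (sX _ (symbol_smooth sk).1).
Qed.

Lemma smooth_done : smooth_sec (done : sec (atiyahb L)).
apply: smooth_secD_dapp => l sl; have := sl; congr smooth_sec.
by apply/dfunext => y; rewrite doneE.
Qed.

Lemma sec_symbol (X : sec (atiyahb L)) : smooth_sec X -> @smooth_sec _ _ (tanb M) (fun y => symbol (X y)).
exact: (smooth_symbol (@smap_id _ M)). Qed.
Lemma app_symbol (X : sec (atiyahb L)) f : smooth_sec X -> smooth_fun f ->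
 smooth_fun (fun y => tapp (symbol (X y)) f).
by move=> sX sf; exact: (sX _ (symbol_smooth sf).1). Qed.

Lemma tbracketE (X Y : sec (tanb M)) x f : smooth_sec X -> smooth_sec Y -> smooth_fun f -> tapp (tbracket X Y x) f =
 tapp (X x) (fun y => tapp (Y y) f) - tapp (Y x) (fun y => tapp (X y) f).
move=> sX sY; move: f.
have sA (Z : sec (tanb M)) f : smooth_sec Z -> smooth_fun f -> smooth_fun (fun y => tapp (Z y) f).
 by move=> sZ sf; exact: (sZ _ (tanb_lin sf).1).
apply: (@theP _ 0 (fun v : tangent x => forall f, smooth_fun f -> tapp v f =
 tapp (X x) (fun y => tapp (Y y) f) - tapp (Y x) (fun y => tapp (X y) f))).
apply: mk_tangent => [a f g sf sg|f g sf sg].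
 have E (Z : sec (tanb M)) : (fun y => tapp (Z y) (fun z => a * f z + g z)) =
   fun y => a * tapp (Z y) f + tapp (Z y) g.
  by apply/funext => y; exact: tapp_lin.
 rewrite !E !tapp_lin; try exact: sA.
 by ring.
have E (Z : sec (tanb M)) : (fun y => tapp (Z y) (fun z => f z * g z)) =
  fun y => tapp (Z y) f * g y + f y * tapp (Z y) g.
 by apply/funext => y; exact: tappM.
rewrite !E !tappD ?tappM; try solve [by []|exact: sA|apply: smoothM => //; exact: sA].
by ring.
Qed.

Lemma dapp_dappM (X Y : sec (atiyahb L)) x f l : smooth_sec X -> smooth_sec Y -> smooth_fun f -> smooth_sec l ->
 dapp (X x) (fun y => dapp (Y y) (fun z => f z *: l z)) =
 tapp (symbol (X x)) (fun y => tapp (symbol (Y y)) f) *: l x + tapp (symbol (Y x)) f *: dapp (X x) l +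
 (tapp (symbol (X x)) f *: dapp (Y x) l + f x *: dapp (X x) (fun y => dapp (Y y) l)).
move=> sX sY sf sl; have sg := app_symbol sY sf; have sd := smooth_dapp sY sl.
rewrite -!dappM // -dappD; try exact: (smooth_secM oL).
by congr dapp; apply/dfunext => y; exact: dappM.
Qed.

Lemma dbracket_ex (X Y : sec (atiyahb L)) x : smooth_sec X -> smooth_sec Y ->
 exists d : atiyah L x, forall l, smooth_sec l ->
  dapp d l = dapp (X x) (fun y => dapp (Y y) l) - dapp (Y x) (fun y => dapp (X y) l).
move=> sX sY; apply: (mk_atiyah (v := tbracket (fun y => symbol (X y)) (fun y => symbol (Y y)) x)).
 move=> a l m sl sm.
 have E (Z : sec (atiyahb L)) : (fun y => dapp (Z y) (fun z => a *: l z + m z)) =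
   fun y => a *: dapp (Z y) l + dapp (Z y) m.
  by apply/dfunext => y; exact: dapp_lin.
 rewrite !E !dapp_lin; try exact: smooth_dapp.
 by line_ring oL.
move=> f l sf sl; rewrite tbracketE //; try exact: sec_symbol.
by rewrite !dapp_dappM //; line_ring oL.
Qed.

Lemma dbracketE (X Y : sec (atiyahb L)) x l : smooth_sec X -> smooth_sec Y -> smooth_sec l ->
 dapp (dbracket X Y x) l = dapp (X x) (fun y => dapp (Y y) l) - dapp (Y x) (fun y => dapp (X y) l).
by move=> sX sY; move: l; exact: (theP 0 (dbracket_ex x sX sY)).
Qed.

Lemma symbol_dbracket (X Y : sec (atiyahb L)) x : smooth_sec X -> smooth_sec Y ->
 symbol (dbracket X Y x) = tbracket (fun y => symbol (X y)) (fun y => symbol (Y y)) x.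
move=> sX sY; apply: tangent_ext => f sf; rewrite tbracketE //; try exact: sec_symbol.
have [e se e0] := line_nz x; apply: (line_scale e0); apply: (addIr (f x *: dapp (dbracket X Y x) e)).
rewrite -(dappM (dbracket X Y x) sf se) !dbracketE //; last exact: (smooth_secM oL).
by rewrite !dapp_dappM //; line_ring oL.
Qed.

Definition coordinatized n := forall x : M, exists q psi U V, U x /\ @coords R M n q psi U V.

Definition commuting (X Y : sec (atiyahb L)) x := forall l, smooth_sec l ->
 dapp (X x) (fun z => dapp (Y z) l) = dapp (Y x) (fun z => dapp (X z) l).

(* Coordinates and a local generator e of L provide the commuting frame of DL
  consisting of the identity and of the derivations l |-> d_i(l / e) e. *)
Lemma atiyah_frame n x : coordinatized n -> exists U (e : 'I_n.+1 -> sec (atiyahb L)) xi, [/\ U x, frame U e xi &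
  forall y, U y -> forall i j, commuting (e i) (e j) y].
move=> HC; have [q [psi [U0 [V [U0x C]]]]] := HC x.
have [U1 [E [U1x FE]]] := coords_frame C U0x.
have [U2 [e [xi [U2x F]]]] := ok_lframe x oL.
have se := lframe_smooth F; have [_ _ fxi _ _] := F.
have sq i : smooth_fun (q i) by have [] := C.
pose U := [set y | [/\ U0 y, U1 y & U2 y]].
have oU : openM U.
 move=> y [U0y U1y U2y]; have := coords_open C U0y.
 by apply: filterS3 (frame_open FE U1y) (lframe_open F U2y) => z *; split.
pose s0 (i : 'I_n) : sec (atiyahb L) := fun y => the 0 (fun d => symbol d = E i y /\ dapp d e = 0).
have s0P i y : U y -> symbol (s0 i y) = E i y /\ dapp (s0 i y) e = 0.
 move=> [_ _ Uy]; have [d d1 d2] := atiyah_make F (E i y) 0 Uy.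
 by apply: (theP 0 (ex_intro (fun d => _ /\ _) d (conj d1 d2))).
pose s (i : 'I_n.+1) : sec (atiyahb L) := if fintype.unlift ord0 i is Some j then s0 j else done.
have sE j : s (lift ord0 j) = s0 j by rewrite /s liftK.
have s0E : s ord0 = done by rewrite /s unlift_none.
have s0l j y l : U y -> smooth_sec l -> dapp (s0 j y) l = tapp (E j y) (fun z => xi (mkt (l z))) *: e y.
 move=> Uy sl; have [_ _ U2y] := Uy; rewrite (dapp_frame F) //.
 by have [-> ->] := s0P j y Uy; rewrite scaler0 addr0.
pose X (i : 'I_n.+1) (p : tot (atiyahb L)) : R :=
 if fintype.unlift ord0 i is Some j then tapp (symbol (projT2 p)) (q j) else xi (mkt (dapp (projT2 p) e)).
have XE j p : X (lift ord0 j) p = tapp (symbol (projT2 p)) (q j) by rewrite /X liftK.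
have X0E p : X ord0 p = xi (mkt (dapp (projT2 p) e)) by rewrite /X unlift_none.
have SE j l : smooth_sec l -> smooth_fun (fun z => tapp (E j z) (fun z => xi (mkt (l z)))).
 move=> sl; have := (tanb_lin (lframe_sec F sl)).1; exact: (frame_smooth FE j).
have [|||||||W [f [Wx FF fE]]] := @lin_frame R M (atiyahb L) n.+1 x U s X.
- exact: atiyahb_proj.
- move=> k [[h gh ->]|[l [zeta [sl fz ->]]]]; [left|right].
  by exists h => //; exact: smooth_gen.
 split=> [y|i y Uy]; first exact: (dapp_smooth sl fz).2.
 case: (unliftP ord0 i) => [j ->|->]; last first.
  rewrite s0E; apply: smooth_atW; have := sl _ fz.1; congr smooth_fun.
  by apply/funext => z; rewrite /= doneE.
 rewrite sE; apply: (@smooth_at_eq _ _ _ (fun z => tapp (E j z) (fun z => xi (mkt (l z))) * zeta (mkt (e z)))).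
  apply: filterS (oU _ Uy) => z Uz /=; rewrite s0l // fib_linZ //; exact: fz.2.
 apply: smooth_atW; apply: smoothM; first exact: SE.
 exact: (se _ fz.1).
- exact: oU.
- by [].
- move=> i; case: (unliftP ord0 i) => [j ->|->].
  rewrite (_ : X _ = fun p => tapp (symbol (projT2 p)) (q j)); last by apply/funext => p; rewrite XE.
  exact: symbol_smooth.
 rewrite (_ : X _ = fun p => xi (mkt (dapp (projT2 p) e))); last by apply/funext => p; rewrite X0E.
 exact: dapp_smooth.
- move=> y Uy i j; have [_ U1y U2y] := Uy; case: (unliftP ord0 i) => [i' ->|->]; case: (unliftP ord0 j) => [j' ->|->].
 + rewrite XE sE /=; have [-> _] := s0P j' y Uy.
  by rewrite (frame_xi_e FE) // (inj_eq lift_inj).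
 + rewrite XE s0E /= symbol_done.
  by rewrite (_ : tapp (0 : tangent y) _ = 0) // eq_sym (negbTE (neq_lift _ _)).
 + rewrite X0E sE /=; have [_ ->] := s0P j' y Uy.
  exact: (fib_lin0 (@lframe_lin _ _ _ F y)).
 + by rewrite X0E s0E /= doneE // (lframe_e F) // eqxx.
- move=> y Uy d; have [_ U1y U2y] := Uy; apply: (atiyah_eq F U2y).
  rewrite (lin_sum (@symbol_lin y)) big_ord_recl s0E (linZ (@symbol_lin y)) symbol_done scaler0 add0r.
  rewrite [LHS](frame_exp FE (symbol d) U1y); apply: eq_bigr => j _.
  by rewrite sE (linZ (@symbol_lin y)) XE; have [-> _] := s0P j y Uy.
 have lE : linear (fun d : atiyah L y => dapp d e) by [].
 rewrite (lin_sum lE) big_ord_recl s0E (linZ lE) doneE // big1 ?addr0.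
  by rewrite X0E; exact: (lframe_exp F).
 by move=> j _; rewrite sE (linZ lE); have [_ ->] := s0P j y Uy; rewrite scaler0.
have oW := frame_open FF.
exists W, f, X; split=> //.
have fs j (l : sec L) : smooth_sec l -> smooth_sec (fun z => dapp (f j z) l).
 by move=> sl; apply: smooth_dapp => //; exact: (frame_smooth FF j).
have c0 y j l : W y -> smooth_sec l -> dapp (f j y) (fun z => dapp (f ord0 z) l) = dapp (f j y) l.
 move=> Wy sl; apply: dapp_local => //; first exact: fs.
 by apply: filterS (oW _ Wy) => z /fE[_ ->]; rewrite s0E doneE.
have cj y i j l : W y -> smooth_sec l -> dapp (f (lift ord0 i) y) (fun z => dapp (f (lift ord0 j) z) l) =
  tapp (E i y) (fun z => tapp (E j z) (fun z => xi (mkt (l z)))) *: e y.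
 move=> Wy sl; have [Uy fy] := fE _ Wy; have sg := SE j l sl.
 rewrite (@dapp_local _ _ _ (fun z => tapp (E j z) (fun z => xi (mkt (l z))) *: e z)) //.
 - rewrite dappM // fy sE; have [-> ->] := s0P i y Uy.
  by rewrite scaler0 addr0.
 - exact: fs.
 - exact: (smooth_secM oL).
 - by apply: filterS (oW _ Wy) => z /fE[Uz ->]; rewrite sE s0l.
move=> y Wy i j l sl; have [[U0y U1y U2y] fy] := fE _ Wy.
case: (unliftP ord0 i) => [i' ->|->]; case: (unliftP ord0 j) => [j' ->|->] //.
- rewrite !cj //; congr (_ *: _).
 have sEc a : smooth_sec (E a) by exact: (frame_smooth FE a).
 have sxl := lframe_sec F sl.
 apply/eqP; rewrite -subr_eq0 -tbracketE //.
 suff -> : tbracket (E i') (E j') y = 0 by [].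
 apply: (tangent_coords_eq C U0y) => k; rewrite tbracketE //.
 have H a b : tapp (E a y) (fun z => tapp (E b z) (q k)) = 0.
  rewrite -(tapp_cst (E a y) (k == b)%:R).
  apply: tapp_local; [exact: (sEc b _ (tanb_lin (sq k)).1)|exact: smooth_cst|].
  by apply: filterS (frame_open FE U1y) => z U1z; rewrite (frame_xi_e FE).
 by rewrite !H subrr.
- by rewrite c0 // (fy ord0) s0E doneE //; exact: fs.
- by rewrite c0 // (fy ord0) s0E doneE //; exact: fs.
Qed.

Lemma atiyah_ok n : coordinatized n -> bundle_ok (atiyahb L) n.+1.
move=> HC; split; first exact: atiyahb_proj.
by move=> x; have [U [e [xi [Ux F _]]]] := atiyah_frame x HC; exists U, e, xi.
Qed.

(** Combinations of the commuting frame with constant coefficients. With such extensions all bracket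
    terms of the Koszul formula vanish, and computations with the differential reduce to iterated
    derivatives. *)
Lemma commuting_ext n x k (d : 'I_k -> atiyah L x) : coordinatized n ->
 exists X : 'I_k -> sec (atiyahb L), [/\ forall i, smooth_sec (X i), forall i, X i x = d i &
  \forall y \near (x : dtop M), forall i j, commuting (X i) (X j) y].
move=> HC; have [U [e [xi [Ux F ce]]]] := atiyah_frame x HC.
have se a := frame_smooth F a; pose c k a : R := xi a (@mkt _ _ (atiyahb L) x (d k)).
exists (fun i y => \sum_a c i a *: e a y); split.
- move=> i; apply: (smooth_secS (atiyah_ok HC)) => a; exact: (smooth_secZ (atiyah_ok HC)).
- by move=> i; rewrite -(frame_exp F).
apply: filterS (frame_open F Ux) => y Uy i j l sl.
have E k' z (m : sec L) : dapp (\sum_a c k' a *: e a z) m = \sum_a c k' a *: dapp (e a z) m.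
 have lE : linear (fun d : atiyah L z => dapp d m) by [].
 by rewrite (lin_sum lE); apply: eq_bigr => a _; rewrite (linZ lE).
have E2 k' : (fun z => dapp (\sum_a c k' a *: e a z) l) = fun z => \sum_a c k' a *: dapp (e a z) l.
 by apply/dfunext => z; exact: E.
rewrite !E !E2.
have sd a : smooth_sec (fun z => dapp (e a z) l) by exact: smooth_dapp.
have E3 k' (b : 'I_n.+1) : dapp (e b y) (fun z => \sum_a c k' a *: dapp (e a z) l) =
  \sum_a c k' a *: dapp (e b y) (fun z => dapp (e a z) l).
 rewrite dapp_sum; last by move=> a; exact: (smooth_secZ oL).
 by apply: eq_bigr => a _; rewrite dappZ.
under eq_bigr do rewrite E3 scaler_sumr.
under [RHS]eq_bigr do rewrite E3 scaler_sumr.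
rewrite exchange_big; apply: eq_bigr => a _; apply: eq_bigr => b _.
by rewrite !scalerA mulrC ce.
Qed.

Lemma comm_dbracket (X Y : sec (atiyahb L)) x : smooth_sec X -> smooth_sec Y -> commuting X Y x -> dbracket X Y x = 0.
move=> sX sY c; apply: atiyah_ext => l sl.
by rewrite dbracketE // c // subrr.
Qed.

End OneBundle.

Section LineMaps.
Variable R : realType.
Implicit Types M N P : dspace R.

Lemma dmap_comp M N P (f : M -> N) (g : N -> P) x (v : tangent x) :
 smooth_map f -> smooth_map g -> dmap g (dmap f v) = dmap (fun y => g (f y)) v.
move=> sf sg; have sc := smap_comp sf sg; apply: tangent_ext => h sh.
by rewrite !dmapE //; exact: sg.
Qed.
Lemma dmap_id M x (v : tangent (x : M)) : dmap (fun y => y) v = v.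
by apply: tangent_ext => h sh; rewrite dmapE //; exact: smap_id. Qed.

Lemma dmap_compE M N P (f : M -> N) (g : N -> P) (h : M -> P) x (v : tangent x) :
 smooth_map f -> smooth_map g -> (forall y, g (f y) = h y) -> tmkt (dmap g (dmap f v)) = tmkt (dmap h v).
by move=> sf sg /funext <-; rewrite dmap_comp. Qed.

(** A smooth fiberwise isomorphism of line bundles; in rank one injectivity says enough. *)
Definition line_map M N (f : M -> N) (L : bundle M) (L' : bundle N) (F : vbmap f L L') :=
 [/\ smooth_map f, smooth_map (totmap F), vblinear F & forall x v, F x v = 0 -> v = 0].

Section OneMap.
Variables (M N : dspace R) (f : M -> N) (L : bundle M) (L' : bundle N) (F : vbmap f L L').
Hypotheses (oL : bundle_ok L 1) (oL' : bundle_ok L' 1) (hF : line_map F).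

Lemma line_smooth : smooth_map f. by case: hF. Qed.
Lemma line_lin x : linear (F (x := x)). by case: hF. Qed.
Lemma line_inj x (v w : L x) : F v = F w -> v = w.
case: hF => _ _ l i E; apply/eqP; rewrite -subr_eq0; apply/eqP/i.
by rewrite (linB (l x)) E subrr.
Qed.
Lemma line_map_surj x (v' : L' (f x)) : exists v, F v = v'.
have [e se e0] := line_nz oL x; have [U [e' [xi [Ux F']]]] := ok_lframe (f x) oL'.
have l := line_lin (x := x); pose a := xi (mkt (F (e x))).
have a0 : a != 0.
 apply/eqP => a0; have := lframe_exp F' (F (e x)) Ux; rewrite -/a a0 scale0r.
 by rewrite -(lin0 l) => /line_inj e1; rewrite e1 eqxx in e0.
exists ((xi (mkt v') / a) *: e x); rewrite (linZ l).
by apply: (lframe_eq F' Ux); rewrite fib_linZ ?divfK //; exact: (lframe_lin F').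
Qed.
Lemma finvE x (v' : L' (f x)) : F (finv F v') = v'.
by apply: (@theP _ 0 (fun e => F e = v')); exact: line_map_surj. Qed.
Lemma finvK x (v : L x) : finv F (F v) = v.
by apply: line_inj; rewrite finvE. Qed.
Lemma finv_linear x : linear (fun v' : L' (f x) => finv F v').
by move=> a v w; apply: line_inj; rewrite (line_lin a) !finvE. Qed.

Lemma line_map_fib (xi : tot L' -> R) : fib_linear xi -> fib_linear (fun p => xi (totmap F p)).
case: hF => _ sF l _ [sxi lxi]; split; first exact: sF.
by move=> x a v w; rewrite /totmap /= (l x a) (lxi (f x) a).
Qed.

Lemma smooth_finv P (g : P -> M) (l : forall y, L' (f (g y))) : smooth_map g ->
 smooth_lift l -> smooth_map (fun y => mkt (finv F (l y))).
move=> sg sl; apply: (smooth_along oL sg) => x U0 e0 xi0 U0x F0 i.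
have [U [e [xi [Ux FL]]]] := ok_lframe (g x) oL.
have [U' [e' [xi' [Ux' FL']]]] := ok_lframe (f (g x)) oL'.
have [_ _ fxi' _ _] := FL'; have [sxF lxF] := line_map_fib fxi'.
have sa := lframe_smooth FL sxF.
have [sf sF lF iF] := hF.
have a0 y : U y -> U' (f y) -> xi' (mkt (F (e y))) != 0.
 move=> Uy U'y; apply/eqP => H; have E : F (e y) = 0.
  by rewrite (lframe_exp FL' (F (e y)) U'y) H scale0r.
 have := lframe_e FL Uy; rewrite (iF _ _ E) fib_lin0; last exact: (lframe_lin FL).
 by move/eqP; rewrite eq_sym oner_eq0.
have fi : fib_linear (xi0 i) by split; [exact: xi_smooth F0 i|exact: xi_lin F0 i].
apply: (@smooth_at_eq _ _ _ (fun y => xi' (mkt (l y)) * (xi' (mkt (F (e (g y)))))^-1 * xi0 i (mkt (e (g y))))).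
 apply: filterS2 (smooth_near sg (lframe_open FL Ux)) (smooth_near (smap_comp sg sf) (lframe_open FL' Ux')) => y Uy U'y.
 rewrite -(fib_linZ _ _ (fi.2 (g y))); congr (xi0 i (mkt _)).
 apply: line_inj; rewrite finvE (linZ (lF (g y))); apply: (lframe_eq FL' U'y).
 by rewrite fib_linZ ?divfK //; [exact: a0|exact: (lframe_lin FL')].
have se' : smooth_fun (fun y => xi' (mkt (F (e (g y))))) by exact: (sg _ sa).
apply: smooth_atM; last by apply: smooth_atW; exact: (sg _ (lframe_smooth FL fi.1)).
apply: smooth_atM; first exact/smooth_atW/(sl _ fxi'.1).
by apply: smooth_at_inv; [exact: smooth_atW|exact: a0].
Qed.

Lemma smooth_pullsec (l : sec L') : smooth_sec l -> smooth_sec (pullsec F l).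
move=> sl; apply: (@smooth_finv M (fun x => x) (fun x => l (f x))); first exact: smap_id.
exact: (smap_comp line_smooth sl).
Qed.

Lemma pullsecM (g : N -> R) (l : sec L') : pullsec F (fun y => g y *: l y) = fun y => g (f y) *: pullsec F l y.
by apply/dfunext => y; rewrite /pullsec (linZ (@finv_linear y)). Qed.
Lemma pullsecD a (l m : sec L') : pullsec F (fun y => a *: l y + m y) = fun y => a *: pullsec F l y + pullsec F m y.
by apply/dfunext => y; rewrite /pullsec finv_linear. Qed.

Lemma DmapP x (d : atiyah L x) : forall l, smooth_sec l -> dapp (Dmap F d) l = F (dapp d (pullsec F l)).
have lF := line_lin (x := x); have sf := line_smooth.
apply: (@theP _ 0 (fun d' : atiyah L' (f x) => forall l, smooth_sec l -> dapp d' l = F (dapp d (pullsec F l)))).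
apply: (mk_atiyah oL' (v := dmap f (symbol d))) => [a l m sl sm|g l sg sl].
 by rewrite pullsecD dapp_lin ?lF //; exact: smooth_pullsec.
rewrite pullsecM dappM //; [|exact: sf|exact: smooth_pullsec].
by rewrite (linD lF) !(linZ lF) dmapE // /pullsec finvE.
Qed.

Lemma symbol_Dmap x (d : atiyah L x) : symbol (Dmap F d) = dmap f (symbol d).
have lF := line_lin (x := x); have sf := line_smooth.
apply: (symbol_eq oL') => g l sg sl; rewrite !DmapP //; last exact: (smooth_secM oL').
rewrite pullsecM dappM //; [|exact: sf|exact: smooth_pullsec].
by rewrite (linD lF) !(linZ lF) dmapE // /pullsec finvE.
Qed.

Lemma Dmap_lin x : linear (fun d : atiyah L x => Dmap F d).
move=> a d d'; apply: atiyah_ext => l sl.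
have E y (d1 d2 : atiyah L' y) : dapp (a *: d1 + d2) l = a *: dapp d1 l + dapp d2 l by [].
rewrite E !DmapP // -(line_lin a); congr (F _); by [].
Qed.

Lemma Dmap_done x : Dmap F (done L x) = done L' (f x).
apply: atiyah_ext => l sl; rewrite DmapP // !doneE //; first exact: finvE.
exact: smooth_pullsec.
Qed.

Lemma pullsec_frame x : exists U e' xi', [/\ U (f x), @lframe _ N L' U e' xi',
 smooth_sec (pullsec F e') & pullsec F e' x != 0].
have [U' [e' [xi' [Ux' FL']]]] := ok_lframe (f x) oL'.
exists U', e', xi'; split=> //; first exact/smooth_pullsec/(lframe_smooth FL').
apply/eqP => E; have := finvE (e' (f x)); rewrite -/(pullsec F e' x) E.
rewrite (lin0 (@line_lin x)) => H; have := lframe_e FL' Ux'; rewrite -H.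
by rewrite (fib_lin0 (@lframe_lin _ _ _ _ _ _ FL' (f x))) => /eqP; rewrite eq_sym oner_eq0.
Qed.

(** Together with [Dmap_lift], this says that D_xL is the fiber product of T_xM and of the Atiyah
    fiber of L' over the tangent space of N. A derivation with zero symbol is a multiple of the
    identity, and [Dmap] maps the identity to the identity. *)
Lemma Dmap_inj x (d d' : atiyah L x) : symbol d = symbol d' -> Dmap F d = Dmap F d' -> d = d'.
move=> Es ED; have Es0 : symbol (d - d') = 0.
 by rewrite (linB (@symbol_lin _ _ _ oL x)) Es subrr.
have [r Er] := symbol0_done oL Es0.
have := linB (@Dmap_lin x) d d'; rewrite ED subrr Er (linZ (@Dmap_lin x)) Dmap_done => H.
have [e se e0] := line_nz oL' (f x).
have : dapp (r *: done L' (f x)) e = 0 by rewrite H.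
have -> : dapp (r *: done L' (f x)) e = r *: dapp (done L' (f x)) e by [].
rewrite doneE // => /eqP; rewrite scaler_eq0 (negbTE e0) orbF => /eqP r0.
by apply/eqP; rewrite -subr_eq0 Er r0 scale0r.
Qed.

Lemma Dmap_lift x (v : tangent x) (d' : atiyah L' (f x)) : symbol d' = dmap f v ->
 exists2 d : atiyah L x, symbol d = v & Dmap F d = d'.
move=> Es; have [U [e [xi [Ux FL]]]] := ok_lframe x oL.
have [d1 s1 _] := atiyah_make oL FL v 0 Ux.
have H : symbol (d' - Dmap F d1) = 0.
 by rewrite (linB (@symbol_lin _ _ _ oL' _)) symbol_Dmap s1 Es subrr.
have [r Er] := symbol0_done oL' H.
exists (d1 + r *: done L x).
 rewrite (linD (@symbol_lin _ _ _ oL _)) (linZ (@symbol_lin _ _ _ oL _)).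
 by rewrite symbol_done // scaler0 addr0.
by rewrite (linD (@Dmap_lin x)) (linZ (@Dmap_lin x)) Dmap_done -Er addrC subrK.
Qed.

Lemma Dmap_smooth : smooth_map (totmap (Dmap F)).
apply: smap_gen => q [[h gh ->]|[l [xi [sl fxi ->]]]].
 exact: (@atiyahb_proj _ _ L _ (line_smooth (smooth_gen gh))).
have := (dapp_smooth (smooth_pullsec sl) (line_map_fib fxi)).1; congr smooth_fun.
by apply/funext => -[x d]; rewrite /= DmapP.
Qed.

End OneMap.

Lemma line_map_comp M N P (f : M -> N) (g : N -> P) (h : M -> P) (L : bundle M) (L' : bundle N)
  (L'' : bundle P) (F : vbmap f L L') (G : vbmap g L' L'') (H : vbmap h L L'') :
 (forall x (v : L x), mkt (G _ (F _ v)) = mkt (H _ v)) -> line_map F -> line_map G -> line_map H.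
move=> E [sf sF lF iF] [sg sG lG iG].
have Eh : h = fun x => g (f x) by apply/funext => x; have := congr1 (@projT1 _ _) (E x 0).
subst h; have EH : H = fun x v => G _ (F _ v).
 by apply/dfunext => x; apply/funext => v; rewrite -(mkt_inj (E x v)).
subst H; split.
- exact: smap_comp sf sg.
- exact: smap_comp sF sG.
- by move=> x a v w; rewrite lF lG.
- by move=> x v /iG /iF.
Qed.

(** The composite is an arbitrary H that agrees with G o F in the total space: in applications the
    composite base map and h are equal functions without being convertible. *)
Lemma Dmap_comp M N P (f : M -> N) (g : N -> P) (h : M -> P) (L : bundle M) (L' : bundle N)
  (L'' : bundle P) (F : vbmap f L L') (G : vbmap g L' L'') (H : vbmap h L L'') :
 bundle_ok L 1 -> bundle_ok L' 1 -> bundle_ok L'' 1 -> line_map F -> line_map G ->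
 (forall x (v : L x), mkt (G _ (F _ v)) = mkt (H _ v)) ->
 forall x (d : atiyah L x), @mkt _ _ (atiyahb L'') _ (Dmap G (Dmap F d)) = mkt (Dmap H d).
move=> oL oL' oL'' hF hG E; have hH := line_map_comp E hF hG.
have Eh : h = fun x => g (f x) by apply/funext => x; have := congr1 (@projT1 _ _) (E x 0).
subst h; have EH : H = fun x v => G _ (F _ v).
 by apply/dfunext => x; apply/funext => v; rewrite -(mkt_inj (E x v)).
subst H => x d; congr mkt; apply: atiyah_ext => l sl.
rewrite !DmapP //; last exact: smooth_pullsec.
congr (G _ (F _ (dapp d _))); apply/dfunext => y.
apply: (line_inj hH); rewrite (finvE oL oL'' hH) /pullsec.
by rewrite (finvE oL oL' hF) (finvE oL' oL'' hG).
Qed.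

Lemma line_map_id M (L : bundle M) : line_map (fun (x : M) (v : L x) => v).
split; [exact: smap_id| |by []|by []].
by have := @smap_id R (tot L); fext => -[].
Qed.

Lemma Dmap_id M (L : bundle M) x (d : atiyah L x) : bundle_ok L 1 -> Dmap (fun (x : M) (v : L x) => v) d = d.
move=> oL; have h := @line_map_id M L; apply: atiyah_ext => l sl; rewrite (DmapP oL oL h) //.
congr dapp; apply/dfunext => y.
by apply: (line_inj h); rewrite /pullsec (finvE oL oL h).
Qed.

End LineMaps.

Notation i1 := (lift ord0 ord0).
Notation i2 := (lift ord0 (lift ord0 ord0)).
Notation i3 := (lift ord0 (lift ord0 (lift ord0 ord0))).
Definition tri3 (T : Type) (a b c : T) : 'I_3 -> T := fun i => nth a [:: a; b; c] i.

(** * Forms and differentials *)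

Section Koszul.
Variable R : realType.
Implicit Types M N P : dspace R.

Lemma fun1E (T : Type) (v : 'I_1 -> T) : v = fun _ => v ord0.
by apply/funext => i; rewrite (ord1 i). Qed.
Lemma fun2E (T : Type) (v : 'I_2 -> T) : v = pair2 (v ord0) (v i1).
by apply/funext => i; case: (unliftP ord0 i) => [j ->|->] //; rewrite (ord1 j).
Qed.
Lemma ord3P (P : 'I_3 -> Prop) : P ord0 -> P i1 -> P i2 -> forall i, P i.
move=> p0 p1 p2 i; case: (unliftP ord0 i) => [j ->|-> //].
by case: (unliftP ord0 j) => [k ->|-> //]; rewrite (ord1 k).
Qed.
Lemma ord4P (P : 'I_4 -> Prop) : P ord0 -> P i1 -> P i2 -> P i3 -> forall i, P i.
by move=> p0 p1 p2 p3 i; case: (unliftP ord0 i) => [j ->|-> //]; move: j; exact: ord3P. Qed.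
Lemma fun3E (T : Type) (v : 'I_3 -> T) : v = tri3 (v ord0) (v i1) (v i2).
by apply/funext; exact: ord3P. Qed.

Lemma form_ext M (E L : bundle M) k (w w' : form E L k) : (forall x v, w x v = w' x v) -> w = w'.
by move=> H; apply/dfunext => x; apply/funext => v. Qed.

Section Expand.
Variables (M : dspace R) (E L : bundle M) (br : sec E -> sec E -> sec E) (act : forall x, E x -> atiyah L x).

Lemma big_ord_reclP (W : lmodType R) n (P : pred 'I_n.+1) (F : 'I_n.+1 -> W) : \sum_(i < n.+1 | P i) F i =
 (if P ord0 then F ord0 else 0) + \sum_(i < n | P (lift ord0 i)) F (lift ord0 i).
by rewrite big_mkcond big_ord_recl -big_mkcond. Qed.

Lemma other_ord k (i j : 'I_k) s : map val s = [seq c <- iota 0 k | (c != val i) && (c != val j)] ->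
 [seq c <- enum 'I_k | (c != i) && (c != j)] = s.
move=> H; apply: (inj_map val_inj); rewrite H -val_enum_ord [RHS]filter_map.
by apply: congr1; apply: eq_filter => c; rewrite /= -!val_eqE.
Qed.

Definition form2 (E' : bundle M) (w : form E' L 2) x a b := w x (pair2 a b).
Definition form3 (E' : bundle M) (w : form E' L 3) x a b c := w x (tri3 a b c).

Lemma koszul1E (w : form E L 1) (X : 'I_2 -> sec E) x : koszul br act w X x =
 dapp (act (X ord0 x)) (fun y => w y (fun _ => X i1 y))
 - dapp (act (X i1 x)) (fun y => w y (fun _ => X ord0 y))
 - w x (fun _ => br (X ord0) (X i1) x).
rewrite /koszul !(big_ord_reclP, big_ord0) /= ?addr0 ?add0r expr0 expr1 scale1r !scaleN1r.
have S1 (i : 'I_2) : (fun y => w y (fun j => X (lift i j) y)) = fun y => w y (fun _ => X (lift i ord0) y).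
 by apply/dfunext => y; exact: (congr1 (w y) (fun1E _)).
have e0 : lift (i1 : 'I_2) ord0 = ord0 by exact: val_inj.
have S2 s b : w x (fun a : 'I_1 => nth 0 (b :: s) a) = w x (fun _ => b) := congr1 (w x) (fun1E _).
by rewrite !S1 e0 S2.
Qed.

Lemma koszul2E (w : form E L 2) (X : 'I_3 -> sec E) x : koszul br act w X x =
 dapp (act (X ord0 x)) (fun y => form2 w (X i1 y) (X i2 y))
 - dapp (act (X i1 x)) (fun y => form2 w (X ord0 y) (X i2 y))
 + dapp (act (X i2 x)) (fun y => form2 w (X ord0 y) (X i1 y))
 - form2 w (br (X ord0) (X i1) x) (X i2 x)
 + form2 w (br (X ord0) (X i2) x) (X i1 x)
 - form2 w (br (X i1) (X i2) x) (X ord0 x).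
rewrite /koszul !(big_ord_reclP, big_ord0) /= ?addr0 ?add0r.
rewrite !(exprS, expr0, mulr1, mulN1r, mul1r, opprK) !scale1r !scaleN1r.
have S1 (i j1 j2 : 'I_3) : (lift i ord0 == j1) && (lift i i1 == j2) ->
  (fun y => w y (fun j => X (lift i j) y)) = fun y => form2 w (X j1 y) (X j2 y).
 by case/andP=> /eqP<- /eqP<-; apply/dfunext => y; exact: (congr1 (w y) (fun2E _)).
have S2 (i j c : 'I_3) : [seq c <- iota 0 3 | (c != val i) && (c != val j)] = [:: val c] ->
  w x (fun a => nth 0 (br (X i) (X j) x :: [seq X c x | c <- enum 'I_3 & (c != i) && (c != j)]) a) =
  form2 w (br (X i) (X j) x) (X c x).
 by move=> H; rewrite (@other_ord 3 i j [:: c]) //; exact: (congr1 (w x) (fun2E _)).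
rewrite (S2 _ _ i2) // (S2 _ _ i1) // (S2 _ _ ord0) //.
by rewrite (S1 _ i1 i2) // (S1 _ ord0 i2) // (S1 _ ord0 i1) // !addrA.
Qed.

Lemma koszul3E (w : form E L 3) (X : 'I_4 -> sec E) x : koszul br act w X x =
 dapp (act (X ord0 x)) (fun y => form3 w (X i1 y) (X i2 y) (X i3 y))
 - dapp (act (X i1 x)) (fun y => form3 w (X ord0 y) (X i2 y) (X i3 y))
 + dapp (act (X i2 x)) (fun y => form3 w (X ord0 y) (X i1 y) (X i3 y))
 - dapp (act (X i3 x)) (fun y => form3 w (X ord0 y) (X i1 y) (X i2 y))
 - form3 w (br (X ord0) (X i1) x) (X i2 x) (X i3 x)
 + form3 w (br (X ord0) (X i2) x) (X i1 x) (X i3 x)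
 - form3 w (br (X ord0) (X i3) x) (X i1 x) (X i2 x)
 - form3 w (br (X i1) (X i2) x) (X ord0 x) (X i3 x)
 + form3 w (br (X i1) (X i3) x) (X ord0 x) (X i2 x)
 - form3 w (br (X i2) (X i3) x) (X ord0 x) (X i1 x).
rewrite /koszul !(big_ord_reclP, big_ord0) /= ?addr0 ?add0r.
rewrite !(exprS, expr0, mulr1, mulN1r, mul1r, opprK) !scale1r !scaleN1r.
have S1 (i j1 j2 j3 : 'I_4) : [&& lift i ord0 == j1, lift i i1 == j2 & lift i i2 == j3] ->
  (fun y => w y (fun j => X (lift i j) y)) = fun y => form3 w (X j1 y) (X j2 y) (X j3 y).
 by case/and3P=> /eqP<- /eqP<- /eqP<-; apply/dfunext => y; exact: (congr1 (w y) (fun3E _)).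
have S2 (i j c d : 'I_4) : [seq c <- iota 0 4 | (c != val i) && (c != val j)] = [:: val c; val d] ->
  w x (fun a => nth 0 (br (X i) (X j) x :: [seq X c x | c <- enum 'I_4 & (c != i) && (c != j)]) a) =
  form3 w (br (X i) (X j) x) (X c x) (X d x).
 by move=> H; rewrite (@other_ord 4 i j [:: c; d]) //; exact: (congr1 (w x) (fun3E _)).
rewrite (S2 _ _ i2 i3) // (S2 _ _ i1 i3) // (S2 _ _ i1 i2) // (S2 _ _ ord0 i3) // (S2 _ _ ord0 i2) // (S2 _ _ ord0 i1) //.
by rewrite (S1 _ i1 i2 i3) // (S1 _ ord0 i2 i3) // (S1 _ ord0 i1 i3) // (S1 _ ord0 i1 i2) // !addrA.
Qed.

End Expand.

Lemma sum2_anti (W : lmodType R) (V : Type) (plus : V -> V -> V) (f : V -> V -> W) a b :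
 (forall a b c, f (plus a b) c = f a c + f b c) ->
 (forall a b c, f a (plus b c) = f a b + f a c) -> (forall a, f a a = 0) -> f a b = - f b a.
move=> l1 l2 alt; have := alt (plus a b); rewrite l1 !l2 !alt add0r addr0.
by move/eqP; rewrite addr_eq0 => /eqP.
Qed.

Lemma anti_alt (W : lmodType R) (v : W) : v = - v -> v = 0.
move=> H; have : (2%:R : R) *: v = 0 by rewrite scaler_nat mulr2n {2}H subrr.
by move/eqP; rewrite scaler_eq0 pnatr_eq0 => /eqP.
Qed.

Lemma lin_eq (V W : lmodType R) (f g : V -> W) : linear f -> (forall v, f v = g v) -> linear g.
by move=> l /funext <-. Qed.

Section FormAPI.
Variables (M : dspace R) (E L : bundle M).

Lemma upd2E (T : Type) (a b e : T) : (upd (pair2 a b) ord0 e = pair2 e b) * (upd (pair2 a b) i1 e = pair2 a e).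
by split; rewrite [LHS]fun2E. Qed.
Lemma upd3E (T : Type) (a b c e : T) : (upd (tri3 a b c) ord0 e = tri3 e b c) *
 (upd (tri3 a b c) i1 e = tri3 a e c) * (upd (tri3 a b c) i2 e = tri3 a b e).
by split; first split; rewrite [LHS]fun3E. Qed.

Lemma form2_ext (w w' : form E L 2) : (forall x a b, form2 w (x := x) a b = form2 w' a b) -> w = w'.
by move=> H; apply: form_ext => x v; rewrite (fun2E v); exact: H. Qed.
Lemma form3_ext (w w' : form E L 3) : (forall x a b c, form3 w (x := x) a b c = form3 w' a b c) -> w = w'.
by move=> H; apply: form_ext => x v; rewrite (fun3E v); exact: H. Qed.

Section One.
Variable w : form E L 1.
Hypothesis fw : is_form w.
Lemma form1_lin x : linear (fun a : E x => @w x (fun _ => a)).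
have [H _ _] := fw; by apply: lin_eq (H x (fun=> 0) ord0) _ => a; congr (@w x); rewrite [LHS]fun1E.
Qed.
Lemma form1_smooth (X : sec E) : smooth_sec X -> smooth_sec (fun x => @w x (fun _ => X x)).
by have [_ _ H] := fw => sX; exact: (H (fun _ => X)). Qed.
End One.

Lemma is_form1 (w : form E L 1) : (forall x, linear (fun a : E x => w x (fun _ => a))) ->
 (forall X : sec E, smooth_sec X -> smooth_sec (fun x => w x (fun _ => X x))) -> is_form w.
move=> l s; split.
- move=> x v i; apply: lin_eq (l x) _ => a; congr (@w x).
 by apply/funext => j; rewrite /upd (ord1 i) (ord1 j).
- by move=> x v i j; rewrite (ord1 i) (ord1 j) eqxx.
- move=> e se; have := s (e ord0) (se _); congr smooth_sec.
 by apply/dfunext => x; congr (@w x); rewrite [RHS]fun1E.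
Qed.

Section Two.
Variable w : form E L 2.
Hypothesis fw : is_form w.
Lemma form2_lin1 x b : linear (fun a : E x => form2 w a b).
by have [H _ _] := fw; apply: lin_eq (H x (pair2 0 b) ord0) _ => a; rewrite /form2 upd2E.
Qed.
Lemma form2_lin2 x a : linear (fun b : E x => form2 w a b).
by have [H _ _] := fw; apply: lin_eq (H x (pair2 a 0) i1) _ => b; rewrite /form2 upd2E.
Qed.
Lemma form2_anti x (a b : E x) : form2 w a b = - form2 w b a.
apply: (@sum2_anti _ _ +%R) => [u v c|u v c|u].
- by rewrite (linD (@form2_lin1 x c)).
- by rewrite (linD (@form2_lin2 x u)).
- by have [_ H _] := fw; apply: (H x _ ord0 i1).
Qed.
Lemma form2_smooth (X Y : sec E) : smooth_sec X -> smooth_sec Y -> smooth_sec (fun x => form2 w (X x) (Y x)).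
have [_ _ H] := fw => sX sY; have := H (pair2 X Y).
rewrite (_ : (fun x => _) = fun x => form2 w (X x) (Y x)).
 by apply => i; rewrite /pair2; case: ifP.
by apply/dfunext => x; congr (@w x); rewrite [LHS]fun2E.
Qed.
End Two.

Lemma is_form2 (w : form E L 2) : (forall x b, linear (fun a : E x => form2 w a b)) ->
 (forall x (a b : E x), form2 w a b = - form2 w b a) ->
 (forall X Y : sec E, smooth_sec X -> smooth_sec Y -> smooth_sec (fun x => form2 w (X x) (Y x))) -> is_form w.
move=> l an s; split.
- move=> x v i; rewrite (fun2E v); case: (unliftP ord0 i) => [j ->|->].
  rewrite (ord1 j); have l2 : linear (fun b : E x => form2 w (v ord0) b).
   by move=> a u1 u2; rewrite an (l x) opprD -scalerN -!an.
  by apply: lin_eq l2 _ => b; rewrite upd2E.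
 by apply: lin_eq (l x (v i1)) _ => b; rewrite upd2E.
- move=> x v i j; have H u : form2 w u u = 0 by apply: anti_alt; exact: an.
 rewrite (fun2E v); case: (unliftP ord0 i) => [i' ->|->]; case: (unliftP ord0 j) => [j' ->|->];
  rewrite ?(ord1 i') ?(ord1 j') ?eqxx //= => _ E1; rewrite /pair2 /= in E1; rewrite E1; exact: H.
- move=> e se; have := s _ _ (se ord0) (se i1); congr smooth_sec.
 by apply/dfunext => x; congr (@w x); rewrite [RHS]fun2E.
Qed.

Section Three.
Variable w : form E L 3.
Hypothesis fw : is_form w.
Lemma form3_lin1 x b c : linear (fun a : E x => form3 w a b c).
by have [H _ _] := fw; apply: lin_eq (H x (tri3 0 b c) ord0) _ => a; rewrite /form3 upd3E.
Qed.
Lemma form3_lin2 x a c : linear (fun b : E x => form3 w a b c).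
by have [H _ _] := fw; apply: lin_eq (H x (tri3 a 0 c) i1) _ => b; rewrite /form3 upd3E.
Qed.
Lemma form3_lin3 x a b : linear (fun c : E x => form3 w a b c).
by have [H _ _] := fw; apply: lin_eq (H x (tri3 a b 0) i2) _ => c; rewrite /form3 upd3E.
Qed.
Lemma form3_anti12 x (a b c : E x) : form3 w a b c = - form3 w b a c.
apply: (@sum2_anti _ _ +%R (fun a b => form3 w a b c)) => [u v d|u v d|u].
- by rewrite (linD (@form3_lin1 x d c)).
- by rewrite (linD (@form3_lin2 x u c)).
- by have [_ H _] := fw; apply: (H x _ ord0 i1).
Qed.
Lemma form3_anti23 x (a b c : E x) : form3 w a b c = - form3 w a c b.
apply: (@sum2_anti _ _ +%R (fun b c => form3 w a b c)) => [u v d|u v d|u].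
- by rewrite (linD (@form3_lin2 x a d)).
- by rewrite (linD (@form3_lin3 x a u)).
- by have [_ H _] := fw; apply: (H x _ i1 i2).
Qed.
Lemma form3_smooth (X Y Z : sec E) : smooth_sec X -> smooth_sec Y -> smooth_sec Z ->
 smooth_sec (fun x => form3 w (X x) (Y x) (Z x)).
have [_ _ H] := fw => sX sY sZ; have := H (tri3 X Y Z).
rewrite (_ : (fun x => _) = fun x => form3 w (X x) (Y x) (Z x)).
 by apply; exact: ord3P.
by apply/dfunext => x; congr (@w x); rewrite [LHS]fun3E.
Qed.
End Three.

Lemma is_form3 (w : form E L 3) : (forall x b c, linear (fun a : E x => form3 w a b c)) ->
 (forall x (a b c : E x), form3 w a b c = - form3 w b a c) ->
 (forall x (a b c : E x), form3 w a b c = - form3 w a c b) ->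
 (forall X Y Z : sec E, smooth_sec X -> smooth_sec Y -> smooth_sec Z ->
   smooth_sec (fun x => form3 w (X x) (Y x) (Z x))) -> is_form w.
move=> l an1 an2 s.
have l2 x a c : linear (fun b : E x => form3 w a b c).
 by move=> r u1 u2; rewrite an1 (l x) opprD -scalerN -!an1.
have l3 x a b : linear (fun c : E x => form3 w a b c).
 by move=> r u1 u2; rewrite an2 (l2 x) opprD -scalerN -!an2.
have H1 x (a b : E x) : form3 w a a b = 0 by apply: anti_alt; exact: an1.
have H2 x (a b : E x) : form3 w a b b = 0 by apply: anti_alt; exact: an2.
have H3 x (a b : E x) : form3 w a b a = 0 by rewrite an1 H2 oppr0.
split.
- move=> x v i; rewrite (fun3E v); move: i; apply: ord3P.
 + by apply: lin_eq (l x (v i1) (v i2)) _ => b; rewrite upd3E.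
 + by apply: lin_eq (l2 x (v ord0) (v i2)) _ => b; rewrite upd3E.
 + by apply: lin_eq (l3 x (v ord0) (v i1)) _ => b; rewrite upd3E.
- move=> x v i j; rewrite (fun3E v) => ij; rewrite /tri3; move: i j ij.
 apply: ord3P; apply: ord3P; rewrite ?eqxx //= => _ ->; solve [exact: H1|exact: H2|exact: H3].
- move=> e se; have := s _ _ _ (se ord0) (se i1) (se i2); congr smooth_sec.
 by apply/dfunext => x; congr (@w x); rewrite [RHS]fun3E.
Qed.
End FormAPI.

Section ExtD.
Variables (M : dspace R) (L : bundle M) (n : nat).
Hypotheses (oL : bundle_ok L 1) (HC : coordinatized M n).
Local Notation DL' := (atiyahb L).
Let oD : bundle_ok DL' n.+1 := atiyah_ok oL HC.

Definition smooth_lin (phi : forall y, atiyah L y -> L y) := (forall y, linear (phi y)) /\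
 forall Y : sec DL', smooth_sec Y -> smooth_sec (fun y => phi y (Y y)).

(* If X and X' agree at x then X - X' = \sum_a f_a e_a with f_a(x) = 0, so that
  the first derivative of X - X' at x is well defined, and linear functions
  phi of X are differentiated by the Leibniz rule. *)
Lemma diff_data (X X' : sec DL') x : smooth_sec X -> smooth_sec X' -> X x = X' x ->
 exists z : atiyah L x -> atiyah L x, forall d phi, smooth_lin phi ->
  dapp d (fun y => phi y (X y)) = dapp d (fun y => phi y (X' y)) + phi x (z d).
move=> sX sX' E; have [U [e [xi [Ux F]]]] := ok_frame oD x.
pose f a y := xi a (mkt (X y)) - xi a (mkt (X' y)).
have sf a : smooth_fun (f a) by apply: smoothB; exact: (frame_sec_xi _ F).
exists (fun d => \sum_a tapp (symbol d) (f a) *: e a x) => d phi [lphi sphi].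
have se a : smooth_sec (fun y => phi y (e a y)) by apply: sphi; exact: (frame_smooth F a).
have sfe a : smooth_sec (fun y => f a y *: phi y (e a y)) by exact: (smooth_secM oL).
apply/eqP; rewrite addrC -subr_eq -dappB //; [|exact: sphi|exact: sphi]; apply/eqP.
rewrite (@dapp_local _ _ _ oL x d _ (fun y => \sum_a f a y *: phi y (e a y))).
- rewrite dapp_sum // (lin_sum (lphi x)); apply: eq_bigr => a _.
 rewrite dappM // (linZ (lphi x)) [X in _ + X *: _](_ : f a x = 0) ?scale0r ?addr0 //.
 by rewrite /f E subrr.
- apply: (smooth_secD oL); first exact: sphi.
 by apply: (smooth_secN oL); exact: sphi.
- exact: (smooth_secS oL).
apply: filterS (frame_open F Ux) => y Uy.
rewrite -(linB (lphi y)) (frame_exp F (X y) Uy) {1}(frame_exp F (X' y) Uy) -sumrB.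
rewrite (lin_sum (lphi y)); apply: eq_bigr => a _; rewrite -scalerBl (linZ (lphi y)).
by [].
Qed.

Lemma smooth_lin_dapp l : smooth_sec l -> smooth_lin (fun y d => dapp d l).
by move=> sl; split=> // Y sY; exact: smooth_dapp. Qed.
Lemma smooth_lin1 (w : form DL' L 1) : is_form w -> smooth_lin (fun y d => w y (fun _ => d)).
by move=> fw; split=> [y|X sX]; [exact: (form1_lin fw)|exact: form1_smooth]. Qed.
Lemma smooth_lin2 (w : form DL' L 2) (Y : sec DL') : is_form w -> smooth_sec Y ->
 smooth_lin (fun y d => form2 w d (Y y)) /\ smooth_lin (fun y d => form2 w (Y y) d).
move=> fw sY; split; split=> [y|X sX]; try exact: form2_smooth.
 exact: (form2_lin1 fw).
exact: (form2_lin2 fw).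
Qed.
Lemma smooth_lin3 (w : form DL' L 3) (Y Z : sec DL') : is_form w -> smooth_sec Y -> smooth_sec Z ->
 [/\ smooth_lin (fun y d => form3 w d (Y y) (Z y)), smooth_lin (fun y d => form3 w (Y y) d (Z y)) &
   smooth_lin (fun y d => form3 w (Y y) (Z y) d)].
move=> fw sY sZ; split; split=> [y|X sX]; try exact: form3_smooth.
- exact: (form3_lin1 fw).
- exact: (form3_lin2 fw).
- exact: (form3_lin3 fw).
Qed.
Lemma dapp_comb x r (d d' : atiyah L x) l : dapp (r *: d + d') l = r *: dapp d l + dapp d' l.
by []. Qed.

Lemma smooth_dbracket (X Y : sec DL') : smooth_sec X -> smooth_sec Y -> smooth_sec (dbracket X Y).
move=> sX sY; apply: smooth_secD_dapp => l sl.
have : smooth_sec (fun y => dapp (X y) (fun z => dapp (Y z) l) - dapp (Y y) (fun z => dapp (X z) l)).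
 apply: (smooth_secD oL); last apply: (smooth_secN oL); by do 2!apply: smooth_dapp => //.
by congr smooth_sec; apply/dfunext => y; rewrite dbracketE.
Qed.

(** Another choice of extensions changes a derivative of phi(X_i) by phi(z_i) and a bracket by
    z_j(X_i) - z_i(X_j). In the Koszul formula these corrections cancel, which makes its value
    depend on the vectors at x alone and the choice in [extd] meaningful. *)
Lemma ext_data k (X X' : 'I_k -> sec DL') x :
 (forall i, smooth_sec (X i)) -> (forall i, smooth_sec (X' i)) -> (forall i, X i x = X' i x) ->
 exists z : 'I_k -> atiyah L x -> atiyah L x, (forall i d phi, smooth_lin phi ->
   dapp d (fun y => phi y (X i y)) = dapp d (fun y => phi y (X' i y)) + phi x (z i d)) /\
  forall i j, dbracket (X i) (X j) x = dbracket (X' i) (X' j) x + (z j (X' i x) - z i (X' j x)).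
move=> sX sX' E.
have /boolp.choice[z zP] i := diff_data (sX i) (sX' i) (E i).
exists z; split=> // i j; apply: atiyah_ext => l sl.
have -> : dapp (dbracket (X' i) (X' j) x + (z j (X' i x) - z i (X' j x))) l =
  dapp (dbracket (X' i) (X' j) x) l + (dapp (z j (X' i x)) l - dapp (z i (X' j x)) l) by [].
rewrite !dbracketE // (zP j (X i x) _ (smooth_lin_dapp sl)) (zP i (X j x) _ (smooth_lin_dapp sl)) !E.
by line_ring oL.
Qed.

Local Notation koszulD := (koszul (@dbracket _ M L) (fun x d => d)).

Lemma koszul1_ext (w : form DL' L 1) (X X' : 'I_2 -> sec DL') x : is_form w ->
 (forall i, smooth_sec (X i)) -> (forall i, smooth_sec (X' i)) -> (forall i, X i x = X' i x) ->
 koszulD w X x = koszulD w X' x.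
move=> fw sX sX' E; have [z [zP brP]] := ext_data sX sX' E.
have D i d := zP i d _ (smooth_lin1 fw).
rewrite !koszul1E brP !D !E (linD (form1_lin fw (x := x))) (linB (form1_lin fw (x := x))).
by line_ring oL.
Qed.

Lemma koszul2_ext (w : form DL' L 2) (X X' : 'I_3 -> sec DL') x : is_form w ->
 (forall i, smooth_sec (X i)) -> (forall i, smooth_sec (X' i)) -> (forall i, X i x = X' i x) ->
 koszulD w X x = koszulD w X' x.
move=> fw sX sX' E; have [z [zP brP]] := ext_data sX sX' E.
have D i j d : dapp d (fun y => form2 w (X i y) (X j y)) = dapp d (fun y => form2 w (X' i y) (X' j y)) +
  form2 w (z i d) (X' j x) + form2 w (X' i x) (z j d).
 rewrite (zP i d _ (smooth_lin2 fw (sX j)).1) (zP j d _ (smooth_lin2 fw (sX' i)).2) E.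
 by rewrite addrAC.
have l1 b := form2_lin1 fw (x := x) b.
rewrite !koszul2E !brP !D !E !(linD (l1 _)) !(linN (l1 _)).
apply: (line_ext oL) => k lk; rewrite !(lfunD lk, lfunN lk).
have A a b : k (form2 w a b) = - k (form2 w b a) by rewrite (form2_anti fw) (lfunN lk).
rewrite (A (X' i1 x) (z i2 _)) (A (X' ord0 x) (z i2 _)) (A (X' ord0 x) (z i1 _)).
by ring.
Qed.

Lemma koszul3_ext (w : form DL' L 3) (X X' : 'I_4 -> sec DL') x : is_form w ->
 (forall i, smooth_sec (X i)) -> (forall i, smooth_sec (X' i)) -> (forall i, X i x = X' i x) ->
 koszulD w X x = koszulD w X' x.
move=> fw sX sX' E; have [z [zP brP]] := ext_data sX sX' E.
have D i j c d : dapp d (fun y => form3 w (X i y) (X j y) (X c y)) =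
  dapp d (fun y => form3 w (X' i y) (X' j y) (X' c y)) +
  form3 w (z i d) (X' j x) (X' c x) + form3 w (X' i x) (z j d) (X' c x) + form3 w (X' i x) (X' j x) (z c d).
 have [/(zP i d)-> _ _] := smooth_lin3 fw (sX j) (sX c).
 have [_ /(zP j d)-> _] := smooth_lin3 fw (sX' i) (sX c).
 by have [_ _ /(zP c d)->] := smooth_lin3 fw (sX' i) (sX' j); rewrite !E; line_ring oL.
have l1 b c := form3_lin1 fw (x := x) b c.
rewrite !koszul3E !brP !D !E !(linD (l1 _ _)) !(linN (l1 _ _)).
apply: (line_ext oL) => k lk; rewrite !(lfunD lk, lfunN lk).
have A a b c : k (form3 w a b c) = - k (form3 w b a c) by rewrite (form3_anti12 fw) (lfunN lk).
have B a b c : k (form3 w a b c) = - k (form3 w a c b) by rewrite (form3_anti23 fw) (lfunN lk).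
have C i j c d : k (form3 w (X' i x) (X' j x) (z c d)) = k (form3 w (z c d) (X' i x) (X' j x)).
 by rewrite B A opprK.
by rewrite !C !(A (X' _ x) (z _ _)); ring.
Qed.

Lemma extdE k (w : form DL' L k) (X : 'I_k.+1 -> sec DL') x :
 (forall X X' : 'I_k.+1 -> sec DL', (forall i, smooth_sec (X i)) -> (forall i, smooth_sec (X' i)) ->
  (forall i, X i x = X' i x) -> koszulD w X x = koszulD w X' x) ->
 (forall i, smooth_sec (X i)) -> dD w (fun i => X i x) = koszulD w X x.
move=> H sX; apply: the_eq => [Y sY YX|y Hy]; last exact: Hy.
exact: H.
Qed.

Lemma dD1E (w : form DL' L 1) (X Y : sec DL') x : is_form w -> smooth_sec X -> smooth_sec Y ->
 form2 (dD w) (X x) (Y x) = dapp (X x) (fun y => w y (fun _ => Y y))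
  - dapp (Y x) (fun y => w y (fun _ => X y)) - w x (fun _ => dbracket X Y x).
move=> fw sX sY; pose Z : 'I_2 -> sec DL' := pair2 X Y.
have sZ i : smooth_sec (Z i) by rewrite /Z /pair2; case: ifP.
rewrite -[RHS](koszul1E (@dbracket _ M L) (fun x d => d) w Z) -extdE //.
 by rewrite /form2; congr (dD _ _); apply/esym; exact: fun2E.
by move=> X1 X2; exact: koszul1_ext.
Qed.

Lemma dD2E (w : form DL' L 2) (X Y Z : sec DL') x : is_form w -> smooth_sec X -> smooth_sec Y -> smooth_sec Z ->
 form3 (dD w) (X x) (Y x) (Z x) = dapp (X x) (fun y => form2 w (Y y) (Z y))
  - dapp (Y x) (fun y => form2 w (X y) (Z y)) + dapp (Z x) (fun y => form2 w (X y) (Y y))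
  - form2 w (dbracket X Y x) (Z x) + form2 w (dbracket X Z x) (Y x) - form2 w (dbracket Y Z x) (X x).
move=> fw sX sY sZ; pose V : 'I_3 -> sec DL' := tri3 X Y Z.
have sV : forall i, smooth_sec (V i) by exact: ord3P.
rewrite -[RHS](koszul2E (@dbracket _ M L) (fun x d => d) w V) -extdE //.
 by rewrite /form3; congr (dD _ _); apply/esym; exact: fun3E.
by move=> X1 X2; exact: koszul2_ext.
Qed.

Lemma dD1C (w : form DL' L 1) (X Y : sec DL') x : is_form w -> smooth_sec X -> smooth_sec Y -> commuting X Y x ->
 form2 (dD w) (X x) (Y x) = dapp (X x) (fun y => w y (fun _ => Y y)) - dapp (Y x) (fun y => w y (fun _ => X y)).
move=> fw sX sY c; rewrite dD1E // comm_dbracket // (lin0 (form1_lin fw (x := x))).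
by rewrite subr0.
Qed.

Lemma dD2C (w : form DL' L 2) (X Y Z : sec DL') x : is_form w ->
 smooth_sec X -> smooth_sec Y -> smooth_sec Z -> commuting X Y x -> commuting X Z x -> commuting Y Z x ->
 form3 (dD w) (X x) (Y x) (Z x) = dapp (X x) (fun y => form2 w (Y y) (Z y))
  - dapp (Y x) (fun y => form2 w (X y) (Z y)) + dapp (Z x) (fun y => form2 w (X y) (Y y)).
move=> fw sX sY sZ c1 c2 c3; rewrite dD2E // !comm_dbracket //.
by rewrite !(lin0 (form2_lin1 fw (x := x) _)) !subr0 addr0.
Qed.

Lemma commuting_ext2 x (a b : atiyah L x) : exists X Y : sec DL', [/\ smooth_sec X /\ smooth_sec Y, X x = a, Y x = b &
  \forall y \near (x : dtop M), commuting X Y y].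
have [X [sX XE c]] := commuting_ext oL (pair2 a b) HC.
exists (X ord0), (X i1); split; [by split|exact: XE|exact: XE|].
by apply: filterS c => y; exact.
Qed.

Lemma commuting_ext3 x (a b c : atiyah L x) : exists X Y Z : sec DL',
 [/\ [/\ smooth_sec X, smooth_sec Y & smooth_sec Z], [/\ X x = a, Y x = b & Z x = c] &
  \forall y \near (x : dtop M), [/\ commuting X Y y, commuting X Z y & commuting Y Z y]].
have [X [sX XE cX]] := commuting_ext oL (tri3 a b c) HC.
exists (X ord0), (X i1), (X i2); split; [by split|by split; exact: XE|].
by apply: filterS cX => y.
Qed.

Lemma commuting_comb (X Y Z : sec DL') r x : smooth_sec X -> smooth_sec Y -> smooth_sec Z ->
 commuting X Z x -> commuting Y Z x -> commuting (fun y => r *: X y + Y y) Z x.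
move=> sX sY sZ cX cY l sl; rewrite dapp_comb cX // cY // -dapp_lin //; exact: smooth_dapp.
Qed.

Lemma commuting_done (Y : sec DL') x : smooth_sec Y -> commuting (done L) Y x.
move=> sY l sl; rewrite doneE //; last exact: smooth_dapp.
by congr dapp; apply/dfunext => z; rewrite doneE.
Qed.

Lemma commuting_ext4 x (a b c d : atiyah L x) : exists X Y Z T : sec DL',
 [/\ [/\ smooth_sec X, smooth_sec Y, smooth_sec Z & smooth_sec T], [/\ X x = a, Y x = b, Z x = c & T x = d],
  \forall y \near (x : dtop M), [/\ commuting X Y y, commuting X Z y & commuting X T y] &
  \forall y \near (x : dtop M), [/\ commuting Y Z y, commuting Y T y & commuting Z T y]].
have [X [sX XE cX]] := commuting_ext oL (fun i : 'I_4 => nth a [:: a; b; c; d] i) HC.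
exists (X ord0), (X i1), (X i2), (X i3); split.
- by split.
- by split; exact: XE.
- by apply: filterS cX => y.
- by apply: filterS cX => y.
Qed.

Lemma dapp_opp x (d : atiyah L x) (f g : sec L) : smooth_sec g -> (forall y, f y = - g y) -> dapp d f = - dapp d g.
by move=> sg E; rewrite -dappN //; congr dapp; apply/dfunext.
Qed.

(** Linearity and skewness are checked at a point, with commuting extensions; smoothness uses the
    full formula with brackets, since the given sections need not commute. *)
Lemma form_dD1 (w : form DL' L 1) : is_form w -> is_form (dD w).
move=> fw; have sw X := form1_smooth fw (X := X); apply: is_form2.
- move=> x c r a b; have [X [Y [Z [[sX sY sZ] [<- <- <-] H]]]] := commuting_ext3 a b c.
 have [_ c1 c2] := near_self H.
 have sXY : smooth_sec (fun y => r *: X y + Y y) by apply: (smooth_secD oD) => //; exact: (smooth_secZ oD).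
 rewrite -[LHS]/(form2 (dD w) ((fun y => r *: X y + Y y) x) (Z x)).
 rewrite !dD1C // ?dapp_comb; last exact: commuting_comb.
 rewrite (_ : (fun y => w y (fun _ => r *: X y + Y y)) = fun y => r *: w y (fun _ => X y) + w y (fun _ => Y y)).
  rewrite dapp_lin; try exact: sw.
  by line_ring oL.
 by apply/dfunext => y; exact: form1_lin.
- move=> x a b; have [X [Y [[sX sY] <- <- /near_self c]]] := commuting_ext2 a b.
 rewrite !dD1C ?opprB // => l sl; exact/esym/c.
- move=> X Y sX sY; have sB := smooth_dbracket sX sY.
 rewrite (dfunext (fun x => dD1E x fw sX sY)).
 apply: (smooth_secD oL); last by apply: (smooth_secN oL); exact: sw.
 by apply: (smooth_secD oL); last apply: (smooth_secN oL); apply: smooth_dapp => //; exact: sw.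
Qed.

Lemma form_dD2 (w : form DL' L 2) : is_form w -> is_form (dD w).
move=> fw; have sw X Y := form2_smooth fw (X := X) (Y := Y); apply: is_form3.
- move=> x c d r a b; have [X [Y [Z [T [[sX sY sZ sT] [<- <- <- <-] H1 H2]]]]] := commuting_ext4 a b c d.
 have [_ c1 c2] := near_self H1; have [c3 c4 c5] := near_self H2.
 have sXY : smooth_sec (fun y => r *: X y + Y y) by apply: (smooth_secD oD) => //; exact: (smooth_secZ oD).
 rewrite -[LHS]/(form3 (dD w) ((fun y => r *: X y + Y y) x) (Z x) (T x)).
 rewrite !dD2C // ?dapp_comb; try exact: commuting_comb.
 have E (V : sec DL') : (fun y => form2 w (r *: X y + Y y) (V y)) = fun y => r *: form2 w (X y) (V y) + form2 w (Y y) (V y).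
  by apply/dfunext => y; exact: (form2_lin1 fw).
 rewrite !E !dapp_lin; try exact: sw.
 by line_ring oL.
- move=> x a b c; have [X [Y [Z [[sX sY sZ] [<- <- <-] /near_self[c1 c2 c3]]]]] := commuting_ext3 a b c.
 rewrite !dD2C //; last by move=> l sl; exact/esym/c1.
 rewrite (@dapp_opp x (Z x) (fun y => form2 w (X y) (Y y)) (fun y => form2 w (Y y) (X y))).
 + by rewrite opprD opprB.
 + exact: sw.
 + by move=> y; exact: form2_anti.
- move=> x a b c; have [X [Y [Z [[sX sY sZ] [<- <- <-] /near_self[c1 c2 c3]]]]] := commuting_ext3 a b c.
 rewrite !dD2C //; last by move=> l sl; exact/esym/c3.
 rewrite (@dapp_opp x (X x) (fun y => form2 w (Y y) (Z y)) (fun y => form2 w (Z y) (Y y))).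
 + by line_ring oL.
 + exact: sw.
 + by move=> y; exact: form2_anti.
- move=> X Y Z sX sY sZ; rewrite (dfunext (fun x => dD2E x fw sX sY sZ)).
 have sB (V T : sec DL') : smooth_sec V -> smooth_sec T -> smooth_sec (dbracket V T) by exact: smooth_dbracket.
 by do ?apply: (smooth_secD oL); try apply: (smooth_secN oL); do ?[apply: smooth_dapp => //]; apply: sw => //; exact: sB.
Qed.

Definition fcomb N (E' L' : bundle N) a k (w w' : form E' L' k) : form E' L' k := fun x v => w x v + a *: w' x v.

Lemma dD1_comb a (w w' : form DL' L 1) : is_form w -> is_form w' -> is_form (fcomb a w w') ->
 dD (fcomb a w w') = fcomb a (dD w) (dD w').
move=> fw fw' fc; apply: form2_ext => x b d.
have [X [Y [[sX sY] <- <- /near_self c]]] := commuting_ext2 b d.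
rewrite -[RHS]/(form2 (dD w) (X x) (Y x) + a *: form2 (dD w') (X x) (Y x)) !dD1C // /fcomb.
rewrite !dappD ?dappZ; try solve [exact: oL|exact: form1_smooth|apply: (smooth_secZ oL); exact: form1_smooth].
by line_ring oL.
Qed.

Lemma dD2_comb a (w w' : form DL' L 2) : is_form w -> is_form w' -> is_form (fcomb a w w') ->
 dD (fcomb a w w') = fcomb a (dD w) (dD w').
move=> fw fw' fc; apply: form3_ext => x b c d.
have [X [Y [Z [[sX sY sZ] [<- <- <-] /near_self[c1 c2 c3]]]]] := commuting_ext3 b c d.
rewrite -[RHS]/(form3 (dD w) (X x) (Y x) (Z x) + a *: form3 (dD w') (X x) (Y x) (Z x)) !dD2C //.
have E (U V : sec DL') : (fun y => form2 (fcomb a w w') (U y) (V y)) = fun y => form2 w (U y) (V y) + a *: form2 w' (U y) (V y) by [].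
rewrite !E !dappD ?dappZ; try solve [exact: oL|exact: form2_smooth|apply: (smooth_secZ oL); exact: form2_smooth].
by line_ring oL.
Qed.

Lemma dD_dD1 (w : form DL' L 1) : is_form w -> dD (dD w) = form00.
move=> fw; have fd := form_dD1 fw.
apply: form3_ext => x u v t.
have [X [Y [Z [[sX sY sZ] [<- <- <-] H]]]] := commuting_ext3 u v t.
have [c1 c2 c3] := near_self H; rewrite dD2C // /form3 /form0.
have sw V := form1_smooth fw (X := V); have sd V T := smooth_dapp (X := V) (l := fun y => w y (fun _ => T y)) oL.
have D (U V T : sec DL') : smooth_sec U -> smooth_sec V -> smooth_sec T -> (\forall y \near (x : dtop M), commuting V T y) ->
  dapp (U x) (fun y => form2 (dD w) (V y) (T y)) =
  dapp (U x) (fun y => dapp (V y) (fun z => w z (fun _ => T z))) - dapp (U x) (fun y => dapp (T y) (fun z => w z (fun _ => V z))).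
 move=> sU sV sT c; rewrite -dappB //; try (by apply: sd => //; exact: sw).
 apply: dapp_local => //; first exact: form2_smooth.
  apply: (smooth_secD oL); last apply: (smooth_secN oL); by apply: sd => //; exact: sw.
 by apply: filterS c => y c; rewrite dD1C.
rewrite !D //; try by apply: filterS H => y [].
have := c1 _ (sw _ sZ); have := c2 _ (sw _ sY); have := c3 _ (sw _ sX) => -> -> ->.
by line_ring oL.
Qed.

(** The value of [dD w] is either the common Koszul value of all extensions or the junk value 0, so
    a single family of extensions with vanishing Koszul expression is enough. *)
Lemma dD3_0 (w : form DL' L 3) : (forall x (a b c d : atiyah L x), exists X Y Z T : sec DL',
  [/\ [/\ smooth_sec X, smooth_sec Y, smooth_sec Z & smooth_sec T], [/\ X x = a, Y x = b, Z x = c & T x = d] &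
    koszulD w (fun i => nth X [:: X; Y; Z; T] i) x = 0]) -> dD w = form00.
move=> H; apply: form_ext => x v.
have [X [Y [Z [T [[sX sY sZ sT] [Xx Yx Zx Tx] K0]]]]] := H x (v ord0) (v i1) (v i2) (v i3).
rewrite /dD /extd /the; case: pselect => // e; case: (cid e) => /= y Hy.
by rewrite /form0 -K0; apply: Hy; exact: ord4P.
Qed.

Lemma dD_dD2 (w : form DL' L 2) : is_form w -> dD (dD w) = form00.
move=> fw; have fd := form_dD2 fw; apply: dD3_0 => x a b c d.
have [X [Y [Z [T [[sX sY sZ sT] E H1 H2]]]]] := commuting_ext4 a b c d.
exists X, Y, Z, T; split=> //.
have [c1 c2 c3] := near_self H1; have [c4 c5 c6] := near_self H2.
have sw V V' := form2_smooth fw (X := V) (Y := V').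
have sd V T' V' := smooth_dapp (X := V) (l := fun y => form2 w (T' y) (V' y)) oL.
have D (U V T' V' : sec DL') : smooth_sec U -> smooth_sec V -> smooth_sec T' -> smooth_sec V' ->
  (\forall y \near (x : dtop M), [/\ commuting V T' y, commuting V V' y & commuting T' V' y]) ->
  dapp (U x) (fun y => form3 (dD w) (V y) (T' y) (V' y)) =
  dapp (U x) (fun y => dapp (V y) (fun z => form2 w (T' z) (V' z)))
  - dapp (U x) (fun y => dapp (T' y) (fun z => form2 w (V z) (V' z)))
  + dapp (U x) (fun y => dapp (V' y) (fun z => form2 w (V z) (T' z))).
 move=> sU sV sT' sV' c0; have sB (A B C : sec DL') : smooth_sec A -> smooth_sec B -> smooth_sec C ->
   smooth_sec (fun y => dapp (A y) (fun z => form2 w (B z) (C z))).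
  by move=> *; apply: sd => //; exact: sw.
 have s1 : smooth_sec (fun y => dapp (V y) (fun z => form2 w (T' z) (V' z)) - dapp (T' y) (fun z => form2 w (V z) (V' z))).
  by apply: (smooth_secD oL); last apply: (smooth_secN oL); exact: sB.
 rewrite -(dappB oL) ?sB; try exact: sB.
 rewrite -(dappD (U x) s1); last exact: sB.
 apply: dapp_local => //; first exact: form3_smooth.
  by apply: (smooth_secD oL) => //; exact: sB.
 by apply: filterS c0 => y [] *; rewrite dD2C.
rewrite koszul3E /= !D //; try by apply: filterS2 H1 H2 => y [] ? ? ? [] ? ? ?; split.
have b0 (A B : sec DL') : smooth_sec A -> smooth_sec B -> commuting A B x -> dbracket A B x = 0 by exact: comm_dbracket.
have z d1 d2 : form3 (dD w) 0 d1 d2 = 0 := lin0 (form3_lin1 fd (x := x) d1 d2).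
rewrite (b0 X Y) // (b0 X Z) // (b0 X T) // (b0 Y Z) // (b0 Y T) // (b0 Z T) // !z !subr0 !addr0 ?subr0 ?addr0.
have S A B := sw A B.
have := c1 _ (sw _ _ sZ sT); have := c2 _ (sw _ _ sY sT); have := c3 _ (sw _ _ sY sZ).
have := c4 _ (sw _ _ sX sT); have := c5 _ (sw _ _ sX sZ); have := c6 _ (sw _ _ sX sY) => -> -> -> -> -> ->.
by line_ring oL.
Qed.

Definition iota2 (w : form DL' L 2) : form DL' L 1 := fun x v => form2 w (done L x) (v ord0).
Definition iota3 (w : form DL' L 3) : form DL' L 2 := fun x v => form3 w (done L x) (v ord0) (v i1).

Lemma form_iota2 w : is_form w -> is_form (iota2 w).
move=> fw; have s1 := smooth_done oL; apply: is_form1 => [x|X sX]; first exact: (form2_lin2 fw).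
exact: (form2_smooth fw s1 sX).
Qed.
Lemma form_iota3 w : is_form w -> is_form (iota3 w).
move=> fw; have s1 := smooth_done oL; apply: is_form2 => [x b|x a b|X Y sX sY].
- exact: (form3_lin2 fw).
- exact: (form3_anti23 fw).
- exact: (form3_smooth fw s1 sX sY).
Qed.

(* Cartan's formula for the contraction with the identity derivation, which is
  central in the Lie algebra of sections of DL. *)
Lemma cartan1 (w : form DL' L 1) x b : is_form w ->
 form2 (dD w) (done L x) b = w x (fun _ => b) - dapp b (fun y => w y (fun _ => done L y)).
move=> fw; have s1 := smooth_done oL; have [X sX <-] := smooth_ext oD b.
rewrite (dD1C fw s1 sX) ?(doneE oL) //; first exact: (form1_smooth fw sX).
exact: commuting_done.
Qed.

Lemma cartan2 (w : form DL' L 2) x b c : is_form w ->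
 form3 (dD w) (done L x) b c = form2 w b c - form2 (dD (iota2 w)) b c.
move=> fw; have s1 := smooth_done oL; have fi := form_iota2 fw.
have [X [Y [[sX sY] <- <- /near_self cXY]]] := commuting_ext2 b c.
have cX : commuting (done L) X x by exact: commuting_done.
have cY : commuting (done L) Y x by exact: commuting_done.
rewrite (dD2C fw s1 sX sY cX cY cXY) (dD1C fi sX sY cXY) (doneE oL) //; last exact: (form2_smooth fw sX sY).
by rewrite opprB addrA addrAC.
Qed.

(** The Koszul formula with the identity as first argument and commuting extensions reads i_1 dw = w
    - d(i_1 w), because the identity acts on sections of L as the identity and has zero brackets. *)
Lemma cartan3 (w : form DL' L 3) : is_form w -> dD w = form00 -> w = dD (iota3 w).
move=> fw dw; apply: form3_ext => x a b c; have s1 := smooth_done oL; have fi := form_iota3 fw.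
have [X [Y [Z [[sX sY sZ] [<- <- <-] /near_self[c1 c2 c3]]]]] := commuting_ext3 a b c.
have cc (A : sec DL') : smooth_sec A -> dbracket (done L) A x = 0.
 by move=> sA; apply: comm_dbracket => //; exact: commuting_done.
pose V : 'I_4 -> sec DL' := fun i => nth (done L) [:: done L; X; Y; Z] i.
have sV : forall i, smooth_sec (V i) by exact: ord4P.
have b0 (A B : sec DL') : smooth_sec A -> smooth_sec B -> commuting A B x -> dbracket A B x = 0.
 by move=> sA sB; exact: comm_dbracket.
have z d1 d2 : form3 w 0 d1 d2 = 0 := lin0 (form3_lin1 fw (x := x) d1 d2).
have H := extdE (fun X1 X2 => koszul3_ext fw (x := x) (X := X1) (X' := X2)) sV.
move: H; rewrite dw /form0 koszul3E /V /= !cc // (b0 X Y) // (b0 X Z) // (b0 Y Z) // !z (doneE oL); last first.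
 exact: (form3_smooth fw sX sY sZ).
move/esym => H; rewrite (dD2C fi sX sY sZ c1 c2 c3).
have ei (A B : sec DL') : (fun y => form2 (iota3 w) (A y) (B y)) = fun y => form3 w (done L y) (A y) (B y) by [].
apply: (line_ext oL) => k lk; have H' := congr1 k H; rewrite !ei.
by rewrite !(lfunD lk, lfunN lk) !(lfun0 lk) in H' *; lra.
Qed.

Lemma form_sigma1 (t : form (tanb M) L 1) : is_form t -> is_form (sigma_pull t).
move=> ft; apply: is_form1 => [x a d d'|X sX].
 by rewrite /sigma_pull (symbol_lin oL a); exact: (form1_lin ft).
exact: (form1_smooth ft (sec_symbol oL sX)).
Qed.
Lemma sigma2E (t : form (tanb M) L 2) x (a b : atiyah L x) : form2 (sigma_pull t) a b = form2 t (symbol a) (symbol b).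
by rewrite /form2 /sigma_pull; congr (t _ _); rewrite [LHS]fun2E. Qed.
Lemma form_sigma2 (t : form (tanb M) L 2) : is_form t -> is_form (sigma_pull t).
move=> ft; apply: is_form2 => [x b r d d'|x a b|X Y sX sY].
- by rewrite !sigma2E (symbol_lin oL r); exact: (form2_lin1 ft).
- by rewrite !sigma2E; exact: form2_anti.
- have := form2_smooth ft (sec_symbol oL sX) (sec_symbol oL sY); congr smooth_sec.
 by apply/dfunext => x; rewrite sigma2E.
Qed.

Lemma iota_dsigma1 (t : form (tanb M) L 1) x (b : atiyah L x) : is_form t ->
 form2 (dD (sigma_pull t)) (done L x) b = t x (fun _ => symbol b).
move=> ft; rewrite cartan1; last exact: form_sigma1.
rewrite (_ : (fun y => sigma_pull t (fun _ => done L y)) = fun y => 0) ?(dapp0 oL) ?subr0 //.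
apply/dfunext => y; rewrite /sigma_pull symbol_done //.
exact: (lin0 (form1_lin ft (x := y))).
Qed.
Lemma iota_dsigma2 (t : form (tanb M) L 2) x (b c : atiyah L x) : is_form t ->
 form3 (dD (sigma_pull t)) (done L x) b c = form2 t (symbol b) (symbol c).
move=> ft; have fs := form_sigma2 ft.
have z y (a : atiyah L y) : form2 (sigma_pull t) (done L y) a = 0.
 by rewrite sigma2E symbol_done //; exact: (lin0 (form2_lin1 ft (x := y) _)).
rewrite cartan2 // sigma2E (_ : iota2 _ = form00); last first.
 by apply: form_ext => y v; rewrite /iota2 z.
have f0 : is_form (@form0 R M DL' L 1).
 apply: is_form1 => [y r u v|X sX]; first by rewrite /form0 scaler0 addr0.
 exact: (smooth_sec0 oL).
have [X [Y [[sX sY] <- <- /near_self cXY]]] := commuting_ext2 b c.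
by rewrite (dD1C f0 sX sY cXY) /form0 !(dapp0 oL) // !subr0.
Qed.

Lemma comm_symbol (X Y : sec DL') x f : smooth_sec X -> smooth_sec Y -> smooth_fun f ->
 commuting X Y x -> tapp (symbol (X x)) (fun y => tapp (symbol (Y y)) f) =
  tapp (symbol (Y x)) (fun y => tapp (symbol (X y)) f).
move=> sX sY sf c; have sSX := sec_symbol oL sX; have sSY := sec_symbol oL sY.
apply/eqP; rewrite -subr_eq0 -(tbracketE x sSX sSY sf) -(symbol_dbracket oL x sX sY).
rewrite (comm_dbracket oL) // -(scale0r (done L x)) (linZ (@symbol_lin _ _ _ oL x)) scale0r.
by [].
Qed.

(** Near x the form is a sum of dx_a tensor lambda_a, with functions and sections defined on all of
    M. Unlike extensions by vector fields, such an expression can be pulled back along any map. *)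
Definition loc1 (t : form (tanb M) L 1) x m (xa : 'I_m -> M -> R) (la : 'I_m -> sec L) :=
 [/\ forall a, smooth_fun (xa a), forall a, smooth_sec (la a) &
  \forall y \near (x : dtop M), forall v : tangent y, t y (fun _ => v) = \sum_a tapp v (xa a) *: la a y].

Lemma loc1_ex t x : is_form t -> exists m xa la, @loc1 t x m xa la.
move=> ft; have [q [psi [U0 [V [U0x C]]]]] := HC x.
have [U [E [Ux FE]]] := coords_frame C U0x.
exists n, q, (fun a y => t y (fun _ => E a y)); split.
- by case: C.
- by move=> a; apply: (form1_smooth ft); exact: (frame_smooth FE a).
apply: filterS (frame_open FE Ux) => y Uy v; have l := form1_lin ft (x := y).
rewrite {1}(frame_exp FE v Uy) (lin_sum l); apply: eq_bigr => a _; exact: (linZ l).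
Qed.

Definition loc2 (t : form (tanb M) L 2) x m (xa : 'I_m -> M -> R) (la : 'I_m -> 'I_m -> sec L) :=
 [/\ forall a, smooth_fun (xa a), forall a b, smooth_sec (la a b), forall a b y, la a b y = - la b a y &
  \forall y \near (x : dtop M), forall v w : tangent y,
   form2 t v w = \sum_a \sum_b (tapp v (xa a) * tapp w (xa b)) *: la a b y].

Lemma loc2_ex t x : is_form t -> exists m xa la, @loc2 t x m xa la.
move=> ft; have [q [psi [U0 [V [U0x C]]]]] := HC x.
have [U [E [Ux FE]]] := coords_frame C U0x.
exists n, q, (fun a b y => form2 t (E a y) (E b y)); split.
- by case: C.
- by move=> a b; apply: (form2_smooth ft); [exact: (frame_smooth FE a)|exact: (frame_smooth FE b)].
- by move=> a b y; exact: form2_anti.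
apply: filterS (frame_open FE Ux) => y Uy v w; have l := form2_lin1 ft (x := y) w.
rewrite {1}(frame_exp FE v Uy) (lin_sum l); apply: eq_bigr => a _; rewrite (linZ l).
have l2 := form2_lin2 ft (x := y) (E a y).
rewrite {1}(frame_exp FE w Uy) (lin_sum l2) scaler_sumr; apply: eq_bigr => b _.
by rewrite (linZ l2) scalerA.
Qed.

(** The right-hand side involves only the symbols of c and d and their values on the sections [la],
    all of which behave well under [Dmap]. Derivatives of the coefficients along the extensions
    cancel by commutation. *)
Lemma loc1_dD t x m xa la (c d : atiyah L x) : is_form t -> @loc1 t x m xa la -> form2 (dD (sigma_pull t)) c d =
 \sum_a (tapp (symbol d) (xa a) *: dapp c (la a) - tapp (symbol c) (xa a) *: dapp d (la a)).
move=> ft [sxa sla E]; have fs := form_sigma1 ft.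
have [X [Y [[sX sY] <- <- /near_self cXY]]] := commuting_ext2 c d.
rewrite (dD1C fs sX sY cXY).
have D (A B : sec DL') : smooth_sec A -> smooth_sec B -> dapp (A x) (fun y => sigma_pull t (fun _ => B y)) =
  \sum_a (tapp (symbol (A x)) (fun y => tapp (symbol (B y)) (xa a)) *: la a x + tapp (symbol (B x)) (xa a) *: dapp (A x) (la a)).
 move=> sA sB.
 have sm a : smooth_sec (fun y => tapp (symbol (B y)) (xa a) *: la a y).
  by apply: (smooth_secM oL) => //; exact: app_symbol.
 have -> : dapp (A x) (fun y => sigma_pull t (fun _ => B y)) =
   dapp (A x) (fun y => \sum_a tapp (symbol (B y)) (xa a) *: la a y).
  apply: (dapp_local oL (A x) (form1_smooth fs sB) (smooth_secS oL (index_enum _) sm)).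
  by apply: filterS E => y E; exact: E.
 rewrite (dapp_sum oL (A x)) //; apply: eq_bigr => a _; rewrite dappM //; exact: app_symbol.
rewrite !D // -sumrB; apply: eq_bigr => a _.
rewrite (comm_symbol sX sY (sxa a) cXY).
by line_ring oL.
Qed.

Lemma loc2_dD t x m xa la (c d e : atiyah L x) : is_form t -> @loc2 t x m xa la ->
 form3 (dD (sigma_pull t)) c d e = \sum_a \sum_b
  ((tapp (symbol d) (xa a) * tapp (symbol e) (xa b)) *: dapp c (la a b)
  - (tapp (symbol c) (xa a) * tapp (symbol e) (xa b)) *: dapp d (la a b)
  + (tapp (symbol c) (xa a) * tapp (symbol d) (xa b)) *: dapp e (la a b)).
move=> ft [sxa sla skew E]; have fs := form_sigma2 ft.
have [X [Y [Z [[sX sY sZ] [<- <- <-] /near_self[c1 c2 c3]]]]] := commuting_ext3 c d e.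
rewrite (dD2C fs sX sY sZ c1 c2 c3).
pose P (A B : sec DL') a := tapp (symbol (A x)) (fun y => tapp (symbol (B y)) (xa a)).
have D (A B C : sec DL') : smooth_sec A -> smooth_sec B -> smooth_sec C ->
 dapp (A x) (fun y => form2 (sigma_pull t) (B y) (C y)) =
  \sum_a \sum_b ((P A B a * tapp (symbol (C x)) (xa b) + tapp (symbol (B x)) (xa a) * P A C b) *: la a b x +
   (tapp (symbol (B x)) (xa a) * tapp (symbol (C x)) (xa b)) *: dapp (A x) (la a b)).
 move=> sA sB sC.
 have sf (V : sec DL') a : smooth_sec V -> smooth_fun (fun y => tapp (symbol (V y)) (xa a)).
  by move=> sV; exact: app_symbol.
 have sm a b : smooth_sec (fun y => (tapp (symbol (B y)) (xa a) * tapp (symbol (C y)) (xa b)) *: la a b y).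
  by apply: (smooth_secM oL) => //; apply: smoothM; exact: sf.
 have ss a : smooth_sec (fun y => \sum_b (tapp (symbol (B y)) (xa a) * tapp (symbol (C y)) (xa b)) *: la a b y).
  exact: (smooth_secS oL).
 have -> : dapp (A x) (fun y => form2 (sigma_pull t) (B y) (C y)) =
   dapp (A x) (fun y => \sum_a \sum_b (tapp (symbol (B y)) (xa a) * tapp (symbol (C y)) (xa b)) *: la a b y).
  apply: (dapp_local oL (A x) (form2_smooth fs sB sC) (smooth_secS oL (index_enum _) ss)).
  by apply: filterS E => y E; rewrite sigma2E E.
 rewrite (dapp_sum oL (A x)) //; apply: eq_bigr => a _.
 rewrite (dapp_sum oL (A x)) //; apply: eq_bigr => b _; rewrite dappM //.
  by rewrite tappM; [|exact: sf|exact: sf].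
 by apply: smoothM; exact: sf.
rewrite !D //.
have e1 a : P Y X a = P X Y a by rewrite /P (comm_symbol sX sY (sxa a) c1).
have e2 a : P Z X a = P X Z a by rewrite /P (comm_symbol sX sZ (sxa a) c2).
have e3 a : P Z Y a = P Y Z a by rewrite /P (comm_symbol sY sZ (sxa a) c3).
(* Second derivatives in X, Y and in Y, Z cancel term by term by commutation; those in X, Z cancel
   only after exchanging the two summation indices, by skewness of [la]. *)
have K : \sum_a \sum_b (tapp (symbol (Y x)) (xa a) * P X Z b) *: la a b x =
  - \sum_a \sum_b (P X Z a * tapp (symbol (Y x)) (xa b)) *: la a b x.
 rewrite exchange_big /= -sumrN; apply: eq_bigr => a _; rewrite -sumrN; apply: eq_bigr => b _.
 by rewrite (skew b a) scalerN mulrC.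
move/eqP: K; rewrite -subr_eq0 opprK => /eqP K.
apply/eqP; rewrite -subr_eq0 -[X in _ == X]K; apply/eqP; rewrite -!(sumrB, big_split) /=; apply: eq_bigr => a _.
rewrite -!(sumrB, big_split) /=; apply: eq_bigr => b _.
rewrite e1 e2 e3; by line_ring oL.
Qed.

End ExtD.

End Koszul.

(** * Compatibility of pull-backs with the differential *)

Section Pullback.
Variable R : realType.
Variables (M N : dspace R) (f : M -> N) (L : bundle M) (L' : bundle N) (F : vbmap f L L') (m n : nat).
Hypotheses (oL : bundle_ok L 1) (oL' : bundle_ok L' 1) (hF : line_map F).
Hypotheses (cM : coordinatized M m) (cN : coordinatized N n).

Let sf := line_smooth hF.

Lemma pull_loc1 t x k (xa : 'I_k -> N -> R) la : is_form t -> @loc1 R N L' t (f x) k xa la ->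
 @loc1 R M L (pullT F t) x k (fun a y => xa a (f y)) (fun a => pullsec F (la a)).
move=> ft [sxa sla E]; split.
- by move=> a; exact: sf.
- by move=> a; exact: (smooth_pullsec oL oL' hF).
apply: filterS (smooth_near sf E) => y Ey v; rewrite /pullT /pull Ey.
rewrite (lin_sum (finv_linear oL oL' hF (x := y))); apply: eq_bigr => a _.
by rewrite (linZ (finv_linear oL oL' hF (x := y))) dmapE.
Qed.

Lemma form2_pull (E : bundle M) (E' : bundle N) (dF : vbmap f E E') (t : form E' L' 2) x (a b : E x) :
 form2 (pull F dF t) a b = finv F (form2 t (dF x a) (dF x b)).
by rewrite /form2 /pull; congr (finv F (t _ _)); rewrite [LHS]fun2E. Qed.
Lemma form3_pull (E : bundle M) (E' : bundle N) (dF : vbmap f E E') (t : form E' L' 3) x (a b c : E x) :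
 form3 (pull F dF t) a b c = finv F (form3 t (dF x a) (dF x b) (dF x c)).
by rewrite /form3 /pull; congr (finv F (t _ _)); rewrite [LHS]fun3E. Qed.

Lemma pull_loc2 t x k (xa : 'I_k -> N -> R) la : is_form t -> @loc2 R N L' t (f x) k xa la ->
 @loc2 R M L (pullT F t) x k (fun a y => xa a (f y)) (fun a b => pullsec F (la a b)).
move=> ft [sxa sla skew E]; have lf y := finv_linear oL oL' hF (x := y); split.
- by move=> a; exact: sf.
- by move=> a b; exact: (smooth_pullsec oL oL' hF).
- by move=> a b y; rewrite /pullsec skew (linN (lf y)).
apply: filterS (smooth_near sf E) => y Ey v w; rewrite form2_pull Ey.
rewrite (lin_sum (lf y)); apply: eq_bigr => a _; rewrite (lin_sum (lf y)); apply: eq_bigr => b _.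
by rewrite (linZ (lf y)) !dmapE.
Qed.

Lemma sec_near_smooth (l : sec L) : (forall x, exists2 l', smooth_sec l' & \forall y \near (x : dtop M), l y = l' y) ->
 smooth_sec l.
move=> H; apply: smooth_map_local => x; have [l' sl' E] := H x; exists (fun y => mkt (l' y)) => //.
by apply: filterS E => y ->.
Qed.

Lemma form_pullT1 t : is_form t -> is_form (pullT F t : form (tanb M) L 1).
move=> ft; have lf y := finv_linear oL oL' hF (x := y); apply: is_form1.
 move=> x a v w; rewrite /pullT /pull (dmap_lin sf a) (form1_lin ft (x := f x) a).
 exact: lf.
move=> X sX; apply: sec_near_smooth => x.
have [k [xa [la H]]] := loc1_ex cN (f x) ft; have [sxa sla E] := pull_loc1 ft H.
exists (fun y => \sum_a tapp (X y) (fun z => xa a (f z)) *: pullsec F (la a) y).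
 apply: (smooth_secS oL) => a; apply: (smooth_secM oL) => //.
 exact: (sX _ (tanb_lin (sxa a)).1).
by apply: filterS E => y ->.
Qed.

Lemma form_pullT2 t : is_form t -> is_form (pullT F t : form (tanb M) L 2).
move=> ft; have lf y := finv_linear oL oL' hF (x := y); apply: is_form2.
- move=> x b a v w; rewrite !form2_pull (dmap_lin sf a) (form2_lin1 ft (x := f x) _ a).
 exact: lf.
- by move=> x a b; rewrite !form2_pull (form2_anti ft) (linN (lf x)).
move=> X Y sX sY; apply: sec_near_smooth => x.
have [k [xa [la H]]] := loc2_ex cN (f x) ft; have [sxa sla _ E] := pull_loc2 ft H.
exists (fun y => \sum_a \sum_b (tapp (X y) (fun z => xa a (f z)) * tapp (Y y) (fun z => xa b (f z))) *: pullsec F (la a b) y).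
 apply: (smooth_secS oL) => a; apply: (smooth_secS oL) => b; apply: (smooth_secM oL) => //.
 by apply: smoothM; [exact: (sX _ (tanb_lin (sxa a)).1)|exact: (sY _ (tanb_lin (sxa b)).1)].
by apply: filterS E => y ->.
Qed.

Lemma pull_sigma k (t : form (tanb N) L' k) : pullD F (sigma_pull t) = sigma_pull (pullT F t).
apply/dfunext => x; apply/funext => v.
rewrite /pullD /pullT /pull /sigma_pull; congr (finv F (t _ _)).
by apply/dfunext => i; rewrite (symbol_Dmap oL oL' hF).
Qed.

(** Both sides are evaluated by [loc1_dD], on a local expression of t and on its pull-back. They
    agree because the symbol of DF(d) is the image of that of d, and because DF(d) applied to lambda
    is F applied to d(F^* lambda). *)
Lemma pull_dD1 (t : form (tanb N) L' 1) : is_form t -> pullD F (dD (sigma_pull t)) = dD (sigma_pull (pullT F t)).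
move=> ft; apply/dfunext => x; apply/funext => v; rewrite (fun2E v).
have [k [xa [la H]]] := loc1_ex cN (f x) ft; have H' := pull_loc1 ft H.
have lf := finv_linear oL oL' hF (x := x); have [sxa sla _] := H.
rewrite -[LHS]/(form2 (pullD F _) _ _) -[RHS]/(form2 (dD _) _ _) form2_pull.
rewrite (loc1_dD oL' cN _ _ ft H) (loc1_dD oL cM _ _ (form_pullT1 ft) H').
rewrite (lin_sum lf); apply: eq_bigr => a _; rewrite (linB lf) !(linZ lf).
by rewrite !(symbol_Dmap oL oL' hF) !dmapE // !(DmapP oL oL' hF) // !(finvK oL oL' hF).
Qed.

Lemma pull_dD2 (t : form (tanb N) L' 2) : is_form t -> pullD F (dD (sigma_pull t)) = dD (sigma_pull (pullT F t)).
move=> ft; apply/dfunext => x; apply/funext => v; rewrite (fun3E v).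
have [k [xa [la H]]] := loc2_ex cN (f x) ft; have H' := pull_loc2 ft H.
have lf := finv_linear oL oL' hF (x := x); have [sxa sla _ _] := H.
rewrite -[LHS]/(form3 (pullD F _) _ _ _) -[RHS]/(form3 (dD _) _ _ _) form3_pull.
rewrite (loc2_dD oL' cN _ _ _ ft H) (loc2_dD oL cM _ _ _ (form_pullT2 ft) H').
rewrite (lin_sum lf); apply: eq_bigr => a _; rewrite (lin_sum lf); apply: eq_bigr => b _.
rewrite (linD lf) (linB lf) !(linZ lf).
by rewrite !(symbol_Dmap oL oL' hF) !dmapE // !(DmapP oL oL' hF) // !(finvK oL oL' hF).
Qed.

Lemma finv0 x : finv F (0 : L' (f x)) = 0.
exact: (lin0 (finv_linear oL oL' hF (x := x))). Qed.
Lemma pull_fadd (E : bundle M) (E' : bundle N) (dF : vbmap f E E') k (w w' : form E' L' k) :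
 pull F dF (fadd w w') = fadd (pull F dF w) (pull F dF w').
apply/dfunext => x; apply/funext => v.
exact: (linD (finv_linear oL oL' hF (x := x))).
Qed.
Lemma pull_fsub (E : bundle M) (E' : bundle N) (dF : vbmap f E E') k (w w' : form E' L' k) :
 pull F dF (fsub w w') = fsub (pull F dF w) (pull F dF w').
apply/dfunext => x; apply/funext => v.
exact: (linB (finv_linear oL oL' hF (x := x))).
Qed.

End Pullback.

(** * Existence of connections *)

Section Connections.
Variable R : realType.
Variables (M : dspace R) (L : bundle M).
Hypotheses (oL : bundle_ok L 1) (mM : is_manifold M).

Definition chart_data : Type := ((M -> R) * set M * sec L * (tot L -> R))%type.
Definition good (c : chart_data) := [/\ smooth_fun c.1.1.1, @lframe R M L c.1.1.2 c.1.2 c.2 &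
 forall y, c.1.1.1 y != 0 -> c.1.1.2 y].

(** A countable basis of the topology indexes the charts: the index of a basic set receives a chart
    whose bump function is 1 on that set, if there is one, and a trivial chart with empty domain
    otherwise. *)
Lemma good_cover : exists c : nat -> chart_data, (forall k, good (c k)) /\
 forall x, exists k, \forall y \near (x : dtop M), (c k).1.1.1 y = 1.
have [_ [B cB [oB bB]] _] := mM; have [code codeI] := (elimT (countable_injP B)) cB.
pose Q (b : set (dtop M)) (c : chart_data) := forall y, b y -> c.1.1.1 y = 1.
have /boolp.choice[c Hc] : forall k : nat, exists c : chart_data, good c /\
  forall b, B b -> code b = k -> (exists2 c', good c' & Q b c') -> Q b c.
 move=> k; have [[b [Bb bk [c gc Qc]]]|nb] := pselect (exists b, [/\ B b, code b = k & exists2 c', good c' & Q b c']).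
  exists c; split=> // b' Bb' b'k _.
  by rewrite (codeI b' b) ?inE // b'k bk.
 exists (fun=> 0, set0, (fun=> 0), (fun=> 0)); split.
  split=> [||y] /=; [exact: smooth_cst| |by rewrite eqxx].
  split=> //; [exact: (smooth_sec0 oL)|].
  by split=> [|y a v w]; [exact: smooth_cst|rewrite scaler0 addr0].
 by move=> b Bb bk Hb; exfalso; apply: nb; exists b.
exists c; split=> [k|x]; first by have [] := Hc k.
have [U [e [xi [Ux F]]]] := ok_lframe x oL.
have [chi [schi chi01 chi1 chi0]] := bump (lframe_open F Ux).
have [b [Bb bx] bW] := bB x _ chi1.
exists (code b); have [_ H] := Hc (code b).
have Qb : Q b (c (code b)).
 apply: H => //; exists (chi, U, e, xi) => //; split=> // y /= nz.
 apply: contrapT => nU; move/eqP: nz; apply; apply: near_self (chi0 y _) => /near_self.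
 by [].
have : \forall y \near (x : dtop M), b y by apply: open_nbhs_nbhs; split => //; exact: oB.
by apply: filterS => y /Qb.
Qed.

(** The functions psi_k = rho_k times the product of the earlier 1 - rho_j form a partition of
    unity: near each point some rho_k equals 1, so the later psi_j vanish there and the first k + 1
    add up to 1. The connection is the psi-weighted sum of the local flat ones. *)
Theorem connection_exists : exists nabla : connection L, is_connection nabla.
have [c [gc cov]] := good_cover.
pose rho k := (c k).1.1.1; pose U k := (c k).1.1.2; pose e k := (c k).1.2; pose xi k := (c k).2.
have srho k : smooth_fun (rho k) by have [] := gc k.
have F k : @lframe R M L (U k) (e k) (xi k) by have [] := gc k.
have rU k y : rho k y != 0 -> U k y by have [_ _] := gc k; exact.
pose psi k y := rho k y * \prod_(j < k) (1 - rho j y).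
have psum N y : \sum_(k < N) psi k y = 1 - \prod_(j < N) (1 - rho j y).
 elim: N => [|N IH]; first by rewrite !big_ord0 subrr.
 by rewrite !big_ord_recr /= IH /psi; ring.
have prod0 k y N : rho k y = 1 -> (k < N)%N -> \prod_(j < N) (1 - rho j y) = 0.
 move=> r1 kN; rewrite (bigD1 (Ordinal kN)) //= r1 subrr mul0r; by [].
have psiz k y N : rho k y = 1 -> (k < N)%N -> psi N y = 0.
 by move=> r1 kN; rewrite /psi (prod0 k) // mulr0.
have cut k y (a : nat -> L y) N : rho k y = 1 -> (k < N)%N ->
  \sum_(j < k.+1) psi j y *: a j = \sum_(j < N) psi j y *: a j.
 move=> r1; elim: N => // N IH; rewrite ltnS leq_eqVlt => /predU1P[->//|kN].
 by rewrite [RHS]big_ord_recr /= (psiz k y N r1 kN) scale0r addr0; exact: IH.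
(* The connection over the j-th chart for which the generator e_j is parallel. *)
pose term x (v : tangent x) (l : sec L) j := tapp v (fun z => xi j (mkt (l z))) *: e j x.
pose P x (v : tangent x) (d : atiyah L x) := symbol d = v /\
 forall k, rho k x = 1 -> forall l, smooth_sec l -> dapp d l = \sum_(j < k.+1) psi j x *: term x v l j.
pose nabla : connection L := fun x v => the 0 (P x v).
have nP x v : P x v (nabla x v).
 apply: theP; have [k /near_self r1] := cov x.
 pose Qd j (d : atiyah L x) := U j x -> symbol d = v /\ dapp d (e j) = 0.
 have /boolp.choice[d Hd] : forall j, exists d, Qd j d.
  move=> j; have [Uj|nU] := pselect (U j x); last by exists 0.
  by have [d d1 d2] := atiyah_make oL (F j) v 0 Uj; exists d.
 have pU j : psi j x != 0 -> U j x.
  by rewrite /psi mulf_eq0 negb_or => /andP[/rU].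
 exists (\sum_(j < k.+1) psi j x *: d j); split.
  have ls := @symbol_lin R M L oL x; rewrite (lin_sum ls).
  rewrite (eq_bigr (fun j : 'I_k.+1 => psi j x *: v)).
   by rewrite -scaler_suml psum (prod0 k) // subr0 scale1r.
  move=> j _; rewrite (linZ ls); have [->|/pU Uj] := eqVneq (psi j x) 0; first by rewrite !scale0r.
  by have [-> _] := Hd j Uj.
 move=> k' r1' l sl; have la : linear (fun d : atiyah L x => dapp d l) by [].
 rewrite (lin_sum la) (cut k' _ _ (k + k').+1) ?ltnS ?leq_addl //.
 rewrite -(cut k _ _ (k + k').+1) ?ltnS ?leq_addr //.
 apply: eq_bigr => j _; rewrite (linZ la); have [->|/pU Uj] := eqVneq (psi j x) 0; first by rewrite !scale0r.
 by have [E1 E2] := Hd j Uj; rewrite (dapp_frame oL (F j)) // E1 E2 scaler0 addr0.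
have nE x v k l : rho k x = 1 -> smooth_sec l -> dapp (nabla x v) l = \sum_(j < k.+1) psi j x *: term x v l j.
 by move=> r1 sl; have [_ H] := nP x v; exact: H.
exists nabla; split.
- move=> x a v w; apply: atiyah_ext => l sl; have [k /near_self r1] := cov x.
 have E (d d' : atiyah L x) : dapp (a *: d + d') l = a *: dapp d l + dapp d' l by [].
 rewrite E !(nE x _ k) // scaler_sumr -big_split; apply: eq_bigr => j _ /=.
 rewrite /term; have -> : forall g, tapp (a *: v + w) g = a * tapp v g + tapp w g by [].
 by line_ring oL.
- by move=> x v; have [E _] := nP x v; have := @symbolP R M L x (nabla x v); rewrite E.
move=> X l sX sl; apply: sec_near_smooth => x; have [k H] := cov x.
exists (fun y => \sum_(j < k.+1) psi j y *: term y (X y) l j); last first.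
 by apply: filterS H => y r1; exact: nE.
apply: (smooth_secS oL) => j; apply: (smooth_secM oL).
 apply: smoothM => //; apply: smooth_prod => i.
 by apply: smoothB => //; exact: smooth_cst.
apply: (smooth_secM oL); last exact: lframe_smooth (F j).
exact: (sX _ (tanb_lin (lframe_sec (F j) sl)).1).
Qed.

End Connections.

(** * Lie groupoids and line bundle groupoids *)

Section FiberProduct.
Variable R : realType.
Variables (M N P : dspace R) (f : M -> N) (g : P -> N) (A : set (prodd M P)) (m n k : nat).
Hypotheses (HA : forall s, A s <-> f s.1 = g s.2) (subf : submersion f) (sg : smooth_map g).
Hypotheses (cM : coordinatized M m) (cN : coordinatized N n) (cP : coordinatized P k).

Definition fpr1 (s : subd A) : M := (sval s).1.
Definition fpr2 (s : subd A) : P := (sval s).2.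
Lemma smooth_fpr1 : smooth_map fpr1.
exact: (smap_comp (@smooth_sval _ _ A) smooth_fst). Qed.
Lemma smooth_fpr2 : smooth_map fpr2.
exact: (smap_comp (@smooth_sval _ _ A) smooth_snd). Qed.
Lemma fprE s : f (fpr1 s) = g (fpr2 s). by apply/HA; case: s. Qed.

Lemma smooth_into_fp (N' : dspace R) (h : N' -> subd A) : smooth_map (fun y => fpr1 (h y)) ->
 smooth_map (fun y => fpr2 (h y)) -> smooth_map h.
move=> s1 s2; apply: smooth_into_sub; have := smooth_pair s1 s2; congr smooth_map.
by apply/funext => y; rewrite -surjective_pairing.
Qed.

Lemma fp_coords (s0 : subd A) : exists p (zc : 'I_n -> N -> R) psiN UN VN (y : 'I_p -> M -> R) psiM UM VM
  (kc : 'I_k -> P -> R) psiP UP VP psi U V, [/\ (n + p)%N = m, UN (f (fpr1 s0)) /\ coords zc psiN UN VN,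
   UM (fpr1 s0) /\ coords (qsplit (fun i => zc i \o f) y) psiM UM VM, UP (fpr2 s0) /\ coords kc psiP UP VP &
   U s0 /\ @coords R (subd A) _ (qsplit (fun j s => y j (fpr1 s)) (fun l s => kc l (fpr2 s))) psi U V].
have [zc [psiN [UN [VN [UNx CN]]]]] := cN (f (fpr1 s0)).
have [q [psi0 [U0 [V0 [U0x C0]]]]] := cM (fpr1 s0).
have [kc [psiP [UP [VP [UPx CP]]]]] := cP (fpr2 s0).
have [sf surj] := subf.
have [p [pE [y [psiM [UM [VM [UMx CM]]]]]]] := submersion_coords CN UNx C0 U0x sf (surj _).
have [psi [U [V H]]] := fiber_coords HA sf sg CN UNx CM UMx CP UPx.
by exists p, zc, psiN, UN, VN, y, psiM, UM, VM, kc; exists psiP, UP, VP, psi, U, V.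
Qed.

Lemma fp_coordinatized : coordinatized (subd A) (m - n + k).
move=> s0; have [p [zc [psiN [UN [VN [y [psiM [UM [VM [kc [psiP [UP [VP [psi [U [V [pE _ _ _ H]]]]]]]]]]]]]]]]] := fp_coords s0.
have -> : (m - n)%N = p by rewrite -pE addKn.
by exists (qsplit (fun j s => y j (fpr1 s)) (fun l s => kc l (fpr2 s))), psi, U, V.
Qed.

(** The dual functionals are differentials of functions pulled back from one of the factors, so
    equality and smoothness of tangent vectors of the fiber product can be tested on the two
    projections. *)
Lemma fp_frame (s0 : subd A) : exists r U (e : 'I_r -> sec (tanb (subd A))) (Q : 'I_r -> subd A -> R),
 [/\ U s0, frame U e (fun i p => tapp (projT2 p) (Q i)) &
   forall i, (exists2 y, smooth_fun y & Q i = fun s => y (fpr1 s)) \/ (exists2 y, smooth_fun y & Q i = fun s => y (fpr2 s))].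
have [p [zc [psiN [UN [VN [y [psiM [UM [VM [kc [psiP [UP [VP [psi [U [V [pE _ [_ CM] [_ CP] [Us C]]]]]]]]]]]]]]]]]] := fp_coords s0.
have [U' [e [U'x F]]] := coords_frame C Us.
exists _, U', e, (qsplit (fun j s => y j (fpr1 s)) (fun l s => kc l (fpr2 s))); split=> // i.
rewrite -(fintype.splitK i); case: (fintype.split i) => j /=.
 left; exists (y j); last by rewrite qsplitl.
 by have [+ _ _ _ _] := CM => /(_ (rshift n j)); rewrite qsplitr.
by right; exists (kc j); [by case: CP|rewrite qsplitr].
Qed.

Lemma fp_tangent_inj (s : subd A) (u u' : tangent s) :
 dmap fpr1 u = dmap fpr1 u' -> dmap fpr2 u = dmap fpr2 u' -> u = u'.
move=> E1 E2; have [r [U [e [Q [Us F HQ]]]]] := fp_frame s.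
apply: (frame_eq F Us) => i /=; have [[y sy ->]|[y sy ->]] := HQ i.
 by rewrite -[LHS](dmapE u smooth_fpr1 sy) -[RHS](dmapE u' smooth_fpr1 sy) E1.
by rewrite -[LHS](dmapE u smooth_fpr2 sy) -[RHS](dmapE u' smooth_fpr2 sy) E2.
Qed.

(** The vector u is prescribed by its derivatives of the coordinates: v on the transverse ones of M,
    w on those of P. On the remaining coordinates of M, pulled back along f, agreement is the
    compatibility of v and w. *)
Lemma fp_tangent (s : subd A) (v : tangent (fpr1 s)) (w : tangent (fpr2 s)) : tmkt (dmap f v) = tmkt (dmap g w) ->
 exists u : tangent s, dmap fpr1 u = v /\ dmap fpr2 u = w.
move=> E.
have [p [zc [psiN [UN [VN [y [psiM [UM [VM [kc [psiP [UP [VP [psi [U [V [pE [UNs CN] [UMs CM] [UPs CP] [Us C]]]]]]]]]]]]]]]]]] := fp_coords s.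
have [sf _] := subf; have s1 := smooth_fpr1; have s2 := smooth_fpr2.
have szc i : smooth_fun (zc i) by have [] := CN.
have sy j : smooth_fun (y j) by have [+ _ _ _ _] := CM => /(_ (rshift n j)); rewrite qsplitr.
have sk l : smooth_fun (kc l) by have [] := CP.
have [U' [e [U'x F]]] := coords_frame C Us.
pose c (i : 'I_(p + k)) : R := match fintype.split i with inl j => tapp v (y j) | inr l => tapp w (kc l) end.
pose u : tangent s := \sum_i c i *: e i s.
have uQ i : tapp u (qsplit (fun j s => y j (fpr1 s)) (fun l s => kc l (fpr2 s)) i) = c i.
 exact: (frame_xi_comb (r := p + k) F i c U'x).
have uy j : tapp u (fun s => y j (fpr1 s)) = tapp v (y j).
 have := uQ (lshift k j); rewrite qsplitl /c.
 by have := fintype.unsplitK (inl j : 'I_p + 'I_k) => /= ->.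
have uk l : tapp u (fun s => kc l (fpr2 s)) = tapp w (kc l).
 have := uQ (rshift p l); rewrite qsplitr /c.
 by have := fintype.unsplitK (inr l : 'I_p + 'I_k) => /= ->.
have e2 : dmap fpr2 u = w.
 by apply: (tangent_coords_eq CP UPs) => l; rewrite dmapE // -uk.
exists u; split=> //.
apply: (tangent_coords_eq CM UMs) => i; rewrite -(fintype.splitK i); case: (fintype.split i) => j /=.
 rewrite qsplitl dmapE //; last exact: sf.
 have -> : tapp v (zc j \o f) = tapp (dmap f v) (zc j) by rewrite dmapE.
 have := congr1 (fun q : tot (tanb N) => tapp (projT2 q) (zc j)) E => /= ->.
 rewrite -e2 !dmapE //; last exact: sg.
 by congr tapp; apply/funext => z /=; rewrite fprE.
by rewrite qsplitr dmapE // -uy.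
Qed.

Lemma smooth_fp_tangent (N' : dspace R) (h : N' -> subd A) (X : forall y, tangent (h y)) : smooth_map h ->
 smooth_map (fun y => tmkt (dmap fpr1 (X y))) -> smooth_map (fun y => tmkt (dmap fpr2 (X y))) ->
 smooth_map (fun y => tmkt (X y)).
move=> sh s1 s2; apply: smooth_map_at => x q gq.
have [r [U [e [Q [Us F HQ]]]]] := fp_frame (h x).
apply: (frame_map_at (E := tanb (subd A)) F sh Us) => // i /=.
apply: smooth_atW; have [[y sy ->]|[y sy ->]] := HQ i.
 have := s1 _ (tanb_lin sy).1; congr smooth_fun.
 by apply/funext => z /=; rewrite dmapE //; exact: smooth_fpr1.
have := s2 _ (tanb_lin sy).1; congr smooth_fun.
by apply/funext => z /=; rewrite dmapE //; exact: smooth_fpr2.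
Qed.

End FiberProduct.

Section Misc.
Variable R : realType.
Implicit Types M N P : dspace R.

Lemma smooth_dmap M N (f : M -> N) P (g : P -> M) (X : forall y, tangent (g y)) : smooth_map f ->
 smooth_map g -> smooth_map (fun y => tmkt (X y)) -> smooth_map (fun y => tmkt (dmap f (X y))).
move=> sf sg sX; apply: smap_gen => q [[h gh ->]|[h sh ->]].
 exact: (sg _ (sf _ (smooth_gen gh))).
have := sX _ (tanb_lin (sf _ sh)).1; congr smooth_fun.
by apply/funext => y /=; rewrite dmapE.
Qed.

Lemma smooth_totmap M N P (f : M -> N) (E : bundle M) (E' : bundle N) (F : vbmap f E E')
  (g : P -> M) (l : forall y, E (g y)) : smooth_map (totmap F) ->
 smooth_lift l -> smooth_map (fun y => mkt (F _ (l y))).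
by move=> sF sl; exact: (smap_comp sl sF). Qed.

End Misc.

Section CastFacts.
Variable R : realType.
Implicit Types M N P : dspace R.

Lemma mkt_eq0 M (E : bundle M) x y (v : E x) : mkt v = mkt (0 : E y) -> v = 0.
move=> e; have xy : x = y by exact: (congr1 (@projT1 _ _) e).
by subst y; exact: mkt_inj e.
Qed.
Lemma mkt_base M (E : bundle M) x y (v : E x) (w : E y) : mkt v = mkt w -> x = y.
exact: (congr1 (@projT1 _ _)). Qed.
Lemma cast_linear M (E : bundle M) (x y : M) : linear (fun v : E x => cast y v).
have [e|ne] := pselect (x = y); first by subst y => a v w; rewrite !castE.
by move=> a v w; rewrite /cast; case: pselect => // _; rewrite scaler0 addr0.
Qed.
Lemma cast_eqP M (E : bundle M) (x y : M) (v : E x) (w : E y) : x = y -> mkt v = mkt w <-> cast y v = w.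
by move=> e; subst y; rewrite castE; split=> [/mkt_inj|->]. Qed.
Lemma totmapE M N (f : M -> N) (E : bundle M) (E' : bundle N) (F : vbmap f E E') x y (v : E x) (w : E y) :
 mkt v = mkt w -> mkt (F _ v) = mkt (F _ w).
by move=> e; have := congr1 (totmap F) e. Qed.
Lemma mktD M (E : bundle M) x y a (v v' : E x) (w w' : E y) : mkt v = mkt w -> mkt v' = mkt w' ->
 mkt (a *: v + v') = mkt (a *: w + w').
move=> e; have xy := mkt_base e; subst y; by rewrite (mkt_inj e) => /mkt_inj ->.
Qed.
End CastFacts.

(** * Lie groupoids and their tangent groupoids *)

Section LieGroupoid.
Variables (R : realType) (G : groupoid R).
Hypothesis hG : is_lie_groupoid G.

Lemma src_subm : submersion (@src _ G). by case: hG => _ []. Qed.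
Lemma tgt_subm : submersion (@tgt _ G). by case: hG => _ []. Qed.
Lemma smooth_src : smooth_map (@src _ G). by case: src_subm. Qed.
Lemma smooth_tgt : smooth_map (@tgt _ G). by case: tgt_subm. Qed.
Lemma smooth_uni : smooth_map (@uni _ G). by case: hG => _ _ []. Qed.
Lemma smooth_ginv : smooth_map (@inv _ G). by case: hG => _ _ []. Qed.
Lemma src_uni (x : ob G) : src (uni x) = x. by case: hG => _ _ _ [/(_ x)[]]. Qed.
Lemma tgt_uni (x : ob G) : tgt (uni x) = x. by case: hG => _ _ _ [/(_ x)[]]. Qed.
Lemma src_inv (g : ar G) : src (inv g) = tgt g. by case: hG => _ _ _ [_ /(_ g)[]]. Qed.
Lemma tgt_inv (g : ar G) : tgt (inv g) = src g. by case: hG => _ _ _ [_ /(_ g)[]]. Qed.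
Lemma src_mul (g h : ar G) : src g = tgt h -> src (mul g h) = src h.
by case: hG => _ _ _ [_ _ H] _ /H[]. Qed.
Lemma tgt_mul (g h : ar G) : src g = tgt h -> tgt (mul g h) = tgt g.
by case: hG => _ _ _ [_ _ H] _ /H[]. Qed.
Lemma gmulA (g h k : ar G) : src g = tgt h -> src h = tgt k -> mul (mul g h) k = mul g (mul h k).
by case: hG => _ _ _ _ [H _ _]; exact: H. Qed.
Lemma mul_uni (g : ar G) : mul g (uni (src g)) = g. by case: hG => _ _ _ _ [_ /(_ g)[]]. Qed.
Lemma uni_mul (g : ar G) : mul (uni (tgt g)) g = g. by case: hG => _ _ _ _ [_ /(_ g)[]]. Qed.
Lemma mul_inv (g : ar G) : mul g (inv g) = uni (tgt g). by case: hG => _ _ _ _ [_ _ /(_ g)[]]. Qed.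
Lemma inv_mul (g : ar G) : mul (inv g) g = uni (src g). by case: hG => _ _ _ _ [_ _ /(_ g)[]]. Qed.
Lemma mulgVK (g h : ar G) : src g = src h -> mul (mul g (inv h)) h = g.
by move=> e; rewrite gmulA ?tgt_inv ?src_inv // inv_mul -e mul_uni. Qed.
Lemma mulgK (g h : ar G) : src g = tgt h -> mul (mul g h) (inv h) = g.
by move=> e; rewrite gmulA ?tgt_inv // mul_inv -e mul_uni. Qed.
Lemma invgK (g : ar G) : inv (inv g) = g.
have <- : mul (mul g (inv g)) (inv (inv g)) = inv (inv g).
 by rewrite mul_inv -src_inv -tgt_inv uni_mul.
by rewrite mulgK // tgt_inv.
Qed.

Lemma smooth_mul (N : dspace R) (f h : N -> ar G) : smooth_map f -> smooth_map h ->
 (forall y, src (f y) = tgt (h y)) -> smooth_map (fun y => mul (f y) (h y)).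
move=> sf sh c; have [_ _ [_ _ sm] _ _] := hG.
have s2 : smooth_map (fun y : N => mkar2 (c y)) by apply: smooth_into_sub; exact: smooth_pair sf sh.
exact: (smap_comp s2 sm).
Qed.

Lemma ob_coord : exists m, coordinatized (ob G) m.
by have [[H _] _ _ _ _] := hG; exact: manifold_coords H. Qed.
Lemma ar_coord : exists n, coordinatized (ar G) n.
by have [[_ H] _ _ _ _] := hG; exact: manifold_coords H. Qed.

Lemma smooth_pr1 : smooth_map (@pr1 R G).
exact: smooth_fpr1. Qed.
Lemma smooth_pr2 : smooth_map (@pr2 R G).
exact: smooth_fpr2. Qed.
Lemma ar2E (p : ar2 G) : src (pr1 p) = tgt (pr2 p). by case: p. Qed.
Lemma smooth_mul2 : smooth_map (@mul2 R G).
exact: (smooth_mul smooth_pr1 smooth_pr2 ar2E). Qed.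
Lemma src_mul2 p : src (@mul2 R G p) = src (pr2 p). exact: src_mul (ar2E p). Qed.
Lemma tgt_mul2 p : tgt (@mul2 R G p) = tgt (pr1 p). exact: tgt_mul (ar2E p). Qed.

Section Tangents.
Variables (m n : nat).
Hypotheses (cM : coordinatized (ob G) m) (cG : coordinatized (ar G) n).
Let HA (s : prodd (ar G) (ar G)) : composable s <-> src s.1 = tgt s.2 := iff_refl _.

Lemma ar2_coord : coordinatized (ar2 G) (n - m + n).
exact: (fp_coordinatized HA src_subm smooth_tgt cG cM cG). Qed.

Definition tcomp (g h : ar G) (v : tangent g) (w : tangent h) := tmkt (dmap src v) = tmkt (dmap tgt w).

Lemma ar2_tangent (g h : ar G) (c : src g = tgt h) (v : tangent g) (w : tangent h) : tcomp v w ->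
 exists u : @tangent R (ar2 G) (mkar2 c), dmap (@pr1 R G) u = v /\ dmap (@pr2 R G) u = w.
exact: (fp_tangent HA src_subm smooth_tgt cG cM cG (s := mkar2 c)). Qed.

(** A tangent vector of the space of composable pairs is determined by its two projections, so the
    choice made in [tmul] is unique. *)
Lemma tmulE (g h : ar G) (c : src g = tgt h) (u : @tangent R (ar2 G) (mkar2 c)) :
 tmul (dmap (@pr1 R G) u) (dmap (@pr2 R G) u) = dmap (@mul2 R G) u.
apply: the_eq; first by exists c, u.
move=> z [c' [u' [E1 E2 <-]]]; have cc : c' = c by exact: Prop_irrelevance.
subst c'; suff -> : u' = u by [].
exact: (fp_tangent_inj HA src_subm smooth_tgt cG cM cG E1 E2).
Qed.

Lemma tmulP (g h : ar G) (v : tangent g) (w : tangent h) (c : src g = tgt h) : tcomp v w ->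
 exists u : @tangent R (ar2 G) (mkar2 c),
  [/\ dmap (@pr1 R G) u = v, dmap (@pr2 R G) u = w & dmap (@mul2 R G) u = tmul v w].
by move=> tc; have [u [<- <-]] := ar2_tangent c tc; exists u; split=> //; rewrite tmulE.
Qed.

Lemma tcomp_base (g h : ar G) (v : tangent g) (w : tangent h) : tcomp v w -> src g = tgt h.
by move/(congr1 (@projT1 _ _)). Qed.

Lemma tmul_src (g h : ar G) (v : tangent g) (w : tangent h) : tcomp v w ->
 tmkt (dmap src (tmul v w)) = tmkt (dmap src w).
move=> tc; have c := tcomp_base tc; have [u [_ <- <-]] := tmulP c tc.
rewrite (dmap_compE (h := fun p => src (pr2 p)) u smooth_mul2 smooth_src src_mul2).
by rewrite (dmap_compE u smooth_pr2 smooth_src (fun _ => erefl)).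
Qed.

Lemma tmul_tgt (g h : ar G) (v : tangent g) (w : tangent h) : tcomp v w ->
 tmkt (dmap tgt (tmul v w)) = tmkt (dmap tgt v).
move=> tc; have c := tcomp_base tc; have [u [<- _ <-]] := tmulP c tc.
rewrite (dmap_compE (h := fun p => tgt (pr1 p)) u smooth_mul2 smooth_tgt tgt_mul2).
by rewrite (dmap_compE u smooth_pr1 smooth_tgt (fun _ => erefl)).
Qed.

Lemma tmul_linear (g h : ar G) a (v v' : tangent g) (w w' : tangent h) : tcomp v w -> tcomp v' w' ->
 tmul (a *: v + v') (a *: w + w') = a *: tmul v w + tmul v' w'.
move=> tc tc'; have c := tcomp_base tc.
have [u [<- <- <-]] := tmulP c tc; have [u' [<- <- <-]] := tmulP c tc'.
have := tmulE (a *: u + u').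
by rewrite (dmap_lin smooth_pr1 a) (dmap_lin smooth_pr2 a) (dmap_lin smooth_mul2 a).
Qed.

(* Stated in the total space, because the base points agree only propositionally. *)
Lemma tmul_map (N : dspace R) (f h k : N -> ar G) y (X : tangent y) (g1 g2 : ar G) (v : tangent g1) (w : tangent g2) :
 smooth_map f -> smooth_map h -> (forall y, src (f y) = tgt (h y)) -> (forall y, mul (f y) (h y) = k y) ->
 tmkt v = tmkt (dmap f X) -> tmkt w = tmkt (dmap h X) -> tmkt (tmul v w) = tmkt (dmap k X).
move=> sf sh c ck Ev Ew.
have e1 : g1 = f y by exact: (congr1 (@projT1 _ _) Ev).
have e2 : g2 = h y by exact: (congr1 (@projT1 _ _) Ew).
subst g1 g2; rewrite (mkt_inj Ev) (mkt_inj Ew).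
pose i (y : N) : ar2 G := mkar2 (c y).
have si : smooth_map i by apply: smooth_into_sub; exact: smooth_pair sf sh.
rewrite -(mkt_inj (dmap_compE (f := i) (g := @pr1 R G) (h := f) X si smooth_pr1 (fun _ => erefl))).
rewrite -(mkt_inj (dmap_compE (f := i) (g := @pr2 R G) (h := h) X si smooth_pr2 (fun _ => erefl))).
rewrite (tmulE (c := c y) (dmap i X)).
exact: (dmap_compE X si smooth_mul2 ck).
Qed.

Lemma smooth_tmul (N : dspace R) (f h : N -> ar G) (X : forall y, tangent (f y)) (Y : forall y, tangent (h y)) :
 smooth_map f -> smooth_map h -> smooth_map (fun y => tmkt (X y)) -> smooth_map (fun y => tmkt (Y y)) ->
 (forall y, tcomp (X y) (Y y)) -> smooth_map (fun y => tmkt (tmul (X y) (Y y))).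
move=> sf sh sX sY tc; pose i (y : N) : ar2 G := mkar2 (tcomp_base (tc y)).
have si : smooth_map i by apply: smooth_into_sub; exact: smooth_pair sf sh.
pose Pu y (u : @tangent R (ar2 G) (i y)) := dmap (@pr1 R G) u = X y /\ dmap (@pr2 R G) u = Y y.
pose u y := the 0 (Pu y).
have uP y : Pu y (u y) by apply: theP; have := ar2_tangent (tcomp_base (tc y)) (tc y); exact.
have su : smooth_map (fun y => tmkt (u y)).
 apply: (smooth_fp_tangent HA src_subm smooth_tgt cG cM cG si).
  by move: sX; fext => y; have [<- _] := uP y.
 by move: sY; fext => y; have [_ <-] := uP y.
have := smooth_dmap smooth_mul2 si su; fext => y.
by have [<- <-] := uP y; rewrite (tmulE (c := tcomp_base (tc y))).
Qed.

(* z = (z y^-1) y *)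
Lemma tmul_div (g h : ar G) (c : src g = tgt h) (z : tangent (mul g h)) (w : tangent h) :
 tmkt (dmap src z) = tmkt (dmap src w) -> exists2 v : tangent g, tcomp v w & tmul v w = z.
move=> E; pose Bs : set (prodd (ar G) (ar G)) := [set s | src s.1 = src s.2].
have HB s : Bs s <-> src s.1 = src s.2 by [].
have e0 : Bs (mul g h, h) by exact: src_mul.
pose s0 : subd Bs := exist _ (mul g h, h) e0.
have [u [u1 u2]] := fp_tangent HB src_subm smooth_src cG cM cG (s := s0) (v := z) (w := w) E.
pose f (s : subd Bs) := mul (fpr1 s) (inv (fpr2 s)).
have s1 := @smooth_fpr1 R (ar G) (ar G) Bs; have s2 := @smooth_fpr2 R (ar G) (ar G) Bs.
have fb s : src (@fpr1 R (ar G) (ar G) Bs s) = src (fpr2 s) by case: s.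
have sf : smooth_map f.
 by apply: smooth_mul => //; [exact: (smap_comp s2 smooth_ginv)|move=> s; rewrite tgt_inv fb].
have fg : f s0 = g by rewrite /f /= mulgK.
have cf s : src (f s) = tgt (fpr2 s) by rewrite /f src_mul ?src_inv // tgt_inv fb.
have Ev : tmkt (@cast _ _ (tanb (ar G)) _ g (dmap f u)) = tmkt (dmap f u).
 exact: mkt_cast.
have Ew : tmkt w = tmkt (dmap (@fpr2 R (ar G) (ar G) Bs) u) by rewrite u2.
exists (@cast _ _ (tanb (ar G)) _ g (dmap f u)).
 rewrite /tcomp.
 have -> : tmkt (dmap src (@cast _ _ (tanb (ar G)) _ g (dmap f u))) = tmkt (dmap src (dmap f u)).
  have := congr1 (totmap (dmap src : vbmap src (tanb (ar G)) (tanb (ob G)))) Ev.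
  by [].
 rewrite -u2 (dmap_compE u sf smooth_src cf).
 by rewrite (dmap_compE u s2 smooth_tgt (fun _ => erefl)).
have := tmul_map (k := @fpr1 R (ar G) (ar G) Bs) sf s2 cf _ Ev Ew; rewrite u1 => H.
by apply: (@mkt_inj _ _ (tanb (ar G))); apply: H => s; rewrite /f mulgVK.
Qed.

Lemma dmap0 (M N : dspace R) (f : M -> N) (x : M) : smooth_map f -> dmap f (0 : tangent x) = 0.
by move=> sf; exact: (lin0 (dmap_lin sf (x := x))). Qed.

Lemma tmul00 (g h : ar G) : src g = tgt h -> tmul (0 : tangent g) (0 : tangent h) = 0.
move=> c; have tc : tcomp (0 : tangent g) (0 : tangent h).
 by rewrite /tcomp !dmap0 ?c //; [exact: smooth_tgt|exact: smooth_src].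
by have := tmul_linear (-1) tc tc; rewrite !scaleN1r !addNr.
Qed.

Lemma tmul_unitr (g : ar G) (v : tangent g) : tmkt (tmul v (dmap uni (dmap src v))) = tmkt v.
rewrite (tmul_map (X := v) (f := fun k => k) (h := fun k => uni (src k)) (k := fun k => k)).
- by rewrite dmap_id.
- exact: smap_id.
- exact: (smap_comp smooth_src smooth_uni).
- by move=> k; rewrite tgt_uni.
- by move=> k; rewrite mul_uni.
- by rewrite dmap_id.
- exact: (dmap_compE v smooth_src smooth_uni (fun _ => erefl)).
Qed.

Lemma tmul_unitl (g : ar G) (v : tangent g) : tmkt (tmul (dmap uni (dmap tgt v)) v) = tmkt v.
rewrite (tmul_map (X := v) (f := fun k => uni (tgt k)) (h := fun k => k) (k := fun k => k)).
- by rewrite dmap_id.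
- exact: (smap_comp smooth_tgt smooth_uni).
- exact: smap_id.
- by move=> k; rewrite src_uni.
- by move=> k; rewrite uni_mul.
- exact: (dmap_compE v smooth_tgt smooth_uni (fun _ => erefl)).
- by rewrite dmap_id.
Qed.

(** Multiplying u 0_h on the right by the zero vector at the inverse of h gives u back. *)
Lemma tmul_inj1 (g h : ar G) (u : tangent g) : tcomp u (0 : tangent h) -> tmul u (0 : tangent h) = 0 -> u = 0.
move=> tc E; have c := tcomp_base tc; have [X [X1 X2 X3]] := tmulP c tc.
have s2 := smooth_pr2; have sm := smooth_mul2.
have H : tmkt (tmul (0 : tangent (mul g h)) (0 : tangent (inv h))) = tmkt (dmap (@pr1 R G) X).
 apply: (tmul_map (f := @mul2 R G) (h := fun p => inv (pr2 p))) => //.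
 - exact: (smap_comp s2 smooth_ginv).
 - by move=> p; rewrite tgt_inv // src_mul2.
 - by move=> p; apply: mulgK => //; exact: ar2E.
 - by rewrite X3 E.
 - rewrite -(dmap_compE X s2 smooth_ginv (fun _ => erefl)) X2 dmap0 //; exact: smooth_ginv.
apply: (@mkt_eq0 _ _ (tanb (ar G)) _ (mul (mul g h) (inv h))).
by rewrite -X1 -H tmul00 // src_mul // tgt_inv.
Qed.

Lemma tmul_inj2 (g h : ar G) (u : tangent h) : tcomp (0 : tangent g) u -> tmul (0 : tangent g) u = 0 -> u = 0.
move=> tc E; have c := tcomp_base tc; have [X [X1 X2 X3]] := tmulP c tc.
have s1 := smooth_pr1; have sm := smooth_mul2.
have H : tmkt (tmul (0 : tangent (inv g)) (0 : tangent (mul g h))) = tmkt (dmap (@pr2 R G) X).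
 apply: (tmul_map (h := @mul2 R G) (f := fun p => inv (pr1 p))) => //.
 - exact: (smap_comp s1 smooth_ginv).
 - by move=> p; rewrite src_inv // tgt_mul2.
 - by move=> p; rewrite -gmulA ?src_inv ?ar2E // inv_mul // ar2E uni_mul.
 - rewrite -(dmap_compE X s1 smooth_ginv (fun _ => erefl)) X1 dmap0 //; exact: smooth_ginv.
 - by rewrite X3 E.
apply: (@mkt_eq0 _ _ (tanb (ar G)) _ (mul (inv g) (mul g h))).
by rewrite -X2 -H tmul00 // src_inv // tgt_mul.
Qed.

Lemma inv_uni (x : ob G) : inv (uni x) = uni x.
have := uni_mul (inv (uni x)); rewrite tgt_inv src_uni mul_inv tgt_uni.
by move=> <-.
Qed.

(** The pair (v, w) is the sum of the composable pairs (v, 0) and (0, w), and the product is linear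
    on composable pairs. *)
Lemma tangent_unit_split (x : ob G) (v w : tangent (uni x)) : dmap src v = 0 -> dmap tgt w = 0 ->
 tmkt (tmul v w) = tmkt (v + w).
move=> v0 w0; have c : src (uni x) = tgt (uni x) by rewrite src_uni ?tgt_uni.
have s0 := dmap0 (uni x) smooth_src; have t0 := dmap0 (uni x) smooth_tgt.
have t1 : tcomp v (0 : tangent (uni x)) by rewrite /tcomp v0 t0 c.
have t2 : tcomp (0 : tangent (uni x)) w by rewrite /tcomp w0 s0 c.
have := tmul_linear 1 t1 t2; rewrite !scale1r addr0 add0r => ->.
have E1 : tmkt (tmul v (0 : tangent (uni x))) = tmkt v.
 have := tmul_unitr v; rewrite v0 dmap0; last exact: smooth_uni.
 have H y : y = x -> tmkt (tmul v (0 : tangent (uni y))) = tmkt v ->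
  tmkt (tmul v (0 : tangent (uni x))) = tmkt v by move=> ->.
 exact: H (src_uni x).
have E2 : tmkt (tmul (0 : tangent (uni x)) w) = tmkt w.
 have := tmul_unitl w; rewrite w0 dmap0; last exact: smooth_uni.
 have H y : y = x -> tmkt (tmul (0 : tangent (uni y)) w) = tmkt w ->
  tmkt (tmul (0 : tangent (uni x)) w) = tmkt w by move=> ->.
 exact: H (tgt_uni x).
by have := mktD 1 E1 E2; rewrite !scale1r.
Qed.

(** The product of z with its inverse y is the unit at dt(z), and by [tangent_unit_split] it is also
    z + y, because ds(z) = 0 = dt(y). *)
Lemma dinv_unit (x : ob G) (z y : tangent (uni x)) (w : tangent x) : dmap src z = 0 -> tmkt y = tmkt (dmap inv z) ->
 tmkt w = tmkt (dmap tgt z) -> y = dmap uni w - z.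
move=> z0 Ey Ew.
have y0 : dmap tgt y = 0.
 have -> : dmap tgt y = projT2 (totmap (dmap tgt : vbmap tgt (tanb (ar G)) (tanb (ob G))) (tmkt y)) by [].
 apply: (@mkt_eq0 _ _ (tanb (ob G)) _ (src (uni x))); rewrite -z0 /=.
 have := congr1 (totmap (dmap tgt : vbmap tgt (tanb (ar G)) (tanb (ob G)))) Ey.
 rewrite /totmap /= => ->.
 by rewrite (dmap_compE z smooth_ginv smooth_tgt tgt_inv).
have H : tmkt (tmul z y) = tmkt (dmap (fun g => uni (tgt g)) z).
 apply: (tmul_map (f := fun k => k) (h := @inv _ G)) => //.
 - exact: smooth_ginv.
 - by move=> k; rewrite tgt_inv.
 - by move=> k; rewrite mul_inv.
 - by rewrite dmap_id.
have H2 : tmkt (dmap uni w) = tmkt (dmap (fun g => uni (tgt g)) z).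
 rewrite -(dmap_compE z smooth_tgt smooth_uni (fun _ => erefl)).
 exact: (congr1 (totmap (dmap uni : vbmap uni (tanb (ob G)) (tanb (ar G)))) Ew).
move: H; rewrite (tangent_unit_split z0 y0) -H2 => /(@mkt_inj _ _ (tanb (ar G))) <-.
by rewrite addrC addKr.
Qed.

End Tangents.
End LieGroupoid.

(** * Line bundle groupoids and their nerve *)

Section Lbg.
Variables (R : realType) (G : groupoid R) (L : vbg G).
Hypothesis hL : is_lbg L.

Lemma gpd : is_lie_groupoid G. by case: hL => -[]. Qed.
Lemma lbg_tot : is_lie_groupoid (vbg_groupoid L). by case: hL => -[]. Qed.
Lemma lbg_ok : bundle_ok (vb L) 1. by apply: vbundle_ok; case: hL. Qed.
Lemma lbg_ok0 : bundle_ok (vb0 L) 1. by apply: vbundle_ok; case: hL. Qed.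
Let hG := gpd.
Let hT := lbg_tot.
Let oL := lbg_ok.
Let oL0 := lbg_ok0.

Lemma vs_lin g : linear (@vs _ _ L g). by case: hL => -[_ _ _ [H]] *; exact: H. Qed.
Lemma vt_lin g : linear (@vt _ _ L g). by case: hL => -[_ _ _ [_ H]] *; exact: H. Qed.
Lemma vu_lin g : linear (@vu _ _ L g). by case: hL => -[_ _ _ [_ _ H]] *; exact: H. Qed.
Lemma vi_lin g : linear (@vi _ _ L g). by case: hL => -[_ _ _ [_ _ _ H]] *; exact: H. Qed.
Lemma vm_lin (g h : ar G) a (v v' : vb L g) (w w' : vb L h) : vcomp v w -> vcomp v' w' ->
 vm (a *: v + v') (a *: w + w') = a *: vm v w + vm v' w'.
by case: hL => -[_ _ _ _ H] _ _; exact: H. Qed.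

Lemma vsu x (w : vb0 L x) : mkt (vs (vu w)) = mkt w.
exact: (src_uni hT (mkt w)). Qed.
Lemma vtu x (w : vb0 L x) : mkt (vt (vu w)) = mkt w.
exact: (tgt_uni hT (mkt w)). Qed.
Lemma vsi g (v : vb L g) : mkt (vs (vi v)) = mkt (vt v).
exact: (src_inv hT (mkt v)). Qed.
Lemma vti g (v : vb L g) : mkt (vt (vi v)) = mkt (vs v).
exact: (tgt_inv hT (mkt v)). Qed.
Lemma vsm (g h : ar G) (v : vb L g) (w : vb L h) : vcomp v w -> mkt (vs (vm v w)) = mkt (vs w).
by move=> c; exact: (src_mul hT (g := mkt v) (h := mkt w) c). Qed.
Lemma vtm (g h : ar G) (v : vb L g) (w : vb L h) : vcomp v w -> mkt (vt (vm v w)) = mkt (vt v).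
by move=> c; exact: (tgt_mul hT (g := mkt v) (h := mkt w) c). Qed.

Lemma line_vu : line_map (@vu _ _ L).
split; [exact: smooth_uni hG|exact: (smooth_uni hT)|exact: vu_lin|].
move=> x v v0; have := vsu v; rewrite v0 (lin0 (@vs_lin _)) => /esym; exact: mkt_eq0.
Qed.

(** An element over a unit is itself a unit of L, since the unit map is injective between lines. So
    v times the inverse of 0_g, which lies over a unit and has source 0, vanishes, and multiplying
    back by 0_g gives v = 0. *)
Lemma vs_inj g (v : vb L g) : vs v = 0 -> v = 0.
move=> v0; pose p : ar (vbg_groupoid L) := mkt v.
pose z : ar (vbg_groupoid L) := mkt (0 : vb L g).
have szp : src p = src z.
 by rewrite /p /z /= /totmap /= v0 (lin0 (@vs_lin _)).
have iz : inv z = mkt (0 : vb L (inv g)) by rewrite /z /= /totmap /= (lin0 (@vi_lin _)).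
have cE : mul p (inv z) = mkt (0 : vb L (uni (tgt g))).
 have c1 : src p = tgt (inv z) by rewrite (tgt_inv hT).
 have := src_mul hT c1; rewrite iz => H.
 have [c' Ec'] : exists c' : vb L (uni (tgt g)), mul p (mkt (0 : vb L (inv g))) = mkt c'.
  exists (cast (uni (tgt g)) (vm v (0 : vb L (inv g)))).
  by rewrite mkt_cast // mul_inv.
 rewrite Ec'; have [w Ew] := line_map_surj oL0 oL line_vu c'.
 have : mkt w = mkt (0 : vb0 L (src (inv g))).
  rewrite -(vsu w) Ew; move: H; rewrite Ec' /= /totmap /= (lin0 (@vs_lin (inv g))).
  by [].
 by move/mkt_eq0 => w0; rewrite -Ew w0 (lin0 (@vu_lin _)).
have zE : mul z (inv z) = mkt (0 : vb L (uni (tgt g))).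
 rewrite (mul_inv hT) /z /= /totmap /= (lin0 (@vt_lin _)) (lin0 (@vu_lin _)); by [].
have := mulgVK hT szp; rewrite cE -zE (mulgVK hT erefl) => /esym; exact: mkt_inj.
Qed.

Lemma line_vs : line_map (@vs _ _ L).
split; [exact: smooth_src hG|exact: (smooth_src hT)|exact: vs_lin|exact: vs_inj].
Qed.
Lemma line_vi : line_map (@vi _ _ L).
split; [exact: smooth_ginv hG|exact: (smooth_ginv hT)|exact: vi_lin|].
move=> g v v0; have := invgK hT (mkt v); rewrite /= {2}/totmap /= v0 /totmap /= (lin0 (@vi_lin _)).
by move/esym; exact: mkt_eq0.
Qed.
Lemma line_vt : line_map (@vt _ _ L).
split; [exact: smooth_tgt hG|exact: (smooth_tgt hT)|exact: vt_lin|].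
move=> g v v0; have := vsi v; rewrite v0 => /mkt_eq0 /vs_inj.
by case: line_vi => _ _ _; exact.
Qed.

Lemma vcompE (g h : ar G) (v : vb L g) (w : vb L h) : src g = tgt h -> vcomp v w <-> cast (tgt h) (vs v) = vt w.
by move=> e; exact: cast_eqP. Qed.

(** Composable pairs over p already form a submodule, so the linear hull in [nerve2_fib] adds
    nothing. *)
Lemma vcomp_closed (p : ar2 G) : let H := [set l : (vb L (pr1 p) * vb L (pr2 p))%type | vcomp l.1 l.2] in
 H 0 /\ forall (a : R) u v, H u -> H v -> H (a *: u + v).
have c := ar2E p; split=> [|a u v] /=.
 by apply/(vcompE _ _ c); rewrite /= (lin0 (@vs_lin _)) (lin0 (@vt_lin _)) (lin0 (@cast_linear _ _ _ _ _)).
move=> /(vcompE _ _ c) Hu /(vcompE _ _ c) Hv; apply/(vcompE _ _ c) => /=.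
by rewrite (vs_lin a) (vt_lin a) (cast_linear _ a) Hu Hv.
Qed.

Lemma nerve2P (p : ar2 G) (l : nerve2 L p) : vcomp (lpr1 l) (lpr2 l).
have H := subvalP l; exact: (H (Submodule (vcomp_closed p)) (fun _ => id)).
Qed.
Lemma nerve2_ex (p : ar2 G) (v : vb L (pr1 p)) (w : vb L (pr2 p)) : vcomp v w ->
 exists l : nerve2 L p, lpr1 l = v /\ lpr2 l = w.
move=> c; have [l Hl] := @mksub _ _ (hull [set l : (vb L (pr1 p) * vb L (pr2 p))%type | vcomp l.1 l.2]) (v, w) (fun S HS => HS (v, w) c).
by exists l; rewrite /lpr1 /lpr2 /lpr1_fib /lpr2_fib Hl.
Qed.
Lemma nerve2_ext (p : ar2 G) (l l' : nerve2 L p) : lpr1 l = lpr1 l' -> lpr2 l = lpr2 l' -> l = l'.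
by move=> e1 e2; apply: subval_inj; apply: pair_eq. Qed.

Lemma lpr1_smooth : smooth_map (totmap (@lpr1 _ _ L)).
by apply: smap_gen => h gh; apply: smooth_gen; left; exists h. Qed.
Lemma lpr2_smooth : smooth_map (totmap (@lpr2 _ _ L)).
by apply: smap_gen => h gh; apply: smooth_gen; right; exists h. Qed.

Lemma line_lpr1 : line_map (@lpr1 _ _ L).
split; [exact: smooth_pr1|exact: lpr1_smooth|by []|].
move=> p l l0; apply: nerve2_ext => //; have := nerve2P l; rewrite l0 /vcomp (lin0 (@vs_lin _)).
by move/esym/mkt_eq0; case: line_vt => _ _ _; exact.
Qed.
Lemma line_lpr2 : line_map (@lpr2 _ _ L).
split; [exact: smooth_pr2|exact: lpr2_smooth|by []|].
move=> p l l0; apply: nerve2_ext => //; have := nerve2P l; rewrite l0 /vcomp (lin0 (@vt_lin _)).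
by move/mkt_eq0; exact: vs_inj.
Qed.
Lemma line_lmul : line_map (@lmul _ _ L).
split; [exact: smooth_mul2 hG| | |].
- have := smooth_mul hT lpr1_smooth lpr2_smooth (fun l : tot (nerve2 L) => nerve2P (projT2 l)).
 by fext => -[p l].
- by move=> p a v w; rewrite /lmul -vm_lin //; exact: nerve2P.
move=> p l l0; case: line_lpr2 => _ _ _; apply; apply: vs_inj.
have := vsm (nerve2P l); rewrite -/(lmul l) l0 (lin0 (@vs_lin _)).
by move/esym; exact: mkt_eq0.
Qed.

Lemma vs_lmul (p : ar2 G) (l : nerve2 L p) : mkt (vs (lmul l)) = mkt (vs (lpr2 l)).
exact: vsm (nerve2P l). Qed.
Lemma vt_lmul (p : ar2 G) (l : nerve2 L p) : mkt (vt (lmul l)) = mkt (vt (lpr1 l)).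
exact: vtm (nerve2P l). Qed.

(** The first component of a frame is a frame of L pulled back along [pr1]; the second is then
    forced by composability, as the inverse image of the source under the target isomorphism. *)
Lemma nerve2_ok : bundle_ok (nerve2 L) 1.
have sp : smooth_map (fun p : tot (nerve2 L) => projT1 p).
 apply: smooth_into_fp; first exact: (smap_comp lpr1_smooth (ok_proj oL)).
 exact: (smap_comp lpr2_smooth (ok_proj oL)).
split=> // p0; have [U [e [xi [Up F]]]] := ok_frame oL (pr1 p0).
have s1 := smooth_pr1 (G := G); have s2 := smooth_pr2 (G := G).
pose a (i : 'I_1) (p : ar2 G) : vb L (pr1 p) := e i (pr1 p).
pose b (i : 'I_1) (p : ar2 G) : vb L (pr2 p) := finv vt (cast (tgt (pr2 p)) (vs (a i p))).
have vE i p : mkt (vt (b i p)) = mkt (vs (a i p)).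
 by rewrite /b (finvE oL oL0 line_vt) mkt_cast // ar2E.
have sa i : smooth_map (fun p => mkt (a i p)) by exact: (smap_comp s1 (frame_smooth F i)).
have sb i : smooth_map (fun p => mkt (b i p)).
 apply: (smooth_finv oL oL0 line_vt s2).
 have := smooth_totmap (smooth_src hT) (sa i); fext => p.
 by rewrite mkt_cast // ar2E.
pose Pe i p (l : nerve2 L p) := lpr1 l = a i p /\ lpr2 l = b i p.
pose e' (i : 'I_1) : sec (nerve2 L) := fun p => the 0 (@Pe i p).
have He i p : Pe i p (e' i p) by apply: theP; apply: nerve2_ex; exact/esym/vE.
have e1 i p : lpr1 (e' i p) = a i p by have [] := He i p.
have e2' i p : lpr2 (e' i p) = b i p by have [] := He i p.
have l1 := line_lin line_lpr1; have l2 := line_lin line_lpr2.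
exists [set p | U (pr1 p)], e', (fun i q => xi i (totmap (@lpr1 _ _ L) q)); split=> //; split.
- split; first by move=> p Up'; exact: (smooth_near s1 (frame_open F Up')).
 move=> i; apply: smap_gen => h [[k gk ->]|[k gk ->]].
  have := sa i _ (smooth_gen gk); fext => p /=.
  by rewrite -e1.
 have := sb i _ (smooth_gen gk); fext => p /=.
 by rewrite -e2'.
- move=> i; apply: (line_map_fib line_lpr1); split; first exact: xi_smooth F i.
 exact: xi_lin F i.
- by move=> p Up' i j; rewrite /totmap /= e1 (frame_xi_e F).
- move=> p Up' v; apply: (line_inj line_lpr1); rewrite (lin_sum (l1 p)).
 rewrite {1}(frame_exp F (lpr1 v) Up'); apply: eq_bigr => i _.
 by rewrite (linZ (l1 p)) e1.
move=> [p c] Up' q gq; apply: smooth_atW.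
have sq1 : @smooth_map R (prodd (ar2 G) (euclid R 1)) (ar2 G) fst := @smooth_fst _ _ _.
have sc : @smooth_fun R (prodd (ar2 G) (euclid R 1)) (fun z => (z.2 : 'rV[R]_1) 0 ord0).
 by apply: smooth_gen; right; exists (fun z : 'rV[R]_1 => z 0 ord0) => //; exists ord0.
case: gq => [[k gk ->]|[k gk ->]].
 have := smooth_alongM oL (smap_comp sq1 s1) sc (smap_comp sq1 (sa ord0)) (smooth_gen gk).
 fext => z /=; congr (k (mkt _)).
 by rewrite -/(lpr1 _) (lin_sum (l1 _)) big_ord1 (linZ (l1 _)) e1.
have := smooth_alongM oL (smap_comp sq1 s2) sc (smap_comp sq1 (sb ord0)) (smooth_gen gk).
fext => z /=; congr (k (mkt _)).
by rewrite -/(lpr2 _) (lin_sum (l2 _)) big_ord1 (linZ (l2 _)) e2'.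
Qed.

(** Both values are transported to the fiber of the nerve by the inverses of the two projections,
    added there and multiplied. By [lsumE] this is the expression in the product of the twisted
    dual, and a multiplicative form is one whose value on products is the [lsum] of its values on
    the factors. *)
Definition lsum (g h : ar G) (c : src g = tgt h) (a : vb L g) (b : vb L h) : vb L (mul g h) :=
 @lmul _ _ L (mkar2 c) (finv lpr1 (x := mkar2 c) a + finv lpr2 (x := mkar2 c) b).

Section Lsum.
Variables (g h : ar G) (c : src g = tgt h).

Lemma lsum_split a b : lsum c a b = lsum c a 0 + lsum c 0 b.
rewrite /lsum (finv0 nerve2_ok oL line_lpr1) (finv0 nerve2_ok oL line_lpr2) addr0 add0r.
exact: (linD (line_lin line_lmul (x := mkar2 c))).
Qed.
Lemma lsum_lin1 : linear (fun a => lsum c a 0).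
move=> r a a'; rewrite /lsum (finv0 nerve2_ok oL line_lpr2) !addr0.
by rewrite (finv_linear nerve2_ok oL line_lpr1 (x := mkar2 c)) (line_lin line_lmul (x := mkar2 c)).
Qed.
Lemma lsum_lin2 : linear (fun b => lsum c 0 b).
move=> r a a'; rewrite /lsum (finv0 nerve2_ok oL line_lpr1) !add0r.
by rewrite (finv_linear nerve2_ok oL line_lpr2 (x := mkar2 c)) (line_lin line_lmul (x := mkar2 c)).
Qed.
Lemma vt_lsum a : mkt (vt (lsum c a 0)) = mkt (vt a).
pose l : nerve2 L (mkar2 c) := finv lpr1 (x := mkar2 c) a.
have -> : lsum c a 0 = @lmul _ _ L (mkar2 c) l by rewrite /lsum (finv0 nerve2_ok oL line_lpr2) addr0.
by have := vt_lmul l; rewrite (finvE nerve2_ok oL line_lpr1).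
Qed.
Lemma vs_lsum b : mkt (vs (lsum c 0 b)) = mkt (vs b).
pose l : nerve2 L (mkar2 c) := finv lpr2 (x := mkar2 c) b.
have -> : lsum c 0 b = @lmul _ _ L (mkar2 c) l by rewrite /lsum (finv0 nerve2_ok oL line_lpr1) add0r.
by have := vs_lmul l; rewrite (finvE nerve2_ok oL line_lpr2).
Qed.

Lemma lsumE (a : vb L g) (b : vb L h) : finv vs (cast (src (mul g h))
 (cast (src h) (lact (inv h) (vs a)) + vs b)) = lsum c a b.
apply: (line_inj line_vs); rewrite (finvE oL oL0 line_vs).
apply/(cast_eqP _ _ (esym (src_mul hG c))); apply/esym.
pose l : nerve2 L (mkar2 c) := finv lpr1 (x := mkar2 c) a.
pose l2 : nerve2 L (mkar2 c) := finv lpr2 (x := mkar2 c) b.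
have := vs_lmul (l + l2); rewrite (linD (line_lin line_lpr2 (x := mkar2 c))).
rewrite (finvE nerve2_ok oL line_lpr2) (linD (@vs_lin _)) => H.
apply: (etrans H); congr (mkt (_ + _)).
have := nerve2P l; rewrite (finvE nerve2_ok oL line_lpr1) => cl.
apply/esym/(cast_eqP _ _ (tgt_inv hG h)); rewrite -(vti (lpr2 l)); congr (mkt (vt _)).
apply: (line_inj line_vs); rewrite (finvE oL oL0 line_vs).
apply/(cast_eqP _ _ _); first by rewrite (src_inv hG).
by rewrite vsi cl.
Qed.
End Lsum.

End Lbg.

(** * The Morita criterion *)

Section LinAlg.
Variable R : realType.
Implicit Types U V W : lmodType R.

(** Fibers are bare modules over the reals; finite dimension is expressed by a basis with its dual
    functionals, which is what a local frame provides at a point. *)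
Definition fbasis W r (b : 'I_r -> W) (f : 'I_r -> W -> R) :=
 [/\ forall i, linear (f i : W -> R^o), forall i j, f i (b j) = (i == j)%:R & forall v, v = \sum_i f i v *: b i].
Definition fdim W r := exists b f, @fbasis W r b f.

Section Basis.
Variables (W : lmodType R) (r : nat) (b : 'I_r -> W) (f : 'I_r -> W -> R).
Hypothesis B : fbasis b f.
Lemma fbasis_comb i (c : 'I_r -> R) : f i (\sum_j c j *: b j) = c i.
have [l d _] := B; rewrite (lfun_sum (l i)) (bigD1 i) //= (lfunZ (l i)) d eqxx mulr1 big1 ?addr0 // => j ji.
by rewrite (lfunZ (l i)) d eq_sym (negbTE ji) mulr0.
Qed.
Lemma fbasis_eq v w : (forall i, f i v = f i w) -> v = w.
by have [_ _ e] := B => H; rewrite (e v) (e w); apply: eq_bigr => i _; rewrite H. Qed.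
Definition frow v : 'rV[R]_r := \row_i f i v.
Definition fvec (c : 'rV[R]_r) : W := \sum_i c 0 i *: b i.
Lemma frowK v : fvec (frow v) = v.
by have [_ _ e] := B; rewrite [RHS]e; apply: eq_bigr => i _; rewrite mxE. Qed.
Lemma fvecK c : frow (fvec c) = c.
by apply/rowP => i; rewrite mxE fbasis_comb. Qed.
Lemma frow_linear : linear frow.
by have [l _ _] := B; move=> a v w; apply/rowP => i; rewrite !mxE (l i a). Qed.
Lemma fvec_linear : linear fvec.
move=> a c d; rewrite /fvec scaler_sumr -big_split; apply: eq_bigr => i _ /=.
by rewrite !mxE scalerDl scalerA.
Qed.
End Basis.

Section Maps.
Variables (U W : lmodType R) (r s : nat) (b : 'I_r -> U) (f : 'I_r -> U -> R) (c : 'I_s -> W) (g : 'I_s -> W -> R).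
Hypotheses (B : fbasis b f) (C : fbasis c g).
Variable T : U -> W.
Hypothesis lT : linear T.
Definition fmx : 'M[R]_(r, s) := \matrix_(i, j) g j (T (b i)).
Lemma fmxE v : frow g (T v) = frow f v *m fmx.
have [l _ e] := C; have [_ _ eb] := B; apply/rowP => j; rewrite !mxE.
rewrite {1}(eb v) (lin_sum lT) (lfun_sum (l j)); apply: eq_bigr => i _.
by rewrite (linZ lT) (lfunZ (l j)) !mxE.
Qed.
Lemma fmx_inj : (forall v, T v = 0 -> v = 0) -> row_free fmx.
move=> inj; rewrite -kermx_eq0; apply/eqP/row_matrixP => i; rewrite row0.
set k := row i _; have k0 : k *m fmx = 0 by apply: sub_kermxP; exact: row_sub.
rewrite -(fvecK B k); have -> : fvec b k = 0.
 apply: inj; apply: (fbasis_eq C) => j; have [l _ _] := C; rewrite (lfun0 (l j)).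
 by have := congr1 (fun z : 'rV[R]_s => z 0 j) (fmxE (fvec b k)); rewrite (fvecK B) k0 !mxE.
exact: (lin0 (frow_linear B)).
Qed.
Lemma fmx_linv : row_free fmx -> exists S : W -> U, linear S /\ forall v, S (T v) = v.
move=> rf; exists (fun w => fvec b (frow g w *m pinvmx fmx)); split.
 by move=> a v w; rewrite (frow_linear C a) mulmxDl -scalemxAl (fvec_linear b a).
by move=> v; rewrite fmxE mulmxKp // (frowK B).
Qed.
End Maps.

Lemma fdim_linv U W r s (T : U -> W) : fdim U r -> fdim W s -> linear T -> (forall v, T v = 0 -> v = 0) ->
 exists S : W -> U, linear S /\ forall v, S (T v) = v.
move=> [b [f B]] [c [g C]] lT inj; apply: (fmx_linv B C lT); exact: (fmx_inj B C lT inj).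
Qed.
Lemma fdim_le U W r s (T : U -> W) : fdim U r -> fdim W s -> linear T -> (forall v, T v = 0 -> v = 0) -> (r <= s)%N.
move=> [b [f B]] [c [g C]] lT inj; have := fmx_inj B C lT inj; rewrite /row_free => /eqP <-.
exact: rank_leq_col.
Qed.
Lemma fdim_onto U W r (T : U -> W) : fdim U r -> fdim W r -> linear T -> (forall v, T v = 0 -> v = 0) ->
 forall w, exists v, T v = w.
move=> [b [f B]] [c [g C]] lT inj w; have rf := fmx_inj B C lT inj.
have uA : fmx b g T \in unitmx by rewrite -row_free_unit.
exists (fvec b (frow g w *m invmx (fmx b g T))); apply: (fbasis_eq C) => j.
have := congr1 (fun z : 'rV[R]_r => z 0 j) (fmxE B C lT (fvec b (frow g w *m invmx (fmx b g T)))).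
by rewrite (fvecK B) mulmxKV // !mxE.
Qed.
Lemma fdim_rinv U W s (T : U -> W) : fdim W s -> linear T -> (forall w, exists v, T v = w) ->
 exists S : W -> U, linear S /\ forall w, T (S w) = w.
move=> [c [g C]] lT /(_ (c _)) sT; have /boolp.choice[h hh] : forall i, exists v, T v = c i by [].
exists (fun w => fvec h (frow g w)); split.
 by move=> a v w; rewrite (frow_linear C a) (fvec_linear h a).
move=> w; rewrite /fvec (lin_sum lT) -[RHS](frowK C); apply: eq_bigr => i _.
by rewrite (linZ lT) hh.
Qed.
Lemma fdim_bij U W r s (T : U -> W) : fdim U r -> fdim W s -> linear T -> (forall v, T v = 0 -> v = 0) ->
 (forall w, exists v, T v = w) -> r = s.
move=> dU dW lT inj sT; apply/eqP; rewrite eqn_leq (fdim_le dU dW lT inj) /=.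
have [S [lS TS]] := fdim_rinv dW lT sT; apply: (fdim_le dW dU lS) => w Sw.
by rewrite -(TS w) Sw (lin0 lT).
Qed.
Lemma fdim_prod U W r s : fdim U r -> fdim W s -> fdim (U * W)%type (r + s).
move=> [b [f [lf fb eb]]] [c [g [lg gc ec]]].
exists (fun i => match fintype.split i with inl j => (b j, 0) | inr j => (0, c j) end),
 (fun i v => match fintype.split i with inl j => f j v.1 | inr j => g j v.2 end); split.
- by move=> i a v w; case: (fintype.split i) => j; [exact: lf|exact: lg].
- move=> i j; rewrite -(fintype.splitK i) -(fintype.splitK j).
 case: (fintype.split i) => i'; case: (fintype.split j) => j'; rewrite !fintype.unsplitK /=.
 + by rewrite fb (inj_eq (@lshift_inj _ _)).
 + by rewrite (lfun0 (lf _)) eq_lrshift.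
 + by rewrite (lfun0 (lg _)) eq_rlshift.
 + by rewrite gc (inj_eq (@rshift_inj _ _)).
move=> [v w]; rewrite big_split_ord /=.
have E1 i : fintype.split (lshift s i : 'I_(r + s)) = inl i by exact: (fintype.unsplitK (inl i : 'I_r + 'I_s)).
have E2 i : fintype.split (rshift r i : 'I_(r + s)) = inr i by exact: (fintype.unsplitK (inr i : 'I_r + 'I_s)).
under eq_bigr do rewrite E1; under [X in _ + X]eq_bigr do rewrite E2.
apply: pair_eq => /=.
 rewrite [RHS]/= !sumb1 [X in _ = _ + X]big1 ?addr0; last by move=> i _; exact: scaler0.
 exact: eb.
rewrite !sumb2 [X in _ = X + _]big1 ?add0r; last by move=> i _; exact: scaler0.
exact: ec.
Qed.
Lemma fdim_hom U W r : fdim U r -> fdim W 1 -> fdim (Hom U W) r.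
move=> [b [f [lf fb eb]]] [c [g [lg gc ec]]].
pose h (i : 'I_r) : Hom U W := tohom (fun v => f i v *: c 0).
have lh i : linear (fun v => f i v *: c 0) by move=> a v w; rewrite (lf i a) scalerDl scalerA.
exists h, (fun i k => g 0 (happ k (b i))); split.
- by move=> i a k k'; rewrite happ_comb; exact: lg.
- by move=> i j; rewrite /h tohomE // (lfunZ (lg 0)) fb gc eqxx mulr1 eq_sym.
move=> k; apply: hom_ext => v.
have -> : happ (\sum_i g 0 (happ k (b i)) *: h i) v = \sum_i g 0 (happ k (b i)) *: happ (h i) v.
 elim: (index_enum _) => [|i s IH]; first by rewrite !big_nil.
 by rewrite !big_cons -IH.
rewrite {1}(eb v) happ_sum; apply: eq_bigr => i _; rewrite /h tohomE // scalerA mulrC -scalerA; congr (_ *: _).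
by rewrite {1}(ec (happ k (b i))) big_ord1.
Qed.
End LinAlg.

Section SmoothMatrix.
Variable R : realType.
Implicit Types M N P : dspace R.

Lemma bundle_fdim M (E : bundle M) r x : bundle_ok E r -> fdim (E x) r.
move=> oE; have [U [e [xi [Ux F]]]] := ok_frame oE x.
exists (fun i => e i x), (fun i v => xi i (mkt v)); split.
- by move=> i; exact: xi_lin F i x.
- by move=> i j; rewrite (frame_xi_e F).
- by move=> v; exact: (frame_exp F).
Qed.

Lemma smooth_at_cst M (x : M) (a : R) : smooth_at x (fun _ : M => a).
exact/smooth_atW/smooth_cst. Qed.

Lemma smooth_at_prod M (I : Type) (r : seq I) (F : I -> M -> R) x :
 (forall i, smooth_at x (F i)) -> smooth_at x (fun y => \prod_(i <- r) F i y).
move=> H; elim: r => [|i r IH].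
 by apply: (@smooth_at_eq _ _ _ (fun=> 1)); [apply: filterE => y; rewrite big_nil|exact: smooth_at_cst].
apply: (@smooth_at_eq _ _ _ (fun y => F i y * \prod_(i <- r) F i y)); last exact: smooth_atM.
by apply: filterE => y; rewrite big_cons.
Qed.

Lemma smooth_at_det M n (A : M -> 'M[R]_n) x : (forall i j, smooth_at x (fun y => A y i j)) ->
 smooth_at x (fun y => \det (A y)).
move=> H; apply: smooth_at_sum => s; apply: smooth_atM; first exact: smooth_at_cst.
by apply: smooth_at_prod => i; exact: H.
Qed.

Lemma smooth_at_invmx M n (A : M -> 'M[R]_n) x : (forall i j, smooth_at x (fun y => A y i j)) ->
 A x \in unitmx -> (\forall y \near (x : dtop M), A y \in unitmx) /\
 forall i j, smooth_at x (fun y => invmx (A y) i j).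
move=> H; rewrite unitmxE unitfE => ux; have sd := smooth_at_det H.
have nd : \forall y \near (x : dtop M), \det (A y) != 0.
 have [k sk Ek] := sd; have kx : k x != 0 by rewrite -(near_self Ek).
 have [g sg Eg] := smooth_inv_near sk kx.
 have gx : g x != 0 by rewrite (near_self Eg) invr_eq0.
 have : \forall y \near (x : dtop M), `|g y - g x| < `|g x| by apply: smooth_dist => //; rewrite normr_gt0.
 apply: filterS3 Ek Eg => y -> Eg' lt; apply/eqP => k0; move: lt.
 by rewrite Eg' k0 invr0 add0r normrN ltxx.
have nu : \forall y \near (x : dtop M), A y \in unitmx by apply: filterS nd => y; rewrite unitmxE unitfE.
split=> // i j.
apply: (@smooth_at_eq _ _ _ (fun y => (\det (A y))^-1 * ((-1) ^+ (j + i) * \det (row' j (col' i (A y)))))).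
 by apply: filterS nu => y uy; rewrite /invmx uy !mxE.
apply: smooth_atM; first exact: smooth_at_inv.
apply: smooth_atM; first exact: smooth_at_cst.
by apply: smooth_at_det => a b; apply: smooth_at_eq (H (lift j a) (lift i b)); apply: filterE => y; rewrite !mxE.
Qed.

(** Every smooth function is locally a smooth function of generators, so [tapp_chain] determines a
    derivation by its values on generators. *)
Lemma tangent_gen M (x : M) (v w : tangent x) : (forall g, gen g -> tapp v g = tapp w g) -> v = w.
move=> H; apply: tangent_ext => f sf; have [n [g [F [gg cF E]]]] := sf x.
have sg i : smooth_fun (g i) by exact: smooth_gen.
have sF := smooth_comp cF sg.
rewrite (tapp_local v sf sF E) (tapp_local w sf sF E) !tapp_chain //.
by apply: eq_bigr => i _; rewrite H.
Qed.

Lemma push_tangent M N (h : N -> M) y x (z : tangent y) : smooth_map h -> h y = x ->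
 exists v : tangent x, forall f, smooth_fun f -> tapp v f = tapp z (fun y => f (h y)).
by move=> sh <-; exists (dmap h z) => f sf; rewrite dmapE. Qed.

Lemma euclid_coords n : @coords R (euclid R n) n (fun i (z : 'rV[R]_n) => z 0 i) id setT setT.
have rE (z : 'rV[R]_n) : @qrow R (euclid R n) n (fun i (z : 'rV[R]_n) => z 0 i) z = z.
 by apply/rowP => i; rewrite mxE.
split.
- by move=> i; apply: smooth_gen; exists i.
- by split=> z _; apply: filterE.
- by move=> y _; split=> //; exact: rE.
- by move=> z _; split=> //; exact: rE.
- by move=> z _; apply: Cmap_into_euclid => i; exists (fun z : 'rV[R]_n => z 0 i); [exact: Ccoord|apply: filterE].
Qed.

Definition tcoord (t : euclid R 1) : R := (t : 'rV[R]_1) 0 0.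
(** The vector d/dt at 0; its push-forward along a curve is the velocity of the curve. *)
Definition dline : tangent (0 : euclid R 1) :=
 @cvec R (euclid R 1) 1 (fun i (z : 'rV[R]_1) => z 0 i) id ord0 (0 : 'rV[R]_1).

Lemma smooth_tcoord : smooth_fun tcoord.
by apply: smooth_gen; exists ord0. Qed.
Lemma dlineE : tapp dline tcoord = 1.
by have := cvec_q (euclid_coords 1) ord0 ord0 (y := (0 : 'rV[R]_1)) I; rewrite eqxx. Qed.

Section Vertical.
Variables (M : dspace R) (E : bundle M) (r : nat).
Hypothesis oE : bundle_ok E r.

Lemma smooth_line x (a b : E x) : @smooth_map R (euclid R 1) (tot E) (fun t => mkt (a + tcoord t *: b)).
have sx := @smooth_map_cst R (euclid R 1) M x.
apply: (smooth_alongD oE sx); first exact: smooth_map_cst.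
by apply: (smooth_alongM oE sx); [exact: smooth_tcoord|exact: smooth_map_cst].
Qed.

(* Vertical tangent vectors are velocities of affine lines in the fiber. *)
Lemma vertical_tangent x (a : E x) (w : @tangent R (tot E) (mkt a)) :
 (forall f, smooth_fun f -> tapp w (fun p => f (projT1 p)) = 0) -> exists b : E x, forall q, smooth_fun q ->
  tapp w q = tapp dline (fun t => q (mkt (a + tcoord t *: b))).
move=> w0; have [U [e [xi [Ux F]]]] := ok_frame oE x.
have sxi i := xi_smooth F i; have lxi i := xi_lin F i.
pose b := \sum_i tapp w (xi i) *: e i x.
have sg := smooth_line a b.
have g0 : mkt (a + tcoord (0 : 'rV[R]_1) *: b) = mkt a by rewrite /tcoord mxE scale0r addr0.
have [w2 w2E] := push_tangent dline sg g0.
exists b => q sq; rewrite -w2E //.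
pose X (p : tot E) : prodd M (euclid R r) := (projT1 p, \row_i xi i p).
have sX : smooth_map X.
 apply: smooth_pair; first exact: (ok_proj oE).
 by apply: smooth_euclidP => i; have := sxi i; fext => p; rewrite mxE.
have sth : smooth_map (theta e).
 apply: (smooth_along_sum oE smooth_fst) => i.
 apply: (smooth_alongM oE smooth_fst).
  exact: smooth_coord2.
 exact: (smap_comp smooth_fst (frame_smooth F i)).
have EX : dmap X w = dmap X w2.
 apply: tangent_gen => k [[h gh ->]|[h [i ->] ->]].
  have sh := smooth_gen gh.
  have shf : @smooth_fun R (prodd M (euclid R r)) (h \o fst) by exact: (@smooth_fst R M (euclid R r) _ sh).
  rewrite !dmapE // w2E; last by exact: (sX _ shf).
  by rewrite /comp /= tapp_cst; exact: w0.
 have sc := @smooth_coord2 R M r i.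
 rewrite !dmapE // w2E; last by exact: (sX _ sc).
 rewrite /comp /= (_ : (fun y => (\row_i0 xi i0 y) 0 i) = xi i); last by apply/funext => p; rewrite mxE.
 rewrite (_ : (fun t => (\row_i0 xi i0 (mkt (a + tcoord t *: b))) 0 i) = fun t => xi i (mkt b) * tcoord t + xi i (mkt a)).
  rewrite tapp_lin; [|exact: smooth_tcoord|exact: smooth_cst].
  by rewrite dlineE tapp_cst mulr1 addr0 /b (frame_xi_comb F).
 by apply/funext => t; rewrite mxE fib_linD ?fib_linZ //; ring.
have H : eqnear (mkt a : tot E) q (fun p => q (theta e (X p))).
 apply: filterS (smooth_near (ok_proj oE) (x := mkt a) (frame_open F Ux)) => -[y v] /= Uy; congr q.
 by rewrite /theta /X /= {1}(frame_exp F v Uy); congr mkt; apply: eq_bigr => i _; rewrite mxE.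
have sq2 : smooth_fun (fun p => q (theta e (X p))) by exact: (smap_comp sX sth sq).
rewrite (tapp_local w sq sq2 H) (tapp_local w2 sq sq2 H).
have sqt := sth _ sq.
by rewrite -[LHS](dmapE w sX sqt) -[RHS](dmapE w2 sX sqt) EX.
Qed.
End Vertical.

End SmoothMatrix.

(* A VB groupoid V whose fibers are V_g = T_gG x_TM V_M, by (a, s) and by
  (a, t), and whose product is determined by that of TG. *)
Record vb_model (R : realType) (G : groupoid R) (V : vbg G)
  (a : forall g : ar G, vb V g -> tangent g) (a0 : forall x : ob G, vb0 V x -> tangent x) (N d : nat) : Prop := {
 m_ok : bundle_ok (vb V) N; m_ok0 : bundle_ok (vb0 V) d; m_slin : vblinear (@vs _ _ V);
 m_tlin : vblinear (@vt _ _ V); m_ulin : vblinear (@vu _ _ V); m_ilin : vblinear (@vi _ _ V);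
 m_alin : forall g, linear (@a g); m_ssm : smooth_map (totmap (@vs _ _ V)); m_tsm : smooth_map (totmap (@vt _ _ V));
 m_usm : smooth_map (totmap (@vu _ _ V)); m_asm : smooth_map (fun p : tot (vb V) => tmkt (a _ (projT2 p)));
 m_as : forall g (v : vb V g), dmap src (a _ v) = a0 _ (vs v);
 m_at : forall g (v : vb V g), dmap tgt (a _ v) = a0 _ (vt v);
 m_au : forall x (w : vb0 V x), a _ (vu w) = dmap uni (a0 _ w);
 m_ai : forall g (v : vb V g), a _ (vi v) = dmap inv (a _ v); m_su : forall x (w : vb0 V x), mkt (vs (vu w)) = mkt w;
 m_tu : forall x (w : vb0 V x), mkt (vt (vu w)) = mkt w; m_si : forall g (v : vb V g), mkt (vs (vi v)) = mkt (vt v);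
 m_ti : forall g (v : vb V g), mkt (vt (vi v)) = mkt (vs v);
 m_inj_s : forall g (v : vb V g), a _ v = 0 -> vs v = 0 -> v = 0;
 m_inj_t : forall g (v : vb V g), a _ v = 0 -> vt v = 0 -> v = 0;
 m_ex_s : forall g (z : tangent g) (w : vb0 V (src g)), dmap src z = a0 _ w ->
  exists v : vb V g, a _ v = z /\ vs v = w;
 m_ex_t : forall g (z : tangent g) (w : vb0 V (tgt g)), dmap tgt z = a0 _ w ->
  exists v : vb V g, a _ v = z /\ vt v = w; m_mul : forall (g h : ar G) (v : vb V g) (w : vb V h), vcomp v w ->
  [/\ mkt (vs (vm v w)) = mkt (vs w), mkt (vt (vm v w)) = mkt (vt v) & a _ (vm v w) = tmul (a _ v) (a _ w)];
 m_init : forall (P : dspace R) (f : P -> ar G) (X : forall y, vb V (f y)), smooth_map f ->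
  smooth_map (fun y => tmkt (a _ (X y))) -> smooth_map (fun y => mkt (vs (X y))) -> smooth_lift X }.

(** Smoothness is required along arbitrary maps into the arrows, not only for sections over G,
    because the pairing is also evaluated along the unit map. *)
Record mult_pairing (R : realType) (G : groupoid R) (L : vbg G) (V : vbg G)
  (B : forall g : ar G, vb V g -> vb V g -> vb L g) : Prop := { p_lin : forall g w, linear (fun v => B g v w);
 p_skew : forall g v w, B g v w = - B g w v;
 p_smooth : forall (P : dspace R) (f : P -> ar G) (X Y : forall y, vb V (f y)), smooth_map f ->
  smooth_lift X -> smooth_lift Y -> smooth_map (fun y => mkt (B _ (X y) (Y y)));
 p_mult : forall (g h : ar G) (c : src g = tgt h) v v' w w', vcomp v v' -> vcomp w w' ->
  B _ (vm v v') (vm w w') = lsum c (B g v w) (B h v' w') }.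

Lemma mkt0 (R : realType) M (E : @bundle R M) x y : x = y -> mkt (0 : E x) = mkt (0 : E y).
by move=> ->. Qed.

Section Hom.
Variables (R : realType) (M N : dspace R) (E L : bundle M) (r : nat) (f : N -> M).
Hypotheses (oE : bundle_ok E r) (oL : bundle_ok L 1) (sf : smooth_map f).
Lemma smooth_into_hom (psi : forall y, homb E L (f y)) :
 (forall e : sec E, smooth_sec e -> smooth_map (fun y => mkt (happ (psi y) (e (f y))))) -> smooth_lift psi.
move=> H; apply: smap_gen => h [[k gk ->]|[e [xi [se [sx _] ->]]]].
 exact: sf (smooth_gen gk).
exact: (H e se _ sx).
Qed.
Lemma smooth_happ (psi : forall y, homb E L (f y)) (X : forall y, E (f y)) : smooth_lift psi -> smooth_lift X ->
 smooth_map (fun y => mkt (happ (psi y) (X y))).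
move=> sp; apply: (smooth_lin_along (phi := fun y => happ (psi y)) oE oL sf) => [y|e se]; first exact: happ_linear.
apply: (smooth_along oL sf) => x U e' xi Ux F i; apply: smooth_atW.
apply: (sp (fun p : tot (homb E L) => xi i (mkt (happ (projT2 p) (e (projT1 p)))))).
apply: smooth_gen; right; exists e, (xi i); split=> //.
by split; [exact: xi_smooth F i|move=> z; exact: xi_lin F i z].
Qed.
End Hom.

Lemma smooth_mkt (R : realType) M (E : @bundle R M) : smooth_map (fun p : tot E => mkt (projT2 p)).
have := @smap_id R (tot E); fext; by case.
Qed.
Lemma line_map_tot (R : realType) (M N : dspace R) (f : M -> N) (L : bundle M) (L' : bundle N)
 (F : vbmap f L L') : line_map F -> smooth_map (totmap F).
by case. Qed.

Lemma mktK (R : realType) M (E : @bundle R M) (p : tot E) : mkt (projT2 p) = p.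
by case: p. Qed.

(** * The cone of the core complex and its dual, over a point *)

Section CoreAlgebra.
Variables (R : realType) (C M K : lmodType R) (r d : nat).
Hypotheses (dC : fdim C r) (dM : fdim M d) (dK : fdim K 1).
Variables (rho : C -> M) (phi : M -> C -> K).
Hypotheses (rl : linear rho) (pl1 : forall c, linear (fun z => phi z c)) (pl2 : forall z, linear (phi z)).
Hypothesis skew : forall c c', phi (rho c) c' = - phi (rho c') c.

(** The three conditions are exactness of 0 -> C -> M + Hom(M, K) -> Hom(C, K) -> 0 at C, in the
    middle and at the right end. The maps are c |-> (rho c, phi(-, c)) and (z, mu) |-> phi(z, -) +
    mu o rho. *)
Definition core_nondeg := forall c, rho c = 0 -> (forall w, phi w c = 0) -> c = 0.
Definition core_exact := forall z (mu : Hom M K), (forall c, phi z c = happ mu (rho c)) ->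
 exists c, rho c = z /\ forall w, happ mu w = - phi w c.
Definition core_onto := forall be : Hom C K, exists z (mu : Hom M K), forall c, happ be c = phi z c + happ mu (rho c).

Let mu c : Hom M K := tohom (fun w => - phi w c).
Let muE c w : happ (mu c) w = - phi w c.
by rewrite tohomE // => s w1 w2; rewrite pl1 opprD scalerN. Qed.
Let j c : (M * Hom M K)%type := (rho c, mu c).
Let jl : linear j.
move=> s c c'; apply: pair_eq; first exact: rl.
by apply: hom_ext => w; rewrite happ_comb !muE pl2 opprD scalerN.
Qed.
Let D (p : (M * Hom M K)%type) : Hom C K := tohom (fun c => phi p.1 c + happ p.2 (rho c)).
Let DE p c : happ (D p) c = phi p.1 c + happ p.2 (rho c).
rewrite tohomE // => s c1 c2; rewrite pl2 rl happD happZ scalerDr !addrA; congr (_ + _).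
by rewrite addrAC.
Qed.
Let Dl : linear D.
move=> s p q; apply: hom_ext => c; rewrite happ_comb !DE /= pl1 happ_comb scalerDr !addrA; congr (_ + _).
by rewrite addrAC.
Qed.
Let happ_opp (m : Hom M K) z : happ (- m) z = - happ m z.
by []. Qed.
Let Dj c : D (rho c, - mu c) = 0.
apply: hom_ext => c'; rewrite DE /= happ_opp.
by rewrite muE opprK skew addNr.
Qed.

(* (z, mu) |-> phi z + mu o rho is the transpose of c |-> (rho c, - phi _ c) *)
Lemma core_nondeg_onto : r = d -> core_nondeg -> core_onto.
move=> rd nd be; have dH := fdim_hom dM dK.
have ji c : j c = 0 -> c = 0.
 move=> E; apply: nd => [|w]; first exact: (congr1 fst E).
 by apply/eqP; rewrite -oppr_eq0 -muE; move: (congr1 snd E) => /= ->; apply/eqP.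
have [S [lS SE]] := fdim_linv dC (fdim_prod dM dH) jl ji.
pose ph p := happ be (S p).
have lph : linear ph by move=> s p q; rewrite /ph lS happD happZ.
pose ev z : Hom (Hom M K) K := tohom (fun m : Hom M K => happ m z).
have evE z m : happ (ev z) m = happ m z by rewrite tohomE // => s m1 m2; exact: happ_comb.
have lev : linear ev by move=> s z z'; apply: hom_ext => m; rewrite happ_comb !evE happD happZ.
have iev z : ev z = 0 -> z = 0.
 move=> ez; have [b [f Bf]] := dM; have [k [g [lg gk _]]] := dK; have [lf _ _] := Bf.
 apply: (fbasis_eq Bf) => i; rewrite (lfun0 (lf i)).
 pose m : Hom M K := tohom (fun v => f i v *: k ord0).
 have : happ (ev z) m = 0 by rewrite ez.
 rewrite evE tohomE; last by move=> s v w; rewrite (lf i s) scalerDl scalerA.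
 move=> fz; apply/eqP; move/eqP: fz; rewrite scaler_eq0 => /orP[//|/eqP k0].
 by have := gk ord0 ord0; rewrite k0 eqxx (lfun0 (lg ord0)) => /esym/eqP; rewrite oner_eq0.
have lp2 : linear (fun m : Hom M K => ph (0, m)).
 by move=> s m m'; rewrite -lph; congr ph; apply: pair_eq => //=; rewrite scaler0 addr0.
have [z Ez] := fdim_onto dM (fdim_hom dH dK) lev iev (tohom (fun m => ph (0, m))).
have lp1 : linear (fun w : M => ph (w, 0)).
 by move=> s m m'; rewrite -lph; congr ph; apply: pair_eq => //=; rewrite scaler0 addr0.
exists (- z), (tohom (fun w => ph (w, 0))) => c; rewrite tohomE //.
have -> : happ be c = ph (rho c, 0) + ph (0, mu c).
 have := lph 1 (rho c, 0) (0, mu c); rewrite !scale1r => <-.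
 rewrite /ph -{1}(SE c); congr (happ be (S _)); apply: pair_eq => //=; first by rewrite addr0.
 by rewrite add0r.
rewrite addrC; congr (_ + _); have := evE z (mu c); rewrite Ez tohomE // => ->.
by rewrite muE -(linN (pl1 c)).
Qed.

(** A linear section of D splits the cone: T is the first map on C plus this section on Hom(C, K).
    It is injective, and it is onto exactly when the middle is exact, so the remaining statements
    become dimension counts. *)
Let TS : core_nondeg -> core_onto -> exists T : (C * Hom C K)%type -> (M * Hom M K)%type,
 [/\ linear T, forall p, T p = 0 -> p = 0, forall p, D (T p) = p.2 & forall c, T (c, 0) = (rho c, - mu c)].
move=> nd on; have dH := fdim_hom dM dK.
have [S [lS SE]] : exists S, linear S /\ forall w, D (S w) = w.
 apply: (fdim_rinv (fdim_hom dC dK) Dl) => be; have [z [m E]] := on be.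
 by exists (z, m); apply: hom_ext => c; rewrite DE E.
pose T (p : (C * Hom C K)%type) : (M * Hom M K)%type := ((rho p.1, - mu p.1) : (M * Hom M K)%type) + S p.2.
have DT p : D (T p) = p.2 by rewrite /T (linD Dl) Dj SE add0r.
exists T; split=> // [s [c be] [c' be']|[c be] E|c]; last by rewrite /T /= (lin0 lS) addr0.
 rewrite /T /= lS; have := jl s c c'; rewrite /j => -[-> ->].
 rewrite scalerDr addrACA; congr (_ + _); apply: pair_eq => //=.
 by rewrite opprD scalerN.
have b0 : be = 0 by have := DT (c, be); rewrite E (lin0 Dl).
move: E; rewrite b0 /T /= (lin0 lS) addr0 => E; apply: pair_eq => //=; apply: nd; first exact: (congr1 fst E).
move=> w; apply/eqP; rewrite -oppr_eq0 -muE; have := congr1 snd E => /= /eqP.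
by rewrite oppr_eq0 => /eqP ->.
Qed.

Lemma core_nondeg_exact : r = d -> core_nondeg -> core_exact.
move=> rd nd; have [T [lT iT DT T0]] := TS nd (core_nondeg_onto rd nd); subst r; move=> z m zm.
have [[c be] E] := fdim_onto (fdim_prod dC (fdim_hom dC dK)) (fdim_prod dM (fdim_hom dM dK)) lT iT (z, - m).
have Dz : D (z, - m) = 0 by apply: hom_ext => c'; rewrite DE /= happ_opp zm subrr.
have := DT (c, be); rewrite E Dz => /= b0; move: E; rewrite -b0 T0 => E.
exists c; split=> [|w]; first exact: (congr1 fst E).
by have /= /oppr_inj <- := congr1 snd E; exact: muE.
Qed.

Lemma core_rank : core_nondeg -> core_exact -> core_onto -> r = d.
move=> nd ex on; have [T [lT iT DT T0]] := TS nd on.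
have sT q : exists p, T p = q.
 pose q' := q - T (0, D q); have q0 : D q' = 0 by rewrite (linB Dl) DT subrr.
 have [|c [c1 c2]] := ex q'.1 (- q'.2).
  by move=> c; rewrite happ_opp; have := DE q' c; rewrite q0 => /esym/eqP; rewrite addr_eq0 => /eqP.
 exists (c, D q); have -> : (c, D q) = ((c, 0) : (C * Hom C K)%type) + (0, D q) by apply: pair_eq; rewrite /= ?addr0 ?add0r.
 rewrite (linD lT) T0; suff -> : (rho c, - mu c) = q' by rewrite subrK.
 by apply: pair_eq => //=; apply: oppr_inj; rewrite opprK; apply: hom_ext => w; rewrite muE c2.
have := fdim_bij (fdim_prod dC (fdim_hom dC dK)) (fdim_prod dM (fdim_hom dM dK)) lT iT sT.
by rewrite !addnn => /double_inj.
Qed.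
End CoreAlgebra.

(** A section of s and the map f together embed the sum of C and W into V; the dimensions agree, so
    the embedding is onto, and an element of the kernel of s has no component in W. *)
Lemma ker_onto (R : realType) (C V W : lmodType R) r N d (s : V -> W) (f : C -> V) : fdim C r -> fdim V N ->
 fdim W d -> N = (d + r)%N -> linear s -> (forall w, exists v, s v = w) -> linear f ->
 (forall c, s (f c) = 0) -> (forall c, f c = 0 -> c = 0) -> forall v, s v = 0 -> exists c, v = f c.
move=> dC dV dW e ls ss lf sf0 fi v v0; have [S [lS SE]] := fdim_rinv dW ls ss.
have fU : fdim (C * W)%type N by rewrite e addnC; exact: fdim_prod.
have lT : linear (fun p : (C * W)%type => f p.1 + S p.2).
 by move=> a p q /=; rewrite lf lS scalerDr addrACA.
have sT c w : s (f c + S w) = w by rewrite (linD ls) sf0 SE add0r.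
have iT : forall p : (C * W)%type, f p.1 + S p.2 = 0 -> p = 0.
 move=> [c w] /= E; have w0 : w = 0 by rewrite -(sT c w) E (lin0 ls).
 by move: E; rewrite w0 (lin0 lS) addr0 => /fi ->.
have [[c w] /= E] := fdim_onto fU dV lT iT v.
have w0 : w = 0 by rewrite -(sT c w) E.
by exists c; rewrite -E w0 (lin0 lS) addr0.
Qed.

(** * VB groupoids with a multiplicative skew pairing *)

Section VBModel.
Variables (R : realType) (G : groupoid R) (L V : vbg G) (hL : is_lbg L).
Variables (a : forall g : ar G, vb V g -> tangent g) (a0 : forall x : ob G, vb0 V x -> tangent x) (N d : nat).
Hypothesis hV : vb_model a a0 N d.
Variable B : forall g : ar G, vb V g -> vb V g -> vb L g.
Hypothesis hB : mult_pairing B.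
Variables (m n : nat).
Hypotheses (cM : coordinatized (ob G) m) (cG : coordinatized (ar G) n).
Local Notation tdual_s := (totmap (@dual_s _ _ L V)).
Local Notation tdual_t := (totmap (@dual_t _ _ L V)).
Let hG := gpd hL.
Let oL := lbg_ok hL.
Let oL0 := lbg_ok0 hL.
Let oV := m_ok hV.
Let oV0 := m_ok0 hV.
Let s0_ (g : ar G) : vs (0 : vb V g) = 0 := lin0 (m_slin hV (x := g)).
Let t0_ (g : ar G) : vt (0 : vb V g) = 0 := lin0 (m_tlin hV (x := g)).
Let a0_ (g : ar G) : a (0 : vb V g) = 0 := lin0 (m_alin hV (g := g)).
Let u0_ x : vu (0 : vb0 V x) = 0 := lin0 (m_ulin hV (x := x)).
Let vsL0 (g : ar G) : vs (0 : vb L g) = 0 := lin0 (vs_lin hL (g := g)).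
Let vtL0 (g : ar G) : vt (0 : vb L g) = 0 := lin0 (vt_lin hL (g := g)).

Lemma m_eq_s g (v w : vb V g) : a v = a w -> vs v = vs w -> v = w.
move=> Ea Es; apply: subr0_eq; apply: (m_inj_s hV).
 by rewrite (linB (m_alin hV (g := g))) Ea subrr.
by rewrite (linB (m_slin hV (x := g))) Es subrr.
Qed.

Lemma m_eq (g h : ar G) (v : vb V g) (w : vb V h) :
 tmkt (a v) = tmkt (a w) -> mkt (vs v) = mkt (vs w) -> mkt v = mkt w.
move=> Ea; have e := mkt_base Ea; subst h => Es.
by rewrite (m_eq_s (mkt_inj Ea) (mkt_inj Es)).
Qed.

Lemma a_mkt (g h : ar G) (v : vb V g) (w : vb V h) : mkt v = mkt w -> tmkt (a v) = tmkt (a w).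
by move=> e; have b := mkt_base e; subst h; rewrite (mkt_inj e). Qed.

Lemma vm_mkt (g h g' h' : ar G) (v : vb V g) (w : vb V h) (v' : vb V g') (w' : vb V h') :
 mkt v = mkt v' -> mkt w = mkt w' -> mkt (vm v w) = mkt (vm v' w').
move=> e1 e2; have b1 := mkt_base e1; have b2 := mkt_base e2; subst g' h'.
by rewrite (mkt_inj e1) (mkt_inj e2).
Qed.

Lemma vcomp_mkt (g h g' h' : ar G) (v : vb V g) (w : vb V h) (v' : vb V g') (w' : vb V h') :
 mkt v = mkt v' -> mkt w = mkt w' -> vcomp v w -> vcomp v' w'.
by move=> e1 e2; rewrite /vcomp (totmapE vs e1) (totmapE vt e2).
Qed.

Lemma vcomp_base (g h : ar G) (v : vb V g) (w : vb V h) : vcomp v w -> src g = tgt h.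
exact: mkt_base. Qed.

Lemma vcomp_tcomp (g h : ar G) (v : vb V g) (w : vb V h) : vcomp v w -> tcomp (a v) (a w).
rewrite /tcomp (m_as hV) (m_at hV) => e.
have := congr1 (fun p : tot (vb0 V) => tmkt (a0 (projT2 p))) e; exact.
Qed.

(** [vb_model] contains no groupoid laws for V. An element is determined by its source and its image
    in TG, so the unit laws follow from those of TG. *)
Lemma m_unitr g (v : vb V g) : mkt (vm v (vu (vs v))) = mkt v.
have c : vcomp v (vu (vs v)) by rewrite /vcomp (m_tu hV).
have [Es _ Ea] := m_mul hV c; apply: m_eq; last by rewrite Es (m_su hV).
by rewrite Ea (m_au hV) -(m_as hV) (tmul_unitr hG cM cG).
Qed.
Lemma m_unitl g (v : vb V g) : mkt (vm (vu (vt v)) v) = mkt v.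
have c : vcomp (vu (vt v)) v by rewrite /vcomp (m_su hV).
have [Es _ Ea] := m_mul hV c; apply: m_eq; last by rewrite Es.
by rewrite Ea (m_au hV) -(m_at hV) (tmul_unitl hG cM cG).
Qed.

Lemma m_surj_s g (w : vb0 V (src g)) : exists v : vb V g, vs v = w.
have [_ /(_ g (a0 w))[z zE]] := src_subm hG.
by have [v [_ <-]] := m_ex_s hV zE; exists v.
Qed.
Lemma m_surj_t g (w : vb0 V (tgt g)) : exists v : vb V g, vt v = w.
have [_ /(_ g (a0 w))[z zE]] := tgt_subm hG.
by have [v [_ <-]] := m_ex_t hV zE; exists v.
Qed.

(** Every element over gh is a product. The multiplication of the twisted dual prescribes a
    homomorphism on products only, and this makes it unique. *)
Lemma m_div (g h : ar G) (c : src g = tgt h) (z : vb V (mul g h)) :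
 exists (v : vb V g) (w : vb V h), vcomp v w /\ vm v w = z.
have [w Ew] := m_surj_s (cast (src h) (vs z)).
have Es : mkt (vs w) = mkt (vs z) by rewrite Ew mkt_cast // src_mul.
have Et : tmkt (dmap src (a z)) = tmkt (dmap src (a w)).
 rewrite !(m_as hV).
 exact: (congr1 (fun p : tot (vb0 V) => tmkt (a0 (projT2 p))) (esym Es)).
have [y tc Ey] := tmul_div hG cM cG c Et.
have Ey2 : dmap src y = a0 (cast (src g) (vt w)).
 apply: (@mkt_inj _ _ (tanb (ob G))); rewrite tc (m_at hV).
 apply: (congr1 (fun p : tot (vb0 V) => tmkt (a0 (projT2 p))) (_ : mkt (vt w) = mkt _)).
 by rewrite mkt_cast.
have [v [Ev1 Ev2]] := m_ex_s hV Ey2.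
have cvw : vcomp v w by rewrite /vcomp Ev2 mkt_cast.
exists v, w; split=> //; have [Es2 _ Ea] := m_mul hV cvw.
apply: m_eq_s; first by rewrite Ea Ev1 Ey.
by apply: mkt_inj; rewrite Es2 Es.
Qed.

Lemma m_vmD (g h : ar G) r (v v' : vb V g) (w w' : vb V h) : vcomp v w -> vcomp v' w' ->
 vcomp (r *: v + v') (r *: w + w') /\ vm (r *: v + v') (r *: w + w') = r *: vm v w + vm v' w'.
move=> c1 c2.
have c3 : vcomp (r *: v + v') (r *: w + w').
 by rewrite /vcomp (m_slin hV r) (m_tlin hV r); exact: mktD.
split=> //; have [E1 _ A1] := m_mul hV c1; have [E2 _ A2] := m_mul hV c2; have [E3 _ A3] := m_mul hV c3.
apply: m_eq_s.
 rewrite A3 (m_alin hV (g := g) r) (m_alin hV (g := h) r) (m_alin hV (g := mul g h) r) A1 A2.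
 by rewrite (tmul_linear hG cM cG) //; exact: vcomp_tcomp.
apply: mkt_inj; rewrite E3 (m_slin hV r) (m_slin hV r).
by apply: mktD; [exact: esym|exact: esym].
Qed.

Lemma core_closed (x : ob G) : let H := [set c : vb V (uni x) | vs c = 0] in
 H 0 /\ forall (r : R) u v, H u -> H v -> H (r *: u + v).
split=> [|r u v] /=; first exact: s0_.
by rewrite (m_slin hV r) => -> ->; rewrite scaler0 addr0.
Qed.
Lemma cvalP x (c : core V x) : vs (cval c) = 0.
have H := subvalP c; exact: (H (Submodule (core_closed x)) (fun _ => id)). Qed.
Lemma core_ex x (v : vb V (uni x)) : vs v = 0 -> exists c : core V x, cval c = v.
move=> v0; have [c Hc] := @mksub _ _ (hull [set c : vb V (uni x) | vs c = 0]) v (fun S HS => HS v v0).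
by exists c.
Qed.
Lemma cval_inj x (c c' : core V x) : cval c = cval c' -> c = c'.
exact: subval_inj. Qed.
Lemma cval_linear x : linear (@cval _ _ V x).
by []. Qed.

Definition cproj x (v : vb V (uni x)) : core V x := the 0 (fun c => cval c = v - vu (cast x (vs v))).
Lemma cprojE x (v : vb V (uni x)) : cval (cproj v) = v - vu (cast x (vs v)).
apply: (@theP _ 0 (fun c : core V x => cval c = v - vu (cast x (vs v)))); apply: core_ex.
rewrite (linB (m_slin hV (x := uni x))); apply/eqP; rewrite subr_eq0; apply/eqP; apply: mkt_inj.
by rewrite (m_su hV) mkt_cast // (src_uni hG).
Qed.

Lemma core_split x (c : core V x) (w : vb0 V x) : cval c + vu w = 0 -> c = 0 /\ w = 0.
move=> E; have w0 : w = 0.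
 have := congr1 (@vs _ _ V _) E; rewrite (linD (m_slin hV (x := uni x))) cvalP add0r s0_ => E2.
 by have := m_su hV w; rewrite E2 => /esym; exact: mkt_eq0.
split=> //; apply: cval_inj; move: E; rewrite w0 u0_ addr0 => ->.
by [].
Qed.
Lemma core_split_ex x (v : vb V (uni x)) : exists (c : core V x) (w : vb0 V x), v = cval c + vu w.
by exists (cproj v), (cast x (vs v)); rewrite cprojE subrK. Qed.

Lemma cast_s_smooth (P : dspace R) (f : P -> ob G) (X : forall y, vb V (uni (f y))) : smooth_map f ->
 smooth_lift X -> smooth_map (fun y => mkt (cval (cproj (X y)))).
move=> sf sX; have su := smap_comp sf (smooth_uni hG).
have s1 : smooth_map (fun y => mkt (vu (cast (f y) (vs (X y))))).
 apply: (smooth_totmap (m_usm hV)).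
 have := smooth_totmap (m_ssm hV) sX; fext => y.
 by rewrite mkt_cast // (src_uni hG).
have := smooth_alongD oV su sX (smooth_alongM oV su (@smooth_cst _ P (-1)) s1).
by fext => y; rewrite cprojE scaleN1r.
Qed.

Lemma smooth_core (P : dspace R) (f : P -> ob G) (c : forall y, core V (f y)) :
 smooth_lift c <-> smooth_map (fun y => mkt (cval (c y))).
split=> H; apply: smap_gen => h; last first.
 by move=> [k gk ->]; exact: (H k (smooth_gen gk)).
by move=> gh; apply: (H (fun p : tot (core V) => h (mkt (cval (projT2 p))))); apply: smooth_gen; exists h.
Qed.
Lemma cval_smooth (P : dspace R) (f : P -> ob G) (c : forall y, core V (f y)) :
 smooth_lift c -> smooth_map (fun y => mkt (cval (c y))).
by move/smooth_core. Qed.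

Section Frame.
Variables (x0 : ob G) (r : nat).
Variables (U : set (ar G)) (e : 'I_(d + r) -> sec (vb V)) (xi : 'I_(d + r) -> tot (vb V) -> R).
Variables (U0 : set (ob G)) (w : 'I_d -> sec (vb0 V)) (ep : 'I_d -> tot (vb0 V) -> R).
Hypotheses (oVr : bundle_ok (vb V) (d + r)) (F : frame U e xi) (F0 : frame U0 w ep).
Hypotheses (Ux : U (uni x0)) (Ux0 : U0 x0).
Let su := smooth_uni hG.

Let X x (v : vb V x) : 'rV[R]_(d + r) := \row_k xi k (mkt v).
(** The units of V_M expressed in the frame e. Their rows are independent at x0 and are completed
    there by a constant block K to an invertible matrix, which stays invertible nearby. The vectors
    with coordinates in K, projected along the units, form a frame of the core. *)
Let W (y : ob G) : 'M[R]_(d, d + r) := \matrix_(j, k) xi k (mkt (vu (w j y))).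

Lemma X_lin x : linear (@X x).
by move=> s v v'; apply/rowP => k; rewrite !mxE; exact: (xi_lin F). Qed.

Lemma X_vu (y : ob G) (z : vb0 V y) : U0 y -> X (vu z) = (\row_l ep l (mkt z)) *m W y.
move=> Uy; apply/rowP => k; rewrite !mxE {1}(frame_exp F0 z Uy) (lin_sum (m_ulin hV (x := y))).
rewrite (eq_bigr (fun l => ep l (mkt z) *: vu (w l y))); last first.
 by move=> l _; rewrite (linZ (m_ulin hV (x := y))).
rewrite (fib_lin_sum _ _ _ (xi_lin F k (y := uni y))).
by apply: eq_bigr => l _; rewrite !mxE.
Qed.

Lemma W_free : row_free (W x0).
apply/inj_row_free => v vW; pose z := \sum_l v 0 l *: w l x0.
have ez : (\row_l ep l (mkt z)) = v by apply/rowP => l; rewrite mxE (frame_xi_comb F0).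
have Xz : X (vu z) = 0 by rewrite X_vu // ez vW.
have uz : vu z = 0.
 apply: (frame_eq F Ux) => k; have := congr1 (fun t : 'rV_(d + r) => t 0 k) Xz; rewrite !mxE => ->.
 by rewrite (fib_lin0 (xi_lin F k (y := uni x0))).
have z0 : z = 0 by have := m_su hV z; rewrite uz s0_ => /esym; exact: mkt_eq0.
by apply/rowP => l; rewrite -ez !mxE z0 (fib_lin0 (xi_lin F0 l (y := x0))).
Qed.

Variable K : 'M[R]_(r, d + r).
Let A y := col_mx (W y) K.
Hypothesis uA : A x0 \in unitmx.

Let sA y i j : smooth_at y (fun y => A y i j).
rewrite /A -(fintype.splitK i); case: (fintype.split i) => l /=.
 apply: (@smooth_at_eq _ _ _ (fun y => W y l j)); first by apply: filterE => z; rewrite col_mxEu.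
 apply: (@smooth_at_eq _ _ _ (fun y => xi j (mkt (vu (w l y))))); first by apply: filterE => z; rewrite mxE.
 apply: smooth_atW; apply: (smooth_totmap (m_usm hV) (frame_smooth F0 l) (xi_smooth F j)).
apply: (@smooth_at_eq _ _ _ (fun y => K l j)); last exact: smooth_at_cst.
by apply: filterE => z; rewrite col_mxEd.
Qed.

Let P := [set y | [/\ U (uni y), U0 y & A y \in unitmx]].
Let oP y : P y -> \forall z \near (y : dtop (ob G)), P z.
move=> [Uy U0y uy]; have [nA _] := smooth_at_invmx (sA y) uy.
by apply: filterS3 nA (frame_open F0 U0y) (smooth_near su (frame_open F Uy)) => z; split.
Qed.

Let c (i : 'I_r) : sec (core V) := fun y => cproj (\sum_k K i k *: e k (uni y)).
Let be y (z : core V y) i := (X (cval z) *m invmx (A y)) 0 (rshift d i).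

Lemma core_sec_smooth i : smooth_sec (c i).
apply/smooth_core; apply: (cast_s_smooth (f := fun y => y)); first exact: smap_id.
apply: (smooth_along_sum oVr su _) => k.
exact: (smooth_alongM oVr su (@smooth_cst _ _ (K i k)) (smap_comp su (frame_smooth F k))).
Qed.

Let Xb y i : U (uni y) -> X (\sum_k K i k *: e k (uni y)) = row i K.
by move=> Uy; apply/rowP => k; rewrite !mxE (frame_xi_comb F). Qed.

Lemma core_dual y i j : P y -> be (c j y) i = (i == j)%:R.
move=> [Uy U0y uy]; set z : vb0 V y := cast y (vs (\sum_k K j k *: e k (uni y))).
rewrite /be; have -> : X (cval (c j y)) = row_mx (- (\row_l ep l (mkt z))) (delta_mx 0 j) *m A y.
 rewrite /c (cprojE) (linB (@X_lin _)) Xb // X_vu // /A mul_row_col -rowE mulNmx.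
 exact: addrC.
by rewrite mulmxK // row_mxEr mxE eqxx.
Qed.

Lemma core_exp y (z : core V y) : P y -> z = \sum_i be z i *: c i y.
move=> [Uy U0y uy]; pose q := X (cval z) *m invmx (A y).
have Xq : X (cval z) = lsubmx q *m W y + rsubmx q *m K.
 by rewrite -mul_row_col hsubmxK mulmxKV.
pose b i := \sum_k K i k *: e k (uni y).
pose om := \sum_l (lsubmx q) 0 l *: w l y.
have E : cval z = vu om + \sum_i be z i *: b i.
 suff XE : X (cval z) = X (vu om + \sum_i be z i *: b i).
  by apply: (frame_eq F Uy) => k; have := congr1 (fun t : 'rV_(d + r) => t 0 k) XE; rewrite !mxE.
 rewrite (linD (@X_lin _)) X_vu // Xq; congr (_ *m _ + _).
  by apply/rowP => l; rewrite [RHS]mxE (frame_xi_comb F0).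
 rewrite (lin_sum (@X_lin _)) mulmx_sum_row; apply: eq_bigr => i _.
 by rewrite (linZ (@X_lin _)) Xb // mxE.
pose t i : vb0 V y := cast y (vs (b i)).
have bE i : b i = cval (c i y) + vu (t i) by rewrite /c (cprojE) subrK.
have S : cval (z - \sum_i be z i *: c i y) + vu (- (om + \sum_i be z i *: t i)) = 0.
 clearbody om; rewrite (linB (@cval_linear y)) (linN (m_ulin hV (x := y))) (linD (m_ulin hV (x := y))) E.
 have -> : cval (\sum_i be z i *: c i y) = \sum_i be z i *: cval (c i y).
  by rewrite (lin_sum (@cval_linear y)); apply: eq_bigr => i _; rewrite (linZ (@cval_linear y)).
 have -> : vu (\sum_i be z i *: t i) = \sum_i be z i *: vu (t i).
  by rewrite (lin_sum (m_ulin hV (x := y))); apply: eq_bigr => i _; rewrite (linZ (m_ulin hV (x := y))).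
 rewrite (eq_bigr (fun i => be z i *: cval (c i y) + be z i *: vu (t i))); last first.
  by move=> i _; rewrite bE scalerDr.
 by rewrite big_split /= [X in vu om + X]addrC addrA addrK subrr.
by have [/eqP] := core_split S; rewrite subr_eq0 => /eqP.
Qed.

Lemma core_proj : smooth_map (fun p : tot (core V) => projT1 p) /\
 smooth_map (fun p : tot (core V) => mkt (cval (projT2 p))).
have s1 : smooth_map (fun p : tot (core V) => mkt (cval (projT2 p))).
 by apply: smap_gen => h gh; apply: smooth_gen; exists h.
split=> //; have := smap_comp (smap_comp s1 (ok_proj (m_ok hV))) (smooth_src hG).
by fext => p; rewrite /= (src_uni hG).
Qed.

Lemma core_frame : exists U' xi', U' x0 /\ @frame R _ (core V) r U' c xi'.
have [chi [sc _ c1 c0]] := bump (oP (And3 Ux Ux0 uA)).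
pose U' := [set y | \forall z \near (y : dtop (ob G)), chi z = 1].
have U'P y : U' y -> P y.
 move=> U'y; apply: near_self; apply: contrapT => /c0/near_self; rewrite (near_self U'y).
 by apply/eqP; rewrite oner_eq0.
exists U', (fun i (p : tot (core V)) => chi (projT1 p) * be (projT2 p) i); split=> //.
have [sp s1] := core_proj.
have bl y i : linear (fun z : core V y => be z i : R^o).
 by move=> s z z'; rewrite /be (cval_linear s) X_lin mulmxDl -scalemxAl !mxE.
split.
- split; last exact: core_sec_smooth.
 by move=> y; exact: near_near.
- move=> i; split; last first.
  by move=> y s z z'; rewrite /= (bl y i s z z') /=; rewrite mulrDr !mulrA [chi _ * s]mulrC -mulrA.
 apply: (@cutoff R (tot (core V)) (fun p : tot (core V) => chi (projT1 p)) (fun p : tot (core V) => be (projT2 p) i) (fun p : tot (core V) => P (projT1 p))).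
 + exact: (sp _ sc).
 + move=> p np; have n0 : \forall z \near (projT1 p : dtop (ob G)), chi z = 0.
   by apply: c0 => nP; apply: np; exact: (smooth_near sp nP).
  exact: (smooth_near sp n0).
 + move=> p /near_self[Uy U0y uy].
  apply: (@smooth_at_eq _ _ _ (fun p : tot (core V) => \sum_k xi k (mkt (cval (projT2 p))) *
    invmx (A (projT1 p)) k (rshift d i))).
   by apply: filterE => p'; rewrite /be mxE; apply: eq_bigr => k _; rewrite mxE.
  apply: smooth_at_sum => k; apply: smooth_atM.
   apply: smooth_atW; exact: (s1 _ (xi_smooth F k)).
  apply: (smooth_at_comp (f := fun p : tot (core V) => projT1 p) (h := fun y => invmx (A y) k (rshift d i)) sp).
  by have [_] := smooth_at_invmx (sA _) uy; exact.
- by move=> y U'y i j; rewrite /= (near_self U'y) mul1r core_dual //; exact: U'P.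
- move=> y U'y z; rewrite {1}(core_exp z (U'P _ U'y)); apply: eq_bigr => i _.
 by rewrite /= (near_self U'y) mul1r.
move=> p _ q [h gh ->]; apply: smooth_atW.
have sf := smap_comp (@smooth_fst _ (ob G) (euclid R r)) su.
have : smooth_map (fun p : prodd (ob G) (euclid R r) => mkt (\sum_i (p.2 : 'rV[R]_r) 0 i *: cval (c i p.1))).
 apply: (smooth_along_sum oVr sf _) => i; apply: (smooth_alongM oVr sf).
  by apply: smooth_gen; right; exists (fun z : 'rV[R]_r => z 0 i) => //; exists i.
 apply: (smap_comp (@smooth_fst _ (ob G) (euclid R r)) (g := fun y => mkt (cval (c i y)))).
 by apply/smooth_core; exact: core_sec_smooth.
move=> /(_ h (smooth_gen gh)); fext => y.
rewrite /theta /=; congr (h (mkt _)); rewrite (lin_sum (@cval_linear y.1)).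
by apply: eq_bigr => i _; rewrite (linZ (@cval_linear y.1)).
Qed.
End Frame.

(** Over a unit V is the sum of the core and V_M, so the core has rank N - d. The subtraction is
    truncated, and d <= N is known only when there is an object; hence the hypothesis in the first
    component. *)
Lemma core_ok : (ob G -> N = d + (N - d))%N /\ bundle_ok (core V) (N - d).
suff H (x : ob G) : N = (d + (N - d))%N /\ exists U (e : 'I_(N - d) -> sec (core V)) xi, U x /\ frame U e xi.
 split; first by move=> x; have [] := H x.
 split; last by move=> x; have [] := H x.
 by have [] := core_proj.
have dN : N = (d + (N - d))%N.
 rewrite subnKC //; apply: (fdim_le (bundle_fdim x oV0) (bundle_fdim (uni x) oV) (m_ulin hV (x := x))) => w w0.
 by have := m_su hV w; rewrite w0 s0_ => /esym; exact: mkt_eq0.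
split=> //; have := oV; rewrite {1}dN; move: (N - d)%N => r oVr.
have [U [e [xi [Ux F]]]] := ok_frame oVr (uni x); have [U0 [w [ep [Ux0 F0]]]] := ok_frame oV0 x.
have [p [K [/addnI ep' fK]]] := complement_rows (W_free F F0 Ux Ux0); subst p.
have uA : col_mx (\matrix_(j, k) xi k (mkt (vu (w j x)))) K \in unitmx by rewrite -row_full_unit.
by have [U' [xi' [U'x F']]] := core_frame oVr F F0 Ux Ux0 uA; exists U', (fun (i : 'I_r) y => cproj (\sum_k K i k *: e k (uni y))), xi'.
Qed.

(** The translates c 0_g and 0_g c^-1 of core elements, on which the target and the source of the
    twisted dual are evaluated. They span the kernels of s and t in V_g, by [rt_onto] and
    [lt_onto]. *)
Definition rt (g : ar G) (c : core V (tgt g)) : vb V g := cast g (vm (cval c) (0 : vb V g)).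
Definition lt (g : ar G) (c : core V (src g)) : vb V g := cast g (vm (0 : vb V g) (vi (cval c))).

Lemma rt_comp (g : ar G) (c : core V (tgt g)) : vcomp (cval c) (0 : vb V g).
rewrite /vcomp (cvalP) t0_; apply: mkt0; exact: (src_uni hG).
Qed.
Lemma rt_mkt (g : ar G) (c : core V (tgt g)) : mkt (rt c) = mkt (vm (cval c) (0 : vb V g)).
by rewrite mkt_cast // (uni_mul hG). Qed.
Lemma rt_s (g : ar G) (c : core V (tgt g)) : vs (rt c) = 0.
apply: mkt_inj; rewrite (totmapE vs (rt_mkt c)); have [-> _ _] := m_mul hV (rt_comp c).
by rewrite s0_.
Qed.
Lemma rt_t (g : ar G) (c : core V (tgt g)) : mkt (vt (rt c)) = mkt (vt (cval c)).
by rewrite (totmapE vt (rt_mkt c)); have [_ -> _] := m_mul hV (rt_comp c). Qed.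
Lemma rt_a (g : ar G) (c : core V (tgt g)) : tmkt (a (rt c)) = tmkt (tmul (a (cval c)) (0 : tangent g)).
rewrite (a_mkt (rt_mkt c)); have [_ _ ->] := m_mul hV (rt_comp c).
by rewrite a0_.
Qed.
Lemma rt_linear (g : ar G) : linear (@rt g).
move=> r c c'; have [_ E] := m_vmD r (rt_comp c) (rt_comp c').
rewrite /rt -cast_linear -E; congr (cast g (vm _ _)); by rewrite scaler0 addr0.
Qed.
Lemma rt_inj (g : ar G) (c : core V (tgt g)) : rt c = 0 -> c = 0.
move=> c0; have := rt_a c; rewrite c0 a0_ => /esym/mkt_eq0 t0.
have tc := vcomp_tcomp (rt_comp c); rewrite a0_ in tc.
apply: cval_inj; rewrite (m_inj_s hV (tmul_inj1 hG cM cG tc t0)) //; exact: (cvalP).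
Qed.

Lemma lt_comp (g : ar G) (c : core V (src g)) : vcomp (0 : vb V g) (vi (cval c)).
rewrite /vcomp (m_ti hV) (cvalP) s0_; apply: mkt0; by rewrite (src_uni hG).
Qed.
Lemma lt_mkt (g : ar G) (c : core V (src g)) : mkt (lt c) = mkt (vm (0 : vb V g) (vi (cval c))).
by rewrite mkt_cast // (inv_uni hG) (mul_uni hG). Qed.
Lemma lt_t (g : ar G) (c : core V (src g)) : vt (lt c) = 0.
apply: mkt_inj; rewrite (totmapE vt (lt_mkt c)); have [_ -> _] := m_mul hV (lt_comp c).
by rewrite t0_.
Qed.
Lemma lt_linear (g : ar G) : linear (@lt g).
move=> r c c'; have [_ E] := m_vmD r (lt_comp c) (lt_comp c').
rewrite /lt -cast_linear -E; congr (cast g (vm _ _)); first by rewrite scaler0 addr0.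
by rewrite (cval_linear r) (m_ilin hV).
Qed.
Lemma vi_inj (g : ar G) (v : vb V g) : vi v = 0 -> v = 0.
move=> v0; apply: (m_inj_s hV).
 have := m_ai hV v; rewrite v0 a0_ => /esym E.
 have := dmap_compE (h := fun k => k) (a v) (smooth_ginv hG) (smooth_ginv hG) (invgK hG).
 by rewrite E dmap0 ?dmap_id; [move=> /esym; exact: mkt_eq0|exact: smooth_ginv].
by have := m_ti hV v; rewrite v0 t0_ => /esym; exact: mkt_eq0.
Qed.
Lemma lt_inj (g : ar G) (c : core V (src g)) : lt c = 0 -> c = 0.
move=> c0; have := a_mkt (lt_mkt c); have [_ _ ->] := m_mul hV (lt_comp c).
rewrite c0 !a0_ => /esym/mkt_eq0 t0.
have tc := vcomp_tcomp (lt_comp c); rewrite a0_ in tc.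
apply: cval_inj; apply: vi_inj; apply: (m_inj_t hV); first exact: (tmul_inj2 hG cM cG tc t0).
have := m_ti hV (cval c); rewrite (cvalP); exact: mkt_eq0.
Qed.

Lemma core_fdim x : fdim (core V x) (N - d).
by have [_ oC] := core_ok; exact: bundle_fdim oC. Qed.

Lemma rt_onto (g : ar G) (v : vb V g) : vs v = 0 -> exists c, v = rt c.
exact: (ker_onto (core_fdim _) (bundle_fdim g oV) (bundle_fdim _ oV0) (core_ok.1 (src g)) (m_slin hV (x := g)) (@m_surj_s g) (@rt_linear g) (@rt_s g) (@rt_inj g)).
Qed.
Lemma lt_onto (g : ar G) (v : vb V g) : vt v = 0 -> exists c, v = lt c.
exact: (ker_onto (core_fdim _) (bundle_fdim g oV) (bundle_fdim _ oV0) (core_ok.1 (src g)) (m_tlin hV (x := g)) (@m_surj_t g) (@lt_linear g) (@lt_t g) (@lt_inj g)).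
Qed.

Lemma p_lin2 (g : ar G) v : linear (fun w => @B g v w).
by move=> r w w'; rewrite (p_skew hB v) (p_lin hB) opprD -scalerN -!(p_skew hB). Qed.
Lemma B_mkt (g h : ar G) (v w : vb V g) (v' w' : vb V h) : mkt v = mkt v' -> mkt w = mkt w' ->
 mkt (B v w) = mkt (B v' w').
by move=> e; have b := mkt_base e; subst h => e'; rewrite (mkt_inj e) (mkt_inj e'). Qed.

Lemma unit_vs_vt x (l : vb L (uni x)) : mkt (vs l) = mkt (vt l).
have [z <-] := line_map_surj oL0 oL (line_vu hL) l.
by rewrite (vsu hL) (vtu hL).
Qed.
Lemma vs_eq (g h : ar G) (l : vb L g) (l' : vb L h) : g = h -> mkt (vs l) = mkt (vs l') -> mkt l = mkt l'.
by move=> e; subst h => /mkt_inj/(line_inj (line_vs hL)) ->. Qed.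
Lemma vt_eq (g h : ar G) (l : vb L g) (l' : vb L h) : g = h -> mkt (vt l) = mkt (vt l') -> mkt l = mkt l'.
by move=> e; subst h => /mkt_inj/(line_inj (line_vt hL)) ->. Qed.

Lemma vu_comp x (w : vb0 V x) : vcomp (vu w) (vu w).
by rewrite /vcomp (m_su hV) (m_tu hV). Qed.
Lemma vu_idem x (w : vb0 V x) : mkt (vm (vu w) (vu w)) = mkt (vu w).
have := m_unitr (vu w).
have H y (w' : vb0 V y) : mkt w' = mkt w -> mkt (vm (vu w) (vu w')) = mkt (vu w) -> mkt (vm (vu w) (vu w)) = mkt (vu w).
 by move=> e; have b := mkt_base e; subst y; rewrite (mkt_inj e).
by apply: H; exact: (m_su hV).
Qed.

(** Over a unit [lsum] is the ordinary sum, so the equation reads b = b + b. *)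
Lemma lsum_unit0 x (c : src (uni x) = tgt (uni x)) (b : vb L (uni x)) : mkt b = mkt (lsum c b b) -> b = 0.
rewrite (lsum_split hL) => E; have u := mul_uni hG (uni x); rewrite (src_uni hG) in u.
have e1 : mkt (lsum c b 0) = mkt b by apply: vt_eq => //; rewrite (vt_lsum hL).
have e2 : mkt (lsum c 0 b) = mkt b by apply: vs_eq => //; rewrite (vs_lsum hL).
have := mktD 1 e1 e2; rewrite !scale1r -E => /mkt_inj /eqP.
by rewrite eq_sym -subr_eq0 addrK => /eqP.
Qed.
Lemma B_unit x (w w' : vb0 V x) : B (vu w) (vu w') = 0.
have c : src (uni x) = tgt (uni x) by rewrite (src_uni hG) (tgt_uni hG).
apply: (@lsum_unit0 x c); rewrite -(p_mult hB c (vu_comp w) (vu_comp w')).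
exact: esym (B_mkt (vu_idem w) (vu_idem w')).
Qed.

(** Here v = v 1 with 1 the unit at s(v), and the translate is 0_g c^-1 with c^-1 = 1 - c for the
    unit 1 at t(c). Multiplicativity moves the pairing to a unit, where units pair to zero, and - c
    accounts for the sign. *)
Lemma B_src (g : ar G) (v : vb V g) (c : core V (src g)) :
 mkt (vs (B v (lt c))) = mkt (- vs (B (vu (vs v)) (cval c))).
have cu : src g = tgt (uni (src g)) by rewrite (tgt_uni hG).
pose w : vb0 V (src g) := cast (src g) (vt (cval c)).
have Ew : mkt w = mkt (vt (cval c)) by rewrite mkt_cast // (tgt_uni hG).
have Ei : mkt (vi (cval c)) = mkt (vu w - cval c).
 have ei := inv_uni hG (src g); pose y : vb V (uni (src g)) := cast _ (vi (cval c)).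
 have Ey : mkt y = mkt (vi (cval c)) by rewrite mkt_cast.
 rewrite -Ey; congr mkt; apply: (m_eq_s).
  rewrite (linB (m_alin hV (g := _))) (m_au hV).
  apply: (dinv_unit hG cM cG (x := src g)).
  - rewrite (m_as hV) (cvalP) -(s0_ (uni (src g))) -(m_as hV).
   by rewrite a0_ dmap0 //; exact: smooth_src.
  - by rewrite (a_mkt Ey) (m_ai hV).
  rewrite (m_at hV).
  exact: (congr1 (fun p : tot (vb0 V) => tmkt (a0 (projT2 p))) Ew).
 apply: mkt_inj; rewrite (linB (m_slin hV (x := _))) (cvalP) subr0 (m_su hV) Ew.
 by rewrite (totmapE vs Ey) (m_si hV).
have c1 : vcomp v (vu (vs v)) by rewrite /vcomp (m_tu hV).
have c2 : vcomp (0 : vb V g) (vu w - cval c) := vcomp_mkt (erefl _) Ei (lt_comp c).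
have E1 := esym (m_unitr v).
have E2 : mkt (lt c) = mkt (vm (0 : vb V g) (vu w - cval c)).
 by rewrite (lt_mkt); apply: vm_mkt.
rewrite (totmapE vs (B_mkt E1 E2)) (p_mult hB cu c1 c2).
rewrite (lin0 (p_lin2 v)) (vs_lsum hL) (linB (p_lin2 _)) B_unit sub0r.
by rewrite (linN (vs_lin hL (g := _))).
Qed.

Lemma B_tgt (g : ar G) (v : vb V g) (c : core V (tgt g)) : mkt (vt (B v (rt c))) = mkt (vs (B (vu (vt v)) (cval c))).
have cu : src (uni (tgt g)) = tgt g by rewrite (src_uni hG).
have c1 : vcomp (vu (vt v)) v by rewrite /vcomp (m_su hV).
have E1 := esym (m_unitl v).
rewrite (totmapE vt (B_mkt E1 (rt_mkt c))) (p_mult hB cu c1 (rt_comp c)).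
by rewrite (lin0 (p_lin2 v)) (vt_lsum hL) unit_vs_vt.
Qed.

(** The object part of the map to the twisted dual: a unit paired with core elements. *)
Definition coflat x (w : vb0 V x) : homb (core V) (vb0 L) x :=
 tohom (fun c : core V x => cast x (vs (B (vu w) (cval c)))).
Lemma coflatE x (w : vb0 V x) c : happ (coflat w) c = cast x (vs (B (vu w) (cval c))).
rewrite tohomE // => r c1 c2; rewrite (cval_linear r) p_lin2 (vs_lin hL r); exact: cast_linear.
Qed.
Lemma coflat_mkt x (w : vb0 V x) c : mkt (happ (coflat w) c) = mkt (vs (B (vu w) (cval c))).
by rewrite coflatE mkt_cast // (src_uni hG). Qed.
Lemma coflat_linear x : linear (@coflat x).
move=> r w w'; apply: hom_ext => c; rewrite happ_comb !coflatE (m_ulin hV r) (p_lin hB).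
by rewrite (vs_lin hL r) cast_linear.
Qed.

Definition bflat (g : ar G) (v : vb V g) : homb (vb V) (vb L) g := tohom (fun w : vb V g => B v w).
Lemma flatE (g : ar G) (v w : vb V g) : happ (bflat v) w = B v w.
by rewrite tohomE //; exact: p_lin2. Qed.
Lemma flat_linear (g : ar G) : linear (@bflat g).
by move=> r v v'; apply: hom_ext => w; rewrite happ_comb !flatE (p_lin hB). Qed.

Lemma dual_sE (g : ar G) (psi : homb (vb V) (vb L) g) c : happ (dual_s psi) c = - vs (happ psi (lt c)).
rewrite /dual_s tohomE // => r c1 c2.
by rewrite -!/(lt _) (lt_linear) happD happZ (vs_lin hL r) opprD scalerN.
Qed.
Lemma dual_tE (g : ar G) (psi : homb (vb V) (vb L) g) c : happ (dual_t psi) c = vt (happ psi (rt c)).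
rewrite /dual_t tohomE // => r c1 c2.
by rewrite -!/(rt _) (rt_linear) happD happZ (vt_lin hL r).
Qed.
Lemma dual_s_lin (g : ar G) : linear (fun psi : homb (vb V) (vb L) g => dual_s psi).
move=> r p q; apply: hom_ext => c; rewrite happ_comb !dual_sE happ_comb (vs_lin hL r).
by rewrite opprD scalerN.
Qed.
Lemma dual_t_lin (g : ar G) : linear (fun psi : homb (vb V) (vb L) g => dual_t psi).
by move=> r p q; apply: hom_ext => c; rewrite happ_comb !dual_tE happ_comb (vt_lin hL r). Qed.

Lemma flat_s (g : ar G) (v : vb V g) : dual_s (bflat v) = coflat (vs v).
apply: hom_ext => c; rewrite dual_sE flatE; apply: mkt_inj; rewrite coflat_mkt.
have /(mktD (-1) (x := src g) (y := src (uni (src g)))) E := B_src v c.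
have /E := mkt0 (vb0 L) (esym (src_uni hG (src g))).
by rewrite !addr0 !scaleN1r opprK.
Qed.
Lemma flat_t (g : ar G) (v : vb V g) : dual_t (bflat v) = coflat (vt v).
by apply: hom_ext => c; rewrite dual_tE flatE; apply: mkt_inj; rewrite coflat_mkt B_tgt. Qed.

Lemma flat_u x (w : vb0 V x) : bflat (vu w) = dual_u (coflat w).
apply: esym; apply: the_eq => [c w'|chi H].
 rewrite flatE (linD (p_lin2 _)) B_unit addr0; apply: (line_inj (line_vs hL)); apply: mkt_inj.
 by rewrite (vsu hL) coflat_mkt.
apply: hom_ext => v; have [c [w' ->]] := core_split_ex v; rewrite H.
rewrite flatE (linD (p_lin2 _)) B_unit addr0; apply: (line_inj (line_vs hL)); apply: mkt_inj.
by rewrite (vsu hL) coflat_mkt.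
Qed.

(** By [lsumE] multiplicativity of the pairing is the defining equation of the dual product, and by
    [m_div] that equation has only one solution. *)
Lemma flat_m (g h : ar G) (v : vb V g) (w : vb V h) : vcomp v w -> bflat (vm v w) = dual_m (bflat v) (bflat w).
move=> cvw; have c := vcomp_base cvw; apply: esym; apply: the_eq => [v' w' c'|chi H].
 by rewrite !flatE (p_mult hB c) // (lsumE hL).
apply: hom_ext => z; have [v' [w' [c' <-]]] := m_div c z.
by rewrite H // !flatE (p_mult hB c) // (lsumE hL).
Qed.

Lemma smooth_bflat : smooth_map (totmap (bflat : vbmap (fun g => g) (vb V) (homb (vb V) (vb L)))).
have sp := ok_proj oV; apply: (smooth_into_hom sp) => e se.
have := p_smooth hB sp (@smooth_mkt _ _ (vb V)) (smap_comp sp se).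
by fext => -[g v]; rewrite flatE.
Qed.
Lemma smooth_coflat : smooth_map (totmap (coflat : vbmap (fun x => x) (vb0 V) (homb (core V) (vb0 L)))).
have sp := ok_proj oV0; apply: (smooth_into_hom sp) => e se.
have := smooth_totmap (line_map_tot (line_vs hL)) (p_smooth hB (smap_comp sp (smooth_uni hG)) (m_usm hV)
 (smap_comp sp (cval_smooth se))).
by fext => -[g v]; rewrite coflat_mkt.
Qed.
Lemma rt_smooth (P : dspace R) (f : P -> ar G) (c : forall y, core V (tgt (f y))) : smooth_map f ->
 smooth_lift c -> smooth_map (fun y => mkt (rt (c y))).
move=> sf sc; have st := smap_comp sf (smooth_tgt hG).
have sz := smooth_tot0 oV sf; have sc' := cval_smooth sc.
apply: (m_init hV sf).
 have := smooth_tmul hG cM cG (smap_comp st (smooth_uni hG)) sf (smap_comp sc' (m_asm hV)) (smap_comp sz (m_asm hV)).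
 move=> H; have {}H := H (fun y => vcomp_tcomp (rt_comp (c y))); move: H.
 fext => y; rewrite (rt_a); congr mkt; by rewrite /= a0_.
have := smooth_tot0 oV0 (smap_comp sf (smooth_src hG)); fext => y.
by rewrite (rt_s).
Qed.
Lemma smooth_dual_t : smooth_map (tdual_t).
have oH := homb_ok oV oL; have sp := ok_proj oH; have st := smap_comp sp (smooth_tgt hG).
apply: (smooth_into_hom st) => c sc.
have s1 := rt_smooth sp (smap_comp st sc).
have := smooth_totmap (line_map_tot (line_vt hL)) (smooth_happ oV oL sp (@smooth_mkt _ _ _) s1).
by fext => -[g psi]; rewrite dual_tE.
Qed.

Lemma flat_morphism : is_vbg_morphism (W := twisted_dual L V) (f := fun g => g) (f0 := fun x => x) bflat coflat.
split.
- by split=> //; split; exact: smap_id.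
- split; first by split; [exact: smooth_bflat|exact: smooth_coflat].
 + by move=> [g v]; split; rewrite /= /totmap /= ?flat_s ?flat_t.
 + by move=> [x w]; rewrite /= /totmap /= flat_u.
 + by move=> [g v] [h w] /= c; rewrite /totmap /= flat_m.
- by move=> g; exact: flat_linear.
- by move=> x; exact: coflat_linear.
Qed.

Definition anchor (x : ob G) (c : core V x) : vb0 V x := cast x (vt (cval c)).
Definition copair (x : ob G) (w : vb0 V x) (c : core V x) := happ (coflat w) c.

Lemma anchor_mkt (x : ob G) (c : core V x) : mkt (anchor c) = mkt (vt (cval c)).
by rewrite mkt_cast // (tgt_uni hG). Qed.
Lemma anchor_linear (x : ob G) : linear (@anchor x).
by move=> r c c'; rewrite /anchor (cval_linear r) (m_tlin hV r) cast_linear. Qed.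
Lemma anchor_rt (g : ar G) (c : core V (tgt g)) : vt (rt c) = anchor c.
by apply: mkt_inj; rewrite anchor_mkt (rt_t). Qed.
Lemma copair_linear1 x c : linear (fun w : vb0 V x => copair w c).
by move=> r w w'; rewrite /copair (coflat_linear) happ_comb. Qed.
Lemma copair_linear2 x (w : vb0 V x) : linear (copair w).
exact: happ_linear. Qed.

Lemma rt_unit x (c : core V x) : exists c' : core V (tgt (uni x)), mkt c' = mkt c /\ mkt (rt c') = mkt (cval c).
have e : x = tgt (uni x) by rewrite (tgt_uni hG).
exists (cast (tgt (uni x)) c); split; first by rewrite mkt_cast.
set c' := cast _ c; have Ec : mkt (cval c') = mkt (cval c).
 have /(congr1 (fun p : tot (core V) => mkt (cval (projT2 p)))) : mkt c' = mkt c by rewrite mkt_cast.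
 exact.
rewrite (rt_mkt) -Ec -(m_unitr (cval c')) (cvalP) u0_.
by apply: vm_mkt => //; apply: mkt0; rewrite (src_uni hG) -e.
Qed.

Lemma core_pair x (c c' : core V x) : mkt (vs (B (cval c) (cval c'))) = mkt (copair (anchor c) c').
have [c1 [e1 e2]] := rt_unit c'; rewrite (totmapE vs (B_mkt (erefl (mkt (cval c))) (esym e2))).
rewrite (unit_vs_vt) (B_tgt) (coflat_mkt).
have Ec : mkt (cval c1) = mkt (cval c') := congr1 (fun p : tot (core V) => mkt (cval (projT2 p))) e1.
apply: (totmapE vs); apply: B_mkt => //.
exact: (totmapE vu (esym (anchor_mkt c))).
Qed.
Lemma copair_skew x (c c' : core V x) : copair (anchor c) c' = - copair (anchor c') c.
apply: mkt_inj; rewrite -core_pair (p_skew hB) (linN (vs_lin hL (g := _))).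
have := mktD (-1) (core_pair c' c) (mkt0 (vb0 L) (src_uni hG x)).
by rewrite !scaleN1r !addr0.
Qed.

(** Homomorphisms pulled back from V_M along t. They are the kernel of the source of the twisted
    dual: that source tests on the left translates of the core, which fill the kernel of t
    ([pull_t_ex]). *)
Definition pull_t (g : ar G) (mu : Hom (vb0 V (tgt g)) (vb0 L (tgt g))) : homb (vb V) (vb L) g :=
 tohom (fun v : vb V g => finv vt (happ mu (vt v))).
Lemma pull_tE g mu v : vt (happ (@pull_t g mu) v) = happ mu (vt v).
rewrite tohomE ?(finvE oL oL0 (line_vt hL)) // => r v1 v2.
by rewrite (m_tlin hV r) happD happZ (finv_linear oL oL0 (line_vt hL)).
Qed.
Lemma pull_t_s g mu : dual_s (@pull_t g mu) = 0.
apply: hom_ext => c; rewrite (dual_sE) (_ : happ (pull_t mu) (lt c) = 0) ?vsL0 ?oppr0 //.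
by apply: (line_inj (line_vt hL)); rewrite pull_tE (lt_t) happ0 vtL0.
Qed.
Lemma pull_t_t g mu c : happ (dual_t (@pull_t g mu)) c = happ mu (anchor c).
by rewrite (dual_tE) pull_tE anchor_rt. Qed.
Lemma pull_t_ex g (psi : homb (vb V) (vb L) g) : dual_s psi = 0 -> exists mu, psi = pull_t mu.
move=> p0; have k0 v : vt v = 0 -> happ psi v = 0.
 move=> /(lt_onto)[c ->]; apply: (line_inj (line_vs hL)).
 by apply/eqP; rewrite vsL0 -oppr_eq0 -(dual_sE) p0.
have [S [lS SE]] := fdim_rinv (bundle_fdim (tgt g) oV0) (m_tlin hV (x := g)) (m_surj_t (g := g)).
exists (tohom (fun w => vt (happ psi (S w)))); apply: hom_ext => v; apply: (line_inj (line_vt hL)).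
rewrite pull_tE tohomE; last by move=> r w w'; rewrite lS happD happZ (vt_lin hL r).
congr vt; apply/eqP; rewrite -subr_eq0 -happN -happD; apply/eqP; apply: k0.
by rewrite (linB (m_tlin hV (x := g))) SE subrr.
Qed.
Lemma flat_rt (g : ar G) (c : core V (tgt g)) (w : vb V g) : vt (happ (bflat (rt c)) w) = - copair (vt w) c.
rewrite (flatE) (p_skew hB) (linN (vt_lin hL (g := _))); congr (- _).
by apply: mkt_inj; rewrite (B_tgt) (coflat_mkt).
Qed.

Definition nondeg_at x := core_nondeg (@anchor x) (@copair x).

(** Full faithfulness over a unit gives exactness of the cone at the core, by injectivity, and in
    the middle, by surjectivity; essential surjectivity gives the right end. Exactness forces the
    core and V_M to have the same rank. *)
Lemma morita_nondeg : is_vb_morita_id (W := twisted_dual L V) (bflat) -> forall x, nondeg_at x /\ N = (d + d)%N.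
move=> [F0 [[_ [_ FS _ _] _ _] [_ _ on [Gi [G1 G2 _ _]]]]].
(* The object map is only known to exist; compatibility with sources at units identifies it with
   [coflat]. *)
have F0E x (w : vb0 V x) : F0 _ w = coflat w.
 apply: mkt_inj; have [E0 _] := FS (mkt (vu w)); have e := m_su hV w.
 have E : mkt (dual_s (bflat (vu w))) = mkt (F0 _ (vs (vu w))) := E0.
 rewrite (flat_s) in E.
 rewrite -(totmapE F0 e) -(totmapE (coflat : vbmap (fun x => x) (vb0 V) (homb (core V) (vb0 L))) e).
 exact: esym E.
have inj g (v : vb V g) : vt v = 0 -> bflat v = 0 -> vs v = 0 -> v = 0.
 move=> t0 f0 s0; apply: mkt_inj; have [_ <-] := G1 (mkt v) I; have [_ <-] := G1 (mkt (0 : vb V g)) I.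
 congr Gi; rewrite /= /totmap /= t0 f0 s0 t0_ s0_.
 by rewrite (lin0 (flat_linear (g := g))).
have sur g (psi : homb (vb V) (vb L) g) (w : vb0 V (tgt g)) (w' : vb0 V (src g)) :
  dual_t psi = coflat w -> dual_s psi = coflat w' -> exists v : vb V g, [/\ vt v = w, bflat v = psi & vs v = w'].
 move=> tp sp; have := G2 ((mkt w, mkt psi), mkt w') => /=; case.
  by split; rewrite /= /totmap /= ?tp ?sp F0E.
 case: (Gi _) => h v _ E.
 have E1 : mkt (vt v) = mkt w := congr1 (fun q => q.1.1) E.
 have E2 : mkt (bflat v) = mkt psi := congr1 (fun q => q.1.2) E.
 have E3 : mkt (vs v) = mkt w' := congr1 (fun q => q.2) E.
 have b := mkt_base E2; subst h; exists v.
 by rewrite (mkt_inj E1) (mkt_inj E2) (mkt_inj E3).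
have nd x : nondeg_at x.
 have : nondeg_at (tgt (uni x)); last by rewrite (tgt_uni hG).
 move=> c c0 cw; apply: (rt_inj); apply: inj.
 - by rewrite anchor_rt.
 - by apply: hom_ext => w; apply: (line_inj (line_vt hL)); rewrite flat_rt cw oppr0 vtL0.
 - exact: (rt_s).
have ex x : core_exact (@anchor x) (@copair x).
 have : core_exact (@anchor (tgt (uni x))) (@copair (tgt (uni x))); last by rewrite (tgt_uni hG).
 move=> z mu zm; have [||v [v1 v2 v3]] := sur (uni x) (pull_t mu) z 0.
 - by apply: hom_ext => c; rewrite pull_t_t -zm.
 - by rewrite pull_t_s (lin0 (coflat_linear (x := _))).
 have [c Ec] := rt_onto v3; exists c; split; first by rewrite -v1 Ec anchor_rt.
 move=> w; have [y Ey] := m_surj_t (g := uni x) w.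
 by rewrite -Ey -pull_tE -v2 Ec flat_rt.
have ont x : core_onto (@anchor x) (@copair x).
 move=> be; have [[[[h psi] [y w]] Ep0] Et0] := on (@mkt _ _ (homb (core V) (vb0 L)) x be).
 have Ep : mkt (dual_s psi) = mkt (F0 _ w) := Ep0.
 have Et : mkt (dual_t psi) = @mkt _ _ (homb (core V) (vb0 L)) x be := Et0.
 have b := mkt_base Ep; subst y; have b := mkt_base Et; subst x.
 have {}Ep := mkt_inj Ep; have {}Et := mkt_inj Et; rewrite F0E in Ep.
 have [v Ev] := m_surj_s w.
 have [|mu Emu] := @pull_t_ex h (psi - bflat v).
  by rewrite (linB (dual_s_lin (g := h))) (flat_s) Ev Ep subrr.
 exists (vt v), mu => c; rewrite -pull_t_t -Emu (linB (dual_t_lin (g := h))) Et.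
 rewrite (flat_t).
 have := happ_comb (-1) (coflat (vt v)) be c; rewrite scaleN1r scaleN1r [- _ + be]addrC => ->.
 by rewrite addrA subrr add0r.
move=> x; split=> //; have dN := (core_ok).1 x.
rewrite {1}dN; congr (d + _)%N.
apply: (core_rank (core_fdim x) (bundle_fdim x oV0) (bundle_fdim x oL0) (@anchor_linear x)
 (@copair_linear1 x) (@copair_linear2 x) (@copair_skew x) (nd x) (ex x) (ont x)).
Qed.

Lemma nondegP x : nondeg_at x <-> forall v : vb V (uni x), vs v = 0 -> vt v = 0 ->
 (forall w : vb0 V x, B v (vu w) = 0) -> v = 0.
have anE (c : core V x) : anchor c = 0 <-> vt (cval c) = 0.
 split=> [E|E]; last by rewrite /anchor E (lin0 (@cast_linear _ _ _ _ _)).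
 by have := anchor_mkt c; rewrite E => /esym; exact: mkt_eq0.
have coE (c : core V x) w : copair w c = 0 <-> B (cval c) (vu w) = 0.
 split=> [E|E].
  have := coflat_mkt w c; rewrite -/(copair w c) E => /esym/mkt_eq0/(vs_inj hL).
  by move=> E1; rewrite (p_skew hB) E1 oppr0.
 by rewrite /copair (coflatE) (p_skew hB) E oppr0 vsL0 (lin0 (@cast_linear _ _ _ _ _)).
split=> nd.
 move=> v v0 t0 H; have [c cE] := core_ex v0; rewrite -cE; rewrite (_ : c = 0) //.
 by apply: nd; [apply/anE; rewrite cE|move=> w; apply/coE; rewrite cE].
move=> c /anE t0 H; apply: cval_inj; rewrite (nd _ (cvalP c) t0) // => w.
by apply/coE.
Qed.

Let oC := (core_ok).2.
Hypothesis nd : forall x, nondeg_at x.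
Hypothesis Nd : N = (d + d)%N.
Let rd : (N - d)%N = d.
by rewrite Nd addnK. Qed.
Let HomV := homb (vb V) (vb L).
Let HomC := homb (core V) (vb0 L).

Let ont x : core_onto (@anchor x) (@copair x).
exact: (core_nondeg_onto (core_fdim x) (bundle_fdim x oV0) (bundle_fdim x oL0) (anchor_linear (x := x))
 (copair_linear1 (x := x)) (copair_linear2 (x := x)) rd (nd (x := x))).
Qed.
Let exa x : core_exact (@anchor x) (@copair x).
exact: (core_nondeg_exact (core_fdim x) (bundle_fdim x oV0) (bundle_fdim x oL0) (anchor_linear (x := x))
 (copair_linear1 (x := x)) (copair_linear2 (x := x)) (copair_skew (x := x)) rd (nd (x := x))).
Qed.

(** Surjectivity at the right end of the cone writes be as phi(z, -) + mu o rho. The first term is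
    the target of the image of an element v with t(v) = z, the second that of [pull_t mu], whose
    source is zero. *)
Lemma flat_tsur (g : ar G) (be : HomC (tgt g)) : exists (psi : HomV g) (w : vb0 V (src g)),
 dual_t psi = be /\ dual_s psi = coflat w.
have [z [mu E]] := ont be; have [v Ev] := m_surj_t z.
exists (bflat v + pull_t mu), (vs v); split.
 rewrite (linD (dual_t_lin (g := g))) (flat_t) Ev; apply: hom_ext => c.
 have := happ_comb 1 (coflat z) (dual_t (pull_t mu)) c; rewrite !scale1r => ->.
 by rewrite (pull_t_t) E.
by rewrite (linD (dual_s_lin (g := g))) (flat_s) (pull_t_s) addr0.
Qed.

Lemma flat_inj (g : ar G) (v : vb V g) : vt v = 0 -> vs v = 0 -> bflat v = 0 -> v = 0.
move=> vt0 vs0 fv; have [c Ec] := rt_onto vs0.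
suff c0 : c = 0 by rewrite Ec c0 (lin0 (rt_linear (g := g))).
apply: nd; first by rewrite -(anchor_rt) -Ec.
move=> w; have [y <-] := m_surj_t w.
by apply/eqP; rewrite -oppr_eq0 -(flat_rt) -Ec fv vtL0.
Qed.

(** An element v0 with source w' has an image that differs from psi by some [pull_t mu]; exactness
    in the middle provides a core element whose right translate corrects both this difference and
    the target without changing the source. *)
Lemma flat_sur (g : ar G) (psi : HomV g) (w : vb0 V (tgt g)) (w' : vb0 V (src g)) :
 dual_t psi = coflat w -> dual_s psi = coflat w' -> exists v : vb V g, [/\ vt v = w, bflat v = psi & vs v = w'].
move=> tp sp; have [v0 Ev0] := m_surj_s w'.
have [|mu Emu] := @pull_t_ex g (psi - bflat v0).
 by rewrite (linB (dual_s_lin (g := g))) (flat_s) Ev0 sp subrr.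
have [|c [c1 c2]] := exa (x := tgt g) (z := w - vt v0) (mu := mu).
 move=> c; rewrite -(pull_t_t) -Emu (linB (dual_t_lin (g := g))) tp.
 by rewrite (flat_t) -(linB (coflat_linear (x := tgt g))).
exists (v0 + rt c); split.
- by rewrite (linD (m_tlin hV (x := g))) (anchor_rt) c1 addrC subrK.
- rewrite (linD (flat_linear (g := g))); apply/eqP; rewrite addrC eq_sym -subr_eq Emu; apply/eqP.
 apply: hom_ext => y; apply: (line_inj (line_vt hL)).
 by rewrite (flat_rt) (pull_tE) c2.
by rewrite (linD (m_slin hV (x := g))) (rt_s) addr0.
Qed.

Local Notation tcoflat := (totmap (coflat : vbmap (fun x => x) (vb0 V) HomC)).
Let P := subd [set p : prodd (tot HomV) (tot (vb0 V)) | tdual_s p.1 = tcoflat p.2].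

(** A tangent vector z of the dual core bundle is lifted in two pieces: its projection to the base
    is lifted through a local section [ph] of P over G, and the remaining vertical vector is the
    velocity of a line in the fiber, lifted by [flat_tsur]. *)
Lemma flat_submersion : @submersion _ P (tot HomC) (fun p => tdual_t (sval p).1).
have sT : @smooth_map _ P (tot HomC) (fun p => tdual_t (sval p).1).
 exact: (smap_comp (smap_comp (@smooth_sval _ _ _) smooth_fst) (smooth_dual_t)).
split=> // -[[[g psi] [y w0]] Ep] z0.
pose z : @tangent R (tot HomC) (@mkt _ _ HomC (tgt g) (dual_t psi)) := z0.
have Eb : mkt (dual_s psi) = @mkt _ _ HomC y (coflat w0) := Ep.
have b := mkt_base Eb; subst y; have {}Eb := mkt_inj Eb.
have oH := homb_ok oV oL; have oHC := homb_ok oC oL0; have oH0 := homb_ok oV0 oL0.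
have sp := ok_proj oHC.
have [_ /(_ g (dmap (fun p : tot HomC => projT1 p) z))[ze zeE]] := tgt_subm hG.
have [v0 Ev0] := m_surj_s w0.
have [|mu Emu] := @pull_t_ex g (psi - bflat v0).
 by rewrite (linB (dual_s_lin (g := g))) (flat_s) Ev0 Eb subrr.
have [V1 sV1 V1E] := smooth_ext oV v0; have [M1 sM1 M1E] := smooth_ext oH0 (mu : homb (vb0 V) (vb0 L) (tgt g)).
(* The given point psi is the image of v0 plus [pull_t mu]. Extending v0 and mu to global sections
   keeps the dual source of the form [coflat], hence stays inside P. *)
pose psi1 (h : ar G) : HomV h := bflat (V1 h) + pull_t (M1 (tgt h)).
have psi1s h : dual_s (psi1 h) = coflat (vs (V1 h)).
 by rewrite (linD (dual_s_lin (g := h))) (flat_s) (pull_t_s) addr0.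
pose ph (h : ar G) : P := exist _ (mkt (psi1 h), mkt (vs (V1 h))) (congr1 (@mkt _ _ HomC _) (psi1s h)).
have sph : smooth_map ph.
 apply: smooth_into_sub; apply: smooth_pair; last exact: smooth_totmap (m_ssm hV) sV1.
 apply: (smooth_alongD oH smap_id).
  exact: smap_comp sV1 (smooth_bflat).
 apply: (smooth_into_hom smap_id) => e se.
 have st := smooth_tgt hG.
 have s1 := smooth_happ oV0 oL0 st (smap_comp st sM1) (smooth_totmap (m_tsm hV) se).
 have := smooth_finv oL oL0 (line_vt hL) smap_id s1; fext => h.
 by congr mkt; apply: (line_inj (line_vt hL)); rewrite (pull_tE) (finvE oL oL0 (line_vt hL)).
pose p0 : P := exist _ (existT _ g psi, existT _ (src g) w0) Ep.
have sub_eq (p q : P) : sval p = sval q -> p = q.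
 by case: p q => [p hp] [q hq] /= e; subst q; congr exist; exact: Prop_irrelevance.
have ph0 : ph g = p0.
 apply: sub_eq; rewrite /= /psi1 V1E M1E -Emu Ev0; congr pair.
 by rewrite addrC subrK.
have [v1 v1E] := push_tangent ze sph ph0.
pose T (p : P) := tdual_t (sval p).1.
pose z1 : @tangent R (tot HomC) (@mkt _ _ HomC (tgt g) (dual_t psi)) := dmap T v1.
(* The difference of z and the vector pushed along [ph] annihilates functions of the base, so
   [vertical_tangent] applies. *)
have [b bE] : exists b : HomC (tgt g), forall q, smooth_fun q ->
  tapp (z - z1) q = tapp (dline R) (fun t => q (mkt (dual_t psi + tcoord t *: b))).
 apply: (@vertical_tangent R _ HomC _ oHC (tgt g) (dual_t psi) (z - z1)) => f sf.
 have -> : tapp (z - z1) (fun p => f (projT1 p)) =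
  tapp z (fun p : tot HomC => f (projT1 p)) - tapp z1 (fun p => f (projT1 p)) by [].
 have sfp : smooth_fun (fun p : tot HomC => f (projT1 p)) := sp _ sf.
 rewrite [tapp z1 _](dmapE v1 sT sfp) v1E; last exact: sT _ sfp.
 have := congr1 (fun v => tapp v f) zeE; rewrite (dmapE ze (smooth_tgt hG) sf) (dmapE z sp sf).
 move=> E; apply/eqP; rewrite subr_eq0; apply/eqP; exact: esym E.
have [psi2 [w2 [t2 s2]]] := flat_tsur b.
have lineE t : tdual_s (mkt (psi + tcoord t *: psi2)) = tcoflat (mkt (w0 + tcoord t *: w2)).
 suff E2 : dual_s (psi + tcoord t *: psi2) = coflat (w0 + tcoord t *: w2) by exact: (congr1 (@mkt _ _ HomC _) E2).
 by rewrite [psi + _]addrC [w0 + _]addrC (dual_s_lin (g := g)) (coflat_linear) s2 Eb.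
pose li (t : euclid R 1) : P := exist _ (mkt (psi + tcoord t *: psi2), mkt (w0 + tcoord t *: w2)) (lineE t).
have sli : smooth_map li.
 by apply: smooth_into_sub; apply: smooth_pair; [exact: (smooth_line oH psi psi2)|exact: (smooth_line oV0 w0 w2)].
have li0 : li (0 : 'rV[R]_1) = p0.
 by apply: sub_eq; rewrite /= /tcoord mxE !scale0r !addr0.
have [v2 v2E] := push_tangent (dline R) sli li0.
exists (v1 + v2); rewrite (linD (dmap_lin sT (x := p0))).
suff E2 : dmap T v2 = z - z1 by rewrite [X in _ + X = _]E2; exact: (subrKC z1 z).
apply: tangent_ext => q sq; rewrite bE // (dmapE v2 sT sq) v2E; last exact: sT _ sq.
congr (tapp _ _); apply/funext => t /=; rewrite /T /li /totmap /=; congr (q (mkt _)).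
by rewrite addrC (dual_t_lin (g := g)) t2 addrC.
Qed.

Lemma flat_ess_sur (y : tot HomC) : exists p : P, tdual_t (sval p).1 = y.
case: y => x be; have e : x = tgt (uni x) by rewrite (tgt_uni hG).
have [psi [w [tp sp]]] := flat_tsur (cast (tgt (uni x)) (be : HomC x)).
exists (exist _ (mkt psi, mkt w) (congr1 (@mkt _ _ HomC _) sp)).
exact: (etrans (congr1 (@mkt _ _ HomC _) tp) (mkt_cast _ e)).
Qed.

Let Q := [set q : prodd (prodd (tot (vb0 V)) (tot HomV)) (tot (vb0 V)) | tdual_t q.1.2 = tcoflat q.1.1 /\
 tdual_s q.1.2 = tcoflat q.2].
Let isinv q (v : vb V (projT1 q.1.2)) := ((mkt (vt v), mkt (bflat v)), mkt (vs v)) = q.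
Let Gi (q : prodd (prodd (tot (vb0 V)) (tot HomV)) (tot (vb0 V))) : vb V (projT1 q.1.2) := the 0 (@isinv q).

Let GiP q : Q q -> isinv (Gi q).
move: q => [[[x w] [g psi]] [x' w']] [/= Et Es]; apply: theP.
have {}Et : mkt (dual_t psi) = @mkt _ _ HomC x (coflat w) := Et.
have {}Es : mkt (dual_s psi) = @mkt _ _ HomC x' (coflat w') := Es.
have b := mkt_base Et; subst x; have b := mkt_base Es; subst x'.
have [v [v1 v2 v3]] := flat_sur (mkt_inj Et) (mkt_inj Es).
by exists v; rewrite /isinv /= v1 v2 v3.
Qed.

Section Observables.
Variables (g0 : ar G) (U : set (ar G)) (e : 'I_N -> sec (vb V)) (xi : 'I_N -> tot (vb V) -> R).
Variables (U1 U2 : set (ob G)) (e1 e2 : 'I_d -> sec (vb0 V)) (ep1 ep2 : 'I_d -> tot (vb0 V) -> R).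
Variables (U3 : set (ar G)) (e3 : 'I_1 -> sec (vb L)) (la : 'I_1 -> tot (vb L) -> R).
Hypotheses (F : frame U e xi) (F1 : frame U1 e1 ep1) (F2 : frame U2 e2 ep2) (F3 : frame U3 e3 la).
Hypotheses (Ug : U g0) (U1g : U1 (tgt g0)) (U2g : U2 (src g0)) (U3g : U3 g0).

(** Target, pairings with a frame and source of v, in coordinates. These determine v by [flat_inj],
    so the coefficient matrix [Dm] has a right inverse K at g0. With K kept constant, Dm K stays
    invertible near g0, and v depends smoothly on the observed quantities: this is smoothness of the
    inverse in the fully faithful condition. *)
Let obs g (v : vb V g) : 'rV[R]_(d + N + d) := row_mx (row_mx (\row_i ep1 i (mkt (vt v)))
 (\row_k la ord0 (mkt (B v (e k g))))) (\row_i ep2 i (mkt (vs v))).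
Let obs_lin g : linear (@obs g).
move=> r v w; rewrite /obs (m_tlin hV r) (m_slin hV r) !scale_row_mx !add_row_mx.
congr (row_mx (row_mx _ _) _); apply/rowP => i; rewrite !mxE.
- exact: (xi_lin F1).
- rewrite (p_lin hB); exact: (xi_lin F3).
- exact: (xi_lin F2).
Qed.
Let Dm g : 'M[R]_(N, d + N + d) := \matrix_(i, j) obs (e i g) 0 j.

Let obsE g (v : vb V g) : U g -> obs v = (\row_i xi i (mkt v)) *m Dm g.
move=> Uy; rewrite {1}(frame_exp F v Uy) (lin_sum (@obs_lin g)) mulmx_sum_row; apply: eq_bigr => i _.
by rewrite (linZ (@obs_lin g)) mxE; congr (_ *: _); apply/rowP => j; rewrite !mxE.
Qed.

Let Dm_free : row_free (Dm g0).
apply/inj_row_free => c c0; pose v := \sum_i c 0 i *: e i g0.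
have cE : \row_i xi i (mkt v) = c by apply/rowP => i; rewrite mxE (frame_xi_comb F).
have : obs v = 0 by rewrite obsE // cE.
move/eqP; rewrite /obs !row_mx_eq0 => /andP[/andP[/eqP o3 /eqP o4] /eqP o2].
have v0 : v = 0.
 apply: flat_inj.
 - apply: (frame_eq F1 U1g) => i; rewrite (fib_lin0 (xi_lin F1 i (y := tgt g0))).
  by have := congr1 (fun t : 'rV_d => t 0 i) o3; rewrite !mxE.
 - apply: (frame_eq F2 U2g) => i; rewrite (fib_lin0 (xi_lin F2 i (y := src g0))).
  by have := congr1 (fun t : 'rV_d => t 0 i) o2; rewrite !mxE.
 apply: hom_ext => w; rewrite (frame_exp F w Ug) !happ_sum; apply: eq_bigr => k _; congr (_ *: _).
 rewrite (flatE); apply: (frame_eq F3 U3g) => i; rewrite (ord1 i).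
 have := congr1 (fun t : 'rV_N => t 0 k) o4; rewrite !mxE => ->.
 by rewrite (fib_lin0 (xi_lin F3 ord0 (y := g0))).
by rewrite -cE v0; apply/rowP => i; rewrite !mxE (fib_lin0 (xi_lin F i (y := g0))).
Qed.

Let Dm_smooth i j g : smooth_at g (fun h => Dm h i j).
apply: smooth_atW; rewrite -(fintype.splitK j); case: (fintype.split j) => [l|l] /=.
 rewrite -(fintype.splitK l); case: (fintype.split l) => [k|k] /=.
  have := smooth_totmap (m_tsm hV) (frame_smooth F i) (xi_smooth F1 k).
  by fext => h; rewrite [RHS]mxE /obs row_mxEl row_mxEl mxE.
 have := p_smooth hB smap_id (frame_smooth F i) (frame_smooth F k) (xi_smooth F3 ord0).
 by fext => h; rewrite [RHS]mxE /obs row_mxEl row_mxEr mxE.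
have := smooth_totmap (m_ssm hV) (frame_smooth F i) (xi_smooth F2 l).
by fext => h; rewrite [RHS]mxE /obs row_mxEr mxE.
Qed.

Lemma xi_inv_smooth (y0 : subd Q) i : projT1 (sval y0).1.2 = g0 ->
 smooth_at y0 (fun y : subd Q => xi i (mkt (Gi (sval y)))).
move=> y0E; pose f (y : subd Q) := projT1 (sval y).1.2.
have s0 := @smooth_sval R _ Q.
have s1 := smap_comp (smap_comp s0 smooth_fst) smooth_fst.
have s2 := smap_comp (smap_comp s0 smooth_fst) smooth_snd.
have s3 := smap_comp s0 smooth_snd.
have oH := homb_ok oV oL; have sf : smooth_map f := smap_comp s2 (ok_proj oH).
pose psi y : HomV (f y) := projT2 (sval y).1.2.
have spsi : smooth_lift psi.
 by move: s2; fext => y; exact: esym (mktK _).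
have [K DK] := row_freeP Dm_free.
pose E g := Dm g *m K.
have sE g j k : smooth_at g (fun h => E h j k).
 apply: (@smooth_at_eq _ _ _ (fun h => \sum_l Dm h j l * K l k)); first by apply: filterE => h; rewrite mxE.
 by apply: smooth_at_sum => l; apply: smooth_atM; [exact: Dm_smooth|exact: smooth_at_cst].
have uE : E (f y0) \in unitmx by rewrite /f y0E /E DK unitmx1.
have [nE sI] := smooth_at_invmx (sE _) uE.
pose known (y : subd Q) : 'rV[R]_(d + N + d) := row_mx (row_mx (\row_i ep1 i (sval y).1.1)
 (\row_k la ord0 (mkt (happ (psi y) (e k (f y)))))) (\row_i ep2 i (sval y).2).
have sk j : smooth_at y0 (fun y => known y 0 j).
 apply: smooth_atW; rewrite -(fintype.splitK j); case: (fintype.split j) => [l|l] /=.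
  rewrite -(fintype.splitK l); case: (fintype.split l) => [k|k] /=.
   have := s1 _ (xi_smooth F1 k).
   by fext => h; rewrite /known row_mxEl row_mxEl mxE.
  have := smooth_happ oV oL sf spsi (smap_comp sf (frame_smooth F k)) (xi_smooth F3 ord0).
  by fext => h; rewrite /known row_mxEl row_mxEr mxE.
 have := s3 _ (xi_smooth F2 l).
 by fext => h; rewrite /known row_mxEr mxE.
apply: (@smooth_at_eq _ _ _ (fun y => \sum_j known y 0 j * (\sum_l K j l * invmx (E (f y)) l i))).
 apply: filterS2 (smooth_near sf (frame_open F (_ : U (f y0)))) (smooth_near sf nE); last by rewrite /f y0E.
 move=> y Uy uy; have oE : obs (Gi (sval y)) = known y.
  have := GiP (svalP y); rewrite /isinv => q.
  have q1 : mkt (vt (Gi (sval y))) = (sval y).1.1 := congr1 (fun t => t.1.1) q.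
  have q2 : mkt (bflat (Gi (sval y))) = mkt (psi y).
   by rewrite /psi mktK; exact: (congr1 (fun t => t.1.2) q).
  have q3 : mkt (vs (Gi (sval y))) = (sval y).2 := congr1 (fun t => t.2) q.
  congr (row_mx (row_mx _ _) _); apply/rowP => j; rewrite !mxE ?q1 ?q3 //.
  by rewrite -(mkt_inj q2) (flatE).
 have xE : \row_i xi i (mkt (Gi (sval y))) = known y *m (K *m invmx (E (f y))).
  by rewrite -oE obsE // -mulmxA [Dm _ *m _]mulmxA -/(E _) mulmxV // mulmx1.
 have := congr1 (fun t : 'rV_N => t 0 i) xE; rewrite !mxE => ->.
 by apply: eq_bigr => j _; congr (_ * _); rewrite mxE.
apply: smooth_at_sum => j; apply: smooth_atM => //; apply: smooth_at_sum => l.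
apply: smooth_atM; first exact: smooth_at_cst.
exact: (smooth_at_comp (h := fun g => invmx (E g) l i) sf (sI l i)).
Qed.
End Observables.

Lemma flat_morita : is_vb_morita_id (W := twisted_dual L V) (bflat).
exists (coflat); split; first exact: (flat_morphism).
split.
- by have [] := flat_morphism.
- exact: flat_submersion.
- exact: flat_ess_sur.
exists (fun q => mkt (Gi q)); split.
- move=> [g v] _; set q := (_, _); have Qq : Q q.
  by split; rewrite /q /= /totmap /= ?(flat_t) ?(flat_s).
 split=> //; have := GiP Qq; rewrite /isinv => E.
 have E1 : mkt (vt (Gi q)) = mkt (vt v) := congr1 (fun t => t.1.1) E.
 have E2 : mkt (bflat (Gi q)) = mkt (bflat v) := congr1 (fun t => t.1.2) E.
 have E3 : mkt (vs (Gi q)) = mkt (vs v) := congr1 (fun t => t.2) E.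
 suff -> : Gi q = v by [].
 apply: subr0_eq; apply: flat_inj.
 - by rewrite (linB (m_tlin hV (x := g))) (mkt_inj E1) subrr.
 - by rewrite (linB (m_slin hV (x := g))) (mkt_inj E3) subrr.
 - by rewrite (linB (flat_linear (g := g))) (mkt_inj E2) subrr.
- move=> q Qq; split=> //; exact: (GiP Qq).
- have s0 := @smooth_sval R (tot (vb V)) setT.
 apply: smooth_pair; first apply: smooth_pair.
 + exact: (smap_comp s0 (m_tsm hV)).
 + exact: (smap_comp s0 (smooth_bflat)).
 + exact: (smap_comp s0 (m_ssm hV)).
have sf : smooth_map (fun y : subd Q => projT1 (sval y).1.2).
 exact: (smap_comp (smap_comp (smap_comp (@smooth_sval R _ Q) smooth_fst) smooth_snd) (ok_proj (homb_ok oV oL))).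
apply: (smooth_along oV sf) => y U e xi Uy F i.
have [U1 [e1 [ep1 [U1x F1]]]] := ok_frame oV0 (tgt (projT1 (sval y).1.2)).
have [U2 [e2 [ep2 [U2x F2]]]] := ok_frame oV0 (src (projT1 (sval y).1.2)).
have [U3 [e3 [la [U3x F3]]]] := ok_frame oL (projT1 (sval y).1.2).
exact: (xi_inv_smooth F F1 F2 F3 Uy U1x U2x U3x).
Qed.
End VBModel.

Notation amkt := (@mkt _ _ (atiyahb _) _) (only parsing).

(** * Contact and Atiyah forms *)

Section Along.
Variable R : realType.

(** DL carries the smooth structure of a fiber product. A section l is locally phi times a pulled
    back generator e, and X(l) is the sum of the symbol of X on phi times F^* e and of phi times
    F^-1 of DF(X) on e. *)
Lemma smooth_into_D (M N P : dspace R) (f : M -> N) (L : bundle M) (L' : bundle N) (F : vbmap f L L')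
  (g : P -> M) (X : forall y, atiyahb L (g y)) : bundle_ok L 1 -> bundle_ok L' 1 -> line_map F -> smooth_map g ->
 smooth_map (fun y => tmkt (symbol (X y))) -> smooth_map (fun y => mkt (Dmap F (X y))) -> smooth_lift X.
move=> oL oL' hF sg sS sD; apply: (smooth_atiyahP sg) => l xi sl fx; apply: smooth_atP => y0.
have [U [e [ze [Ue le se _]]]] := pullsec_frame oL oL' hF (g y0).
pose phi x := ze (mkt (F x (l x))); have sF := line_smooth hF.
have sphi : smooth_fun phi := smooth_totmap (line_map_tot hF) sl (let: And5 _ _ H _ _ := le in H.1).
have lE x : U (f x) -> l x = phi x *: pullsec F e x.
 move=> Ux; apply: (line_inj hF); rewrite (linZ (line_lin hF (x := x))) (finvE oL oL' hF).
 exact: (lframe_exp le).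
apply: (@smooth_at_eq _ _ _ (fun y => tapp (symbol (X y)) phi * xi (mkt (pullsec F e (g y))) +
  phi (g y) * xi (mkt (finv F (dapp (Dmap F (X y)) e))))).
 apply: filterS (smooth_near (smap_comp sg sF) (lframe_open le Ue)) => y Uy.
 have -> : dapp (X y) l = dapp (X y) (fun x => phi x *: pullsec F e x).
  apply: (dapp_local oL (X y) sl (smooth_secM oL sphi se)).
  by apply: filterS (smooth_near sF (lframe_open le Uy)) => x; exact: lE.
 rewrite dappM // (DmapP oL oL' hF); last exact: lframe_smooth le.
 by rewrite (finvK oL oL' hF) (lfunD (fx.2 (g y))) !(lfunZ (fx.2 (g y))).
apply: smooth_atW; apply: smoothD; apply: smoothM.
- exact: (sS _ (tanb_lin sphi).1).
- exact: (sg _ (se _ fx.1)).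
- exact: sg _ sphi.
apply: (smooth_finv oL oL' hF (g := g) (l := fun y => dapp (Dmap F (X y)) e) sg _ fx.1).
apply: (smooth_along oL' (smap_comp sg sF)) => x U' e' xi' U'x F' i; apply: smooth_atW.
have fl : @fib_linear _ _ L' (xi' i) by split; [exact: xi_smooth F' i|exact: xi_lin F' i].
by have := sD _ (dapp_smooth (lframe_smooth le) fl).1; exact.
Qed.
Lemma smooth_form1_along (M P : dspace R) (E L : bundle M) r (w : form E L 1) (g : P -> M) (X : forall y, E (g y)) :
 bundle_ok E r -> bundle_ok L 1 -> is_form w -> smooth_map g ->
 smooth_lift X -> smooth_map (fun y => mkt (w _ (fun _ => X y))).
move=> oE oL fw sg.
apply: (smooth_lin_along (phi := fun y x => w _ (fun _ => x)) oE oL sg) => [y|e se]; first exact: form1_lin.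
exact: smap_comp sg (form1_smooth fw se).
Qed.
Lemma smooth_form2_along (M P : dspace R) (E L : bundle M) r (w : form E L 2) (g : P -> M) (X Y : forall y, E (g y)) :
 bundle_ok E r -> bundle_ok L 1 -> is_form w -> smooth_map g -> smooth_lift X ->
 smooth_lift Y -> smooth_map (fun y => mkt (form2 w (X y) (Y y))).
move=> oE oL fw sg sX sY; apply: (smooth_lin_along oE oL sg (phi := fun y x => form2 w x (Y y))) sX => [y|e se].
 exact: form2_lin1.
apply: (smooth_lin_along oE oL sg (phi := fun y x => form2 w (e (g y)) x)) sY => [y|e' se']; first exact: form2_lin2.
exact: smap_comp sg (form2_smooth fw se se').
Qed.
End Along.

Section Comb.
Variables (R : realType) (M : dspace R) (E L : bundle M) (k : nat).
Hypothesis oL : bundle_ok L 1.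
Lemma form_fcomb a (w w' : form E L k) : is_form w -> is_form w' -> is_form (fcomb a w w').
move=> [l1 a1 s1] [l2 a2 s2]; split.
- move=> x v i r e e'; rewrite /fcomb l1 l2; by line_ring oL.
- by move=> x v i j ij E0; rewrite /fcomb (a1 _ _ i j) // (a2 _ _ i j) // scaler0 addr0.
- move=> e se; have := smooth_secD oL (s1 e se) (smooth_secZ oL a (s2 e se)); exact.
Qed.
Lemma fsubE (w w' : form E L k) : fsub w w' = fcomb (-1) w w'.
by apply/dfunext => x; apply/funext => v; rewrite /fsub /fcomb scaleN1r. Qed.
Lemma faddE (w w' : form E L k) : fadd w w' = fcomb 1 w w'.
by apply/dfunext => x; apply/funext => v; rewrite /fadd /fcomb scale1r. Qed.
Lemma form_fsub (w w' : form E L k) : is_form w -> is_form w' -> is_form (fsub w w').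
by rewrite fsubE; exact: form_fcomb. Qed.
Lemma form_fadd (w w' : form E L k) : is_form w -> is_form w' -> is_form (fadd w w').
by rewrite faddE; exact: form_fcomb. Qed.
End Comb.

Section Connections.
Variable R : realType.

Section One.
Variables (M : dspace R) (L : bundle M) (n : nat) (nabla : connection L).
Hypotheses (oL : bundle_ok L 1) (cM : coordinatized M n) (hn : is_connection nabla).

Lemma conn_linear x : linear (@nabla x).
by case: hn. Qed.
Lemma conn_symbol x (v : tangent x) : symbol (nabla v) = v.
by apply: (symbol_eq oL); case: hn. Qed.

Lemma conn_smooth (P : dspace R) (g : P -> M) (v : forall y, tangent (g y)) : smooth_map g ->
 smooth_map (fun y => tmkt (v y)) -> smooth_map (fun y => @mkt _ _ (atiyahb L) _ (nabla (v y))).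
move=> sg sv; apply: (smooth_atiyahP sg) => l xi sl fx; apply: smooth_atP => x.
have [U [e [ze [Ux F]]]] := ok_frame (tanb_ok cM) (g x).
apply: (@smooth_at_eq _ _ _ (fun y => \sum_i ze i (tmkt (v y)) * xi (mkt (dapp (nabla (e i (g y))) l)))).
 apply: filterS (smooth_near sg (frame_open F Ux)) => y Uy.
 rewrite {1}(frame_exp F (v y) Uy) (lin_sum (@conn_linear (g y))).
 have lE : linear (fun d : atiyah L (g y) => dapp d l) by [].
 rewrite (lin_sum lE) (lfun_sum (fx.2 (g y))); apply: eq_bigr => i _.
 by rewrite (linZ (@conn_linear (g y))) (linZ lE) (lfunZ (fx.2 (g y))).
apply: smooth_atW; apply: smooth_sum => i _; apply: smoothM; first exact: (sv _ (xi_smooth F i)).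
have [_ _ H] := hn; exact: (sg _ (H _ _ (frame_smooth F i) sl _ fx.1)).
Qed.

(** The pull-back by the symbol sees only symbols, and the bracket of two covariant derivatives has
    as symbol the bracket of the vector fields. So the Koszul formulas agree, and the independence
    of extensions is inherited from [dD]. *)
Lemma dconn_dD (t : form (tanb M) L 1) x (v w : tangent x) : is_form t ->
 form2 (dconn nabla t) v w = form2 (dD (sigma_pull t)) (nabla v) (nabla w).
move=> ft; have oT := tanb_ok cM.
have key (X Y : sec (tanb M)) : smooth_sec X -> smooth_sec Y ->
  dapp (nabla (X x)) (fun y => t y (fun _ => Y y)) - dapp (nabla (Y x)) (fun y => t y (fun _ => X y))
  - t x (fun _ => tbracket X Y x) = form2 (dD (sigma_pull t)) (nabla (X x)) (nabla (Y x)).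
 move=> sX sY; have sc (Z : sec (tanb M)) : smooth_sec Z -> @smooth_sec _ _ (atiyahb L) (fun y => nabla (Z y)).
  by move=> sZ; exact: (conn_smooth smap_id sZ).
 rewrite (dD1E oL cM (X := fun y => nabla (X y)) (Y := fun y => nabla (Y y)) _ (form_sigma1 oL ft) (sc X sX) (sc Y sY)).
 have E (Z : sec (tanb M)) : (fun y : M => sigma_pull t (fun _ => nabla (Z y))) = fun y => t y (fun _ => Z y).
  by apply/dfunext => y; rewrite /sigma_pull conn_symbol.
 rewrite !E; congr (_ - _); rewrite /sigma_pull (symbol_dbracket oL x (sc X sX) (sc Y sY)).
 have S (Z : sec (tanb M)) : (fun y : M => symbol (nabla (Z y))) = Z.
  by apply/dfunext => y; rewrite conn_symbol.
 by rewrite !S.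
apply: the_eq => [X sX XE|y Hy].
 by rewrite koszul1E key // !XE.
have [X sX Xx] := smooth_ext oT v; have [Y sY Yx] := smooth_ext oT w.
rewrite (Hy (fun i => if i == ord0 then X else Y)); last 2 first.
- by move=> i; case: ifP.
- by move=> i; rewrite /pair2; case: ifP.
by rewrite koszul1E key // Xx Yx.
Qed.
End One.

Section Pull.
Variables (M N : dspace R) (f : M -> N) (L : bundle M) (L' : bundle N) (F : vbmap f L L') (n : nat).
Hypotheses (oL : bundle_ok L 1) (oL' : bundle_ok L' 1) (hF : line_map F).
Hypotheses (cN : coordinatized N n).
Variable nabla : connection L'.
Hypothesis hn : is_connection nabla.

(** The pulled back covariant derivative is the point of the fiber product D_xL with components v
    and the covariant derivative along df(v). *)
Lemma pullconnP x (v : tangent x) : symbol (pullconn F nabla v) = v /\ Dmap F (pullconn F nabla v) = nabla (dmap f v).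
have [d ds dD] := Dmap_lift oL oL' hF (conn_symbol oL' hn (dmap f v)).
rewrite (_ : pullconn F nabla v = d) //; apply: the_eq.
 split=> [|l sl]; first by rewrite -ds; exact: symbolP.
 by rewrite -dD (DmapP oL oL' hF) // (finvK oL oL' hF).
move=> d' [s' H']; apply: (Dmap_inj oL oL' hF); first by rewrite ds; exact: symbol_eq s'.
rewrite dD; apply: atiyah_ext => l sl.
by rewrite (DmapP oL oL' hF) // H' // (finvE oL oL' hF).
Qed.
Lemma pullconn_connection : is_connection (pullconn F nabla).
split.
- move=> x r v w; apply: (Dmap_inj oL oL' hF).
  by rewrite (symbol_lin oL) !(pullconnP _).1.
 rewrite (Dmap_lin oL oL' hF) !(pullconnP _).2 (dmap_lin (line_smooth hF)).
 exact: conn_linear hn _ _ _ _.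
- by move=> x v; have := symbolP (pullconn F nabla v); rewrite (pullconnP _).1.
move=> X l sX sl; apply: smooth_dapp => //.
apply: (smooth_into_D oL oL' hF smap_id).
 by move: sX; fext => y; rewrite (pullconnP _).1.
have sf := line_smooth hF.
have := conn_smooth cN hn sf (smooth_dmap sf smap_id sX).
by fext => y; rewrite (pullconnP _).2.
Qed.
End Pull.
End Connections.

Lemma sumb_mkt (R : realType) M (E F : @bundle R M) x y (v : E x) (w : E y) (l : F x) (k : F y) :
 mkt v = mkt w -> mkt l = mkt k -> @mkt _ _ (sumb E F) x (v, l) = @mkt _ _ (sumb E F) y (w, k).
by move=> e; have b := mkt_base e; subst y; rewrite (mkt_inj e) => /mkt_inj ->. Qed.
Lemma sumb_mkt1 (R : realType) M (E F : @bundle R M) x y (v : sumb E F x) (w : sumb E F y) :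
 mkt v = mkt w -> mkt v.1 = mkt w.1 /\ mkt v.2 = mkt w.2.
by move=> e; have b := mkt_base e; subst y; rewrite (mkt_inj e). Qed.

Section PullComp.
Variable R : realType.

Lemma form_mkt (M : dspace R) (E L : bundle M) k (w : form E L k) x y (v : 'I_k -> E x) (u : 'I_k -> E y) :
 x = y -> (forall i, mkt (v i) = mkt (u i)) -> mkt (w x v) = mkt (w y u).
by move=> e; subst y => H; congr (mkt (w x _)); apply/funext => i; apply: mkt_inj. Qed.

Lemma pullT_square (M N N' P : dspace R) (f : M -> N) (h : N -> P) (f' : M -> N') (h' : N' -> P)
  (L : bundle M) (K : bundle N) (K' : bundle N') (J : bundle P)
  (F : vbmap f L K) (H : vbmap h K J) (F' : vbmap f' L K') (H' : vbmap h' K' J) k (w : form (tanb P) J k) :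
 bundle_ok L 1 -> bundle_ok K 1 -> bundle_ok K' 1 -> bundle_ok J 1 ->
 line_map F -> line_map H -> line_map F' -> line_map H' ->
 (forall x, h (f x) = h' (f' x)) -> (forall x (l : L x), mkt (H _ (F _ l)) = mkt (H' _ (F' _ l))) ->
 pullT F (pullT H w) = pullT F' (pullT H' w).
move=> oL oK oK' oJ lF lH lF' lH' hf HF; apply: form_ext => x v.
apply: (line_inj lF); apply: (line_inj lH); apply: mkt_inj; rewrite [RHS]HF.
rewrite (finvE oL oK lF) (finvE oK oJ lH) (finvE oL oK' lF') (finvE oK' oJ lH').
refine (@form_mkt P (tanb P) J k w _ _ _ _ (hf x) _) => i.
have [sf sh sf' sh'] := And4 (line_smooth lF) (line_smooth lH) (line_smooth lF') (line_smooth lH').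
rewrite (dmap_compE (h := fun y => h (f y)) (v i) sf sh) //.
by rewrite (dmap_compE (h := fun y => h (f y)) (v i) sf' sh').
Qed.
End PullComp.

Section AtiyahForms.
Variables (R : realType) (M : dspace R) (L : bundle M) (n : nat).
Hypotheses (oL : bundle_ok L 1) (cM : coordinatized M n).

Lemma symbol_surj x (v : tangent x) : exists d : atiyah L x, symbol d = v.
have [U [e [xi [Ux F]]]] := ok_lframe x oL.
by have [d <- _] := atiyah_make oL F v 0 Ux; exists d.
Qed.

Lemma sigma_fcomb k a (w w' : form (tanb M) L k) : sigma_pull (fcomb a w w') = fcomb a (sigma_pull w) (sigma_pull w').
by []. Qed.

Lemma dD_form0_1 : dD (@form0 _ _ (atiyahb L) L 1) = form00.
have f0 : is_form (@form0 _ _ (atiyahb L) L 1).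
 by apply: is_form1 => [x r v w|X _]; [rewrite /form0 scaler0 addr0|exact: smooth_sec0 oL].
have e : @form0 _ _ (atiyahb L) L 1 = fcomb (-1) form00 form00.
 by apply: form_ext => x v; rewrite /fcomb /form0 scaler0 addr0.
have := dD1_comb oL cM (a := -1) f0 f0; rewrite -e => /(_ f0) ->.
by apply: form_ext => x v; rewrite /fcomb scaleN1r subrr.
Qed.

Lemma atiyah_form0 (ka : form (tanb M) L 2) : atiyah_form ka form00 = dD (sigma_pull ka).
by apply: form_ext => x v; rewrite /atiyah_form /fadd /sigma_pull /form0 add0r. Qed.

Lemma form_atiyah (t : form (tanb M) L 1) (ka : form (tanb M) L 2) : is_form t -> is_form ka ->
 is_form (atiyah_form t ka).
move=> ft fk; apply: (form_fadd oL); first exact (form_sigma2 oL fk).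
exact: (form_dD1 oL cM (form_sigma1 oL ft)).
Qed.

Lemma dD_atiyah_form (t : form (tanb M) L 1) (ka : form (tanb M) L 2) : is_form t -> is_form ka ->
 dD (atiyah_form t ka) = dD (sigma_pull ka).
move=> ft fk; have f1 := form_sigma1 oL ft; have f2 := form_dD1 oL cM f1; have f3 := form_sigma2 oL fk.
have := dD2_comb oL cM (a := 1) f3 f2 (form_fcomb oL _ f3 f2); rewrite -!faddE => ->.
by rewrite (dD_dD1 oL cM f1); apply: form_ext => x v; rewrite /fadd /form0 addr0.
Qed.

Lemma atiyah_form_fcomb a (t t' : form (tanb M) L 1) (ka ka' : form (tanb M) L 2) : is_form t -> is_form t' ->
 atiyah_form (fcomb a t t') (fcomb a ka ka') = fcomb a (atiyah_form t ka) (atiyah_form t' ka').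
move=> ft ft'; rewrite /atiyah_form sigma_fcomb (dD1_comb oL cM) ?sigma_fcomb //; last 3 first.
- exact (form_sigma1 oL ft).
- exact (form_sigma1 oL ft').
- by apply: (form_fcomb oL); [exact (form_sigma1 oL ft)|exact (form_sigma1 oL ft')].
apply: form_ext => x v; rewrite /fadd /fcomb /=; by line_ring oL.
Qed.

Lemma iota_atiyah (t : form (tanb M) L 1) (ka : form (tanb M) L 2) x (b : atiyah L x) : is_form t -> is_form ka ->
 form2 (atiyah_form t ka) (done L x) b = t x (fun _ => symbol b).
move=> ft fk; rewrite (_ : form2 (atiyah_form t ka) (done L x) b = form2 (sigma_pull ka) (done L x) b + form2 (dD (sigma_pull t)) (done L x) b) //.
by rewrite (iota_dsigma1 oL cM) // sigma2E symbol_done // (lin0 (form2_lin1 fk (symbol b))) add0r.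
Qed.

Lemma dsigma_inj (ka ka' : form (tanb M) L 2) : is_form ka -> is_form ka' ->
 dD (sigma_pull ka) = dD (sigma_pull ka') -> ka = ka'.
move=> fk fk' E; apply: form2_ext => x a b; have [c <-] := symbol_surj a; have [d <-] := symbol_surj b.
by rewrite -!(iota_dsigma2 oL cM) // E.
Qed.
Lemma atiyah_form_inj (t t' : form (tanb M) L 1) (ka ka' : form (tanb M) L 2) : is_form t -> is_form t' ->
 is_form ka -> is_form ka' -> atiyah_form t ka = atiyah_form t' ka' -> t = t' /\ ka = ka'.
move=> ft ft' fk fk' E; split.
 apply: form_ext => x v; rewrite (fun1E v); have [d <-] := symbol_surj (v ord0).
 by rewrite -(iota_atiyah d ft fk) E iota_atiyah.
by apply: dsigma_inj => //; rewrite -(dD_atiyah_form ft fk) E dD_atiyah_form.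
Qed.

Variable nabla : connection L.
Hypothesis hn : is_connection nabla.
Let sn (X : sec (tanb M)) : smooth_sec X -> @smooth_sec _ _ (atiyahb L) (fun y => nabla (X y)).
by move=> sX; exact: (conn_smooth cM hn smap_id sX). Qed.
Let dE x (d : atiyah L x) : exists r, d = nabla (symbol d) + r *: done L x.
have Es : symbol (d - nabla (symbol d)) = 0 by rewrite (linB (symbol_lin oL (x := x))) (conn_symbol oL hn) subrr.
by have [r Er] := symbol0_done oL Es; exists r; rewrite -Er addrC subrK.
Qed.

(** A form killed by contraction with the identity depends on symbols only. The connection provides
    smooth lifts of vector fields to derivations, and hence smoothness of the induced form on TM. *)
Lemma horizontal1 (w : form (atiyahb L) L 1) : is_form w -> (forall x, w x (fun _ => done L x) = 0) ->
 exists2 t : form (tanb M) L 1, is_form t & w = sigma_pull t.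
move=> fw w0; exists (fun x v => w x (fun _ => nabla (v ord0))).
 apply: is_form1 => [x r v u|X sX]; last exact: (form1_smooth fw (sn sX)).
 by rewrite (conn_linear hn (x := x)) (form1_lin fw).
apply: form_ext => x v; rewrite (fun1E v) /sigma_pull; have [r {1}->] := dE (v ord0).
by rewrite (linD (form1_lin fw (x := x))) (linZ (form1_lin fw (x := x))) w0 scaler0 addr0.
Qed.
Lemma horizontal2 (w : form (atiyahb L) L 2) : is_form w -> (forall x d, form2 w (done L x) d = 0) ->
 exists2 t : form (tanb M) L 2, is_form t & w = sigma_pull t.
move=> fw w0; pose t : form (tanb M) L 2 := fun x v => form2 w (nabla (v ord0)) (nabla (v i1)).
exists t.
 apply: is_form2 => [x b r v u|x v u|X Y sX sY]; last exact: (form2_smooth fw (sn sX) (sn sY)).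
 - by rewrite /form2 /t /= (conn_linear hn (x := x)) (form2_lin1 fw).
 by rewrite /form2 /t /=; exact: form2_anti.
apply: form2_ext => x a b; rewrite sigma2E /form2 /t /= -!/(form2 w _ _).
have [r {1}->] := dE a; have [s {1}->] := dE b.
rewrite (linD (form2_lin1 fw _)) (linZ (form2_lin1 fw _)) w0 scaler0 addr0.
rewrite (linD (form2_lin2 fw _)) (linZ (form2_lin2 fw _)) (form2_anti fw _ (done L x)) w0.
by rewrite oppr0 scaler0 addr0.
Qed.

(** The contraction of w with the identity is killed by a second contraction, so it comes from some
    t; subtracting d_D of its pull-back leaves a form killed by contraction. *)
Lemma atiyah_form_ex (w : form (atiyahb L) L 2) : is_form w -> exists (t : form (tanb M) L 1) (ka : form (tanb M) L 2),
 [/\ is_form t, is_form ka & w = atiyah_form t ka].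
move=> fw; have [|t ft Et] := horizontal1 (form_iota2 oL fw).
 by move=> x; have := form2_anti fw (done L x) (done L x); exact: anti_alt.
have f1 := form_dD1 oL cM (form_sigma1 oL ft).
have fw' := form_fsub oL fw f1.
have [|ka fk Ek] := horizontal2 fw'.
 move=> x d; rewrite (_ : form2 (fsub w _) _ d = form2 w (done L x) d - form2 (dD (sigma_pull t)) (done L x) d) //.
 rewrite (iota_dsigma1 oL cM) //; have := congr1 (fun W : form (atiyahb L) L 1 => W x (fun _ => d)) Et.
 by rewrite /iota2 /sigma_pull => ->; rewrite subrr.
exists t, ka; split=> //; rewrite /atiyah_form -Ek.
by apply: form_ext => x v; rewrite /fadd /fsub subrK.
Qed.

Lemma closed3_ex (W : form (atiyahb L) L 3) : is_form W -> dD W = form00 ->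
 exists2 ka : form (tanb M) L 2, is_form ka & W = dD (sigma_pull ka).
move=> fW W0; have [|ka fk Ek] := horizontal2 (form_iota3 oL fW).
 by move=> x d; have := form3_anti12 fW (done L x) (done L x) d; exact: anti_alt.
by exists ka => //; rewrite -Ek; exact: (cartan3 oL cM fW W0).
Qed.
End AtiyahForms.

Section Contact.
Variables (R : realType) (G : groupoid R) (L : vbg G) (hL : is_lbg L) (m n : nat).
Hypotheses (cM : coordinatized (ob G) m) (cG : coordinatized (ar G) n).
Let hG := gpd hL.
Let oL := lbg_ok hL.
Let oL0 := lbg_ok0 hL.
Let oL2 := nerve2_ok hL.
Let lvs := line_vs hL.
Let lvt := line_vt hL.
Let lvu := line_vu hL.
Let lvi := line_vi hL.
Let l1 := line_lpr1 hL.
Let l2 := line_lpr2 hL.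
Let lm := line_lmul hL.
Let oT := tanb_ok cG.
Let oT0 := tanb_ok cM.
Let cA := ar2_coord hG cM cG.
Let HA (s : prodd (ar G) (ar G)) : composable s <-> src s.1 = tgt s.2 := iff_refl _.

Lemma dsymbol_mkt (x y : ob G) (d : atiyah (vb0 L) x) (d' : atiyah (vb0 L) y) : amkt d = amkt d' ->
 tmkt (symbol d) = tmkt (symbol d').
by move/(congr1 (fun p : tot (atiyahb (vb0 L)) => tmkt (symbol (projT2 p)))). Qed.

(** The product in DL goes through a derivation on the nerve. Its symbol is the vector of the
    composable pair of symbols, and [Dmap_lift] along the first projection produces it; its image
    under the second is right because [Dmap vt] together with the symbol determines a derivation. *)
Lemma dmulP (g h : ar G) (d : vb (DL L) g) (d' : vb (DL L) h) (c : src g = tgt h) : vcomp d d' ->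
 exists dd : atiyahb (nerve2 L) (mkar2 c), [/\ Dmap lpr1 dd = d, Dmap lpr2 dd = d' & Dmap lmul dd = vm d d'].
move=> cd.
have tc : tcomp (symbol d) (symbol d').
 by rewrite /tcomp -(symbol_Dmap oL oL0 lvs) -(symbol_Dmap oL oL0 lvt); exact: dsymbol_mkt cd.
have [u [u1 u2]] := ar2_tangent hG cM cG c tc.
have [dd sdd dd1] := Dmap_lift oL2 oL l1 (esym u1).
have dd2 : Dmap lpr2 dd = d'.
 apply: (Dmap_inj oL oL0 lvt); first by rewrite (symbol_Dmap oL2 oL l2) sdd.
 apply: (@mkt_inj _ _ (atiyahb (vb0 L))).
 pose Hc : vbmap (fun p : ar2 G => src (pr1 p)) (nerve2 L) (vb0 L) := fun p l => vs (lpr1 l).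
 rewrite (Dmap_comp (H := Hc) oL2 oL oL0 l2 lvt); last by move=> p l; rewrite /Hc; exact: esym (nerve2P hL l).
 rewrite -(Dmap_comp (H := Hc) oL2 oL oL0 l1 lvs) // dd1; exact: cd.
exists dd; split=> //; apply: esym; apply: the_eq; first by exists c, dd.
move=> z [c' [dd' [E1 E2 <-]]]; have cc : c' = c by exact: Prop_irrelevance.
subst c'; suff -> : dd' = dd by [].
apply: (Dmap_inj oL2 oL l1); last by rewrite E1 dd1.
apply: (fp_tangent_inj HA (src_subm hG) (smooth_tgt hG) cG cM cG).
 by rewrite -!(symbol_Dmap oL2 oL l1) E1 dd1.
by rewrite -!(symbol_Dmap oL2 oL l2) E2 dd2.
Qed.

(** The fiber description is [Dmap_inj] and [Dmap_lift] applied to the source and target of L, which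
    are isomorphisms on fibers. *)
Lemma DL_model : @vb_model R G (DL L) (fun g d => symbol d) (fun x d => symbol d) n.+1 m.+1.
split.
- refine (atiyah_ok oL cG).
- refine (atiyah_ok oL0 cM).
- by move=> g; exact: (Dmap_lin oL oL0 lvs).
- by move=> g; exact: (Dmap_lin oL oL0 lvt).
- by move=> g; exact: (Dmap_lin oL0 oL lvu).
- by move=> g; exact: (Dmap_lin oL oL lvi).
- by move=> g; exact: symbol_lin oL _.
- exact: (Dmap_smooth oL oL0 lvs).
- exact: (Dmap_smooth oL oL0 lvt).
- exact: (Dmap_smooth oL0 oL lvu).
- exact: (smooth_symbol oL (ok_proj (atiyah_ok oL cG)) (@smooth_mkt _ _ _)).
- by move=> g d; rewrite (symbol_Dmap oL oL0 lvs).
- by move=> g d; rewrite (symbol_Dmap oL oL0 lvt).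
- by move=> x d; exact: (symbol_Dmap oL0 oL lvu).
- by move=> g d; exact: (symbol_Dmap oL oL lvi).
- move=> x d; have := Dmap_comp (H := fun (x : ob G) (l : vb0 L x) => l) oL0 oL oL0 lvu lvs (vsu hL) d.
 by rewrite (Dmap_id _ oL0).
- move=> x d; have := Dmap_comp (H := fun (x : ob G) (l : vb0 L x) => l) oL0 oL oL0 lvu lvt (vtu hL) d.
 by rewrite (Dmap_id _ oL0).
- move=> g d; exact: (Dmap_comp oL oL oL0 lvi lvs (vsi hL) d).
- move=> g d; exact: (Dmap_comp oL oL oL0 lvi lvt (vti hL) d).
- move=> g d s0 d0; apply: (Dmap_inj oL oL0 lvs); first by rewrite s0 (lin0 (symbol_lin oL (x := g))).
 by rewrite (lin0 (Dmap_lin oL oL0 lvs (x := g))).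
- move=> g d s0 d0; apply: (Dmap_inj oL oL0 lvt); first by rewrite s0 (lin0 (symbol_lin oL (x := g))).
 by rewrite (lin0 (Dmap_lin oL oL0 lvt (x := g))).
- move=> g z w E; have [d d1 d2] := Dmap_lift oL oL0 lvs (esym E); by exists d.
- move=> g z w E; have [d d1 d2] := Dmap_lift oL oL0 lvt (esym E); by exists d.
- move=> g h d d' cd; have c := vcomp_base cd; have [dd [<- <- <-]] := dmulP c cd.
 split.
 + pose Hc : vbmap (fun p : ar2 G => src (pr2 p)) (nerve2 L) (vb0 L) := fun p l => vs (lpr2 l).
  apply: (etrans (Dmap_comp (H := Hc) oL2 oL oL0 lm lvs _ dd) (esym (Dmap_comp (H := Hc) oL2 oL oL0 l2 lvs _ dd))) => //.
  by move=> p l; exact: vs_lmul.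
 + pose Hc : vbmap (fun p : ar2 G => tgt (pr1 p)) (nerve2 L) (vb0 L) := fun p l => vt (lpr1 l).
  apply: (etrans (Dmap_comp (H := Hc) oL2 oL oL0 lm lvt _ dd) (esym (Dmap_comp (H := Hc) oL2 oL oL0 l1 lvt _ dd))) => //.
  by move=> p l; exact: vt_lmul.
 exact: (etrans (symbol_Dmap oL2 oL lm dd) (etrans (esym (tmulE hG cM cG (symbol dd)))
  (congr2 (@tmul _ _ g h) (esym (symbol_Dmap oL2 oL l1 dd)) (esym (symbol_Dmap oL2 oL l2 dd))))).
by move=> P f X sf s1 s2; exact: (smooth_into_D oL oL0 lvs sf s1 s2).
Qed.

Lemma lsum_delta (g h : ar G) (c : src g = tgt h) (a : vb L g) (b : vb L h) (k : vb L (mul g h)) :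
 finv lpr2 (x := mkar2 c) b - finv lmul (x := mkar2 c) k + finv lpr1 (x := mkar2 c) a = 0 -> k = lsum c a b.
move=> E; rewrite /lsum -(finvE oL2 oL lm (x := mkar2 c) k); apply: (congr1 (@lmul _ _ L (mkar2 c))).
by apply/eqP; rewrite eq_sym -subr_eq0 -E -addrA addrC.
Qed.

Section AtiyahPairing.
Variable w : form (atiyahb (vb L)) (vb L) 2.
Hypotheses (fw : is_form w) (mw : delD1 w = form00).

Lemma DL_mult (g h : ar G) (c : src g = tgt h) (v u : vb (DL L) g) (v' u' : vb (DL L) h) : vcomp v v' -> vcomp u u' ->
 form2 w (vm v v' : vb (DL L) (mul g h)) (vm u u') = lsum c (form2 w v u) (form2 w v' u').
move=> c1 c2; have [dv [<- <- <-]] := dmulP c c1; have [du [<- <- <-]] := dmulP c c2.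
have := congr1 (fun W : form (atiyahb (nerve2 L)) (nerve2 L) 2 => form2 W dv du) mw.
rewrite -[LHS]/(form2 (pullD lpr2 w) dv du - form2 (pullD lmul w) dv du + form2 (pullD lpr1 w) dv du).
by rewrite !form2_pull; exact: lsum_delta.
Qed.

Lemma DL_pairing : @mult_pairing R G L (DL L) (fun g d d' => w (pair2 d d')).
split.
- by move=> g d; exact: form2_lin1.
- by move=> g d d'; exact: form2_anti.
- move=> P f X Y sf sX sY; exact: (smooth_form2_along (atiyah_ok oL cG) oL fw sf sX sY).
by move=> g h c v v' u u'; exact: DL_mult.
Qed.
End AtiyahPairing.

Lemma unit_vs_vt' (g : ar G) x (l : vb L g) : g = uni x -> mkt (vs l) = mkt (vt l).
by move=> e; subst g; exact: unit_vs_vt hL _ _. Qed.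

Lemma lsum_vm (g h : ar G) (c : src g = tgt h) (l : vb L g) (k : vb L h) : vcomp l k ->
 lsum c 0 k = vm l k /\ lsum c l 0 = vm l k.
move=> cl; split; [apply: (line_inj lvs)|apply: (line_inj lvt)]; apply: mkt_inj.
 by rewrite (vs_lsum hL) (vsm hL).
by rewrite (vt_lsum hL) (vtm hL).
Qed.

Lemma form_delT0_1 (b : form (tanb (ob G)) (vb0 L) 1) : is_form b -> is_form (delT0 b).
by move=> fb; apply: (form_fsub oL); [exact (form_pullT1 oL oL0 lvs cM fb)|exact (form_pullT1 oL oL0 lvt cM fb)]. Qed.
Lemma form_delT0_2 (b : form (tanb (ob G)) (vb0 L) 2) : is_form b -> is_form (delT0 b).
by move=> fb; apply: (form_fsub oL); [exact (form_pullT2 oL oL0 lvs cM fb)|exact (form_pullT2 oL oL0 lvt cM fb)]. Qed.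
Lemma form_delT1_1 (t : form (tanb (ar G)) (vb L) 1) : is_form t -> is_form (delT1 t).
move=> ft; apply: (form_fadd oL2); last exact (form_pullT1 oL2 oL l1 cG ft).
by apply: (form_fsub oL2); [exact (form_pullT1 oL2 oL l2 cG ft)|exact (form_pullT1 oL2 oL lm cG ft)].
Qed.

Lemma delT_delT k (b : form (tanb (ob G)) (vb0 L) k) : delT1 (delT0 b) = form00.
rewrite /delT1 /delT0 /pullT !(pull_fsub oL2 oL l1) !(pull_fsub oL2 oL l2) !(pull_fsub oL2 oL lm) -!/(pullT _ _).
have -> : pullT lpr2 (pullT vs b) = pullT lmul (pullT vs b).
 apply: (pullT_square _ oL2 oL oL oL0) => // [p|p l]; first by rewrite (src_mul2 hG).
 exact: esym (vs_lmul hL l).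
have -> : pullT lpr2 (pullT vt b) = pullT lpr1 (pullT vs b).
 apply: (pullT_square _ oL2 oL oL oL0) => // [p|p l]; first by rewrite (ar2E p).
 exact: esym (nerve2P hL l).
have -> : pullT lmul (pullT vt b) = pullT lpr1 (pullT vt b).
 apply: (pullT_square _ oL2 oL oL oL0) => // [p|p l]; first by rewrite (tgt_mul2 hG).
 exact: vt_lmul.
apply: form_ext => x v; rewrite /fadd /fsub /form0; by line_ring oL2.
Qed.

Lemma delD0_sigma k (b : form (tanb (ob G)) (vb0 L) k) : delD0 (sigma_pull b) = sigma_pull (delT0 b).
by rewrite /delD0 (pull_sigma oL oL0 lvs) (pull_sigma oL oL0 lvt). Qed.
Lemma delD0_dD1 (b : form (tanb (ob G)) (vb0 L) 1) : is_form b ->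
 delD0 (dD (sigma_pull b)) = dD (sigma_pull (delT0 b)).
move=> fb; have fs := form_pullT1 oL oL0 lvs cM fb; have ft := form_pullT1 oL oL0 lvt cM fb.
rewrite /delD0 (pull_dD1 oL oL0 lvs cG cM fb) (pull_dD1 oL oL0 lvt cG cM fb) /delT0 !fsubE sigma_fcomb.
rewrite (dD1_comb oL cG (form_sigma1 oL fs) (form_sigma1 oL ft)) //.
by apply: (form_fcomb oL); [exact (form_sigma1 oL fs)|exact (form_sigma1 oL ft)].
Qed.
Lemma delD0_dD2 (b : form (tanb (ob G)) (vb0 L) 2) : is_form b ->
 delD0 (dD (sigma_pull b)) = dD (sigma_pull (delT0 b)).
move=> fb; have fs := form_pullT2 oL oL0 lvs cM fb; have ft := form_pullT2 oL oL0 lvt cM fb.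
rewrite /delD0 (pull_dD2 oL oL0 lvs cG cM fb) (pull_dD2 oL oL0 lvt cG cM fb) /delT0 !fsubE sigma_fcomb.
rewrite (dD2_comb oL cG (form_sigma2 oL fs) (form_sigma2 oL ft)) //.
by apply: (form_fcomb oL); [exact (form_sigma2 oL fs)|exact (form_sigma2 oL ft)].
Qed.
Lemma delD0_fadd k (w w' : form (atiyahb (vb0 L)) (vb0 L) k) : delD0 (fadd w w') = fadd (delD0 w) (delD0 w').
rewrite /delD0 /pullD (pull_fadd oL oL0 lvs) (pull_fadd oL oL0 lvt); apply: form_ext => x v.
rewrite /fadd /fsub; by line_ring oL.
Qed.
Lemma delD0_atiyah (b : form (tanb (ob G)) (vb0 L) 1) (c : form (tanb (ob G)) (vb0 L) 2) : is_form b ->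
 delD0 (atiyah_form b c) = atiyah_form (delT0 b) (delT0 c).
by move=> fb; rewrite /atiyah_form delD0_fadd delD0_sigma delD0_dD1. Qed.

Lemma delD1_atiyah (t : form (tanb (ar G)) (vb L) 1) (c : form (tanb (ar G)) (vb L) 2) : is_form t ->
 delD1 (atiyah_form t c) = atiyah_form (delT1 t) (delT1 c).
move=> ft; have f1 := form_pullT1 oL2 oL l1 cG ft; have f2 := form_pullT1 oL2 oL l2 cG ft.
have fm := form_pullT1 oL2 oL lm cG ft.
have P (pr : ar2 G -> ar G) (F : vbmap pr (nerve2 L) (vb L)) : line_map F ->
  pullD F (atiyah_form t c) = atiyah_form (pullT F t) (pullT F c).
 move=> lF; rewrite /atiyah_form /pullD (pull_fadd oL2 oL lF) -!/(pullD F _) (pull_sigma oL2 oL lF).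
 by rewrite (pull_dD1 oL2 oL lF cA cG ft).
rewrite /delD1 !P // /delT1 !fsubE !faddE.
have fx := form_fcomb oL2 (-1) f2 fm.
by rewrite -!(atiyah_form_fcomb oL2 cA).
Qed.

(** The simplicial differential has components (del t, del del ka), whose second entry is zero;
    contraction with the identity on the nerve recovers the first one. *)
Lemma delD1_eq0 (t : form (tanb (ar G)) (vb L) 1) (ka : form (tanb (ob G)) (vb0 L) 2) : is_form t ->
 delD1 (atiyah_form t (delT0 ka)) = form00 <-> delT1 t = form00.
move=> ft; rewrite (delD1_atiyah _ ft) delT_delT; split=> [E|->].
 have f0 : is_form (@form0 _ _ (tanb (ar2 G)) (nerve2 L) 2).
  have f1 := form_delT1_1 ft.
  by apply: is_form2 => [x b r v u|x v u|X Y _ _]; rewrite /form2 /form0 ?scaler0 ?addr0 ?oppr0 //; exact: smooth_sec0 oL2.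
 apply: form_ext => x v; rewrite (fun1E v); have [d <-] := symbol_surj oL2 (v ord0).
 by rewrite -(iota_atiyah oL2 cA d (form_delT1_1 ft) f0) E.
rewrite /atiyah_form (_ : sigma_pull (@form0 _ _ (tanb (ar2 G)) (nerve2 L) 1) = form00) //.
by rewrite (dD_form0_1 oL2 cA); apply: form_ext => x v; rewrite /fadd /sigma_pull /form0 addr0.
Qed.

Lemma to_atiyah_inj (tk tk' : cdata L 1) : is_form tk.1 -> is_form tk.2 -> is_form tk'.1 -> is_form tk'.2 ->
 to_atiyah tk = to_atiyah tk' -> tk = tk'.
case: tk tk' => t ka [t' ka'] /= ft fk ft' fk' [] E1 E2.
have [-> _] := atiyah_form_inj oL cG ft ft' (form_delT0_2 fk) (form_delT0_2 fk') E1.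
by rewrite (dsigma_inj oL0 cM fk fk') // -!atiyah_form0.
Qed.

(** W = d_D(sigma^* ka) because it is closed. If w has components (t, ka1), then d_D w = del W says
    that ka1 and del ka have the same d_D o sigma^*, and this operator is injective. *)
Lemma symplectic_ex (wW : sdata L 1) : is_shifted_symplectic wW ->
 exists tk : cdata L 1, [/\ is_form tk.1, is_form tk.2 & wW = to_atiyah tk].
case: wW => w W [[/= fw fW] mw dw dW _].
have mM : is_manifold (ob G) /\ is_manifold (ar G) by case: hG.
have [nabla0 hn0] := connection_exists oL0 mM.1; have [nabla hn] := connection_exists oL mM.2.
have [ka fk EW] := closed3_ex oL0 cM hn0 fW dW.
have [t [ka1 [ft fk1 Ew]]] := atiyah_form_ex oL cG hn fw.
exists (t, ka); split=> //=; rewrite /to_atiyah /= (atiyah_form0 ka) -EW; congr pair.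
rewrite Ew; congr atiyah_form; apply: (dsigma_inj oL cG fk1 (form_delT0_2 fk)).
by rewrite -(dD_atiyah_form oL cG ft fk1) -Ew dw EW (delD0_dD2 fk).
Qed.

(** The gauge parameter (b, c) of the contact side is the Atiyah form with these components; since
    every Atiyah 2-form has this shape, no gauge transformation of the symplectic side is missed. *)
Lemma gauge_to_atiyah b c (tk : cdata L 1) : is_form b -> is_form c -> is_form tk.1 -> is_form tk.2 ->
 symplectic_gauge (atiyah_form b c) (to_atiyah tk) = to_atiyah (contact_gauge b c tk).
case: tk => t ka /= fb fc ft fk; rewrite /symplectic_gauge /to_atiyah /contact_gauge /=; congr pair.
 rewrite (delD0_atiyah c fb) !faddE -(atiyah_form_fcomb oL cG) ?form_delT0_1 //; last exact: form_delT0_1.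
 congr atiyah_form; rewrite -!faddE; apply: form_ext => x v.
 rewrite /delT0 /pullT !(pull_fadd oL oL0 lvs) !(pull_fadd oL oL0 lvt) /fadd /fsub.
 by line_ring oL.
rewrite (dD_atiyah_form oL0 cM fb fc) !atiyah_form0 !faddE sigma_fcomb.
rewrite (dD2_comb oL0 cM (form_sigma2 oL0 fk) (form_sigma2 oL0 fc)) //.
by apply: (form_fcomb oL0); [exact (form_sigma2 oL0 fk)|exact (form_sigma2 oL0 fc)].
Qed.

Lemma gauge_equiv_iff (tk tk' : cdata L 1) : is_form tk.1 -> is_form tk.2 -> is_form tk'.1 -> is_form tk'.2 ->
 contact_gauge_equiv tk tk' <-> symplectic_gauge_equiv (to_atiyah tk) (to_atiyah tk').
move=> ft fk ft' fk'; split=> [[b [c [fb fc ->]]]|[al fal E]].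
 by exists (atiyah_form b c); [exact: (form_atiyah oL0 cM)|rewrite gauge_to_atiyah].
have [nabla0 hn0] := connection_exists oL0 (let: And5 H _ _ _ _ := hG in H.1).
have [b [c [fb fc Eal]]] := atiyah_form_ex oL0 cM hn0 fal.
exists b, c; split=> //; apply: to_atiyah_inj => //=.
- by apply: (form_fadd oL) => //; exact: form_delT0_1.
- exact: (form_fadd oL0).
by rewrite E Eal gauge_to_atiyah.
Qed.

Variable th : form (tanb (ar G)) (vb L) 1.
Hypotheses (ft : is_form th) (mth : delT1 th = form00).
Let t1 (g : ar G) (v : tangent g) : vb L g := form1 th v.
Let tl (g : ar G) : linear (@t1 g).
by move=> r v w; exact: (form1_lin ft). Qed.

Lemma theta_mult (g h : ar G) (c : src g = tgt h) (v : tangent g) (w : tangent h) : tcomp v w ->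
 form1 th (tmul v w) = lsum c (form1 th v) (form1 th w).
move=> tc; have [u [<- <- <-]] := tmulP hG cM cG c tc.
by apply: lsum_delta; exact: (congr1 (fun W : form (tanb (ar2 G)) (nerve2 L) 1 => form1 W u) mth).
Qed.
Lemma theta_mkt (g h : ar G) (v : tangent g) (w : tangent h) : tmkt v = tmkt w -> mkt (form1 th v) = mkt (form1 th w).
by move=> e; have b := mkt_base e; subst h; rewrite (mkt_inj e). Qed.
Lemma theta_unit x (w : tangent x) : form1 th (dmap uni w) = 0.
have c : src (uni x) = tgt (uni x) by rewrite (src_uni hG) (tgt_uni hG).
have e1 : tmkt (dmap src (dmap uni w)) = tmkt w.
 by rewrite (dmap_compE (h := fun y => y) w (smooth_uni hG) (smooth_src hG) (src_uni hG)) dmap_id.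
have e2 : tmkt (dmap tgt (dmap uni w)) = tmkt w.
 by rewrite (dmap_compE (h := fun y => y) w (smooth_uni hG) (smooth_tgt hG) (tgt_uni hG)) dmap_id.
have tc : tcomp (dmap uni w) (dmap uni w) by rewrite /tcomp e1 e2.
apply: (lsum_unit0 hL (c := c)); rewrite -theta_mult //; apply: theta_mkt; apply: esym.
apply: (tmul_map hG cM cG (X := w) (f := uni) (h := uni) (k := uni) (smooth_uni hG) (smooth_uni hG)) => // y.
 by rewrite (src_uni hG) (tgt_uni hG).
by have := mul_uni hG (uni y); rewrite (src_uni hG).
Qed.
(** The product of the inverse of v with v is a unit, on which theta vanishes. The two summands of
    [lsum] are then opposite; they are compared through t and s, which agree over a unit. *)
Lemma theta_inv (g : ar G) (v : tangent g) : mkt (vt (form1 th (dmap inv v))) = mkt (- vs (form1 th v)).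
have c : src (inv g) = tgt g by rewrite (src_inv hG).
have tc : tcomp (dmap inv v) v.
 by rewrite /tcomp (dmap_compE (h := tgt) v (smooth_ginv hG) (smooth_src hG) (src_inv hG)).
have E : lsum c (form1 th (dmap inv v)) (form1 th v) = 0.
 rewrite -theta_mult //.
 have e : tmkt (tmul (dmap inv v) v) = tmkt (dmap uni (dmap src v)).
  rewrite (dmap_comp v (smooth_src hG) (smooth_uni hG)).
  apply: (tmul_map hG cM cG (X := v) (f := inv) (h := fun k => k) (smooth_ginv hG) smap_id).
  - exact: (src_inv hG).
  - exact: (inv_mul hG).
  - by [].
  - by rewrite dmap_id.
 have := theta_mkt e; rewrite theta_unit; exact: mkt_eq0.
move: E; rewrite (lsum_split hL) => /eqP; rewrite addr_eq0 => /eqP E.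
rewrite -(vt_lsum hL c (form1 th (dmap inv v))) E -(unit_vs_vt' _ (inv_mul hG g)).
rewrite (linN (vs_lin hL (g := _))).
have := mktD (-1) (vs_lsum hL c (form1 th v)) (mkt0 (vb0 L) (src_mul hG c)).
by rewrite !scaleN1r !addr0.
Qed.

Let MK_vt (g : ar G) (l : vb L g) (v : tangent g) := vt (l + t1 v).

Let smkt x y (v : tangent x) (w : tangent y) (l : vb0 L x) (k : vb0 L y) :=
 @sumb_mkt R (ob G) (tanb (ob G)) (vb0 L) x y v w l k.
(** The second component of an arrow is recovered from its source or, after subtracting theta, from
    its target. Multiplicativity of theta enters through the units, the inverses and the target of a
    product. *)
Lemma MK_model : @vb_model R G (MK th) (fun g vl => vl.1) (fun x vl => vl.1) n.+1 m.+1.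
have svs := line_map_tot lvs; have svt := line_map_tot lvt; have svu := line_map_tot lvu.
split.
- by have := sumb_ok oT oL; rewrite addn1.
- by have := sumb_ok oT0 oL0; rewrite addn1.
- move=> g r [v l] [w k] /=; apply: pair_eq => /=; first exact: (dmap_lin (smooth_src hG)).
 exact: vs_lin hL _ _ _ _.
- move=> g r [v l] [w k] /=; apply: pair_eq => /=; first exact: (dmap_lin (smooth_tgt hG)).
 rewrite -!/(t1 _) tl -(vt_lin hL r) scalerDr; congr vt.
 by rewrite addrACA.
- move=> x r [v l] [w k] /=; apply: pair_eq => /=; first exact: (dmap_lin (smooth_uni hG)).
 exact: vu_lin hL _ _ _ _.
- move=> g r [v l] [w k] /=; apply: pair_eq => /=; first exact: (dmap_lin (smooth_ginv hG)).
 rewrite -!/(t1 _) tl -(vi_lin hL r) scalerDr; congr vi.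
 by rewrite addrACA.
- by [].
- have sp := sumb_smooth (f := fun p : tot (vb (MK th)) => src (projT1 p)); apply: sp.
  exact: (smooth_dmap (smooth_src hG) (ok_proj (sumb_ok oT oL)) (@sumb_fst _ _ (tanb (ar G)) (vb L))).
 exact: (smooth_totmap svs (@sumb_snd _ _ (tanb (ar G)) (vb L))).
- have s1 := @sumb_fst _ _ (tanb (ar G)) (vb L); have s2 := @sumb_snd _ _ (tanb (ar G)) (vb L).
 have sp := ok_proj (sumb_ok oT oL).
 apply: (sumb_smooth (f := fun p : tot (vb (MK th)) => tgt (projT1 p))).
  exact: (smooth_dmap (smooth_tgt hG) sp s1).
 apply: (smooth_totmap svt); apply: (smooth_alongD oL sp s2).
 exact: (smooth_form1_along oT oL ft sp s1).
- have s1 := @sumb_fst _ _ (tanb (ob G)) (vb0 L); have s2 := @sumb_snd _ _ (tanb (ob G)) (vb0 L).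
 have sp := ok_proj (sumb_ok oT0 oL0).
 apply: (sumb_smooth (f := fun p : tot (vb0 (MK th)) => uni (projT1 p))).
  exact: (smooth_dmap (smooth_uni hG) sp s1).
 exact: (smooth_totmap svu s2).
- exact: sumb_fst.
- by [].
- by [].
- by [].
- by [].
- move=> x [v l] /=; refine (smkt _ _) => /=; last exact: (vsu hL).
 by rewrite (dmap_compE (h := fun y => y) v (smooth_uni hG) (smooth_src hG) (src_uni hG)) dmap_id.
- move=> x [v l] /=; rewrite theta_unit addr0; refine (smkt _ _) => /=; last exact: (vtu hL).
 by rewrite (dmap_compE (h := fun y => y) v (smooth_uni hG) (smooth_tgt hG) (tgt_uni hG)) dmap_id.
- move=> g [v l] /=; refine (smkt _ _) => /=; last exact: (vsi hL).
 exact: (dmap_compE v (smooth_ginv hG) (smooth_src hG) (src_inv hG)).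
- move=> g [v l] /=; refine (smkt _ _) => /=.
  exact: (dmap_compE v (smooth_ginv hG) (smooth_tgt hG) (tgt_inv hG)).
 rewrite (linD (vt_lin hL (g := _))).
 have := mktD 1 (vti hL (l + form1 th v)) (theta_inv v).
 by rewrite !scale1r (linD (vs_lin hL (g := _))) addrK.
- move=> g [v l] /= -> [_ l0]; congr pair; exact: (vs_inj hL l0).
- move=> g [v l] /= -> [_]; rewrite -/(t1 _) (lin0 (@tl g)) addr0 => l0; congr pair.
 by apply: (line_inj lvt); rewrite l0 (lin0 (vt_lin hL (g := _))).
- move=> g z [w k] /= zE; exists (z, finv vs k) => /=; split=> //.
 by rewrite zE (finvE oL oL0 lvs).
- move=> g z [w k] /= zE; exists (z, finv vt k - form1 th z) => /=; split=> //.
 by rewrite zE subrK (finvE oL oL0 lvt).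
- move=> g h [v l] [w k] cvw; have [/= c1 c2] := sumb_mkt1 cvw; have c := vcomp_base cvw.
 have E : finv vs (cast (src (mul g h)) (vs k)) = lsum c 0 k.
  apply: (line_inj lvs); rewrite (finvE oL oL0 lvs); apply: mkt_inj.
  by rewrite (vs_lsum hL) mkt_cast // (src_mul hG c).
 rewrite /= E; split=> //.
 + refine (smkt _ _); first exact: (tmul_src hG cM cG c1).
  by rewrite /= (vs_lsum hL).
 + refine (smkt _ _); first exact: (tmul_tgt hG cM cG c1).
  (* Writing theta(vw) as theta(v) 0 + 0 theta(w), the summands 0 k and 0 theta(w) combine to 0 (k +
     theta(w)) = l (k + theta(w)), because l is composable with k + theta(w). Its target is that of
     l, as required. *)
  have -> : lsum c 0 k + form1 th (tmul v w) = vm l (k + form1 th w) + lsum c (form1 th v) 0.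
   rewrite -(lsum_vm c c2).1 (theta_mult c c1) (lsum_split hL c (form1 th v)) (linD (lsum_lin2 hL c)).
   by rewrite -addrA; congr (_ + _); exact: addrC.
  rewrite (linD (vt_lin hL (g := _))) (linD (vt_lin hL (g := g))).
  by have := mktD 1 (vtm hL c2) (vt_lsum hL c (form1 th v)); rewrite !scale1r.
move=> P f X sf s1 s2; have s3 := smap_comp s2 (@sumb_snd _ _ (tanb (ob G)) (vb0 L)).
have s4 := smooth_finv oL oL0 lvs sf s3.
have := sumb_smooth s1 s4; fext => y; rewrite (finvK oL oL0 lvs).
by case: (X y).
Qed.

Variable nabla : connection (vb0 L).
Hypothesis hn : is_connection nabla.
Let ns : connection (vb L) := pullconn vs nabla.
Let nt : connection (vb L) := pullconn vt nabla.
Let hs : is_connection ns := pullconn_connection oL oL0 lvs cM hn.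
Let ht : is_connection nt := pullconn_connection oL oL0 lvt cM hn.

(** The two pulled back covariant derivatives have the same symbol, so they differ by a multiple of
    the identity, and eta is the factor. *)
Lemma etaP (g : ar G) (v : tangent g) : ns v = nt v + eta nabla v *: done (vb L) g.
have Es : symbol (ns v - nt v) = 0 by rewrite (linB (symbol_lin oL (x := g))) !(conn_symbol oL) // subrr.
have [r Er] := symbol0_done oL Es.
suff -> : eta nabla v = r by rewrite -Er addrC subrK.
have E l : smooth_sec l -> dapp (ns v) l - dapp (nt v) l = r *: l g.
 by move=> sl; have := congr1 (fun d => dapp d l) Er; rewrite -{1}(doneE oL g sl); exact.
apply: the_eq => // r' Hr'; have [e se e0] := line_nz oL g.
by apply: (line_scale e0); rewrite -Hr' // -E.
Qed.
Lemma eta_linear (g : ar G) : linear (fun v : tangent g => eta nabla v : R^o).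
move=> r v w; have [e se e0] := line_nz oL g; apply: (line_scale e0).
have E u : eta nabla u *: e g = dapp (ns u) e - dapp (nt u) e.
 rewrite (etaP u) (_ : dapp (_ + _) e = dapp (nt u) e + eta nabla u *: dapp (done (vb L) g) e) //.
 by rewrite doneE // addrC addKr.
have ls := conn_linear hs r v w; have lt := conn_linear ht r v w.
rewrite E ls lt (_ : dapp (r *: ns v + ns w) e = r *: dapp (ns v) e + dapp (ns w) e) //.
rewrite (_ : dapp (r *: nt v + nt w) e = r *: dapp (nt v) e + dapp (nt w) e) //.
rewrite scalerDl -scalerA !E; by line_ring oL.
Qed.
Lemma eta_smooth (P : dspace R) (f : P -> ar G) (v : forall y, tangent (f y)) : smooth_map f ->
 smooth_map (fun y => tmkt (v y)) -> smooth_fun (fun y => eta nabla (v y)).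
move=> sf sv; apply: smooth_atP => x; have [U [e [xi [Ux F]]]] := ok_lframe (f x) oL.
have ls := conn_smooth cG hs sf sv; have lt := conn_smooth cG ht sf sv.
have fx : fib_linear xi by case: F.
apply: (@smooth_at_eq _ _ _ (fun y => xi (mkt (dapp (ns (v y)) e)) - xi (mkt (dapp (nt (v y)) e)))).
 apply: filterS (smooth_near sf (lframe_open F Ux)) => y Uy.
 rewrite (etaP (v y)) (_ : dapp (_ + _) e = dapp (nt (v y)) e + eta nabla (v y) *: dapp (done (vb L) (f y)) e) //.
 rewrite doneE //; last exact: lframe_smooth F.
 by rewrite (lfunD (fx.2 (f y))) (lfunZ (fx.2 (f y))) (lframe_e F Uy); ring.
apply: smooth_atW; apply: smoothB.
 by have := ls _ (dapp_smooth (lframe_smooth F) fx).1; exact.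
by have := lt _ (dapp_smooth (lframe_smooth F) fx).1; exact.
Qed.

(** Derivations of L at g, and of L_M at x for [nderiv], parametrised by a vector and a number
    through the connection. In these terms t sends (v, r) to (dt v, r), while s sends it to (ds v, r
    - eta v). *)
Definition tderiv (g : ar G) (v : tangent g) r : atiyah (vb L) g := nt v + r *: done (vb L) g.
Definition nderiv (x : ob G) (v : tangent x) r : atiyah (vb0 L) x := nabla v + r *: done (vb0 L) x.

Lemma tderiv_ex (g : ar G) (d : atiyah (vb L) g) : exists r, d = tderiv (symbol d) r.
have Es : symbol (d - nt (symbol d)) = 0 by rewrite (linB (symbol_lin oL (x := g))) (conn_symbol oL ht) subrr.
by have [r Er] := symbol0_done oL Es; exists r; rewrite /tderiv -Er addrC subrK.
Qed.
Lemma nderiv_ex (x : ob G) (d : atiyah (vb0 L) x) : exists r, d = nderiv (symbol d) r.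
have Es : symbol (d - nabla (symbol d)) = 0 by rewrite (linB (symbol_lin oL0 (x := x))) (conn_symbol oL0 hn) subrr.
by have [r Er] := symbol0_done oL0 Es; exists r; rewrite /nderiv -Er addrC subrK.
Qed.
Lemma tderiv_symbol (g : ar G) (v : tangent g) r : symbol (tderiv v r) = v.
rewrite /tderiv (linD (symbol_lin oL (x := g))) (linZ (symbol_lin oL (x := g))) symbol_done //.
by rewrite scaler0 addr0 (conn_symbol oL ht).
Qed.
Lemma nderiv_symbol (x : ob G) (v : tangent x) r : symbol (nderiv v r) = v.
rewrite /nderiv (linD (symbol_lin oL0 (x := x))) (linZ (symbol_lin oL0 (x := x))) symbol_done //.
by rewrite scaler0 addr0 (conn_symbol oL0 hn).
Qed.
Lemma tderiv_t (g : ar G) (v : tangent g) r : Dmap vt (tderiv v r) = nderiv (dmap tgt v) r.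
rewrite /tderiv (linD (Dmap_lin oL oL0 lvt (x := g))) (linZ (Dmap_lin oL oL0 lvt (x := g))).
by rewrite (Dmap_done oL oL0 lvt) (pullconnP oL oL0 lvt hn v).2.
Qed.
Lemma tderiv_s (g : ar G) (v : tangent g) r : Dmap vs (tderiv v r) = nderiv (dmap src v) (r - eta nabla v).
have -> : tderiv v r = ns v + (r - eta nabla v) *: done (vb L) g.
 by rewrite etaP scalerBl -addrA [eta _ _ *: _ + _]addrC subrK.
rewrite (linD (Dmap_lin oL oL0 lvs (x := g))) (linZ (Dmap_lin oL oL0 lvs (x := g))).
by rewrite (Dmap_done oL oL0 lvs) (pullconnP oL oL0 lvs hn v).2.
Qed.
Lemma nderiv_eq (x y : ob G) (v : tangent x) (w : tangent y) r s : amkt (nderiv v r) = amkt (nderiv w s) <->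
 tmkt v = tmkt w /\ r = s.
split=> [E|[E ->]]; last first.
 by have b := mkt_base E; subst y; rewrite (mkt_inj E).
have b := mkt_base E; subst y; have {}E := mkt_inj E.
have Ev : v = w by rewrite -(nderiv_symbol v r) E nderiv_symbol.
split; first by rewrite Ev.
move: E; rewrite Ev /nderiv => /addrI E; have [e se e0] := line_nz oL0 x.
by apply: (line_scale e0); have := congr1 (fun d => dapp d e) E; rewrite -!(doneE oL0 x se); exact.
Qed.
Lemma nderiv_u (x : ob G) (w : tangent x) q : Dmap vu (nderiv w q) = tderiv (dmap uni w) q.
apply: (Dmap_inj oL oL0 lvt).
 by rewrite (symbol_Dmap oL0 oL lvu) nderiv_symbol tderiv_symbol.
apply: (@mkt_inj _ _ (atiyahb (vb0 L))); rewrite tderiv_t.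
have -> : amkt (Dmap vt (Dmap vu (nderiv w q))) = amkt (nderiv w q).
 exact: (m_tu DL_model (nderiv w q)).
apply/nderiv_eq; split=> //; have := dmap_compE (h := fun y => y) w (smooth_uni hG) (smooth_tgt hG) (tgt_uni hG).
by rewrite dmap_id => ->.
Qed.

Variable ka : form (tanb (ob G)) (vb0 L) 2.
Hypothesis fk : is_form ka.
Let w := atiyah_form th (delT0 ka).
Let K := curvature th ka nabla.
Hypotheses (fw : is_form w) (mw : delD1 w = form00).

Lemma w_done (g : ar G) (d : atiyah (vb L) g) : form2 w (done (vb L) g) d = form1 th (symbol d).
rewrite (_ : form2 w _ d = form2 (sigma_pull (delT0 ka)) (done (vb L) g) d + form2 (dD (sigma_pull th)) (done (vb L) g) d) //.
rewrite (iota_dsigma1 oL cG) // sigma2E symbol_done //.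
have -> : form2 (delT0 ka) 0 (symbol d) = 0 by exact: lin0 (form2_lin1 (form_delT0_2 fk) (symbol d)).
by rewrite add0r.
Qed.

Lemma curvatureE (g : ar G) (v u : tangent g) : form2 K v u = form2 w (nt v) (nt u).
rewrite (_ : form2 K v u = form2 (dconn nt th) v u + form2 (delT0 ka) v u) //.
rewrite (dconn_dD oL cG ht) // addrC.
rewrite (_ : form2 w _ _ = form2 (sigma_pull (delT0 ka)) (nt v) (nt u) + form2 (dD (sigma_pull th)) (nt v) (nt u)) //.
by rewrite sigma2E !(conn_symbol oL ht).
Qed.

(** Contraction of w with the identity is theta of the symbol, and on covariant derivatives w is the
    curvature K. *)
Lemma w_tderiv (g : ar G) (v u : tangent g) r q :
 form2 w (tderiv v r) (tderiv u q) = form2 K v u + r *: form1 th u - q *: form1 th v.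
rewrite {1}/tderiv (linD (form2_lin1 fw (tderiv u q))) (linZ (form2_lin1 fw (tderiv u q))).
rewrite w_done tderiv_symbol {1}/tderiv (linD (form2_lin2 fw (nt v))) (linZ (form2_lin2 fw (nt v))).
rewrite (form2_anti fw (nt v) (done _ _)) w_done (conn_symbol oL ht) curvatureE.
by rewrite scalerN addrAC.
Qed.

Let hD := DL_model.
Let et (g : ar G) (v : tangent g) : R := eta nabla v.
Let D (g : ar G) (v : tangent g) r : vb (DL L) g := tderiv v r.

(** The source of (v, 0) is (ds v, - eta v), so the factor composable with it carries the number -
    eta v and not 0. The product is (vv', 0), and comparing sources gives additivity of eta. *)
Let mulD (g h : ar G) (v : tangent g) (v' : tangent h) : tcomp v v' ->
 [/\ vcomp (D v 0) (D v' (- et v)), vm (D v 0) (D v' (- et v)) = D (tmul v v') 0 & et (tmul v v') = et v + et v'].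
move=> tc; have cD : vcomp (D v 0) (D v' (- et v)).
 rewrite /vcomp /D /= tderiv_s // tderiv_t //.
 by apply/nderiv_eq; split; [exact: tc|rewrite sub0r].
have [E1 E2 E3] := m_mul hD cD.
have E : vm (D v 0) (D v' (- et v)) = D (tmul v v') 0.
 apply: (Dmap_inj oL oL0 lvt); first by rewrite E3 !tderiv_symbol.
 apply: (@mkt_inj _ _ (atiyahb (vb0 L))); rewrite [LHS]E2 /D /= !tderiv_t.
 by apply/nderiv_eq; split=> //; apply: esym; exact: (tmul_tgt hG cM cG tc).
split=> //; move: E1; rewrite E /D /= !tderiv_s => /nderiv_eq[_].
by rewrite sub0r -/(et _) -/(et v') -opprD => /oppr_inj.
Qed.

Let BK (g : ar G) (v u : vb (MK th) g) : vb L g :=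
 K (pair2 v.1 u.1) + eta nabla u.1 *: v.2 + (- eta nabla v.1) *: u.2.

Let KE (g : ar G) (v u : tangent g) : K (pair2 v u) = form2 w (nt v) (nt u).
exact: (curvatureE v u). Qed.

(** K itself is not multiplicative: by [mulD] its value on products contains the extra terms -
    eta(v) theta(u') + eta(u) theta(v'). The terms with eta in the Morita curvature compensate for
    them. *)
Lemma MK_pairing : @mult_pairing R G L (MK th) BK.
have ntl g := conn_linear ht (x := g).
have wl1 g y := form2_lin1 fw (x := g) y.
split.
- move=> g u r v v'; rewrite /BK /= !KE ntl (wl1 g) (eta_linear r) opprD -mulNr.
 apply: (line_ext oL) => k lk; rewrite !(lfunD lk, lfunZ lk, lfunN lk).
 by rewrite /GRing.scale /=; ring.
- move=> g v u; rewrite /BK !KE (form2_anti fw); by line_ring oL.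
- move=> P f X Y sf sX sY; have sX1 := smap_comp sX (@sumb_fst _ _ (tanb (ar G)) (vb L)).
 have sX2 := smap_comp sX (@sumb_snd _ _ (tanb (ar G)) (vb L)).
 have sY1 := smap_comp sY (@sumb_fst _ _ (tanb (ar G)) (vb L)).
 have sY2 := smap_comp sY (@sumb_snd _ _ (tanb (ar G)) (vb L)).
 have s1 := smooth_form2_along (atiyah_ok oL cG) oL fw sf (conn_smooth cG ht sf sX1) (conn_smooth cG ht sf sY1).
 have s2 := smooth_alongM oL sf (eta_smooth sf sY1) sX2.
 have s3 := smooth_alongM oL sf (smoothN (eta_smooth sf sX1)) sY2.
 have := smooth_alongD oL sf (smooth_alongD oL sf s1 s2) s3.
 by fext => y; rewrite /BK KE.
move=> g h c [v l] [v' l'] [u k] [u' k'] c1 c2.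
have [/= tv cl] := sumb_mkt1 c1; have [/= tu ck] := sumb_mkt1 c2.
have [cD1 mD1 eD1] := mulD tv; have [cD2 mD2 eD2] := mulD tu.
have := DL_mult mw c cD1 cD2; rewrite mD1 mD2 !w_tderiv.
rewrite !scale0r !addr0 !subr0 => EK.
have fE (l0 : vb L h) : finv vs (cast (src (mul g h)) (vs l0)) = lsum c 0 l0.
 apply: (line_inj lvs); rewrite (finvE oL oL0 lvs); apply: mkt_inj.
 by rewrite (vs_lsum hL) mkt_cast // (src_mul hG c).
(* Composability in the Morita kernel: l matches l' + theta(v'), and this is the source of the
   compensating theta terms. *)
have el : lsum c l 0 = lsum c 0 l' + lsum c 0 (form1 th v').
 by rewrite (lsum_vm c cl).2 -(lsum_vm c cl).1 (linD (lsum_lin2 hL c)).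
have ek : lsum c k 0 = lsum c 0 k' + lsum c 0 (form1 th u').
 by rewrite (lsum_vm c ck).2 -(lsum_vm c ck).1 (linD (lsum_lin2 hL c)).
rewrite /et in eD1 eD2 EK; rewrite /BK /= !fE eD1 eD2.
have {}EK : K (pair2 (tmul v v') (tmul u u')) = lsum c (K (pair2 v u)) (K (pair2 v' u') +
 - eta nabla v *: form1 th u' - - eta nabla u *: form1 th v') := EK.
move: EK; move: (K (pair2 v u)) (K (pair2 v' u')) (K (pair2 (tmul v v') (tmul u u'))) => K1 K2 K3 ->.
rewrite (lsum_split hL) [in RHS](lsum_split hL).
rewrite !(linD (lsum_lin1 hL c)) !(linZ (lsum_lin1 hL c)) el ek.
rewrite !(linD (lsum_lin2 hL c), linN (lsum_lin2 hL c), linZ (lsum_lin2 hL c)).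
by line_ring oL.
Qed.

Let BD (g : ar G) (d d' : vb (DL L) g) : vb L g := w (pair2 d d').
Let hBD := DL_pairing fw mw.
Let hM := MK_model.

Definition morita_nd x := forall v : tangent (uni x), dmap src v = 0 -> dmap tgt v = 0 ->
 form1 th v = 0 -> eta nabla v = 0 -> (forall u, form2 K v (dmap uni u) = 0) -> v = 0.

Let Kl2 (g : ar G) (v : tangent g) : linear (fun u : tangent g => form2 K v u).
by move=> r u u'; rewrite /form2 !KE (conn_linear ht (x := g)) (form2_lin2 fw). Qed.
Let du_lin x : linear (fun u : tangent x => dmap uni u) := dmap_lin (smooth_uni hG) (x := x).
Let el (g : ar G) : linear (fun v : tangent g => eta nabla v : R^o) := eta_linear (g := g).
Let thl (g : ar G) : linear (fun v : tangent g => form1 th v) := form1_lin ft (x := g).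

Lemma MK_nondeg x : nondeg_at BK x <-> morita_nd x.
split=> [/(nondegP hL hM MK_pairing) nd v s0 t0 h0 e0 k0|nd].
 have /(congr1 fst) // : ((v, 0) : vb (MK th) (uni x)) = 0.
 apply: nd => /=; first by rewrite s0 (lin0 (vs_lin hL (g := _))).
  by rewrite t0 h0 addr0 (lin0 (vt_lin hL (g := _))).
 by move=> [u q]; rewrite /BK /= -/(form2 K _ _) k0 e0 oppr0 !scale0r scaler0 !addr0.
apply/(nondegP hL hM MK_pairing) => -[v l] /= [s0 l0] [t0 h0] k0.
have {}l0 := vs_inj hL l0; subst l; rewrite add0r in h0.
have {}h0 : form1 th v = 0.
 by apply: (line_inj lvt); rewrite h0 (lin0 (vt_lin hL (g := _))).
(* Pairing with the unit of (0, e), for a nonzero e in L_M, isolates eta(v). *)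
have e0 : eta nabla v = 0.
 have [e _ ex] := line_nz oL0 x; have := k0 (0, e x); rewrite /BK /= -/(form2 K _ _).
 rewrite (lin0 (@du_lin x)) (lin0 (@Kl2 _ v)) (lfun0 (@el _)) scale0r !add0r => /eqP.
 rewrite scaler_eq0 oppr_eq0 => /orP[/eqP//|/eqP u0].
 case/eqP: ex; have [_ _ _ inj] := line_vu hL; exact: inj u0.
rewrite (nd v) // => u; have := k0 (u, 0); rewrite /BK /= -/(form2 K _ _) scaler0 e0 oppr0 scale0r !addr0.
exact.
Qed.

Let nd0 (x : ob G) (v : tangent x) r : nderiv v r = 0 -> v = 0 /\ r = 0.
have z0 : nderiv (0 : tangent x) 0 = 0.
 by rewrite /nderiv (lin0 (conn_linear hn (x := x))) scale0r addr0.
rewrite -z0 => E; have [E1 E2] := (nderiv_eq v (0 : tangent x) r 0).1 (congr1 _ E).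
by split=> //; exact: mkt_inj E1.
Qed.

Lemma DL_nondeg x : nondeg_at BD x <-> morita_nd x.
split=> [/(nondegP hL hD hBD) nd v s0 t0 h0 e0 k0|nd].
 have n0 y (z : tangent y) : z = 0 -> nderiv z 0 = 0.
  by move=> ->; rewrite /nderiv (lin0 (conn_linear hn (x := y))) scale0r addr0.
 suff d0 : D v 0 = 0.
  by rewrite -(tderiv_symbol v 0) (_ : tderiv v 0 = 0) ?(lin0 (symbol_lin oL (x := _))).
 apply: nd.
 - by rewrite /D /= tderiv_s e0 subr0 n0.
 - by rewrite /D /= tderiv_t n0.
 move=> d; have [q ->] := nderiv_ex d.
 rewrite /= (nderiv_u); apply: etrans (w_tderiv _ _ _ _) _.
 by rewrite k0 h0 scale0r scaler0 addr0 subr0.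
apply/(nondegP hL hD hBD) => d; have [r ->] := tderiv_ex d; move: (symbol d) => v.
rewrite /= tderiv_s tderiv_t => /nd0[s0 e0] /nd0[t0 r0] H; subst r.
have {}e0 : eta nabla v = 0 by move: e0; rewrite sub0r => /eqP; rewrite oppr_eq0 => /eqP.
have H' u q : form2 K v (dmap uni u) - q *: form1 th v = 0.
 have := H (nderiv u q); rewrite nderiv_u => E.
 have := w_tderiv v (dmap uni u) 0 q.
 have {}E : form2 (atiyah_form th (delT0 ka)) (tderiv v 0) (tderiv (dmap uni u) q) = 0 := E.
 by rewrite E scale0r addr0 => E2; exact: esym E2.
have v0 : v = 0.
 apply: nd => //.
  (* Pairing with minus the identity derivation isolates theta(v). On this side eta(v) = 0 came from
     the source and target, whereas in the Morita kernel the two roles are exchanged. *)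
  have := H' 0 (-1); rewrite (lin0 (@du_lin x)) (lin0 (@Kl2 _ v)) scaleN1r opprK add0r; exact.
 by move=> u; have := H' u 0; rewrite scale0r subr0.
by rewrite v0 /tderiv -/nt (lin0 (conn_linear ht (x := _))) scale0r addr0.
Qed.

(** The rank equation can be read off only at an object, while the criterion asks for it
    unconditionally; the case without objects is settled where this is applied. *)
Hypothesis dim : (ob G -> n.+1 = (m.+1 + m.+1)%N) -> n.+1 = (m.+1 + m.+1)%N.

Lemma morita_iff_dim : is_vb_morita_id (flat2 w) <-> is_vb_morita_id (@MR R G L th ka nabla).
split=> H.
- have nd := morita_nondeg hL hD hBD cM cG H.
 apply: (flat_morita hL hM MK_pairing cM cG); first by move=> x; apply/MK_nondeg/DL_nondeg; exact: (nd x).1.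
 by apply: dim => x; have [_] := nd x.
have nd := morita_nondeg hL hM MK_pairing cM cG H.
apply: (flat_morita hL hD hBD cM cG); first by move=> x; apply/DL_nondeg/MK_nondeg; exact: (nd x).1.
by apply: dim => x; have [_] := nd x.
Qed.
End Contact.

(** * Equivalence of the two nondegeneracy conditions *)

Theorem morita_iff (R : realType) (G : groupoid R) (L : vbg G) (hL : is_lbg L) (nabla : connection (vb0 L))
  (th : form (tanb (ar G)) (vb L) 1) (ka : form (tanb (ob G)) (vb0 L) 2) (w := atiyah_form th (delT0 ka)) :
 is_connection nabla -> is_form th -> is_form ka -> delT1 th = form00 -> is_form w -> delD1 w = form00 ->
 is_vb_morita_id (flat2 w) <-> is_vb_morita_id (@MR R G L th ka nabla).
move=> hn ft fk mth fw mw; have hG := gpd hL; have [m cM] := ob_coord hG; have [n cG] := ar_coord hG.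
have [[x]|ne] := pselect (inhabited (ob G)); first by apply: (morita_iff_dim hL cM cG ft mth hn fk fw mw) => /(_ x).
(* Without objects there are no arrows either, and any dimensions are admissible; 0 and 1 satisfy
   the rank equation 1 + 1 = (0 + 1) + (0 + 1). *)
have cM0 : coordinatized (ob G) 0 by move=> x; case: ne.
have cG0 : coordinatized (ar G) 1 by move=> g; case: ne; exact: (inhabits (src g)).
exact: (morita_iff_dim hL cM0 cG0 ft mth hn fk fw mw).
Qed.

(** From right to left the contact structure needs a connection, which [connection_exists] supplies;
    the equivalence of the Morita conditions holds for every connection. *)
Lemma contact_symplectic (R : realType) (G : groupoid R) (L : vbg G) (hL : is_lbg L) (tk : cdata L 1) : is_form tk.1 -> is_form tk.2 ->
 is_shifted_contact tk <-> is_shifted_symplectic (to_atiyah tk).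
case: tk => t ka /= ft fk; have hG := gpd hL; have [m cM] := ob_coord hG; have [n cG] := ar_coord hG.
have oL := lbg_ok hL; have oL0 := lbg_ok0 hL; have fdk := form_delT0_2 hL cM fk; have fw := form_atiyah oL cG ft fdk.
have E2 : atiyah_form ka form00 = dD (sigma_pull ka) := atiyah_form0 ka.
split=> [[_ mt [nabla hn mo]]|[_ /= mw _ _ mo]].
 have mw := (delD1_eq0 hL cM cG ka ft).2 mt; split=> //=.
 - by split=> //; rewrite E2; exact (form_dD2 oL0 cM (form_sigma2 oL0 fk)).
 - by rewrite E2 (delD0_dD2 hL cM cG fk) (dD_atiyah_form oL cG).
 - by rewrite E2 (dD_dD2 oL0 cM (form_sigma2 oL0 fk)).
 exact/(morita_iff hL hn ft fk mt fw mw).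
have mt := (delD1_eq0 hL cM cG ka ft).1 mw; have [nabla hn] := connection_exists oL0 (let: And5 H _ _ _ _ := hG in H.1).
split=> //; exists nabla => //; exact/(morita_iff hL hn ft fk mt fw mw).
Qed.

(** * Morita maps between line bundle groupoids *)

Section MoritaMaps.
Variables (R : realType) (G G1 : groupoid R) (L : vbg G) (L1 : vbg G1) (hL : is_lbg L) (hL1 : is_lbg L1).
Variables (f : ar G -> ar G1) (f0 : ob G -> ob G1) (F : vbmap f (vb L) (vb L1)) (F0 : vbmap f0 (vb0 L) (vb0 L1)).
Hypothesis mF : is_vb_morita F F0.
Let oL := lbg_ok hL.
Let oL0 := lbg_ok0 hL.
Let oK := lbg_ok hL1.
Let oK0 := lbg_ok0 hL1.

Lemma morita_vs g (v : vb L g) : mkt (vs (F v)) = mkt (F0 (vs v)).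
by have [[_ [_ H _ _] _ _] _] := mF; exact: (H (mkt v)).1. Qed.
Lemma morita_vt g (v : vb L g) : mkt (vt (F v)) = mkt (F0 (vt v)).
by have [[_ [_ H _ _] _ _] _] := mF; exact: (H (mkt v)).2. Qed.

(* An object l of L with F0 l = 0 is isomorphic to 0 by fullness, and only 0 is. *)
Lemma morita_inj0 x (l : vb0 L x) : F0 l = 0 -> l = 0.
move=> l0; have [[_ _ lF lF0] [_ _ _ [Gi [_ G2 _ _]]]] := mF.
have z0 : F0 (0 : vb0 L x) = 0 := lin0 (lF0 x).
have [|_ E] := G2 ((mkt (0 : vb0 L x), mkt (vu (F0 (0 : vb0 L x)))), mkt l).
 by split; rewrite /= /totmap /= ?(vtu hL1) ?(vsu hL1) ?l0 ?z0.
move: E; case: (Gi _) => g v E.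
have E1 : mkt (vt v) = mkt (0 : vb0 L x) := congr1 (fun q => q.1.1) E.
have E3 : mkt (vs v) = mkt l := congr1 (fun q => q.2) E.
have v0 : v = 0.
 by apply: (line_inj (line_vt hL)); rewrite (lin0 (vt_lin hL (g := g))); exact: mkt_eq0 E1.
by move: E3; rewrite v0 (lin0 (vs_lin hL (g := g))) => /esym; exact: mkt_eq0.
Qed.
Lemma morita_line0 : line_map F0.
have [[[[_ s0] _ _ _] [[_ S0] _ _ _] _ lF0] _] := mF.
by split=> // x v; exact: morita_inj0.
Qed.
Lemma morita_line : line_map F.
have [[[[s0 _] _ _ _] [[S0 _] _ _ _] lF _] _] := mF.
split=> // g v v0; apply: (vs_inj hL); apply: morita_inj0.
by have := morita_vs v; rewrite v0 (lin0 (vs_lin hL1 (g := _))) => /esym; exact: mkt_eq0.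
Qed.

(** Pull-back commutes with d_D and with the symbol, and it commutes with the simplicial
    differential because a Morita map intertwines sources and targets, on the base and on the line
    bundles. *)
Lemma pull_to_atiyah (tk : cdata L1 1) : is_form tk.1 -> is_form tk.2 ->
 (pullD F (to_atiyah tk).1, pullD F0 (to_atiyah tk).2) = to_atiyah ((pullT F tk.1, pullT F0 tk.2) : cdata L 1).
case: tk => t ka /= ft fk; have lF := morita_line; have lF0 := morita_line0.
have hG := gpd hL; have hG1 := gpd hL1.
have [m cM] := ob_coord hG; have [n cG] := ar_coord hG.
have [m1 cM1] := ob_coord hG1; have [n1 cG1] := ar_coord hG1.
have [[[_ st _ _] _ _ _] _] := mF.
rewrite /to_atiyah /=; congr pair.
 rewrite /atiyah_form /pullD (pull_fadd oL oK lF) -!/(pullD F _) (pull_sigma oL oK lF).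
 rewrite (pull_dD1 oL oK lF cG cG1 ft); congr (fadd (sigma_pull _) _).
 rewrite /delT0 [LHS](pull_fsub oL oK lF) -!/(pullT _ _); congr fsub.
  apply: (pullT_square _ oL oK oL0 oK0 lF (line_vs hL1) (line_vs hL) lF0) => [g|g v]; first exact: (st g).1.
  exact: morita_vs.
 apply: (pullT_square _ oL oK oL0 oK0 lF (line_vt hL1) (line_vt hL) lF0) => [g|g v]; first exact: (st g).2.
 exact: morita_vt.
by rewrite !atiyah_form0 (pull_dD2 oL0 oK0 lF0 cM cM1 fk).
Qed.
End MoritaMaps.

Theorem theorem5p32 (R : realType) (G : groupoid R) (L : vbg G)
    (hL : is_lbg L) :
  [/\ set_bij [set tk : cdata L 1 | is_shifted_contact tk]
              [set wW : sdata L 1 | is_shifted_symplectic wW]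
              (@to_atiyah R G L 1),
      forall tk tk' : cdata L 1, is_shifted_contact tk -> is_shifted_contact tk' ->
        (contact_gauge_equiv tk tk' <->
         symplectic_gauge_equiv (to_atiyah tk) (to_atiyah tk')) &
      forall (G' : groupoid R) (L' : vbg G'), is_lbg L' ->
      forall (tk : cdata L 1) (tk' : cdata L' 1),
        is_shifted_contact tk -> is_shifted_contact tk' ->
        (contact_morita tk tk' <->
         symplectic_morita (to_atiyah tk) (to_atiyah tk'))].
Proof.
have hG := gpd hL; have [m cM] := ob_coord hG; have [n cG] := ar_coord hG.
split.
- split.
 + by move=> tk /= h; have [[f1 f2] _ _] := h; exact/(contact_symplectic hL f1 f2).
 + move=> tk tk' /set_mem[[f1 f2] _ _] /set_mem[[f1' f2'] _ _].
  exact: (to_atiyah_inj hL cM cG f1 f2 f1' f2').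
 move=> wW h; have [tk [f1 f2 E]] := symplectic_ex hL cM cG h.
 by exists tk => //; apply/(contact_symplectic hL f1 f2); rewrite -E.
- move=> tk tk' [[f1 f2] _ _] [[f1' f2'] _ _].
 exact: (gauge_equiv_iff hL cM cG f1 f2 f1' f2').
move=> G' L' hL' tk tk' [[f1 f2] _ _] [[f1' f2'] _ _].
(* Both notions of Morita equivalence use the same spans of VB Morita maps, so it suffices to
   compare gauge equivalence of the pulled back structures. The pulled back forms are used only as
   smooth forms. *)
have key (H : groupoid R) (J : vbg H) (p : ar H -> ar G) (p0 : ob H -> ob G) (F1 : vbmap p (vb J) (vb L))
  (H1 : vbmap p0 (vb0 J) (vb0 L)) (q : ar H -> ar G') (q0 : ob H -> ob G') (F2 : vbmap q (vb J) (vb L'))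
  (H2 : vbmap q0 (vb0 J) (vb0 L')) : is_lbg J -> is_vb_morita F1 H1 -> is_vb_morita F2 H2 ->
 @contact_gauge_equiv _ H J (pullT F1 tk.1, pullT H1 tk.2) (pullT F2 tk'.1, pullT H2 tk'.2) <->
 @symplectic_gauge_equiv _ H J (pullD F1 (to_atiyah tk).1, pullD H1 (to_atiyah tk).2)
  (pullD F2 (to_atiyah tk').1, pullD H2 (to_atiyah tk').2).
 move=> hJ m1 m2; rewrite (pull_to_atiyah hJ hL m1 f1 f2) (pull_to_atiyah hJ hL' m2 f1' f2').
 have hH := gpd hJ; have hG' := gpd hL'.
 have [mJ cMJ] := ob_coord hH; have [nJ cGJ] := ar_coord hH.
 have [m' cM'] := ob_coord hG'; have [n' cG'] := ar_coord hG'.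
 apply: (gauge_equiv_iff hJ cMJ cGJ) => /=.
 - exact (form_pullT1 (lbg_ok hJ) (lbg_ok hL) (morita_line hJ hL m1) cG f1).
 - exact (form_pullT2 (lbg_ok0 hJ) (lbg_ok0 hL) (morita_line0 hJ hL m1) cM f2).
 - exact (form_pullT1 (lbg_ok hJ) (lbg_ok hL') (morita_line hJ hL' m2) cG' f1').
 - exact (form_pullT2 (lbg_ok0 hJ) (lbg_ok0 hL') (morita_line0 hJ hL' m2) cM' f2').
split=> -[H [J [p [p0 [F1 [H1 [q [q0 [F2 [H2 [hJ m1 m2 E]]]]]]]]]]];
 exists H, J, p, p0, F1, H1, q, q0, F2, H2; split=> //; exact/(key _ _ _ _ _ _ _ _ _ _ hJ m1 m2).
Qed.
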